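(* Let $(\Psi,\mu,w)$ be a tame labeled root ideal of length $\ell$ with $\mu=(\mu_1\ge\cdots\ge\mu_\ell\ge0)$ a partition. Then \[ \zeta\big(H(\Psi;\mu;w)\big)=e^{-\mu_1\Lambda_0+n_\ell(\mu)\delta}\,\mathrm{ch}\big(\mathrm{AGD}(\mu;(w,\mathrm{ns}(\Psi)))\big), \] where $n_\ell(\mu)=\frac{|\mu|(\ell-1)}{2\ell}-\frac1\ell\sum_{i=1}^\ell(i-1)\mu_i$.
   Context: Nonsymmetric Catalan functions. Work in $\mathbb{Z}[q][x_1^{\pm1},\dots,x_\ell^{\pm1}]$. $\pi_i(f)=\frac{x_if-x_{i+1}s_i(f)}{x_i-x_{i+1}}$ ($s_i$ swaps $x_i,x_{i+1}$). $H_\ell$ is the 0-Hecke monoid generated by $\bar s_1,\dots,\bar s_{\ell-1}$ (relations $\bar s_i^2=\bar s_i$, far commutation, braid relations); $\pi_w=\pi_{i_1}\cdots\pi_{i_m}$ for $w=\bar s_{i_1}\cdots\bar s_{i_m}$. $H_\ell$ acts on $\mathbb{Z}^\ell$ by $\bar s_i\alpha=s_i\alpha$ if $\alpha_i\ge\alpha_{i+1}$, else $\alpha$. Key polynomial: $\kappa_\alpha=\pi_{\mathsf p(\alpha)}\mathbf x^{\alpha^+}$ with $\alpha^+$ the decreasing rearrangement and $\mathsf p(\alpha)$ the shortest element with $\mathsf p(\alpha)\alpha^+=\alpha$; these form a basis of the Laurent polynomials. $\mathrm{poly}(\kappa_\alpha)=\kappa_\alpha$ if $\alpha\in\mathbb{Z}^\ell_{\ge0}$,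 $0$ otherwise (linear, coefficientwise in $q$). A root ideal is an upper order ideal of $\Delta^+_\ell=\{(i,j):i<j\}$ under $(a,b)\le(c,d)$ iff $a\ge c,b\le d$. $H(\Psi;\gamma;w)=\pi_w\mathrm{poly}\big(\prod_{(i,j)\in\Psi}(1-qx_i/x_j)^{-1}\mathbf x^\gamma\big)$. $\mathrm{nr}(\Psi)_i=|\{j\in\{i,\dots,\ell\}:(i,j)\notin\Psi\}|$ ($i\in[\ell-1]$); $(\Psi,\gamma,w)$ is tame if $\{i:w\bar s_i=w\}\supseteq\{\mathrm{nr}(\Psi)_1+1,\dots,\ell-1\}$. $\mathsf c(d)=\bar s_{\ell-1}\cdots\bar s_d$, and $\mathrm{ns}(\Psi)=(\mathsf c(\mathrm{nr}(\Psi)_1),\dots,\mathsf c(\mathrm{nr}(\Psi)_{\ell-1}))$. Affine crystals. Let $I=\mathbb{Z}/\ell\mathbb{Z}$. The weight lattice of $U_q(\widehat{\mathfrak{sl}}_\ell)$ is $P=\bigoplus_{i\in I}\mathbb{Z}\Lambda_i\oplus\mathbb{Z}\frac{\delta}{2\ell}$, with simple roots $\alpha_i=2\Lambda_i-\Lambda_{i-1}-\Lambda_{i+1}+\delta_{i0}\delta$, and $P^+=\sum_i\mathbb{Z}_{\ge0}\Lambda_i+\mathbb{Z}\frac{\delta}{2\ell}$. (Convention: the scaling element $d$ satisfies $\langle d,\Lambda_0\rangle=0$, $\langle d,\Lambda_i-\Lambda_{i-1}\rangle=\frac{2i-1-\ell}{2\ell}$, $\langle d,\delta\rangle=1$.)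 For $\Lambda\in P^+$, $B(\Lambda)$ is Kashiwara's crystal of the irreducible integrable highest weight module of highest weight $\Lambda$, with highest weight element $u_\Lambda$, operators $\tilde f_i,\tilde e_i$ ($i\in I$), and $\varepsilon_i(b)=\max\{k:\tilde e_i^kb\ne0\}$, $\varphi_i(b)=\max\{k:\tilde f_i^kb\ne0\}$. Tensor products use the convention $\tilde f_i(b_1\otimes b_2)=\tilde f_ib_1\otimes b_2$ if $\varepsilon_i(b_1)\ge\varphi_i(b_2)$ and $b_1\otimes\tilde f_ib_2$ otherwise ($\tilde e_i$: $\tilde e_ib_1\otimes b_2$ if $\varepsilon_i(b_1)>\varphi_i(b_2)$, else $b_1\otimes\tilde e_ib_2$), weights adding. For a subset $S$, $\mathcal F_iS=\{\tilde f_i^mb:b\in S,m\ge0\}\setminus\{0\}$. Let $\tau$ be the automorphism $i\mapsto i+1$ of $I$, acting on $P$ by $\Lambda_i\mapsto\Lambda_{i+1}$, $\delta\mapsto\delta$. For $\Lambda\in P^+$, $\mathcal F_\tau:B(\Lambda)\to B(\tau\Lambda)$ is the bijection $\tilde f_{j_1}^{d_1}\cdots\tilde f_{j_k}^{d_k}u_\Lambda\mapsto\tilde f_{j_1+1}^{d_1}\cdots\tilde f_{j_k+1}^{d_k}u_{\tau\Lambda}$, applied factorwise on tensor products. For $w\in H_\ell$ with expression $\bar s_{i_1}\cdots\bar s_{i_m}$, $\mathcal F_w=\mathcal F_{i_1}\cdots\mathcal F_{i_m}$ (independent of expression on the sets considered), and $\mathcal F_{\tau w}=\mathcal F_\tau\mathcal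 F_w$. For $\mathbf w=(w_1,\dots,w_p)\in H_\ell^p$ and a partition $(\mu_1\ge\cdots\ge\mu_p\ge0)$ with $\mu^i=\mu_i-\mu_{i+1}$ ($\mu_{p+1}=0$), the affine generalized Demazure crystal is $\mathrm{AGD}(\mu;\mathbf w)=\mathcal F_{w_1}\big(\mathcal F_{\tau w_2}\big(\cdots\mathcal F_{\tau w_{p-1}}\big(\mathcal F_{\tau w_p}\{u_{\mu^p\Lambda_1}\}\otimes u_{\mu^{p-1}\Lambda_1}\big)\cdots\otimes u_{\mu^2\Lambda_1}\big)\otimes u_{\mu^1\Lambda_1}\big)\subset B(\mu^p\Lambda_p)\otimes\cdots\otimes B(\mu^1\Lambda_1)$ (indices of $\Lambda$ mod $\ell$), where $S\otimes u=\{s\otimes u:s\in S\}$. The character of a set $G$ of crystal elements is $\mathrm{ch}(G)=\sum_{g\in G}e^{\mathrm{wt}(g)}\in\mathbb{Z}[P]$. $\zeta:\mathbb{Z}[q][\mathbf x^{\pm1}]\to\mathbb{Z}[P]$ is the ring homomorphism $x_i\mapsto e^{\Lambda_i-\Lambda_{i-1}+\frac{\ell+1-2i}{2\ell}\delta}$ (with $\Lambda_\ell=\Lambda_0$), $q\mapsto e^{-\delta}$.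
   Formalization: The simple roots are taken as α_i = 2Λ_i − Λ_{i−1} − Λ_{i+1} + δ/ℓ (so that ⟨d,α_i⟩ = δ_{i0} for the stated d); with the printed +δ_{i0}δ the identity fails, e.g. for ℓ=2, Ψ=∅, μ=(1,0), w=s̄_1. *)

(* Defs.v *)
(* [epsilon] (classical choice) is used for objects whose existence and
   uniqueness is a theorem: the value is the object with the stated property. *)
From HB Require Import structures.
From mathcomp Require Import all_boot all_order all_algebra.
From mathcomp Require Import perm finmap zify.
From mathcomp Require Import monalg.
From Stdlib Require Import ClassicalEpsilon.
From Stdlib Require List.

Set Implicit Arguments.
Unset Strict Implicit.
Unset Printing Implicit Defensive.

Import GRing.Theory.
Local Open Scope ring_scope.

(* The group ring Z[G] of an additive abelian group G.  The product that
   [monalg] puts on {malg R[K]} requires K to have no nontrivial invertible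
   elements, so it is not available for a group. *)
Definition group_ring (G : zmodType) : Type := {malg int[G]}.

Section GroupRing.
Variable G : zmodType.
Local Open Scope fset_scope.
Local Open Scope ring_scope.

HB.instance Definition _ := GRing.Zmodule.copy (group_ring G) {malg int[G]}.

Implicit Types (g : group_ring G) (k : G).

Definition gexp k : group_ring G := << (1 : int) *g k >>.

Definition gmul (g1 g2 : group_ring G) : group_ring G :=
  \sum_(k1 <- msupp g1) \sum_(k2 <- msupp g2)
    (<< g1@_k1 * g2@_k2 *g k1 + k2 >> : group_ring G).

Lemma gmulw (d1 d2 : {fset G}) g1 g2 : msupp g1 `<=` d1 -> msupp g2 `<=` d2 ->
  gmul g1 g2 = \sum_(k1 <- d1) \sum_(k2 <- d2)
    (<< g1@_k1 * g2@_k2 *g k1 + k2 >> : group_ring G).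
Proof.
move=> le_d1 le_d2; rewrite /gmul (big_fset_incl _ le_d1) /=.
  apply/eq_bigr=> k1 _; apply/big_fset_incl => // k _ /mcoeff_outdom ->.
  by rewrite mulr0 monalgU0.
move=> k _ /mcoeff_outdom g1k.
by rewrite big1 => // k' _; rewrite g1k mul0r monalgU0.
Qed.

Lemma gmulC : commutative gmul.
Proof.
move=> g1 g2; rewrite /gmul exchange_big; apply/eq_bigr=> k1 _.
by apply/eq_bigr=> k2 _; rewrite mulrC addrC.
Qed.

Lemma gmulUU (c1 c2 : int) k1 k2 :
  gmul << c1 *g k1 >> << c2 *g k2 >> = << c1 * c2 *g k1 + k2 >>.
Proof. by rewrite (gmulw msuppU_le msuppU_le) !big_seq_fset1 !mcoeffUU. Qed.

Lemma gmulDl : left_distributive gmul +%R.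
Proof.
move=> g1 g2 g; rewrite [in RHS](gmulw (fsubsetUl _ (msupp g2)) (fsubset_refl _)).
rewrite [in RHS](gmulw (fsubsetUr (msupp g1) _) (fsubset_refl _)).
rewrite (gmulw (msuppD_le _ _) (fsubset_refl _)).
rewrite -big_split /=; apply/eq_bigr=> k1 _.
rewrite -big_split /=; apply/eq_bigr=> k2 _.
by rewrite mcoeffD mulrDl monalgUD.
Qed.

Lemma gmulDr : right_distributive gmul +%R.
Proof. by move=> g g1 g2; rewrite !(gmulC g) gmulDl. Qed.

Lemma gmul0g : left_zero 0 gmul.
Proof. by move=> g; rewrite /gmul msupp0 big_seq_fset0. Qed.

Lemma gmulg0 : right_zero 0 gmul.
Proof. by move=> g; rewrite gmulC gmul0g. Qed.

Lemma group_ringE g :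
  g = \sum_(k <- msupp g) (<< g@_k *g k >> : group_ring G).
Proof. exact: monalgE. Qed.

Lemma gmul_suml (r : seq G) (F : G -> group_ring G) g :
  gmul (\sum_(k <- r) F k) g = \sum_(k <- r) gmul (F k) g.
Proof. exact: (big_morph (gmul^~ _) (fun _ _ => gmulDl _ _ _) (gmul0g _)). Qed.

Lemma gmul_sumr (r : seq G) (F : G -> group_ring G) g :
  gmul g (\sum_(k <- r) F k) = \sum_(k <- r) gmul g (F k).
Proof. exact: (big_morph (gmul _) (fun _ _ => gmulDr _ _ _) (gmulg0 _)). Qed.

Lemma gmulA : associative gmul.
Proof.
move=> g1 g2 g3.
have UUE c1 c2 k1 k2 g : gmul << c1 *g k1 >> (gmul << c2 *g k2 >> g) =
    gmul << c1 * c2 *g k1 + k2 >> g.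
  rewrite [in LHS](group_ringE g) [in RHS](group_ringE g).
  rewrite (gmul_sumr _ _ << c2 *g k2 >>) (gmul_sumr _ _ << c1 *g k1 >>).
  rewrite (gmul_sumr _ _ << _ *g k1 + k2 >>).
  by apply/eq_bigr=> k3 _; rewrite !gmulUU mulrA addrA.
have Ug c k g g' : gmul << c *g k >> (gmul g g') = gmul (gmul << c *g k >> g) g'.
  rewrite [in LHS](group_ringE g) [in RHS](group_ringE g).
  rewrite (gmul_suml _ _ g') (gmul_sumr _ _ << c *g k >>).
  rewrite (gmul_sumr _ _ << c *g k >>) (gmul_suml _ _ g').
  by apply/eq_bigr=> k2 _; rewrite UUE gmulUU.
rewrite [in LHS](group_ringE g1) [in RHS](group_ringE g1).
rewrite (gmul_suml _ _ (gmul g2 g3)) (gmul_suml _ _ g2) (gmul_suml _ _ g3).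
by apply/eq_bigr=> k _; rewrite Ug.
Qed.

Lemma gmul1g : left_id (gexp 0) gmul.
Proof.
move=> g; rewrite [in LHS](group_ringE g) [in RHS](group_ringE g) gmul_sumr.
by apply/eq_bigr=> k _; rewrite gmulUU mul1r add0r.
Qed.

Lemma gone_neq0 : gexp 0 != 0.
Proof. by apply/eqP/malgP=> /(_ 0) /eqP; rewrite mcoeffUU mcoeff0. Qed.

HB.instance Definition _ := GRing.Zmodule_isComNzRing.Build (group_ring G)
  gmulA gmulC gmul1g gmulDl gone_neq0.

Lemma gexpD k1 k2 : gexp (k1 + k2) = gexp k1 * gexp k2.
Proof. by rewrite [RHS]gmulUU mulr1. Qed.

End GroupRing.

(* Throughout, ell = n.+2, since affine sl_ell requires ell >= 2.  Positions
   1, ..., ell are the elements 0, ..., ell - 1 of 'I_n.+2, and the generator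
   indices 1, ..., ell - 1 are the elements 0, ..., ell - 2 of 'I_n.+1. *)

Section Catalan.
Variable n : nat.

Definition expo : zmodType := {ffun 'I_n.+2 -> int}.

Definition laurent : comNzRingType := group_ring expo.

Implicit Types (a : expo) (f g : laurent) (w : seq 'I_n.+1).

Definition monom a : laurent := gexp a.

Definition evec (j : 'I_n.+2) : expo := [ffun k => ((k == j)%:R : int)].

Definition var (j : 'I_n.+2) : laurent := monom (evec j).

(* The positions i and i+1 exchanged by s_i. *)
Definition posl (i : 'I_n.+1) : 'I_n.+2 := widen_ord (leqnSn n.+1) i.
Definition posr (i : 'I_n.+1) : 'I_n.+2 := lift ord0 i.

Definition swap_expo (i : 'I_n.+1) a : expo :=
  [ffun k => a (tperm (posl i) (posr i) k)].

Definition swap (i : 'I_n.+1) f : laurent :=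
  \sum_(a <- msupp f) monom (swap_expo i a) *~ f@_a.

(* The quotient (x_i f - x_{i+1} s_i f) / (x_i - x_{i+1}), which exists in the
   domain of Laurent polynomials. *)
Definition demazure (i : 'I_n.+1) f : laurent :=
  epsilon (inhabits 0) (fun g : laurent =>
    (var (posl i) - var (posr i)) * g
      = var (posl i) * f - var (posr i) * swap i f).

(* Elements of the 0-Hecke monoid are given by words in its generators, and
   equality in the monoid is the congruence [hecke_eq]. *)
Inductive hecke_eq : seq 'I_n.+1 -> seq 'I_n.+1 -> Prop :=
| hecke_refl w : hecke_eq w w
| hecke_sym w w' : hecke_eq w w' -> hecke_eq w' w
| hecke_trans w w' w'' : hecke_eq w w' -> hecke_eq w' w'' -> hecke_eq w w''
| hecke_cat w1 w1' w2 w2' :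
    hecke_eq w1 w1' -> hecke_eq w2 w2' -> hecke_eq (w1 ++ w2) (w1' ++ w2')
| hecke_idem i : hecke_eq [:: i; i] [:: i]
| hecke_comm (i j : 'I_n.+1) : (i.+1 < j)%N -> hecke_eq [:: i; j] [:: j; i]
| hecke_braid (i j : 'I_n.+1) : j = i.+1 :> nat -> hecke_eq [:: i; j; i] [:: j; i; j].

Definition demazure_word w f : laurent := foldr demazure f w.

Definition hecke_act (i : 'I_n.+1) a : expo :=
  if (a (posr i) <= a (posl i))%O then swap_expo i a else a.

Definition hecke_act_word w a : expo := foldr hecke_act a w.

Definition decr a : expo :=
  [ffun k : 'I_n.+2 => nth 0 (sort (fun x y : int => (y <= x)%O) (codom a)) k].

(* A reduced word of the shortest element p(a) with p(a) a^+ = a. *)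
Definition shortest_word a : seq 'I_n.+1 :=
  epsilon (inhabits [::]) (fun w =>
    hecke_act_word w (decr a) = a /\
    forall w', hecke_act_word w' (decr a) = a -> (size w <= size w')%N).

Definition key a : laurent := demazure_word (shortest_word a) (monom (decr a)).

Definition key_coef f : {malg int[expo]} :=
  epsilon (inhabits 0) (fun c : {malg int[expo]} =>
    f = \sum_(a <- msupp c) key a *~ c@_a).

Definition polypart f : laurent :=
  \sum_(a <- msupp (key_coef f) | [forall k, (0 <= a k)%O])
    key a *~ (key_coef f)@_a.

Definition root_ideal (Psi : {set 'I_n.+2 * 'I_n.+2}) : Prop :=
  (forall i j, (i, j) \in Psi -> (i < j)%N) /\
  (forall a b c d : 'I_n.+2, (a, b) \in Psi -> (c < d)%N ->
     (c <= a)%N -> (b <= d)%N -> (c, d) \in Psi).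

(* Power series in q with Laurent polynomial coefficients, as sequences. *)
Definition ps_mul (s t : nat -> laurent) : nat -> laurent :=
  fun d => \sum_(k < d.+1) s k * t (d - k)%N.

Definition ps_geom f : nat -> laurent := fun d => f ^+ d.

Definition ps_const f : nat -> laurent := fun d => if d is 0 then f else 0.

(* prod_((i, j) in Psi) (1 - q x_i / x_j)^-1 x^gamma *)
Definition catalan_series (Psi : {set 'I_n.+2 * 'I_n.+2}) (gamma : expo) :
    nat -> laurent :=
  foldr (fun r => ps_mul (ps_geom (monom (evec r.1 - evec r.2))))
    (ps_const (monom gamma)) (enum Psi).

(* H(Psi; gamma; w), as a polynomial in q: all but finitely many coefficients
   of the series vanish once [polypart] has been applied. *)
Definition catalan (Psi : {set 'I_n.+2 * 'I_n.+2}) (gamma : expo) w :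
    {poly laurent} :=
  epsilon (inhabits 0) (fun h : {poly laurent} => forall d,
    h`_d = demazure_word w (polypart (catalan_series Psi gamma d))).

Definition nr (Psi : {set 'I_n.+2 * 'I_n.+2}) (i : 'I_n.+2) : nat :=
  #|[set j : 'I_n.+2 | (i <= j)%N && ((i, j) \notin Psi)]|.

Definition tame (Psi : {set 'I_n.+2 * 'I_n.+2}) w : Prop :=
  forall i : 'I_n.+1, (nr Psi ord0 < i.+1)%N -> hecke_eq (rcons w i) w.

(* c(d) = s_{ell-1} ... s_d, for 1 <= d <= ell. *)
Definition cword (d : nat) : seq 'I_n.+1 :=
  rev [seq i : 'I_n.+1 <- enum 'I_n.+1 | (d <= i.+1)%N].

Definition ns (Psi : {set 'I_n.+2 * 'I_n.+2}) : seq (seq 'I_n.+1) :=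
  [seq cword (nr Psi (posl i)) | i <- enum 'I_n.+1].

End Catalan.

Section Weights.
Variable n : nat.

(* The Dynkin nodes Z/ell, with the arithmetic of Z/ell. *)
Definition node : finComNzRingType := 'I_n.+2.

(* Coordinates on the basis Lambda_i (i in Z/ell), delta/(2 ell). *)
Definition weight : zmodType := ({ffun node -> int} * int)%type.

(* Coordinates on the dual basis of Hom(P, Z). *)
Definition coweight : zmodType := ({ffun node -> int} * int)%type.

Definition pairing (h : coweight) (la : weight) : int :=
  \sum_i h.1 i * la.1 i + h.2 * la.2.

Definition Lam (i : node) : weight := ([ffun j => ((j == i)%:R : int)], 0).

(* delta_frac m = m * delta / (2 ell) *)
Definition delta_frac (m : int) : weight := (0, m).

Definition delta : weight := delta_frac (2 * n.+2)%:Z.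

Definition coroot (i : node) : coweight :=
  ([ffun j => ((j == i)%:R : int)], 0).

(* 2 ell <d, Lambda_i>, for the scaling element d with <d, Lambda_0> = 0 and
   <d, Lambda_k - Lambda_{k-1}> = (2 k - 1 - ell) / (2 ell). *)
Definition dLam (i : node) : int :=
  \sum_(1 <= k < i.+1) ((2 * k)%:Z - 1 - (n.+2)%:Z).

(* The fundamental weight normalised by <d, Lam0 i> = 0. *)
Definition Lam0 (i : node) : weight := Lam i - delta_frac (dLam i).

(* The usual formula for the simple roots (which gives <d, alpha_i> =
   delta_{i0}) holds for the fundamental weights normalised by d; in terms of
   the Lam i it reads as in [alphaE]. *)
Definition alpha (i : node) : weight :=
  Lam0 i *+ 2 - Lam0 (i - 1) - Lam0 (i + 1) + delta *+ (i == 0).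

Lemma dLamE i : dLam i = i%:Z * (i%:Z - (n.+2)%:Z).
Proof.
rewrite /dLam; elim: (nat_of_ord i) => [|k IHk]; first by rewrite big_geq.
by rewrite big_nat_recr //= IHk; lia.
Qed.

Lemma alphaE i :
  alpha i = Lam i *+ 2 - Lam (i - 1) - Lam (i + 1) + delta_frac 2.
Proof.
have dD : dLam (i - 1) + dLam (i + 1) + (2 * n.+2)%:Z *+ (i == 0)
    = dLam i *+ 2 + 2.
  have ltin := ltn_ord i; rewrite !dLamE.
  have -> : nat_of_ord (i + 1) = ((i + 1) %% n.+2)%N by rewrite /= modnDmr.
  have -> : nat_of_ord (i - 1) = ((i + n.+1) %% n.+2)%N by rewrite /= !modnDmr.
  have -> : (i == 0) = (nat_of_ord i == 0%N) by [].
  case: (posnP i) => [->|i_gt0].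
    by rewrite /= !modn_small //; lia.
  have -> : ((i + n.+1) %% n.+2 = i.-1)%N.
    by rewrite -[in LHS](prednK i_gt0) addSnnS modnDr modn_small //; lia.
  have [->|neq] := eqVneq (nat_of_ord i) n.+1.
    by rewrite addn1 modnn /=; lia.
  rewrite modn_small; last by lia.
  by case: (nat_of_ord i) i_gt0 => // k _ /=; lia.
rewrite /alpha /Lam0 /delta /delta_frac; apply/pair_eqP/andP; split; apply/eqP => /=.
  by apply/ffunP => j; rewrite !ffunE; case: (i == 0); rewrite /= !ffunE; lia.
by case: (i == 0) dD => /=; lia.
Qed.

Definition dominant (la : weight) : Prop := forall i, (0 <= la.1 i)%O.

Definition tau_weight (la : weight) : weight :=
  ([ffun j => la.1 (j - 1)], la.2).

(* x_i |-> Lambda_i - Lambda_{i-1} + (ell + 1 - 2 i) / (2 ell) delta; the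
   variable x_i is var j with i = j + 1. *)
Definition var_weight (j : 'I_n.+2) : weight :=
  Lam (inZp j.+1) - Lam (inZp j)
    + delta_frac ((n.+2)%:Z + 1 - (2 * j.+1)%:Z).

(* The ring homomorphism with x_j |-> e^(var_weight j) and q |-> e^(- delta),
   written on the basis of monomials. *)
Definition zeta (h : {poly laurent n}) : group_ring weight :=
  \sum_(d < size h) \sum_(a <- msupp h`_d)
    gexp (\sum_j var_weight j *~ a j - delta *+ d) *~ (h`_d)@_a.

End Weights.

(* The field Q(q) and the quantum parameter, unrelated to the q above. *)
Definition Qq : fieldType := {fraction {poly rat}}.
Definition qq : Qq := tofrac ('X : {poly rat}).

(* Rational functions regular at q = 0. *)
Definition regular0 (c : Qq) : Prop :=
  exists p r : {poly rat}, r.[0] != 0 /\ c = tofrac p / tofrac r.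

Definition qint (k : nat) : Qq := (qq ^+ k - qq ^- k) / (qq - qq^-1).
Definition qfact (k : nat) : Qq := \prod_(j < k) qint j.+1.

Definition divpow (M : lmodType Qq) (g : M -> M) (k : nat) (v : M) : M :=
  (qfact k)^-1 *: iter k g v.

(* Modules over U_q(affine sl_ell), given by the action of the generators
   e_i, f_i, q^h (h in Hom(P, Z)) subject to the defining relations. *)
Record uqmod (n : nat) := UqMod {
  uq_space :> lmodType Qq;
  uq_e : node n -> {linear uq_space -> uq_space};
  uq_f : node n -> {linear uq_space -> uq_space};
  uq_t : coweight n -> {linear uq_space -> uq_space};
  uq_t0 : forall v, uq_t 0 v = v;
  uq_tD : forall h h' v, uq_t (h + h') v = uq_t h (uq_t h' v);
  uq_te : forall h i v,
    uq_t h (uq_e i v) = qq ^ pairing h (alpha i) *: uq_e i (uq_t h v);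
  uq_tf : forall h i v,
    uq_t h (uq_f i v) = qq ^ (- pairing h (alpha i)) *: uq_f i (uq_t h v);
  uq_ef : forall i j v,
    uq_e i (uq_f j v) - uq_f j (uq_e i v) =
      if i == j then
        (qq - qq^-1)^-1 *: (uq_t (coroot i) v - uq_t (- coroot i) v)
      else 0;
  uq_serre_e : forall i j v, i != j ->
    let m := absz (1 - pairing (coroot i) (alpha j)) in
    \sum_(k < m.+1) (-1) ^+ k *:
      divpow (uq_e i) (m - k) (uq_e j (divpow (uq_e i) k v)) = 0;
  uq_serre_f : forall i j v, i != j ->
    let m := absz (1 - pairing (coroot i) (alpha j)) in
    \sum_(k < m.+1) (-1) ^+ k *:
      divpow (uq_f i) (m - k) (uq_f j (divpow (uq_f i) k v)) = 0
}.

Arguments uq_e {n u} _.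
Arguments uq_f {n u} _.
Arguments uq_t {n u} _.

Section Modules.
Variables (n : nat) (M : uqmod n).

Definition weight_vec (la : weight n) (v : M) : Prop :=
  forall h, uq_t h v = qq ^ pairing h la *: v.

Definition submodule (W : M -> Prop) : Prop :=
  [/\ W 0, forall (c : Qq) x y, W x -> W y -> W (c *: x + y),
      forall i x, W x -> W (uq_e i x), forall i x, W x -> W (uq_f i x)
    & forall h x, W x -> W (uq_t h x)].

Definition irreducible_mod : Prop :=
  (exists v : M, v <> 0) /\
  forall W, submodule W -> (forall v, W v -> v = 0) \/ (forall v, W v).

Definition integrable_mod : Prop :=
  (forall v : M, exists s : seq M,
     (forall x, List.In x s -> exists la, weight_vec la x)
     /\ v = \sum_(x <- s) x) /\
  (forall i (v : M), exists k, iter k (uq_e i) v = 0 /\ iter k (uq_f i) v = 0).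

Definition highest_weight_vec (La : weight n) (u : M) : Prop :=
  [/\ u <> 0, weight_vec La u & forall i, uq_e i u = 0].

Definition irr_integrable_hw (La : weight n) (u : M) : Prop :=
  [/\ irreducible_mod, integrable_mod & highest_weight_vec La u].

(* v = sum_(k < N) f_i^(k) x_k, with v of weight la, e_i x_k = 0, x_k of weight
   la + k alpha_i, and x_k = 0 unless k >= - <alpha_i^vee, la>; the last
   condition makes the nonzero x_k unique. *)
Definition string_dec (i : node n) (la : weight n) (v : M) (N : nat)
    (x : nat -> M) : Prop :=
  [/\ weight_vec la v,
      forall k, (k < N)%N ->
        [/\ uq_e i (x k) = 0, weight_vec (la + alpha i *+ k) (x k)
          & (k%:Z + pairing (coroot i) la < 0)%O -> x k = 0]
    & v = \sum_(k < N) divpow (uq_f i) k (x k)].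

(* v' is the image of the weight vector v under the Kashiwara operator. *)
Definition kash_f (i : node n) (v v' : M) : Prop :=
  exists la N x, string_dec i la v N x /\
    v' = \sum_(k < N) divpow (uq_f i) k.+1 (x k).

Definition kash_e (i : node n) (v v' : M) : Prop :=
  exists la N x, string_dec i la v N x /\
    v' = \sum_(1 <= k < N) divpow (uq_f i) k.-1 (x k).

Variable u : M.

Inductive string_vec : M -> Prop :=
| string_hw : string_vec u
| string_step i v v' : string_vec v -> kash_f i v v' -> string_vec v'.

Definition lattice (v : M) : Prop :=
  exists s : seq (Qq * M),
    (forall p, List.In p s -> regular0 p.1 /\ string_vec p.2) /\
    v = \sum_(p <- s) p.1 *: p.2.

Definition qlattice (v : M) : Prop := exists2 x, lattice x & v = qq *: x.

Definition qcoset (v : M) : M -> Prop := fun x => qlattice (x - v).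

(* The nonzero cosets of the f_{i_1} ... f_{i_k} u in L / q L. *)
Definition crystal_basis : Type :=
  {c : M -> Prop |
    exists v, [/\ string_vec v, ~ qlattice v & c = qcoset v]}.

Definition is_hw_elt (b : crystal_basis) : Prop := sval b = qcoset u.

(* The partial map on the crystal basis induced by an operator on L. *)
Definition induced_op (R : M -> M -> Prop) (b : crystal_basis) :
    option crystal_basis :=
  let graph b' := exists v v', [/\ sval b v, R v v' & sval b' v'] in
  epsilon (inhabits None) (fun o =>
    if o is Some b' then graph b' else forall b', ~ graph b').

Definition crystal_wt (b : crystal_basis) : weight n :=
  epsilon (inhabits 0) (fun la => exists2 v, sval b v & weight_vec la v).

End Modules.

(* The value None of an operator stands for 0. *)
Record crystal (n : nat) := Crystal {
  cr_elt :> Type;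
  cr_wt : cr_elt -> weight n;
  cr_e : node n -> cr_elt -> option cr_elt;
  cr_f : node n -> cr_elt -> option cr_elt
}.

Section Crystals.
Variable n : nat.

Definition iter_op (T : Type) (g : T -> option T) (k : nat) (b : T) : option T :=
  iter k (obind g) (Some b).

(* max { k | g^k b <> 0 } *)
Definition op_depth (T : Type) (g : T -> option T) (b : T) : nat :=
  epsilon (inhabits 0%N) (fun k => iter_op g k b <> None /\
    forall m, iter_op g m b <> None -> (m <= k)%N).

Definition cr_eps (C : crystal n) (i : node n) (b : C) : nat :=
  op_depth (cr_e i) b.
Definition cr_phi (C : crystal n) (i : node n) (b : C) : nat :=
  op_depth (cr_f i) b.

Definition tensor (C1 C2 : crystal n) : crystal n := {|
  cr_elt := (C1 * C2)%type;
  cr_wt := fun b => cr_wt b.1 + cr_wt b.2;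
  cr_e := fun i b =>
    if (cr_phi i b.2 < cr_eps i b.1)%N
    then omap (fun b1 => (b1, b.2)) (cr_e i b.1)
    else omap (fun b2 => (b.1, b2)) (cr_e i b.2);
  cr_f := fun i b =>
    if (cr_phi i b.2 <= cr_eps i b.1)%N
    then omap (fun b1 => (b1, b.2)) (cr_f i b.1)
    else omap (fun b2 => (b.1, b2)) (cr_f i b.2)
|}.

Definition Fset (C : crystal n) (i : node n) (S : C -> Prop) : C -> Prop :=
  fun b' => exists b m, S b /\ iter_op (cr_f i) m b = Some b'.

Definition Fword (C : crystal n) (w : seq 'I_n.+1) (S : C -> Prop) : C -> Prop :=
  foldr (fun i => Fset (posr i : node n)) S w.

(* Meaningful for finite S. *)
Definition ch (C : crystal n) (S : C -> Prop) : group_ring (weight n) :=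
  epsilon (inhabits 0) (fun chi : group_ring (weight n) =>
    exists s : seq C, [/\ List.NoDup s, forall b, S b <-> List.In b s
      & chi = \sum_(b <- s) gexp (cr_wt b)]).

(* A choice of modules and of highest weight vectors. *)
Variables (V : weight n -> uqmod n) (u : forall La, V La).

Definition Bcr (La : weight n) : crystal n := {|
  cr_elt := crystal_basis (u La);
  cr_wt := @crystal_wt n (V La) (u La);
  cr_e := fun i => induced_op (@kash_e n (V La) i);
  cr_f := fun i => induced_op (@kash_f n (V La) i)
|}.

Definition Bhw (La : weight n) : Bcr La -> Prop :=
  @is_hw_elt n (V La) (u La).

(* The crystal B(La_k) (x) ... (x) B(La_2) (x) B(La_1) (x) B(La), for
   s = [:: La_1; La_2; ...; La_k], left associated. *)
Fixpoint Btens (La : weight n) (s : seq (weight n)) : crystal n :=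
  if s is La' :: s' then tensor (Btens La' s') (Bcr La) else Bcr La.

Definition fseq (C : crystal n) (js : seq (node n)) (b : C) : option C :=
  foldr (fun j => obind (cr_f j)) (Some b) js.

(* The graph of the bijection F_tau : B(La) -> B(tau La). *)
Definition Ftau1 (La : weight n) (b : Bcr La) (b' : Bcr (tau_weight La)) : Prop :=
  exists b0 b0' (js : seq (node n)),
    [/\ Bhw b0, Bhw b0', fseq js b0 = Some b
      & fseq [seq j + 1 | j <- js] b0' = Some b'].

Fixpoint Ftau_graph (La : weight n) (s : seq (weight n)) :
    Btens La s -> Btens (tau_weight La) (map (@tau_weight n) s) -> Prop :=
  match s return
    Btens La s -> Btens (tau_weight La) (map (@tau_weight n) s) -> Prop with
  | [::] => fun b b' => Ftau1 b b'
  | La' :: s' => fun b b' =>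
      @Ftau_graph La' s' b.1 b'.1 /\ @Ftau1 La b.2 b'.2
  end.

Definition Ftau (La : weight n) (s : seq (weight n)) (S : Btens La s -> Prop) :
    Btens (tau_weight La) (map (@tau_weight n) s) -> Prop :=
  fun b' => exists2 b, S b & Ftau_graph b b'.

(* The highest weights of the factors to the left of the last one. *)
Fixpoint agd_weights (r : seq (seq 'I_n.+1 * nat)) : seq (weight n) :=
  if r is (w, m) :: r' then
    tau_weight (Lam 1 *+ m) :: map (@tau_weight n) (agd_weights r')
  else [::].

(* F_{w_1}( F_{tau w_2}( ... F_{tau w_p} {u_{m_p Lambda_1}} ... )
   (x) u_{m_1 Lambda_1} ), for r = [:: (w_2, m_2); ...; (w_p, m_p)] *)
Fixpoint agd (w : seq 'I_n.+1) (m : nat) (r : seq (seq 'I_n.+1 * nat)) :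
    Btens (Lam 1 *+ m) (agd_weights r) -> Prop :=
  match r return Btens (Lam 1 *+ m) (agd_weights r) -> Prop with
  | [::] => Fword w (@Bhw (Lam 1 *+ m))
  | (w', m') :: r' =>
      @Fword (Btens (Lam 1 *+ m) (agd_weights ((w', m') :: r'))) w
        (fun b => Ftau (@agd w' m' r') b.1 /\ Bhw b.2)
  end.

Definition mudiff (mu : seq nat) (i : nat) : nat :=
  (nth 0 mu i - nth 0 mu i.+1)%N.

(* AGD(mu; (w, ws)) *)
Definition AGD (mu : seq nat) (w : seq 'I_n.+1) (ws : seq (seq 'I_n.+1)) :=
  @agd w (mudiff mu 0) (zip ws [seq mudiff mu i | i <- iota 1 (size ws)]).

End Crystals.

Arguments AGD {n V} u mu w ws.

Definition mu_expo n (mu : n.+2.-tuple nat) : expo n :=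
  [ffun i => (tnth mu i)%:Z].

(* 2 ell n_ell(mu) *)
Definition n_ell2 n (mu : n.+2.-tuple nat) : int :=
  (sumn mu)%:Z * (n.+1)%:Z - 2 * \sum_(i < n.+2) i%:Z * (tnth mu i)%:Z.

(* Main.v *)
Require Import Defs.
From HB Require Import structures.
From mathcomp Require Import all_boot all_order all_algebra.
From mathcomp Require Import perm finmap zify ring monalg.
From Stdlib Require Import ClassicalEpsilon.
From Stdlib Require Import FunctionalExtensionality PropExtensionality.
From Stdlib Require List ProofIrrelevance.

(** On the Catalan side, the kernel of the polynomial part is stable under the
    operators pi_i. Modulo this kernel the product over Psi can be built one row at
    a time, and H(Psi; mu; w) becomes pi_w O_1, where
    O_k = x_1^(mu_k) Phi pi_(c(nr_k)) O_(k+1) and Phi is the rotation x_i |-> x_(i+1),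
    with x_(l+1) = q x_1.

    On the crystal side, B(m Lambda_c) is realised on m-tuples of Maya diagrams: the
    irreducible module is cut out of a module spanned by them, and it carries a
    crystal lattice reducing to the connected component of the vacuum tuple. The
    subsets occurring in AGD meet every i-string in the empty set, in its top or in
    the whole string, so F_i acts on characters as a Demazure operator. Under zeta,
    F_tau becomes Phi and tensoring with u_(m Lambda_1) becomes multiplication by
    x_1^m up to the stated normalisation, so both sides satisfy the same recursion. *)

(** The objects of the statement are given by choice, so each is first pinned down by a checkable
    criterion. For the polynomial part it is the vanishing, at nonnegative exponents, of the
    coefficients of f times the product of all 1 - x_i/x_j with i < j: keys with a negative entry
    satisfy it, nonzero polynomials do not, and every pi_i preserves it. For the crystal of an
    abstract irreducible module the obstacle is to identify the lattice spanned by Kashiwara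
    monomials with the vectors regular at q = 0. Configurations are orthonormal for a form under
    which e_i and f_i are adjoint up to powers of q, and a sum of rational squares vanishes only if
    each term does, so norms detect divisibility by q. Generation of the lattice comes from bases of
    Demazure submodules, and these need the string property. The latter is obtained beforehand from
    combinatorics and one linear input: highest weight configurations of equal weight generate
    isomorphic crystals, so vacua may be permuted until the innermost f_j acts on a block of its
    own. In the coordinates used, every alpha_i has delta-coordinate 2; this level measures depth in
    the inductions. *)

Set Implicit Arguments.
Unset Strict Implicit.
Unset Printing Implicit Defensive.

Import GRing.Theory Num.Theory Order.TTheory.
Local Open Scope ring_scope.
Local Notation funext := functional_extensionality.

(** * Group rings *)

Section ZmodMorphism.
Variables (M N : zmodType) (F : M -> N).
Hypothesis FB : zmod_morphism F.
Lemma zmorph0 : F 0 = 0. Proof. by rewrite -[X in F X](subrr 0) FB subrr. Qed.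
Lemma zmorphN x : F (- x) = - F x. Proof. by rewrite -sub0r FB zmorph0 sub0r. Qed.
Lemma zmorphD x y : F (x + y) = F x + F y.
Proof. by rewrite -{1}[y]opprK FB zmorphN opprK. Qed.
Lemma zmorph_sum (I : Type) (r : seq I) (P : pred I) (E : I -> M) :
  F (\sum_(i <- r | P i) E i) = \sum_(i <- r | P i) F (E i).
Proof. exact: (big_morph F zmorphD zmorph0). Qed.
Lemma zmorph_mulz x (z : int) : F (x *~ z) = F x *~ z.
Proof.
have Fn k : F (x *+ k) = F x *+ k.
  by elim: k => [|k IH]; rewrite ?mulr0n ?zmorph0 // !mulrS zmorphD IH.
by case: z => k; rewrite ?NegzE ?mulrNz -?pmulrn ?zmorphN Fn.
Qed.
End ZmodMorphism.

Section GroupRingTheory.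
Variable G : zmodType.
Implicit Types (f g : group_ring G) (a b : G).

Lemma group_ring_ext f g : (forall a, f@_a = g@_a) -> f = g.
Proof. by move=> fg; apply/malgP. Qed.
Lemma coefB f g a : (f - g)@_a = f@_a - g@_a.
Proof. exact: mcoeffB. Qed.
Lemma coefD f g a : (f + g)@_a = f@_a + g@_a.
Proof. exact: mcoeffD. Qed.
Lemma coefN f a : (- f)@_a = - f@_a.
Proof. exact: mcoeffN. Qed.
Lemma coef0g a : (0 : group_ring G)@_a = 0.
Proof. exact: mcoeff0. Qed.
Lemma coef_gexp b a : (gexp b)@_a = (b == a)%:R.
Proof. exact: mcoeffU. Qed.
Lemma coef_mulz f (z : int) a : (f *~ z)@_a = f@_a * z.
Proof.
have nat_case k : (f *+ k)@_a = f@_a * k%:Z.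
  by elim: k => [|k IH]; rewrite ?mulr0n ?mulr0 ?coef0g // mulrS coefD IH intS mulrDr mulr1.
case: z => k; first exact: nat_case.
by rewrite NegzE mulrNz coefN [X in X@_a](_ : _ = f *+ k.+1) // nat_case mulrN.
Qed.

Lemma gexp0 : gexp 0 = 1 :> group_ring G. Proof. by []. Qed.

Definition lin_ext (M : zmodType) (phi : G -> M) f : M :=
  \sum_(a <- msupp f) phi a *~ f@_a.

Lemma lin_extw (M : zmodType) (phi : G -> M) f (d : {fset G}) :
  (msupp f `<=` d)%fset -> lin_ext phi f = \sum_(a <- d) phi a *~ f@_a.
Proof.
move=> le; rewrite /lin_ext (big_fset_incl _ le) //= => k _ /mcoeff_outdom ->.
by rewrite mulr0z.
Qed.

Lemma lin_ext_is_zmod (M : zmodType) (phi : G -> M) : zmod_morphism (lin_ext phi).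
Proof.
move=> f g; pose d := (msupp f `|` msupp g)%fset.
rewrite (@lin_extw _ _ (f - g) d); last exact: msuppB_le.
rewrite (@lin_extw _ _ f d) ?fsubsetUl // (@lin_extw _ _ g d) ?fsubsetUr //.
by rewrite -sumrB; apply/eq_bigr => a _; rewrite -mulrzBr coefB.
Qed.
HB.instance Definition _ (M : zmodType) (phi : G -> M) :=
  GRing.isZmodMorphism.Build (group_ring G) M (lin_ext phi) (lin_ext_is_zmod phi).

Lemma lin_ext_gexp (M : zmodType) (phi : G -> M) a : lin_ext phi (gexp a) = phi a.
Proof.
rewrite (@lin_extw _ _ _ [fset a]%fset) ?msuppU_le // big_seq_fset1 coef_gexp eqxx.
by rewrite mulr1z.
Qed.

Lemma group_ring_sum f : f = \sum_(a <- msupp f) gexp a *~ f@_a.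
Proof.
rewrite {1}[f]group_ringE; apply/eq_bigr => a _; apply/group_ring_ext => b.
by rewrite coef_mulz coef_gexp mcoeffU mulr_natl.
Qed.

End GroupRingTheory.

(* Computing directly in [group_ring G] makes unification unfold the product;
   the theory is therefore developed for an abstract ring with this interface. *)
Record gring (G : zmodType) := GRingI {
  gr_ring :> comNzRingType;
  gX : G -> gr_ring;
  gcf : gr_ring -> G -> int;
  gsupp : gr_ring -> seq G;
  glin : forall M : zmodType, (G -> M) -> gr_ring -> M;
  gX0 : gX 0 = 1;
  gXD : forall a b, gX (a + b) = gX a * gX b;
  gcfB : forall f g a, gcf (f - g) a = gcf f a - gcf g a;
  gcfX : forall b a, gcf (gX b) a = (b == a)%:R;
  gext : forall f g, gcf f =1 gcf g -> f = g;
  gsupp_uniq : forall f, uniq (gsupp f);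
  gsuppP : forall f a, (a \in gsupp f) = (gcf f a != 0);
  gsumE : forall f, f = \sum_(a <- gsupp f) gX a *~ gcf f a;
  glinB : forall (M : zmodType) (phi : G -> M), zmod_morphism (glin phi);
  glinX : forall (M : zmodType) (phi : G -> M) a, glin phi (gX a) = phi a }.

Definition group_gring (G : zmodType) : gring G :=
  @GRingI G (group_ring G) (@gexp G) (fun f a => f@_a) (fun f => msupp f)
    (@lin_ext G) (gexp0 G) (@gexpD G) (@coefB G) (@coef_gexp G)
    (@group_ring_ext G) (fun f => fset_uniq _) (fun f a => esym (mcoeff_neq0 _ _))
    (@group_ring_sum G) (@lin_ext_is_zmod G) (@lin_ext_gexp G).

Section GRingTheory.
Variables (G : zmodType) (L : gring G).
Implicit Types (f g : L) (a b : G).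
Local Notation X := (@gX G L).
Local Notation cf := (@gcf G L).

HB.instance Definition _ (M : zmodType) (phi : G -> M) :=
  GRing.isZmodMorphism.Build L M (@glin G L M phi) (glinB phi).

Definition gcoef a f := cf f a.
Lemma gcoef_is_zmod a : zmod_morphism (gcoef a).
Proof. by move=> f g; rewrite /gcoef gcfB. Qed.
HB.instance Definition _ a :=
  GRing.isZmodMorphism.Build L int (gcoef a) (gcoef_is_zmod a).
Lemma gcfN f a : cf (- f) a = - cf f a.
Proof. exact: (raddfN (gcoef a)). Qed.
Lemma gcf0 a : cf 0 a = 0.
Proof. exact: (raddf0 (gcoef a)). Qed.
Lemma gcf_sum (I : Type) (r : seq I) (P : pred I) (F : I -> L) a :
  cf (\sum_(i <- r | P i) F i) a = \sum_(i <- r | P i) cf (F i) a.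
Proof. exact: (raddf_sum (gcoef a)). Qed.
Lemma gcf_mulz f (z : int) a : cf (f *~ z) a = cf f a * z.
Proof. by rewrite -mulrzz; exact: (raddfMz (gcoef a) z f). Qed.

Lemma gring_ind (P : L -> Prop) : P 0 ->
  (forall f g, P f -> P g -> P (f - g)) -> (forall a, P (X a)) -> forall f, P f.
Proof.
move=> P0 PB Pg f.
have PN g : P g -> P (- g) by move=> Pg'; rewrite -[- g]add0r; apply: PB.
have PD g h : P g -> P h -> P (g + h) by move=> ? ?; rewrite -[h]opprK; apply/PB/PN.
rewrite [f]gsumE; elim/big_ind: _ => // a _.
have Pn k : P (X a *+ k) by elim: k => [|k IH]; rewrite ?mulr0n // mulrS; apply: PD.
by case: (cf f a) => k; rewrite ?NegzE ?mulrNz -?pmulrn; [|apply: PN]; apply: Pn.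
Qed.

(** Monomials generate the group ring additively; most operator identities below are reduced to
    monomials in this way. *)
Lemma gadd_ext (M : zmodType) (F H : L -> M) :
  zmod_morphism F -> zmod_morphism H -> (forall a, F (X a) = H (X a)) -> F =1 H.
Proof.
move=> FB HB FH; apply: gring_ind => // [|f g Ff Fg].
  by rewrite -[0](subrr 0) FB HB !subrr.
by rewrite FB HB Ff Fg.
Qed.

Lemma gcfXM b f a : cf (X b * f) a = cf f (a - b).
Proof.
move: f; apply: gadd_ext => [f g|f g|c].
- by rewrite mulrBr gcfB.
- by rewrite gcfB.
by rewrite -gXD !gcfX [c == _]eq_sym subr_eq eq_sym addrC.
Qed.

Lemma gcf_mul f g b : cf (f * g) b = \sum_(a <- gsupp f) cf f a * cf g (b - a).
Proof.
rewrite {1}[f]gsumE mulr_suml gcf_sum; apply/eq_bigr => a _.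
by rewrite mulrzAl gcf_mulz gcfXM mulrC.
Qed.

Lemma gXNK a : X a * X (- a) = 1.
Proof. by rewrite -gXD subrr gX0. Qed.
Lemma gX_inj a f g : X a * f = X a * g -> f = g.
Proof.
move=> e; have : X (- a) * (X a * f) = X (- a) * (X a * g) by rewrite e.
by rewrite !mulrA (mulrC (X (- a))) gXNK !mul1r.
Qed.

(* A relation f = x^b f would propagate a support point to infinitely many. *)
Lemma one_subX_reg b f : (forall k, b *+ k = 0 -> k = 0%N) ->
  (1 - X b) * f = 0 -> f = 0.
Proof.
move=> binf f0; apply/gext => a; rewrite gcf0; apply/eqP/negPn/negP => fa.
have step c : cf f c = cf f (c - b).
  have := congr1 (cf^~ c) f0; rewrite mulrBl mul1r gcfB gcfXM gcf0.
  by move/eqP; rewrite subr_eq0 => /eqP.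
have all k : cf f (a - b *+ k) = cf f a.
  by elim: k => [|k <-]; rewrite ?mulr0n ?subr0 // mulrSr opprD addrA -step.
pose s := [seq a - b *+ k | k <- iota 0 (size (gsupp f)).+1].
have us : uniq s.
  rewrite map_inj_uniq ?iota_uniq // => k m /addrI /oppr_inj.
  wlog: k m / (k <= m)%N => [W|km].
    by case/orP: (leq_total k m) => [/W|/W h /esym /h].
  move/eqP; rewrite eq_sym -subr_eq0 -mulrnBr // => /eqP /binf; lia.
have := @uniq_leq_size _ s (gsupp f) us.
rewrite size_map size_iota ltnn => H; apply: (notF (H _)) => x /mapP [k _ ->].
by rewrite gsuppP all.
Qed.

Lemma one_subX_inj b f g : (forall k, b *+ k = 0 -> k = 0%N) ->
  (1 - X b) * f = (1 - X b) * g -> f = g.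
Proof.
move=> binf e; apply/eqP; rewrite -subr_eq0; apply/eqP/(one_subX_reg binf).
by rewrite mulrBr e subrr.
Qed.

End GRingTheory.

Section GRingMap.
Variables (G H : zmodType) (L : gring G) (L' : gring H) (phi : G -> H).
Hypothesis phiB : zmod_morphism phi.

Definition gmap : L -> L' := glin (fun a => gX L' (phi a)).

HB.instance Definition _ := GRing.isZmodMorphism.Build L L' gmap (glinB _).

Lemma gmapX a : gmap (gX L a) = gX L' (phi a).
Proof. exact: glinX. Qed.

Lemma gmapM f g : gmap (f * g) = gmap f * gmap g.
Proof.
have phi0 : phi 0 = 0 by rewrite -[0](subrr 0) phiB subrr.
have phiD a b : phi (a + b) = phi a + phi b.
  by rewrite -{1}[b]opprK -(sub0r b) !phiB phi0 sub0r opprK.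
move: f; apply: gadd_ext => [f f'|f f'|a]; rewrite ?mulrBl ?raddfB ?mulrBl //.
move: g; apply: gadd_ext => [g g'|g g'|b]; rewrite ?mulrBr ?raddfB ?mulrBr //.
by rewrite -gXD !gmapX phiD gXD.
Qed.

Lemma gmap1 : gmap 1 = 1.
Proof. by rewrite -gX0 gmapX -[0](subrr 0) phiB subrr gX0. Qed.

End GRingMap.

(** * Demazure operators *)

Section Exponents.
Variable n : nat.
Implicit Types (i j : 'I_n.+1) (p : 'I_n.+2) (a b : expo n).

Definition sroot i : expo n := evec (posl i) - evec (posr i).

Lemma evecE p q : evec p q = (q == p)%:R :> int. Proof. by rewrite ffunE. Qed.

Lemma posl_posr i : posl i != posr i.
Proof. by rewrite -val_eqE /= /bump /=; lia. Qed.

Lemma posrE i : posr i = i.+1 :> nat. Proof. by rewrite /= /bump. Qed.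
Lemma poslE i : posl i = i :> nat. Proof. by []. Qed.

Lemma expoB a b p : (a - b) p = a p - b p.
Proof. by rewrite !ffunE. Qed.
Lemma expoD a b p : (a + b) p = a p + b p.
Proof. by rewrite !ffunE. Qed.
Lemma expoN a p : (- a) p = - a p.
Proof. by rewrite !ffunE. Qed.
Lemma expo0 p : (0 : expo n) p = 0.
Proof. by rewrite !ffunE. Qed.
Lemma expoMn a k p : (a *+ k) p = a p * k%:Z.
Proof. by elim: k => [|k IH]; rewrite ?mulr0n ?expo0 ?mulr0 // mulrS expoD IH intS mulrDr mulr1. Qed.

Definition expoE := (expoB, expoD, expoN, expo0, expoMn, evecE).

Lemma sroot_l i : sroot i (posl i) = 1.
Proof. by rewrite !expoE eqxx (negbTE (posl_posr i)). Qed.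
Lemma sroot_r i : sroot i (posr i) = -1.
Proof. by rewrite !expoE eqxx eq_sym (negbTE (posl_posr i)). Qed.
Lemma sroot_o i p : p != posl i -> p != posr i -> sroot i p = 0.
Proof. by move=> /negbTE h1 /negbTE h2; rewrite !expoE h1 h2. Qed.
Lemma swap_expo_l i a : swap_expo i a (posl i) = a (posr i).
Proof. by rewrite ffunE tpermL. Qed.
Lemma swap_expo_r i a : swap_expo i a (posr i) = a (posl i).
Proof. by rewrite ffunE tpermR. Qed.
Lemma swap_expo_o i a p : p != posl i -> p != posr i -> swap_expo i a p = a p.
Proof. by move=> h1 h2; rewrite ffunE tpermD // eq_sym. Qed.

Lemma posP i (P : 'I_n.+2 -> Prop) : P (posl i) -> P (posr i) ->
  (forall p, p != posl i -> p != posr i -> P p) -> forall p, P p.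
Proof.
move=> Pl Pr Po p; have [->//|pl] := eqVneq p (posl i).
by have [->//|pr] := eqVneq p (posr i); apply: Po.
Qed.

Lemma swap_expo_zmod i : zmod_morphism (swap_expo i).
Proof. by move=> a b; apply/ffunP => p; rewrite !ffunE. Qed.
Lemma swap_expoK i : involutive (swap_expo i).
Proof. by move=> a; apply/ffunP => p; rewrite !ffunE tpermK. Qed.

(** The reflection formula s_i a = a - <a, alpha_i> alpha_i, which turns statements about swaps into
    statements along a root line. *)
Lemma swap_expoE i a : swap_expo i a = a - (sroot i *~ (a (posl i) - a (posr i))).
Proof.
apply/ffunP => p; rewrite expoB.
have -> : forall z, (sroot i *~ z) p = sroot i p * z.
  move=> z; case: z => k; rewrite ?NegzE ?mulrNz ?expoN ?mulrN -?pmulrn; first by rewrite -expoMn.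
  by rewrite -expoMn.
elim/(posP (i := i)): p => [||p pl pr].
- by rewrite swap_expo_l sroot_l; lia.
- by rewrite swap_expo_r sroot_r; lia.
by rewrite swap_expo_o // sroot_o // mul0r subr0.
Qed.

Lemma swap_sroot i : swap_expo i (- sroot i) = sroot i.
Proof.
apply/ffunP; apply: (posP (i := i)) => [||p pl pr].
- by rewrite swap_expo_l expoN sroot_l sroot_r.
- by rewrite swap_expo_r expoN sroot_l sroot_r.
by rewrite swap_expo_o // expoN sroot_o // oppr0.
Qed.

Lemma swap_expoC i j a : (i.+1 < j)%N ->
  swap_expo i (swap_expo j a) = swap_expo j (swap_expo i a).
Proof.
move=> ij; apply/ffunP; apply: (posP (i := i)) => [||p pl pr].
- by rewrite swap_expo_l !(swap_expo_o (i := j)) ?swap_expo_l // -val_eqE /= /bump /=; lia.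
- by rewrite swap_expo_r !(swap_expo_o (i := j)) ?swap_expo_r // -val_eqE /= /bump /=; lia.
rewrite swap_expo_o //; elim/(posP (i := j)): p pl pr => [||p ql qr] pl pr.
- by rewrite !swap_expo_l swap_expo_o // -val_eqE /= /bump /=; lia.
- by rewrite !swap_expo_r swap_expo_o // -val_eqE /= /bump /=; lia.
by rewrite !swap_expo_o.
Qed.

Lemma sroot_far i j : (i.+1 < j)%N -> swap_expo i (sroot j) = sroot j /\
  swap_expo j (sroot i) = sroot i.
Proof.
move=> ij; split; rewrite swap_expoE.
  by rewrite !(sroot_o (i := j)) ?subrr ?mulr0z ?subr0 // -val_eqE /= /bump /=; lia.
by rewrite !(sroot_o (i := i)) ?subrr ?mulr0z ?subr0 // -val_eqE /= /bump /=; lia.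
Qed.

Lemma swap_expo_braid i j a : j = i.+1 :> nat ->
  swap_expo i (swap_expo j (swap_expo i a)) = swap_expo j (swap_expo i (swap_expo j a)).
Proof.
move=> ij; have e : posl j = posr i by apply: val_inj; rewrite /= /bump /= ij.
have d1 : posr j != posl i by rewrite -val_eqE /= /bump /=; lia.
have d2 : posr j != posr i by rewrite -e eq_sym posl_posr.
have d3 : posl i != posl j by rewrite e posl_posr.
apply/ffunP; apply: (posP (i := i)) => [||p pl pr].
- rewrite swap_expo_l -e swap_expo_l swap_expo_o // (swap_expo_o (i := j)) // 1?eq_sym //.
  by rewrite swap_expo_l -e swap_expo_l.
- rewrite swap_expo_r (swap_expo_o (i := j) _ d3) 1?eq_sym //.
  rewrite swap_expo_l -{2}e swap_expo_l (swap_expo_o _ d1 d2) swap_expo_r.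
  by rewrite e.
rewrite swap_expo_o //; elim/(posP (i := j)): p pl pr => [||p ql qr] pl pr.
- by rewrite e eqxx in pr.
- rewrite !swap_expo_r e !swap_expo_r (swap_expo_o (i := j)) // 1?eq_sym //.
by rewrite !swap_expo_o.
Qed.

End Exponents.

Section DemazureOperators.
Variables (n : nat) (L : gring (expo n)).
Implicit Types (i j : 'I_n.+1) (p : 'I_n.+2) (a b : expo n) (f g : L).
Local Notation monom := (gX L).
Local Notation var p := (gX L (evec p)).

Definition sw i : L -> L := @gmap _ _ L L (swap_expo i).
HB.instance Definition _ i :=
  GRing.isZmodMorphism.Build L L (sw i) (@glinB _ L L _).
Local Notation swap := sw.
Lemma swB i f g : swap i (f - g) = swap i f - swap i g.
Proof. exact: raddfB. Qed.
Lemma swapM i f g : swap i (f * g) = swap i f * swap i g.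
Proof. exact: (@gmapM _ _ _ _ _ (swap_expo_zmod i)). Qed.
Lemma swap1 i : swap i 1 = 1.
Proof. exact: (gmap1 _ _ (swap_expo_zmod i)). Qed.
Lemma swap_monom i a : swap i (monom a) = monom (swap_expo i a).
Proof. exact: gmapX. Qed.
Lemma swapK i : involutive (swap i).
Proof.
apply: gadd_ext => [f g|f g|a]; rewrite ?swB //.
by rewrite !swap_monom swap_expoK.
Qed.

Lemma var_sub_reg p q f g : p != q ->
  (var p - var q) * f = (var p - var q) * g -> f = g.
Proof.
move=> pq; have -> : var p - var q = monom (evec p) * (1 - monom (evec q - evec p)) :> L.
  by rewrite mulrBr mulr1 -gXD addrCA subrr addr0.
rewrite -!mulrA => /gX_inj; apply: one_subX_inj => k /(congr1 (fun a : expo n => a q)).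
by rewrite !expoE eqxx eq_sym (negbTE pq); lia.
Qed.

(** The quotient defining pi_i x^a, expanded as a finite geometric sum. With a_i - a_{i+1} = -(k+1)
    only the k interior points of the segment occur, with sign -1; in particular the value is 0 when
    the difference is -1. *)
Definition dem_monom i a : L :=
  match a (posl i) - a (posr i) with
  | Posz k => \sum_(j < k.+1) monom (a - sroot i *+ j)
  | Negz k => - \sum_(j < k) monom (a + sroot i *+ j.+1)
  end.

Lemma dem_monomP i a : (1 - monom (- sroot i)) * dem_monom i a
  = monom a - monom (- sroot i) * monom (swap_expo i a).
Proof.
rewrite /dem_monom swap_expoE; case E: (a (posl i) - a (posr i)) => [k|k]; rewrite -gXD.
  rewrite mulrBl mul1r mulr_sumr big_ord_recl /= mulr0n subr0 -addrA; congr (_ + _).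
  rewrite big_ord_recr /= opprD addrA -sumrB big1 => [|j _].
    by rewrite add0r -gXD -pmulrn.
  by rewrite -gXD /bump /= add1n mulrS; rewrite opprD addrCA subrr.
have -> : - sroot i + (a - sroot i *~ Negz k) = a + sroot i *+ k.
  by rewrite NegzE mulrNz opprK -pmulrn mulrS (addrCA a) addKr.
rewrite mulrN mulrBl mul1r mulr_sumr; elim: k {E} => [|k IH].
  by rewrite !big_ord0 subr0 oppr0 mulr0n addr0 subrr.
have aux (x y z t : L) : - (x + y - (z + t)) = - (x - z) + (t - y) by ring.
rewrite !big_ord_recr /= aux IH -gXD.
have -> : - sroot i + (a + sroot i *+ k.+1) = a + sroot i *+ k by rewrite mulrS (addrCA a) addKr.
by rewrite addrA subrK.
Qed.

Lemma var_eq i : (var (posl i) - var (posr i)) = monom (evec (posl i)) * (1 - monom (- sroot i)) :> L.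
Proof. by rewrite mulrBr mulr1 -gXD /sroot opprB addrCA subrr addr0. Qed.

Lemma var_eq' i f g : var (posl i) * f - var (posr i) * g
   = monom (evec (posl i)) * (f - monom (- sroot i) * g) :> L.
Proof. by rewrite mulrBr mulrA -gXD /sroot opprB addrCA subrr addr0. Qed.

(** Any operator satisfying the defining relation divided by x_i. Since 1 - x^(-alpha_i) is regular,
    the relation determines the operator, so the one obtained by choice enters only through
    [demP]. *)
Variable demazure : 'I_n.+1 -> L -> L.
Hypothesis demP : forall i f,
  (1 - monom (- sroot i)) * demazure i f = f - monom (- sroot i) * swap i f.

Lemma dem_var i f : (var (posl i) - var (posr i)) * demazure i f
      = var (posl i) * f - var (posr i) * swap i f.
Proof. by rewrite var_eq var_eq' -mulrA demP. Qed.

Lemma one_sub_sroot_inj i f g :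
  (1 - monom (- sroot i)) * f = (1 - monom (- sroot i)) * g -> f = g.
Proof.
apply: one_subX_inj => k /(congr1 (fun a : expo n => a (posl i))).
by rewrite expoMn expoN sroot_l expo0; lia.
Qed.

Lemma dem_uniq i f g :
  (1 - monom (- sroot i)) * g = f - monom (- sroot i) * swap i f -> demazure i f = g.
Proof. by rewrite -demP => /one_sub_sroot_inj. Qed.
Lemma dem_monomE i a : demazure i (monom a) = dem_monom i a.
Proof. by apply: dem_uniq; rewrite dem_monomP swap_monom. Qed.
Lemma dem_zmod i : zmod_morphism (demazure i).
Proof. by move=> f g; apply: dem_uniq; rewrite swB [LHS]mulrBr !demP; ring. Qed.

Lemma swap_dem i f : swap i (demazure i f) = demazure i f.
Proof.
have := congr1 (swap i) (demP i f); rewrite swapM /= !swB /= swapM swap1 swapK swap_monom.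
rewrite swap_sroot => e; apply: (@one_sub_sroot_inj i); apply: (@gX_inj _ _ (sroot i)).
transitivity (- ((1 - monom (sroot i)) * swap i (demazure i f))).
  by rewrite mulrA mulrBr mulr1 gXNK -mulNr opprB.
by rewrite e demP mulrBr mulrA gXNK mul1r opprB.
Qed.

Lemma dem_symM i f g : swap i g = g -> demazure i (g * f) = g * demazure i f.
Proof. by move=> sg; apply: dem_uniq; rewrite mulrCA demP swapM sg; ring. Qed.
Lemma dem_sym i f : swap i f = f -> demazure i f = f.
Proof. by move=> sf; apply: dem_uniq; rewrite sf; ring. Qed.
Lemma dem_idem i f : demazure i (demazure i f) = demazure i f.
Proof. exact/dem_sym/swap_dem. Qed.

Lemma swap_var i p : swap i (var p) = var (tperm (posl i) (posr i) p).
Proof.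
rewrite swap_monom; congr monom; apply/ffunP => q; rewrite !ffunE.
by rewrite -(inj_eq (@perm_inj _ (tperm (posl i) (posr i)))) tpermK.
Qed.

Lemma swapC i j f : (i.+1 < j)%N -> swap i (swap j f) = swap j (swap i f).
Proof.
move=> ij; move: f; apply: gadd_ext => [f g|f g|a]; rewrite /= ?swB //.
by rewrite !swap_monom swap_expoC.
Qed.

Lemma swap_dem_far i j f : (i.+1 < j)%N -> swap i (demazure j f) = demazure j (swap i f).
Proof.
move=> ij; apply/esym/dem_uniq; have := congr1 (swap i) (demP j f).
have e : swap i (monom (- sroot j)) = monom (- sroot j).
  rewrite swap_monom -[- sroot j]sub0r swap_expo_zmod (sroot_far ij).1.
  by rewrite -{1}(subrr 0) swap_expo_zmod subrr.
by rewrite swapM !swB swap1 swapM e (swapC f ij).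
Qed.

Lemma dem_far i j f : (i.+1 < j)%N ->
  demazure i (demazure j f) = demazure j (demazure i f).
Proof.
move=> ij; apply: dem_uniq.
rewrite swap_dem_far //.
have s0 : swap j (monom (- sroot i)) = monom (- sroot i).
  rewrite swap_monom -[- sroot i]sub0r swap_expo_zmod (sroot_far ij).2.
  by rewrite -{1}(subrr 0) swap_expo_zmod subrr.
have s1 : swap j (1 - monom (- sroot i)) = 1 - monom (- sroot i) by rewrite swB /= swap1 s0.
by rewrite -(dem_symM _ s1) demP dem_zmod dem_symM.
Qed.

Lemma swap_braid i j f : j = i.+1 :> nat ->
  swap i (swap j (swap i f)) = swap j (swap i (swap j f)).
Proof.
move=> ij; move: f; apply: gadd_ext => [f g|f g|a]; rewrite /= ?swB //.
by rewrite !swap_monom swap_expo_braid.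
Qed.

(* Both triple composites are, up to the Vandermonde factor, the signed sum of
   the six permutations of x_i^2 x_{i+1} f. *)
Lemma dem_braid i j f : j = i.+1 :> nat ->
  demazure i (demazure j (demazure i f)) = demazure j (demazure i (demazure j f)).
Proof.
move=> ij; have e : posl j = posr i by apply: val_inj; rewrite /= /bump /= ij.
have d1 : posl i != posr j by rewrite -val_eqE /= /bump /=; lia.
have d2 : posr i != posr j by rewrite -e posl_posr.
have d3 := posl_posr i.
set X := var (posl i); set Y := var (posr i); set Z := var (posr j).
have siX : swap i X = Y by rewrite swap_var tpermL.
have siY : swap i Y = X by rewrite swap_var tpermR.
have siZ : swap i Z = Z by rewrite swap_var tpermD.
have sjX : swap j X = X by rewrite swap_var e tpermD // eq_sym.
have sjY : swap j Y = Z by rewrite swap_var e tpermL.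
have sjZ : swap j Z = Y by rewrite swap_var e tpermR.
have ei g : (X - Y) * demazure i g = X * g - Y * swap i g by exact: dem_var.
have ej g : (Y - Z) * demazure j g = Y * g - Z * swap j g by rewrite /Y -e; exact: dem_var.
apply: (var_sub_reg d3); apply: (var_sub_reg d1); apply: (var_sub_reg d2).
rewrite -/X -/Y -/Z.
set f1 := swap i f; set f2 := swap j f.
pose R := X ^+ 2 * Y * f - Y ^+ 2 * X * f1 - X ^+ 2 * Z * f2 + Y ^+ 2 * Z * swap i f2
  + Z ^+ 2 * X * swap j f1 - Z ^+ 2 * Y * swap i (swap j f1).
have E1 : (Y - Z) * ((X - Z) * ((X - Y) * demazure i (demazure j (demazure i f)))) = R.
  set p1 := demazure i f; set r := demazure j p1.
  have e1 : (X - Y) * p1 = X * f - Y * f1 by exact: ei.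
  have e2 : (X - Z) * swap j p1 = X * f2 - Z * swap j f1.
    by have := congr1 (swap j) e1; rewrite swapM /= !swB /= !swapM sjX sjY.
  have e3 : (Y - Z) * swap i (swap j p1) = Y * swap i f2 - Z * swap i (swap j f1).
    by have := congr1 (swap i) e2; rewrite swapM /= !swB /= !swapM siX siZ.
  have er : (Y - Z) * r = Y * p1 - Z * swap j p1 by exact: ej.
  have er' : (X - Z) * swap i r = X * p1 - Z * swap i (swap j p1).
    have := congr1 (swap i) er; rewrite swapM /= !swB /= !swapM siY siZ.
    by rewrite {1}/p1 swap_dem.
  rewrite ei (_ : _ * _ = X * (X - Z) * ((Y - Z) * r) - Y * (Y - Z) * ((X - Z) * swap i r)); last by ring.
  rewrite er er' (_ : _ - _ = X * Y * ((X - Y) * p1) - X * Z * ((X - Z) * swap j p1)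
     + Y * Z * ((Y - Z) * swap i (swap j p1))); last by ring.
  by rewrite e1 e2 e3 /R; ring.
have E2 : (Y - Z) * ((X - Z) * ((X - Y) * demazure j (demazure i (demazure j f)))) = R.
  set p1 := demazure j f; set r := demazure i p1.
  have e1 : (Y - Z) * p1 = Y * f - Z * f2 by exact: ej.
  have e2 : (X - Z) * swap i p1 = X * f1 - Z * swap i f2.
    by have := congr1 (swap i) e1; rewrite swapM /= !swB /= !swapM siY siZ.
  have e3 : (X - Y) * swap j (swap i p1) = X * swap j f1 - Y * swap i (swap j f1).
    have := congr1 (swap j) e2; rewrite swapM /= !swB /= !swapM sjX sjZ.
    by rewrite {3}/f1 swap_braid.
  have er : (X - Y) * r = X * p1 - Y * swap i p1 by exact: ei.
  have er' : (X - Z) * swap j r = X * p1 - Z * swap j (swap i p1).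
    have := congr1 (swap j) er; rewrite swapM /= !swB /= !swapM sjX sjY.
    by rewrite {1}/p1 swap_dem.
  rewrite (_ : _ * _ = (X - Z) * (X - Y) * ((Y - Z) * demazure j r)); last by ring.
  rewrite ej (_ : _ * _ = Y * (X - Z) * ((X - Y) * r) - Z * (X - Y) * ((X - Z) * swap j r)); last by ring.
  rewrite er er' (_ : _ - _ = X ^+ 2 * ((Y - Z) * p1) - Y ^+ 2 * ((X - Z) * swap i p1)
     + Z ^+ 2 * ((X - Y) * swap j (swap i p1))); last by ring.
  by rewrite e1 e2 e3 /R; ring.
by rewrite E1 E2.
Qed.

Definition dmw (w : seq 'I_n.+1) f := foldr demazure f w.

Lemma dmw_zmod (w : seq 'I_n.+1) : zmod_morphism (dmw w).
Proof. by elim: w => [|i w IH] f g //=; rewrite IH dem_zmod. Qed.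
Lemma dmw_cat w w' f : dmw (w ++ w') f = dmw w (dmw w' f).
Proof. by rewrite /dmw foldr_cat. Qed.

(** The 0-Hecke monoid exists only as a congruence on words; this makes it act, which is how
    tameness is used to absorb letters. *)
Lemma dmw_hecke w w' : hecke_eq w w' -> dmw w =1 dmw w'.
Proof.
elim=> {w w'} [w|w w' _ IH|w w' w'' _ IH _ IH'|w1 w1' w2 w2' _ IH1 _ IH2|i|i j ij|i j ij] f.
- by [].
- by rewrite IH.
- by rewrite IH IH'.
- by rewrite !dmw_cat IH1 IH2.
- exact: dem_idem.
- exact: dem_far.
- exact: dem_braid.
Qed.

End DemazureOperators.

Notation demazure_op L dm :=
  (forall i f, (1 - gX L (- sroot i)) * dm i f = f - gX L (- sroot i) * sw i f).

(** * The kernel of the polynomial part *)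

Section Support.
Variables (G : zmodType) (L : gring G).
Implicit Types (f g : L) (P Q S : G -> Prop).

Definition supp_in P f := forall a, gcf f a != 0 -> P a.

Lemma supp_in0 P : supp_in P 0. Proof. by move=> a; rewrite gcf0 eqxx. Qed.

Lemma supp_inB P f g : supp_in P f -> supp_in P g -> supp_in P (f - g).
Proof.
move=> Pf Pg a; rewrite gcfB; have [->|fa _] := eqVneq (gcf f a) 0; last exact: Pf.
by rewrite sub0r oppr_eq0; apply: Pg.
Qed.

Lemma supp_inN P f : supp_in P f -> supp_in P (- f).
Proof. by move=> Pf a; rewrite gcfN oppr_eq0; apply: Pf. Qed.
Lemma supp_inD P f g : supp_in P f -> supp_in P g -> supp_in P (f + g).
Proof. by move=> Pf Pg; rewrite -[g]opprK; apply: supp_inB => //; apply: supp_inN. Qed.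

Lemma supp_in_sum P (I : Type) (r : seq I) (c : pred I) (F : I -> L) :
  (forall i, c i -> supp_in P (F i)) -> supp_in P (\sum_(i <- r | c i) F i).
Proof.
by move=> h; elim/big_ind: _ => //; [exact: supp_in0|move=> *; exact: supp_inD].
Qed.

Lemma supp_inX P a : P a -> supp_in P (gX L a).
Proof. by move=> Pa b; rewrite gcfX; have [<-|] := eqVneq a b; rewrite ?eqxx. Qed.
Lemma supp_inW P Q f : (forall a, P a -> Q a) -> supp_in P f -> supp_in Q f.
Proof. by move=> PQ Pf a /Pf /PQ. Qed.

Lemma supp_inM P Q S f g : (forall a b, P a -> Q b -> S (a + b)) ->
  supp_in P f -> supp_in Q g -> supp_in S (f * g).
Proof.
move=> PQS Pf Qg b; rewrite gcf_mul; have [|H] := boolP (has (fun a => gcf g (b - a) != 0) (gsupp f)).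
  case/hasP => a; rewrite gsuppP => /Pf Pa /Qg Qb _; have := PQS _ _ Pa Qb.
  by rewrite addrCA subrr addr0.
rewrite big1_seq ?eqxx // => a /andP[_ sa]; move/hasPn/(_ _ sa): H.
by rewrite negbK => /eqP ->; rewrite mulr0.
Qed.

Lemma supp_in_mulz P f (z : int) : supp_in P f -> supp_in P (f *~ z).
Proof. by move=> Pf a; rewrite gcf_mulz mulf_eq0 negb_or => /andP[/Pf]. Qed.

Lemma supp_in_additive (H : zmodType) (L' : gring H) P (Q : H -> Prop) (F : L -> L') f :
  zmod_morphism F -> (forall a, P a -> forall c, gcf (F (gX L a)) c != 0 -> Q c) ->
  supp_in P f -> forall c, gcf (F f) c != 0 -> Q c.
Proof.
move=> FB PQ Pf c.
rewrite [f]gsumE (zmorph_sum FB) gcf_sum => h.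
have [/hasP [a sa fa]|/hasPn H0] := boolP (has (fun a => gcf (F (gX L a)) c != 0) (gsupp f)).
  by apply: PQ fa; apply: Pf; rewrite -gsuppP.
case/eqP: h; rewrite big1_seq // => a /andP[_ /H0].
by rewrite negbK (zmorph_mulz FB) gcf_mulz => /eqP ->; rewrite mul0r.
Qed.

Lemma ex_max_seq (T : eqType) (s : seq T) (F : T -> int) : s != [::] ->
  exists2 b, b \in s & forall a, a \in s -> (F a <= F b)%O.
Proof.
elim: s => // x s IH _; have [->|/IH [b bs hb]] := eqVneq s [::].
  by exists x; rewrite ?mem_head // => a; rewrite inE => /eqP ->.
have [h|h] := leP (F x) (F b).
  by exists b; rewrite ?inE ?bs ?orbT // => a; rewrite inE => /orP[/eqP ->|/hb].
exists x; rewrite ?mem_head // => a; rewrite inE => /orP[/eqP ->//|/hb /le_trans]; apply.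
exact: ltW.
Qed.

(** An element 1 + (terms strictly lower for the linear functional [phi]): multiplication by it
    preserves leading coefficients. *)
Definition unipotent (phi : G -> int) f :=
  gcf f 0 = 1 /\ supp_in (fun c => c = 0 \/ (phi c < 0)%O) f.

Lemma unipotent1 phi : unipotent phi 1.
Proof.
split; first by rewrite -gX0 gcfX eqxx.
by rewrite -gX0; apply: supp_inX; left.
Qed.

Lemma unipotentM phi f g : {morph phi : a b / a + b} ->
  unipotent phi f -> unipotent phi g -> unipotent phi (f * g).
Proof.
move=> phiD [f1 fs] [g1 gs]; have phi0 : phi 0 = 0.
  by apply: (addrI (phi 0)); rewrite -phiD !addr0.
split; last first.
  apply: supp_inM fs gs => a b [->|ha] [->|hb]; rewrite ?add0r ?addr0; try by [left|right].
  by right; rewrite phiD; lia.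
rewrite gcf_mul (bigD1_seq 0) ?gsupp_uniq //=; last by rewrite gsuppP f1.
rewrite subr0 f1 g1 mulr1 big1_seq ?addr0 // => a /andP[a0]; rewrite gsuppP.
case/fs => [a0'|ha]; first by rewrite a0' eqxx in a0.
have [->|/gs [/eqP|h]] := eqVneq (gcf g (0 - a)) 0; first by rewrite mulr0.
  by rewrite sub0r oppr_eq0 (negbTE a0).
have := phiD (0 - a) a; rewrite subrK phi0; lia.
Qed.

Lemma unipotent_subX phi c : (phi c < 0)%O -> phi 0 = 0 -> unipotent phi (1 - gX L c).
Proof.
move=> hc phi0; split.
  rewrite gcfB gcfX -gX0 gcfX eqxx; case: eqP => [c0|]; last by rewrite subr0.
  by rewrite c0 phi0 ltxx in hc.
by rewrite -gX0; apply: supp_inB; apply: supp_inX; [left|right].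
Qed.

(** At an exponent b maximizing [phi] on the support of f, every other product of terms lands
    strictly lower, so only f_b times the constant term 1 contributes. *)
Lemma unipotent_lead phi f g : {morph phi : a b / a + b} -> unipotent phi g -> f != 0 ->
  exists b, [/\ gcf f b != 0, forall a, gcf f a != 0 -> (phi a <= phi b)%O
    & gcf (f * g) b = gcf f b].
Proof.
move=> phiD [g1 gs] f0; have : gsupp f != [::].
  by apply: contra_neq f0 => s0; rewrite [f]gsumE s0 big_nil.
case/(ex_max_seq phi) => b bs bmax; exists b; rewrite -gsuppP; split=> // [a|].
  by rewrite -gsuppP; apply: bmax.
rewrite gcf_mul (bigD1_seq b) ?gsupp_uniq //= subrr g1 mulr1 big1_seq ?addr0 //.
move=> a /andP[ab /bmax ha]; have [->|/gs [/eqP|h]] := eqVneq (gcf g (b - a)) 0.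
- by rewrite mulr0.
- by rewrite subr_eq0 eq_sym (negbTE ab).
have := phiD (b - a) a; rewrite subrK; lia.
Qed.

End Support.

Section Kernel.
Variables (n : nat) (L : gring (expo n)).
Implicit Types (i j : 'I_n.+1) (p : 'I_n.+2) (a b c : expo n) (f g : L).
Local Notation X := (gX L).

Definition nonneg a : Prop := forall p, (0 <= a p)%O.
Definition pos_roots : pred ('I_n.+2 * 'I_n.+2) := fun r => (r.1 < r.2)%N.
Definition root_fac (r : 'I_n.+2 * 'I_n.+2) : L := 1 - X (evec r.1 - evec r.2).
Definition Delta : L := \prod_(r | pos_roots r) root_fac r.
(** A coefficientwise test for membership in the kernel of the polynomial part. It is stable under
    pi_i, contains the keys with a negative entry and meets the polynomials in 0. *)
Definition ker f := forall b, nonneg b -> gcf (f * Delta) b = 0.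

Lemma ker0 : ker 0. Proof. by move=> b _; rewrite mul0r gcf0. Qed.
Lemma kerB f g : ker f -> ker g -> ker (f - g).
Proof. by move=> kf kg b hb; rewrite mulrBl gcfB kf // kg // subrr. Qed.
Lemma kerN f : ker f -> ker (- f).
Proof. by move=> kf; rewrite -sub0r; apply/kerB/kf/ker0. Qed.
Lemma kerD f g : ker f -> ker g -> ker (f + g).
Proof. by move=> kf kg; rewrite -[g]opprK; apply/kerB/kerN. Qed.
Lemma ker_sum (I : Type) (r : seq I) (P : pred I) (F : I -> L) :
  (forall x, P x -> ker (F x)) -> ker (\sum_(i <- r | P i) F i).
Proof. by move=> h; elim/big_ind: _ => //; [exact: ker0|move=> *; exact: kerD]. Qed.
Lemma ker_mulz f (z : int) : ker f -> ker (f *~ z).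
Proof. by move=> kf b hb; rewrite mulrzAl gcf_mulz kf // mul0r. Qed.

(** Division by a nonnegative monomial moves the tested coefficients to larger exponents, where they
    still vanish. There is no such argument for multiplication by variables, whence the stronger
    congruence [eqk0] later. *)
Lemma ker_XN a f : nonneg a -> ker f -> ker (X (- a) * f).
Proof.
move=> ha kf b hb; rewrite -mulrA gcfXM opprK kf // => p; rewrite expoD.
by rewrite addr_ge0.
Qed.

Definition eqk f g := ker (f - g).
Lemma eqk_refl f : eqk f f. Proof. by rewrite /eqk subrr; apply: ker0. Qed.
Lemma eqk_sym f g : eqk f g -> eqk g f.
Proof. by move/kerN; rewrite opprB. Qed.
Lemma eqk_trans g f h : eqk f g -> eqk g h -> eqk f h.
Proof. by move=> fg gh; have := kerD fg gh; rewrite addrA subrK. Qed.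

(** The positive roots other than alpha_i; s_i permutes them, so their product is s_i-invariant. *)
Definition altroot i (r : 'I_n.+2 * 'I_n.+2) := pos_roots r && (r != (posl i, posr i)).

Lemma Delta_split i : Delta = (1 - X (sroot i)) * \prod_(r | altroot i r) root_fac r.
Proof.
rewrite /Delta (bigD1 (posl i, posr i)) //=; last by rewrite /pos_roots /= /bump /=; lia.
Qed.

Lemma swap_evec i p : swap_expo i (evec p) = evec (tperm (posl i) (posr i) p).
Proof.
apply/ffunP => q; rewrite !ffunE.
by rewrite -(inj_eq (@perm_inj _ (tperm (posl i) (posr i)))) tpermK.
Qed.

Lemma altroot_perm i (r : 'I_n.+2 * 'I_n.+2) : let t := tperm (posl i) (posr i) in
  altroot i (t r.1, t r.2) = altroot i r.
Proof.
case: r => p q /=; rewrite /altroot /pos_roots /= !xpair_eqE.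
have tE (x : 'I_n.+2) : nat_of_ord (tperm (posl i) (posr i) x) =
   if x == i :> nat then i.+1 else if x == i.+1 :> nat then nat_of_ord i else x.
  case: tpermP => [->|->|/eqP h1 /eqP h2]; rewrite /= /bump /= ?add1n ?eqxx //.
    by rewrite ifF //; lia.
  by move: h1 h2; rewrite -!val_eqE /= /bump /= => /negbTE -> /negbTE ->.
rewrite -!val_eqE /= !tE /bump /=.
do 4! case: eqP; rewrite ?andbT ?andbF /=; try lia.
Qed.

Lemma swap_alt i : sw i (\prod_(r | altroot i r) root_fac r) = \prod_(r | altroot i r) root_fac r.
Proof.
rewrite (big_morph _ (swapM i) (swap1 L i)).
pose h (r : 'I_n.+2 * 'I_n.+2) := (tperm (posl i) (posr i) r.1, tperm (posl i) (posr i) r.2).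
have hinj : injective h by case=> [p q] [p' q'] [/perm_inj -> /perm_inj ->].
rewrite [RHS](reindex_inj hinj) /=; apply: eq_big => [r|r _]; first by rewrite altroot_perm.
by rewrite /root_fac swB swap1 swap_monom swap_expo_zmod !swap_evec.
Qed.

Lemma gcf_swap i f b : gcf (sw i f) b = gcf f (swap_expo i b).
Proof.
move: f; apply: gadd_ext => [f g|f g|a]; rewrite ?swB ?gcfB //.
by rewrite swap_monom !gcfX (can2_eq (swap_expoK i) (swap_expoK i)).
Qed.

(** Vanishing of the coefficients of (1 - x^(alpha_i)) g in the nonnegative range says that g is
    constant along the alpha_i-line there, up to one step beyond its lower end. Both exponents
    compared lie on this line. *)
Lemma ker_line i f : ker f -> let g := f * \prod_(r | altroot i r) root_fac r in
  forall b, nonneg b -> gcf g (swap_expo i b) = gcf g (b - sroot i).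
Proof.
move=> kf g; have step b : nonneg b -> gcf g b = gcf g (b - sroot i).
  move=> /kf; rewrite (Delta_split i) mulrCA mulrBl mul1r gcfB gcfXM => /eqP.
  by rewrite subr_eq0 => /eqP.
have line t b : nonneg b -> (t%:Z <= b (posr i))%O -> gcf g (b + sroot i *+ t) = gcf g b.
  move=> hb; elim: t => [|t IH] ht; first by rewrite mulr0n addr0.
  rewrite step; last first.
    apply: (posP (i := i)) => [||p pl pr].
    - by rewrite !expoD expoMn sroot_l; have := hb (posl i); lia.
    - by rewrite !expoD expoMn sroot_r; lia.
    by rewrite !expoD expoMn sroot_o // mul0r addr0.
  by rewrite mulrSr addrA addrK IH //; lia.
move=> b hb; rewrite -step //.
have [le|lt] := leP (b (posl i)) (b (posr i)).
  rewrite swap_expoE; have -> : b (posl i) - b (posr i) = - (absz (b (posr i) - b (posl i)))%:Z.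
    by lia.
  by rewrite mulrNz opprK -pmulrn line //; have := hb (posl i); lia.
(* In this case s_i b lies below b on the line, so constancy is read upwards starting from s_i b. *)
pose t := absz (b (posl i) - b (posr i)).
have e : b = swap_expo i b + sroot i *+ t.
  by rewrite swap_expoE (_ : b (posl i) - b (posr i) = t) ?subrK // /t; lia.
rewrite [in RHS]e line // => [p|]; first by rewrite ffunE.
by rewrite swap_expo_r /t; have := hb (posr i); lia.
Qed.

Definition tail (r : nat) a : int := \sum_(p < n.+2 | (r <= p)%N) a p.

Lemma tailD r : {morph tail r : a b / a + b}.
Proof. by move=> a b; rewrite /tail -big_split; apply/eq_bigr => p _; rewrite expoD. Qed.
Lemma tail0 r : tail r 0 = 0.
Proof. by rewrite /tail big1 // => p _; rewrite expo0. Qed.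
Lemma tailN r a : tail r (- a) = - tail r a.
Proof. by apply: (addrI (tail r a)); rewrite -tailD !subrr tail0. Qed.
Lemma tail_evec r p : tail r (evec p) = (r <= p)%N%:R.
Proof.
rewrite /tail; case: (boolP (r <= p)%N) => h.
  rewrite (bigD1 p) //= evecE eqxx big1 ?addr0 // => q /andP[_ /negbTE qp].
  by rewrite evecE qp.
by rewrite big1 // => q rq; rewrite evecE; case: eqP => // qp; rewrite qp (negbTE h) in rq.
Qed.
Lemma tail_ge0 r a : nonneg a -> (0 <= tail r a)%O.
Proof. by move=> ha; apply: sumr_ge0 => p _; apply: ha. Qed.

Lemma supp_Delta (P : expo n -> Prop) : P 0 -> (forall a b, P a -> P b -> P (a + b)) ->
  (forall p q : 'I_n.+2, (p < q)%N -> P (evec p - evec q)) -> supp_in P Delta.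
Proof.
move=> P0 PD Pr; rewrite /Delta; elim/big_ind: _ => [|f g|[p q] /= pq].
- by rewrite -gX0; apply: supp_inX.
- exact: supp_inM.
by rewrite /root_fac -gX0; apply: supp_inB; apply: supp_inX; [|apply: Pr].
Qed.

(** Each factor x_p/x_q with p < q can only lower a tail sum, so no exponent of f times [Delta] is
    nonnegative. *)
Lemma ker_tail r f : supp_in (fun a => (tail r a < 0)%O) f -> ker f.
Proof.
move=> fs b hb; apply/eqP/negPn/negP => h.
have sD : supp_in (fun a => (tail r a <= 0)%O) Delta.
  apply: supp_Delta => [|a c|p q pq]; rewrite ?tail0 ?tailD //; first by lia.
  by rewrite tailN !tail_evec; case: leqP; case: leqP => //; lia.
have := @supp_inM _ L _ _ (fun a => (tail r a < 0)%O) _ _ _ fs sD b h.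
by have := tail_ge0 r hb; move=> ? /(_ ltac:(move=> x y; rewrite tailD; lia)); lia.
Qed.

(** A linear functional negative on every e_p - e_q with p < q, which makes [Delta] unipotent. The
    weight N on the last coordinate lets that coordinate dominate all others. *)
Definition hgt (N : int) a : int := N * a ord_max + \sum_(p < n.+2) p%:Z * a p.

Lemma hgtD N : {morph hgt N : a b / a + b}.
Proof.
move=> a b; rewrite /hgt expoD mulrDr (eq_bigr (fun p : 'I_n.+2 => p%:Z * a p + p%:Z * b p)).
  by rewrite big_split /=; ring.
by move=> p _; rewrite expoD mulrDr.
Qed.
Lemma hgt0 N : hgt N 0 = 0.
Proof. by apply: (addrI (hgt N 0)); rewrite -hgtD !addr0. Qed.
Lemma hgt_evec N p : hgt N (evec p) = N * (p == ord_max)%:R + p%:Z.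
Proof.
rewrite /hgt evecE eq_sym; congr (_ + _); rewrite (bigD1 p) //= evecE eqxx mulr1 big1 ?addr0 //.
by move=> q /negbTE qp; rewrite evecE qp mulr0.
Qed.

Lemma unipotent_Delta N : (0 <= N)%O -> unipotent (hgt N) Delta.
Proof.
move=> hN; rewrite /Delta; elim/big_ind: _ => [|f g|[p q] pq].
- exact: unipotent1.
- by apply: unipotentM; apply: hgtD.
apply: unipotent_subX; last exact: hgt0.
have -> : hgt N (evec p - evec q) = hgt N (evec p) - hgt N (evec q).
  by apply: (addIr (hgt N (evec q))); rewrite -hgtD !subrK.
rewrite !hgt_evec; move: pq; rewrite /pos_roots /= => pq.
have -> : (p == ord_max) = false.
  by apply/negbTE; rewrite -val_eqE /=; have := ltn_ord q; lia.
by case: (q == ord_max); lia.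
Qed.

Definition ispoly := supp_in (L := L) nonneg.
Definition free_last := supp_in (L := L) (fun a => a ord_max = 0).

(** The leading exponent of a nonzero polynomial survives multiplication by [Delta], and it is one
    of the tested nonnegative exponents. *)
Lemma ispoly_ker f : ispoly f -> ker f -> f = 0.
Proof.
move=> pf kf; apply/eqP/negPn/negP => f0.
have [b [fb _ e]] := unipotent_lead (hgtD 0) (unipotent_Delta (lexx 0)) f0.
by move: (fb); rewrite -e (kf _ (pf _ fb)) eqxx.
Qed.

Lemma ispoly_eqk f g : ispoly f -> ispoly g -> eqk f g -> f = g.
Proof.
by move=> pf pg fg; apply/eqP; rewrite -subr_eq0; apply/eqP/ispoly_ker => //; apply: supp_inB.
Qed.

(** If g involved the last variable, its leading exponent for a functional dominated by the last
    coordinate would too, and would survive in g times [Delta]; but the exponents of f times [Delta]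
    never have positive last entry. *)
Lemma eqk_free f g : free_last f -> ispoly g -> eqk f g -> free_last g.
Proof.
move=> ff pg fg a0 ga0; apply/eqP/negPn/negP => a00.
pose K : int := \sum_(a <- gsupp g) `|hgt 0 a|.
have hK a : gcf g a != 0 -> (`|hgt 0 a| <= K)%O.
  rewrite -gsuppP => sa; rewrite /K (bigD1_seq a) ?gsupp_uniq //= lerDl.
  by apply: sumr_ge0.
have hgtE N a : hgt N a = N * a ord_max + hgt 0 a by rewrite /hgt mul0r add0r.
have K0 : (0 <= K)%O by apply: sumr_ge0.
have g0 : g != 0 by apply: contra_neq ga0 => ->; rewrite gcf0.
(* K bounds |hgt 0| on the support of g, so with weight 2K + 1 a single unit in the last coordinate
   outweighs any difference of [hgt 0]. *)
have hN : (0 <= 2 * K + 1)%O by lia.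
have [b [gb bmax e]] := unipotent_lead (hgtD _) (unipotent_Delta hN) g0.
have b_gt0 : (0 < b ord_max)%O.
  have := bmax _ ga0; rewrite !(hgtE (2 * K + 1)); have := hK _ ga0; have := hK _ gb.
  have := pg _ ga0 ord_max; have := pg _ gb ord_max => hb ha.
  have [->|] := eqVneq (b ord_max) 0; last by lia.
  have a1 : (1 <= a0 ord_max)%O by lia.
  have : ((2 * K + 1) * 1 <= (2 * K + 1) * a0 ord_max)%O by rewrite ler_wpM2l.
  by lia.
have := fg b (pg _ gb); rewrite mulrBl gcfB e => /eqP; rewrite subr_eq0 => /eqP fb.
have sD : supp_in (fun c => (c ord_max <= 0)%O) Delta.
  apply: supp_Delta => [|a c|p q pq]; rewrite ?expo0 ?expoD //; first by lia.
  rewrite expoN !evecE; have -> : (ord_max == p :> 'I_n.+2) = false.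
    by apply/negbTE; rewrite -val_eqE /=; have := ltn_ord q; lia.
  by case: eqP.
have := @supp_inM _ L _ _ (fun a => (a ord_max <= 0)%O) _ _ _ ff sD b.
rewrite fb gb => /(_ ltac:(move=> x y hx hy; rewrite expoD hx; lia) isT); lia.
Qed.

(** The lattice segment from a to s_i a, where all exponents of pi_i x^a lie. *)
Definition dem_range i a c := [/\ forall p, p != posl i -> p != posr i -> c p = a p,
      c (posl i) + c (posr i) = a (posl i) + a (posr i),
      (Num.min (a (posl i)) (a (posr i)) <= c (posl i))%O
    & (c (posl i) <= Num.max (a (posl i)) (a (posr i)))%O].

Lemma dem_monom_supp i a c : gcf (dem_monom L i a) c != 0 -> dem_range i a c.
Proof.
rewrite /dem_monom; case E: (a (posl i) - a (posr i)) => [k|k]; move: c.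
  apply: supp_in_sum => j _; apply: supp_inX.
  have := ltn_ord j; split=> [p pl pr|||]; rewrite expoB expoMn ?sroot_l ?sroot_r ?sroot_o //; try lia.
  by rewrite expoB expoMn sroot_r; lia.
apply: supp_inN; apply: supp_in_sum => j _; apply: supp_inX.
have := ltn_ord j; split=> [p pl pr|||]; rewrite expoD expoMn ?sroot_l ?sroot_r ?sroot_o //; try lia.
by rewrite expoD expoMn sroot_r; lia.
Qed.

Variable dm : 'I_n.+1 -> L -> L.
Hypothesis demP : demazure_op L dm.

(* Along the nonnegative part of each line of direction alpha_i the
   coefficients of f Delta / (1 - x_i / x_{i+1}) are constant. *)
Lemma ker_dem i f : ker f -> ker (dm i f).
Proof.
move=> kf b hb; rewrite (Delta_split i).
have e : (1 - X (sroot i)) * dm i f = sw i f - X (sroot i) * f.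
  have := congr1 (fun g => - (X (sroot i) * g)) (demP i f).
  rewrite mulrA !mulrBr mulr1 mulrA gXNK mul1r -mulNr !opprB; exact.
rewrite mulrCA mulrA e mulrBl -[X in sw i f * X]swap_alt -swapM -mulrA gcfB gcf_swap gcfXM.
by rewrite ker_line // subrr.
Qed.

Lemma ker_dmw w f : ker f -> ker (dmw dm w f).
Proof. by elim: w => //= i w IH /IH; apply: ker_dem. Qed.

Lemma supp_dem i (P : expo n -> Prop) f :
  (forall a, P a -> forall c, dem_range i a c -> P c) -> supp_in P f -> supp_in P (dm i f).
Proof.
move=> h; apply: (supp_in_additive (dem_zmod demP i)) => a Pa c.
by rewrite (dem_monomE demP) => /dem_monom_supp; apply: h.
Qed.

Lemma ispoly_dem i f : ispoly f -> ispoly (dm i f).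
Proof.
apply: supp_dem => a ha c [ho hs h1 h2]; have := ha (posl i); have := ha (posr i).
by move=> ? ?; apply: (posP (i := i)) => [||p pl pr]; [lia|lia|rewrite ho].
Qed.

Lemma ispoly_dmw w f : ispoly f -> ispoly (dmw dm w f).
Proof. by elim: w => //= i w IH /IH; apply: ispoly_dem. Qed.

End Kernel.

(** * Key polynomials span *)

Section Keys.
Variable n : nat.
Implicit Types (i j : 'I_n.+1) (p : 'I_n.+2) (a b c : expo n).

Definition norm2 a : nat := \sum_p absz (a p) ^ 2.
Definition inversions a : nat := #|[set r | pos_roots r && (a r.1 < a r.2)%O]|.

Lemma norm2E i a : norm2 a = (absz (a (posl i)) ^ 2 + (absz (a (posr i)) ^ 2
  + \sum_(p | (p != posl i) && (p != posr i)) absz (a p) ^ 2))%N.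
Proof.
by rewrite /norm2 (bigD1 (posl i)) //= (bigD1 (posr i)) //= eq_sym posl_posr.
Qed.

Lemma inversionsE i a : inversions a = (#|[set r | altroot i r && (a r.1 < a r.2)%O]|
  + (a (posl i) < a (posr i))%O)%N.
Proof.
rewrite /inversions (cardsD1 (posl i, posr i)) addnC inE /= /pos_roots /=.
rewrite (_ : (i < bump 0 i)%N) ?andTb; last by rewrite /bump /=; lia.
congr (_ + _)%N; apply: eq_card => r; rewrite !inE /altroot andbC.
by rewrite andbAC.
Qed.

Lemma altinv_swap i a : #|[set r | altroot i r && (swap_expo i a r.1 < swap_expo i a r.2)%O]|
  = #|[set r | altroot i r && (a r.1 < a r.2)%O]|.
Proof.
pose t := tperm (posl i) (posr i).
pose h (r : 'I_n.+2 * 'I_n.+2) := (t r.1, t r.2).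
have hinj : injective h by case=> [p q] [p' q'] [/perm_inj -> /perm_inj ->].
rewrite -[RHS](card_imset _ hinj); apply: eq_card => r; rewrite !inE.
apply/idP/imsetP => [/andP[ar lt]|[r' + ->]].
  exists (h r); last by rewrite /h /= !tpermK; case: r {ar lt}.
  by rewrite inE altroot_perm ar /=; move: lt; rewrite !ffunE.
by rewrite inE => /andP[ar lt]; rewrite altroot_perm ar /= !ffunE !tpermK.
Qed.

Lemma inversions_swap i a : (inversions (swap_expo i a) <= (inversions a).+1)%N.
Proof. by rewrite !(inversionsE i) altinv_swap swap_expo_l swap_expo_r; do 2 case: (_ < _)%O; lia. Qed.

Lemma inversions_swap_gt i a : (a (posr i) < a (posl i))%O ->
  inversions (swap_expo i a) = (inversions a).+1.
Proof.
move=> h; rewrite !(inversionsE i) altinv_swap swap_expo_l swap_expo_r h.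
by rewrite ltNge (ltW h) /= addn0 addn1.
Qed.

(** Squared norm first, then number of inversions: the order for which keys are unitriangular in the
    monomials. *)
Definition lower b a := (norm2 b < norm2 a)%N \/ norm2 b = norm2 a /\ (inversions b < inversions a)%N.

Lemma norm2_swap i a : norm2 (swap_expo i a) = norm2 a.
Proof.
rewrite !(norm2E i) swap_expo_l swap_expo_r addnCA; do 2 congr (_ + _)%N.
by apply: eq_bigr => p /andP[pl pr]; rewrite swap_expo_o.
Qed.

(** Strict convexity of the squared norm along the segment from b to s_i b. *)
Lemma segment_norm2 i b c : (forall p, p != posl i -> p != posr i -> c p = b p) ->
  c (posl i) + c (posr i) = b (posl i) + b (posr i) ->
  (Num.min (b (posl i)) (b (posr i)) <= c (posl i))%O ->
  (c (posl i) <= Num.max (b (posl i)) (b (posr i)))%O ->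
  [\/ (norm2 c < norm2 b)%N, c = b | c = swap_expo i b].
Proof.
move=> ho hs h1 h2.
have [e|ne] := eqVneq (c (posl i)) (b (posl i)).
  constructor 2; apply/ffunP; apply: (posP (i := i)) => //; lia.
have [e'|ne'] := eqVneq (c (posl i)) (b (posr i)).
  constructor 3; apply/ffunP; apply: (posP (i := i)) => [||p pl pr].
  - by rewrite swap_expo_l.
  - by rewrite swap_expo_r; lia.
  by rewrite swap_expo_o // ho.
constructor 1; rewrite !(norm2E i) (eq_bigr (fun p => absz (b p) ^ 2)%N); last first.
  by move=> p /andP[pl pr]; rewrite ho.
rewrite !addnA ltn_add2r.
have abs2 (z : int) : ((absz z ^ 2)%N : int) = z * z by rewrite -abszX; lia.
have : ((absz (c (posl i)) ^ 2 + absz (c (posr i)) ^ 2)%N%:Z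
  < (absz (b (posl i)) ^ 2 + absz (b (posr i)) ^ 2)%N%:Z)%O; last by lia.
rewrite !PoszD !abs2.
move: (c (posl i)) (c (posr i)) (b (posl i)) (b (posr i)) hs h1 h2 ne ne' => x y u v hs h1 h2 /eqP ne /eqP ne'.
have -> : y = u + v - x by lia.
(* The difference u^2 + v^2 - x^2 - (u + v - x)^2 is twice this product. *)
have : (0 < (x - u) * (v - x))%O.
  have [uv|uv] := leP u v; first by rewrite mulr_gt0 //; lia.
  by rewrite -mulrNN mulr_gt0 //; lia.
nia.
Qed.

Lemma act_step i a : hecke_act i a != a ->
  (a (posr i) < a (posl i))%O /\ hecke_act i a = swap_expo i a.
Proof.
rewrite /hecke_act; case: (leP (a (posr i)) (a (posl i))) => [le ne|]; last by rewrite eqxx.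
split=> //; rewrite lt_neqAle le andbT; apply: contraNN ne => /eqP e.
by apply/eqP/ffunP; apply: (posP (i := i)) => [||p pl pr];
  rewrite ?swap_expo_l ?swap_expo_r ?swap_expo_o.
Qed.

Lemma decr_swap i a : decr (swap_expo i a) = decr a.
Proof.
apply/ffunP => p; rewrite !ffunE; congr (nth _ _ _); apply/perm_sortP.
- by move=> x y; exact: le_total.
- by move=> y x z h1 h2; exact: le_trans h2 h1.
- by move=> x y; rewrite andbC => /le_anti.
have -> : codom (swap_expo i a) = map a (map (tperm (posl i) (posr i)) (enum 'I_n.+2)).
  by rewrite -map_comp; apply: eq_codom => q; rewrite ffunE.
apply: perm_map; apply: uniq_perm; rewrite ?(map_inj_uniq (@perm_inj _ _)) ?enum_uniq // => q.
rewrite -[q](tpermK (posl i) (posr i)) map_f ?mem_enum //.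
Qed.

Lemma size_codom_expo a : size (codom a) = n.+2.
Proof. by rewrite size_codom card_ord. Qed.
Lemma nth_codom_expo a p : nth 0 (codom a) p = a p.
Proof. by rewrite (nth_map p) ?size_enum_ord // nth_ord_enum. Qed.

Lemma decr_id a : (forall i, (a (posr i) <= a (posl i))%O) -> decr a = a.
Proof.
move=> h; apply/ffunP => p; rewrite ffunE sorted_sort ?nth_codom_expo //.
  by move=> y x z h1 h2; exact: le_trans h2 h1.
apply/(sortedP 0) => k; rewrite size_codom_expo => kn.
have k1 : (k < n.+1)%N by [].
have := h (Ordinal k1); rewrite -!nth_codom_expo /= /bump /= add1n; exact.
Qed.

Lemma decr_word a : exists w, hecke_act_word w (decr a) = a.
Proof.
have [m] := ubnP (inversions a); elim: m a => // m IH a hm.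
have [/existsP[i hi]|/existsPn h] := boolP [exists i, (a (posl i) < a (posr i))%O]; last first.
  by exists [::]; rewrite decr_id // => i; rewrite leNgt.
have hs : (swap_expo i a (posr i) < swap_expo i a (posl i))%O by rewrite swap_expo_l swap_expo_r.
have := inversions_swap_gt hs; rewrite swap_expoK => e.
have [w hw] := IH (swap_expo i a) ltac:(lia).
exists (i :: w); rewrite /= -(decr_swap i) hw /hecke_act (ltW hs).
by rewrite swap_expoK.
Qed.

Lemma shortest_wordP a : hecke_act_word (shortest_word a) (decr a) = a /\
    forall w', hecke_act_word w' (decr a) = a -> (size (shortest_word a) <= size w')%N.
Proof.
apply: (epsilon_spec (inhabits [::]) (fun w => hecke_act_word w (decr a) = a /\
    forall w', hecke_act_word w' (decr a) = a -> (size w <= size w')%N)).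
have [w hw] := decr_word a; have [m] := ubnP (size w); elim: m w hw => // m IH w hw hm.
have [[w' [hw' lt]]|H] := classic (exists w', hecke_act_word w' (decr a) = a /\ (size w' < size w)%N).
  by apply: (IH w' hw'); lia.
exists w; split=> // w' hw'; rewrite leqNgt; apply/negP => lt; apply: H; by exists w'.
Qed.

Lemma decr_mem a p : exists q, decr a p = a q.
Proof.
have : decr a p \in codom a.
  rewrite ffunE -(mem_sort (fun x y : int => (y <= x)%O)) mem_nth //.
  by rewrite size_sort size_codom_expo.
by case/codomP => q e; exists q.
Qed.

Lemma decr_nonneg a : nonneg a -> nonneg (decr a).
Proof. by move=> ha p; have [q ->] := decr_mem a p. Qed.

Lemma decr_last a p : (decr a ord_max <= a p)%O.
Proof.
have : a p \in sort (fun x y : int => (y <= x)%O) (codom a).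
  by rewrite mem_sort codom_f.
case/(nthP 0) => k; rewrite size_sort size_codom_expo => hk <-.
rewrite ffunE; apply: (@sorted_leq_nth _ (fun x y : int => (y <= x)%O)).
- by move=> y x z h1 h2; exact: le_trans h2 h1.
- by move=> x.
- by apply: sort_sorted => x y; exact: le_total.
- by rewrite inE size_sort size_codom_expo.
- by rewrite inE size_sort size_codom_expo.
by rewrite -ltnS.
Qed.

Variable L : gring (expo n).
Local Notation X := (gX L).
Variable dm : 'I_n.+1 -> L -> L.
Hypothesis demP : demazure_op L dm.

Lemma dem_monom_lead i a : (a (posr i) < a (posl i))%O ->
  supp_in (fun b => lower b (swap_expo i a)) (dm i (X a) - X (swap_expo i a)).
Proof.
move=> h; rewrite (dem_monomE demP).
have hl b : b = a -> lower b (swap_expo i a).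
  by move=> ->; right; rewrite norm2_swap inversions_swap_gt.
move=> b; have [->|ne] := eqVneq b (swap_expo i a).
  rewrite gcfB gcfX eqxx => h'; exfalso; move: h'; rewrite /dem_monom.
  case E: (a (posl i) - a (posr i)) => [k|k]; last by lia.
  rewrite gcf_sum (bigD1 ord_max) //= gcfX big1 ?addr0 => [|j /eqP jk].
    by rewrite swap_expoE E -pmulrn eqxx subrr eqxx.
  rewrite gcfX swap_expoE E -pmulrn; case: eqP => // /(congr1 (fun c : expo n => c (posl i))).
  rewrite !expoB !expoMn sroot_l => e; case: jk; apply: val_inj => /=; lia.
rewrite gcfB gcfX [_ == b]eq_sym (negbTE ne) subr0 => /dem_monom_supp [ho hs h1 h2].
case: (segment_norm2 ho hs h1 h2) => [lt|/hl//|e]; last by rewrite e eqxx in ne.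
by left; rewrite norm2_swap.
Qed.

(** In a word of minimal length every letter really moves the exponent, so each pi_i produces the
    leading monomial x^(s_i a') plus terms of smaller norm or with fewer inversions. *)
Lemma dmw_lead w a : (forall w', hecke_act_word w' a = hecke_act_word w a -> (size w <= size w')%N) ->
  supp_in (fun b => lower b (hecke_act_word w a)) (dmw dm w (X a) - X (hecke_act_word w a)).
Proof.
elim: w => [_|i w IH hmin]; first by rewrite subrr; apply: supp_in0.
have {}IH : supp_in (fun b => lower b (hecke_act_word w a)) (dmw dm w (X a) - X (hecke_act_word w a)).
  by apply: IH => w' e; have := hmin (i :: w'); rewrite /= e => /(_ erefl).
move: IH; set a' := hecke_act_word w a => IH.
have [e|/act_step [h e]] := eqVneq (hecke_act i a') a'.
  by have := hmin w; rewrite /= -/a' e => /(_ erefl); lia.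
rewrite /= -/a' e -[_ - _](subrKA (dm i (X a'))) -(dem_zmod demP).
apply: supp_inD; last exact: dem_monom_lead.
apply: (supp_in_additive (dem_zmod demP i)) IH => b lb c.
rewrite (dem_monomE demP) => /dem_monom_supp [ho hs h1 h2].
have e1 := inversions_swap_gt h; have e2 := norm2_swap i a'.
case: (segment_norm2 ho hs h1 h2) => [lt|->|->]; case: lb; rewrite /lower ?norm2_swap ?e1 ?e2.
- by left; lia.
- by case=> ? ?; left; lia.
- by left; lia.
- by case=> ? ?; right; split=> //; lia.
- by left; lia.
by case=> ? ?; right; split=> //; have := inversions_swap i b; lia.
Qed.

Definition keyL a : L := dmw dm (shortest_word a) (X (decr a)).

Lemma keyL_lead a : supp_in (fun b => lower b a) (keyL a - X a).
Proof.
have [e hmin] := shortest_wordP a; rewrite /keyL -{2}e; have := @dmw_lead (shortest_word a) (decr a).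
by rewrite e; apply=> w' /hmin.
Qed.

Lemma glinE (M : zmodType) (phi : expo n -> M) (f : L) :
  glin phi f = \sum_(a <- gsupp f) phi a *~ gcf f a.
Proof.
rewrite {1}[f]gsumE (zmorph_sum (@glinB _ L _ phi)); apply: eq_bigr => a _.
by rewrite (zmorph_mulz (@glinB _ L _ phi)) glinX.
Qed.

Lemma keyL_span (f : L) : exists c : L, f = glin keyL c.
Proof.
pose Sp f := exists c : L, f = glin keyL c.
have Sp0 : Sp 0 by exists 0; rewrite raddf0.
have SpB f1 f2 : Sp f1 -> Sp f2 -> Sp (f1 - f2).
  by move=> [c1 ->] [c2 ->]; exists (c1 - c2); rewrite raddfB.
have SpN f1 : Sp f1 -> Sp (- f1) by move=> h; rewrite -sub0r; apply: SpB.
have SpD f1 f2 : Sp f1 -> Sp f2 -> Sp (f1 + f2).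
  by move=> h1 h2; rewrite -[f2]opprK; apply: SpB => //; apply: SpN.
have Spz f1 (z : int) : Sp f1 -> Sp (f1 *~ z).
  by move=> [c ->]; exists (c *~ z); rewrite raddfMz.
apply: (gring_ind (P := Sp)) => //.
(* Inversions number at most the number of pairs of positions, so this combination encodes the
   lexicographic order [lower] in one natural number. *)
suff H m a : (norm2 a * (#|{: 'I_n.+2 * 'I_n.+2}|.+1) + inversions a < m)%N -> Sp (X a).
  by move=> a; apply: (H _ a (ltnSn _)).
elim: m a => // m IH a hm.
rewrite -[X a]opprK -[- X a](addKr (keyL a)) opprD opprK; apply: SpB.
  by exists (X a); rewrite glinX.
rewrite [_ - _]gsumE big_seq; elim/big_ind: _ => // b; rewrite gsuppP => /keyL_lead lb.
apply: Spz; apply: IH; move: hm.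
have ib : (inversions b <= #|{: 'I_n.+2 * 'I_n.+2}|)%N by apply: max_card.
case: lb => [|[-> ?]]; last by lia.
by move=> lt hm; nia.
Qed.

Lemma keyL_ispoly a : nonneg a -> ispoly (keyL a).
Proof. by move=> ha; apply: ispoly_dmw => //; apply: supp_inX; apply: decr_nonneg. Qed.

(** The last entry of the decreasing rearrangement is the minimum, hence negative; so the dominant
    monomial is in the kernel by its last tail, and the operators pi_i keep it there. *)
Lemma keyL_ker a : ~ nonneg a -> ker (keyL a).
Proof.
move=> ha; apply: ker_dmw => //; apply: (@ker_tail _ _ n.+1); apply: supp_inX.
have [/existsP [p hp]|/existsPn h] := boolP [exists p, (a p < 0)%O]; last first.
  by case: ha => p; rewrite leNgt.
rewrite /tail (bigD1 ord_max) //= big1 ?addr0; first exact: le_lt_trans (decr_last a p) hp.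
by move=> q /andP[h1 /eqP h2]; case: h2; apply: val_inj => /=; have := ltn_ord q; lia.
Qed.

(** Any expansion in keys yields a polynomial congruent to f; with [ispoly_eqk] this characterizes
    the polynomial part, whichever expansion was chosen. *)
Lemma poly_part_spec (c : L) :
  let f := glin keyL c in
  let P := \sum_(a <- gsupp c | [forall k, (0 <= a k)%O]) keyL a *~ gcf c a in
  ispoly P /\ eqk f P.
Proof.
move=> f P; split.
  by apply: supp_in_sum => a /forallP ha; apply: supp_in_mulz; apply: keyL_ispoly.
rewrite /eqk /f glinE (bigID (fun a : expo n => [forall k, (0 <= a k)%O])) /= addrC addrK.
by apply: ker_sum => a /forallP ha; apply: ker_mulz; apply: keyL_ker.
Qed.

End Keys.

(** * Words of longest elements, series in q, and the rotation operator *)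

Section Operators.
Variables (n : nat) (L : gring (expo n)).
Local Notation X := (gX L).
Variable dm : 'I_n.+1 -> L -> L.
Hypothesis demP : demazure_op L dm.
Implicit Types (i j k : nat) (p : 'I_n.+2) (a b : expo n) (f g : L).

(** Natural number indices allow arithmetic on words; the relations below carry the bound k <= n
    wherever [inord] must be faithful. *)
Definition dn k := dm (inord k).
Definition dnw (w : seq nat) (f : L) := foldr dn f w.

Lemma dnw_cat w w' f : dnw (w ++ w') f = dnw w (dnw w' f).
Proof. by rewrite /dnw foldr_cat. Qed.
Lemma dn_idem k f : dn k (dn k f) = dn k f.
Proof. exact: dem_idem. Qed.
Lemma dn_far j k f : (j <= n)%N -> (k <= n)%N -> (j.+1 < k)%N -> dn j (dn k f) = dn k (dn j f).
Proof. by move=> jn kn jk; apply: dem_far; rewrite // !inordK. Qed.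
Lemma dn_far' j k f : (j <= n)%N -> (k <= n)%N -> (j.+1 < k)%N || (k.+1 < j)%N ->
  dn j (dn k f) = dn k (dn j f).
Proof. by move=> jn kn /orP [] h; [|apply/esym]; apply: dn_far. Qed.
Lemma dn_braid k f : (k < n)%N -> dn k (dn k.+1 (dn k f)) = dn k.+1 (dn k (dn k.+1 f)).
Proof. by move=> kn; apply: dem_braid; rewrite // !inordK //; lia. Qed.

Lemma dnw_far j w f : (j <= n)%N ->
  all (fun k => (k <= n)%N && ((j.+1 < k)%N || (k.+1 < j)%N)) w ->
  dnw w (dn j f) = dn j (dnw w f).
Proof.
move=> jn; elim: w => //= k w IH /andP[/andP[kn far] /IH ->].
by apply: dn_far' => //; rewrite orbC.
Qed.

Definition desc k m := rev (iota k m).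
Lemma descS k m : desc k m.+1 = (k + m)%N :: desc k m.
Proof. by rewrite /desc -addn1 iotaD rev_cat. Qed.
Lemma descSr k m : desc k m.+1 = rcons (desc k.+1 m) k.
Proof. by rewrite /desc /= rev_cons. Qed.
Lemma mem_desc k m j : (j \in desc k m) = (k <= j < k + m)%N.
Proof. by rewrite mem_rev mem_iota. Qed.

(** A reduced word of the longest element of the parabolic generated by s_k, ..., s_{k+m-1}, built
    from descending runs. *)
Fixpoint longest k m : seq nat :=
  if m is m'.+1 then longest k m' ++ desc k m'.+1 else [::].

Lemma mem_longest k m j : j \in longest k m -> (k <= j < k + m)%N.
Proof. by elim: m => //= m IH; rewrite mem_cat mem_desc => /orP[/IH|]; lia. Qed.

(** The descending run acts as a Coxeter element, conjugating s_j into s_{j-1}: a single braid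
    relation between far commutations. *)
Lemma desc_shift k m j f : (k < j < k + m)%N -> (k + m <= n.+1)%N ->
  dnw (desc k m) (dn j f) = dn j.-1 (dnw (desc k m) f).
Proof.
elim: m j => [|m IH] j; first by lia.
move=> hj hm; rewrite descS /=; have [e|ne] := eqVneq j (k + m)%N; last first.
  rewrite IH; try lia.
  by apply: dn_far'; lia.
case: m IH hj hm e => [|m] IH hj hm e; first by lia.
rewrite descS /= dnw_far; try lia; last first.
  by apply/allP => x; rewrite mem_desc; lia.
have -> : j.-1 = (k + m)%N by lia.
by rewrite e addnS dn_braid //; lia.
Qed.

Lemma asc_shift k m j f : (k < j < k + m)%N -> (k + m <= n.+1)%N ->
  dn j (dnw (iota k m) f) = dnw (iota k m) (dn j.-1 f).
Proof.
elim: m k => [|m IH] k; first by lia.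
move=> hj hm /=; have [e|ne] := eqVneq j k.+1; last first.
  rewrite dn_far'; try lia.
  by rewrite IH //; lia.
case: m IH hj hm => [|m] IH hj hm /=; first by lia.
rewrite e /= -dn_braid; last by lia.
rewrite dnw_far //; try lia.
by apply/allP => x; rewrite mem_iota; lia.
Qed.

Lemma longest_absr k m j f : (k <= j < k + m)%N -> (k + m <= n.+1)%N ->
  dnw (longest k m) (dn j f) = dnw (longest k m) f.
Proof.
elim: m j f => [|m IH] j f hj hm; first by lia.
rewrite /= !dnw_cat; have [->|ne] := eqVneq j k.
  by rewrite descSr -cats1 !dnw_cat /= dn_idem.
by rewrite desc_shift; try lia; rewrite IH //; lia.
Qed.

Lemma longest_absl k m j f : (k <= j < k + m)%N -> (k + m <= n.+1)%N ->
  dn j (dnw (longest k m) f) = dnw (longest k m) f.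
Proof.
elim: m j f => [|m IH] j f hj hm; first by lia.
rewrite /= !dnw_cat; have [e|ne] := eqVneq j (k + m)%N; last by rewrite IH //; lia.
case: m IH hj hm e => [|m] IH hj hm e.
  by rewrite /= e addn0 dn_idem.
rewrite /= !dnw_cat -dnw_far; try lia; last first.
  by apply/allP => x /mem_longest; lia.
congr dnw.
(* The previous run is the next one without its lowest letter, shifted down by one. Pulled through
   the next run it leaves that run leftmost, and its first letter is j, which absorbs the extra
   operator. *)
have push w g : all (fun x => k < x < k + m.+2)%N w ->
    dnw (desc k m.+2) (dnw w g) = dnw [seq x.-1 | x <- w] (dnw (desc k m.+2) g).
  elim: w => //= x w IHw /andP[hx /IHw e']; rewrite desc_shift // ?e' //; lia.
have e' : desc k m.+1 = [seq x.-1 | x <- desc k.+1 m.+1].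
  rewrite /desc map_rev; congr rev; rewrite -[k.+1]addn1 -[1%N]/(1 + 0)%N addnC iotaDl -map_comp.
  by rewrite -[LHS]map_id; apply: eq_map.
rewrite e' -push; last by apply/allP => x; rewrite mem_desc; lia.
by rewrite descS /= e dn_idem.
Qed.

Lemma longest_absw k m w f : all (fun j => k <= j < k + m)%N w -> (k + m <= n.+1)%N ->
  dnw (longest k m) (dnw w f) = dnw (longest k m) f.
Proof.
by move=> + hm; elim: w => //= j w IH /andP[hj /IH e]; rewrite longest_absr.
Qed.

Lemma longest_sym k m f : (k + m <= n.+1)%N ->
  (forall j, (k <= j < k + m)%N -> dn j f = f) -> dnw (longest k m) f = f.
Proof.
move=> hm h; have := @mem_longest k m; elim: (longest k m) => //= j w IH hw.
rewrite IH ?h // => [|x xw]; apply: hw; rewrite inE ?eqxx ?xw ?orbT //.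
Qed.

(** The ascending word is a coset representative. The left side is fixed by all generators of the
    larger parabolic, so applying the longest element changes nothing, and that element absorbs both
    words from the right. *)
Lemma asc_longest k m f : (k + m.+1 <= n.+1)%N ->
  dnw (iota k m.+1) (dnw (longest k m) f) = dnw (longest k m.+1) f.
Proof.
move=> hm; set g := dnw (longest k m) f.
have gsym j : (k <= j < k + m)%N -> dn j g = g by move=> hj; apply: longest_absl; lia.
have -> : dnw (longest k m.+1) f = dnw (longest k m.+1) (dnw (iota k m.+1) g).
  have h1 : all (fun j => k <= j < k + m.+1)%N (iota k m.+1).
    by apply/allP => j; rewrite mem_iota.
  have h2 : all (fun j => k <= j < k + m.+1)%N (longest k m).
    by apply/allP => j /mem_longest; lia.
  by rewrite /g !longest_absw.
rewrite longest_sym // => j hj; have [->|ne] := eqVneq j k; first by rewrite /= dn_idem.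
by rewrite asc_shift; try lia; rewrite gsym //; lia.
Qed.

(** The coefficients in q of s / (1 - q f); [dif] below is multiplication by 1 - q f. *)
Fixpoint geom f (s : nat -> L) (d : nat) : L :=
  if d is d'.+1 then s d + f * geom f s d' else s 0%N.
Definition dif f (s : nat -> L) (d : nat) : L :=
  if d is d'.+1 then s d - f * s d' else s 0%N.

Lemma geomK f s : dif f (geom f s) = s.
Proof. by apply: funext => -[|d] //=; rewrite addrK. Qed.
Lemma difK f s : geom f (dif f s) = s.
Proof.
by apply: funext; elim=> //= d ->; rewrite subrK.
Qed.
Lemma difC f g s : dif f (dif g s) = dif g (dif f s).
Proof.
by apply: funext => -[|[|d]] //=; ring.
Qed.
Lemma geomC f g s : geom f (geom g s) = geom g (geom f s).
Proof.
rewrite -[RHS](difK f); congr geom; rewrite -[RHS](difK g); congr geom.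
by rewrite difC !geomK.
Qed.

Lemma geomM (c : L) f s : geom f (fun d => c * s d) = fun d => c * geom f s d.
Proof.
apply: funext; elim=> //= d ->.
by rewrite mulrDr mulrCA.
Qed.

Lemma geomB f s t : geom f (fun d => s d - t d) = fun d => geom f s d - geom f t d.
Proof.
apply: funext; elim=> //= d ->; ring.
Qed.

Lemma geom_psmul f s : (fun d => \sum_(k < d.+1) f ^+ k * s (d - k)%N) = geom f s.
Proof.
apply: funext; elim=> [|d IH] /=.
  by rewrite big_ord_recl big_ord0 /= subn0 expr0 mul1r addr0.
rewrite big_ord_recl expr0 mul1r subn0; congr (_ + _); rewrite -IH mulr_sumr.
by apply: eq_bigr => k _; rewrite /= /bump /= add1n subSS exprS mulrA.
Qed.

Definition xr p : L := X (evec ord0 - evec p).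
Definition geoms (J : seq 'I_n.+2) s := foldr (fun j : 'I_n.+2 => geom (xr j)) s J.

Lemma perm_foldrC (T : eqType) (R : Type) (F : T -> R -> R) z (s t : seq T) :
  (forall x y u, F x (F y u) = F y (F x u)) -> perm_eq s t -> foldr F z s = foldr F z t.
Proof.
move=> FC; elim: s t => [|x s IH] t; first by rewrite perm_sym => /perm_nilP ->.
move=> st; have xt : x \in t by rewrite -(perm_mem st) mem_head.
have := perm_to_rem xt; move: st => /[swap] e; rewrite (permPr e) perm_cons => /IH /= ->.
elim: t xt {e} => //= y t IHt; rewrite inE eq_sym; case: eqP => [->//|_] /= xt.
by rewrite FC IHt.
Qed.

Lemma geoms_perm J J' s : perm_eq J J' -> geoms J s = geoms J' s.
Proof. by apply: perm_foldrC => x y u; exact: geomC. Qed.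
Lemma geoms_cat J J' s : geoms (J ++ J') s = geoms J (geoms J' s).
Proof. by rewrite /geoms foldr_cat. Qed.
Lemma geomsM (c : L) J s : geoms J (fun d => c * s d) = fun d => c * geoms J s d.
Proof. by elim: J => //= j J ->; rewrite geomM. Qed.
Lemma geomsB J s t : geoms J (fun d => s d - t d) = fun d => geoms J s d - geoms J t d.
Proof. by elim: J => //= j J ->; rewrite geomB. Qed.

Lemma dm_geom (i : 'I_n.+1) f s : sw i f = f ->
  (fun d => dm i (geom f s d)) = geom f (fun d => dm i (s d)).
Proof.
move=> hf; apply: funext; elim=> //= d <-.
by rewrite -(dem_symM demP _ hf) (zmorphD (dem_zmod demP i)).
Qed.

(** Neither factor is s_i-invariant alone, but f + g and f g are, hence so is (1 - q f)(1 - q g),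
    which therefore passes through pi_i. *)
Lemma dm_geom2 (i : 'I_n.+1) f g s : sw i f = g -> sw i g = f ->
  (fun d => dm i (geom f (geom g s) d)) = geom f (geom g (fun d => dm i (s d))).
Proof.
move=> hf hg; set U := geom f (geom g s).
have dmB := dem_zmod demP i.
have h1 : sw i (f + g) = f + g by rewrite (zmorphD (swB i)) hf hg addrC.
have h2 : sw i (f * g) = f * g by rewrite swapM hf hg mulrC.
rewrite -[LHS](difK f); congr geom; rewrite -[LHS](difK g); congr geom.
have -> : s = dif g (dif f U) by rewrite geomK geomK.
apply: funext => -[|[|d]] //=.
  rewrite (_ : U 1%N - _ - _ = U 1%N - (f + g) * U 0%N); last by ring.
  by rewrite dmB (dem_symM demP _ h1); ring.
rewrite (_ : U d.+2 - _ - _ = U d.+2 - ((f + g) * U d.+1 - (f * g) * U d)); last by ring.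
by rewrite !dmB (dem_symM demP _ h1) (dem_symM demP _ h2); ring.
Qed.

Definition rotl a : expo n := [ffun p => a (ord_pred p)].

(** The q^m-coefficient of the substitution x_i -> x_{i+1}, x_l -> q x_1, read off from the exponent
    m of the last variable. Monomials with a negative last exponent are dropped by every [phi m]. *)
Definition phi (m : nat) : L -> L :=
  glin (fun a => if a ord_max == m%:Z then X (rotl a) else 0).

Lemma phi_zmod m : zmod_morphism (phi m). Proof. exact: glinB. Qed.
Lemma phiX m a : phi m (X a) = if a ord_max == m%:Z then X (rotl a) else 0.
Proof. exact: glinX. Qed.

Lemma ord_pred_posr (i : 'I_n.+1) : ord_pred (posr i) = posl i.
Proof. apply: val_inj; have -> : val (ord_pred (posr i)) = ((posr i + n.+2).-1 %% n.+2)%N by [].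
by rewrite posrE addSn /= modnDr modn_small //; have := ltn_ord i; lia. Qed.
Lemma ord_pred_0 : ord_pred (ord0 : 'I_n.+2) = ord_max.
Proof. by apply: val_inj; rewrite /= modn_small. Qed.
Lemma rotl_zmod : zmod_morphism rotl.
Proof. by move=> a b; apply/ffunP => p; rewrite !ffunE. Qed.
Lemma rotlD a b : rotl (a + b) = rotl a + rotl b.
Proof. by apply/ffunP => p; rewrite !ffunE. Qed.

Lemma phiXM m (c : expo n) f : c ord_max = 0 -> phi m (X c * f) = X (rotl c) * phi m f.
Proof.
move=> c0; move: f; apply: gadd_ext => [f g|f g|a]; rewrite ?mulrBr ?phi_zmod ?mulrBr //.
rewrite -gXD !phiX expoD c0 add0r; case: eqP; rewrite ?mulr0 // => _.
by rewrite rotlD gXD.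
Qed.

Section Shift.
Variables (i j : 'I_n.+1).
Hypothesis ij : j = i.+1 :> nat.

Let e : posl j = posr i. Proof. by apply: val_inj; rewrite /= /bump /= ij. Qed.
Let nl : ord_max != posl i :> 'I_n.+2.
Proof. by rewrite -val_eqE /=; have := ltn_ord i; lia. Qed.
Let nr : ord_max != posr i :> 'I_n.+2.
Proof. by rewrite -val_eqE /= /bump /=; have := ltn_ord j; lia. Qed.

Lemma ord_pred_shift p : tperm (posl i) (posr i) (ord_pred p)
  = ord_pred (tperm (posl j) (posr j) p).
Proof.
have inj := @ord_pred_inj n.+2.
case: (tpermP (posl j)) => [->|->|/eqP h1 /eqP h2].
- by rewrite e ord_pred_posr tpermL ord_pred_posr e.
- by rewrite ord_pred_posr e tpermR ord_pred_posr.
rewrite tpermD //.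
  by apply: contra_neq h1; rewrite -[posl i]ord_pred_posr e => /inj.
by apply: contra_neq h2; rewrite -e -[posl j]ord_pred_posr => /inj.
Qed.

Lemma rotl_swap a : rotl (swap_expo i a) = swap_expo j (rotl a).
Proof. by apply/ffunP => p; rewrite !ffunE ord_pred_shift. Qed.

Lemma rotl_sroot : rotl (sroot i) = sroot j.
Proof.
apply/ffunP => p; rewrite ffunE !expoE.
have inj := @ord_pred_inj n.+2.
by rewrite -(ord_pred_posr i) (inj_eq inj) -e -(ord_pred_posr j) (inj_eq inj).
Qed.

Lemma phi_swap m f : phi m (sw i f) = sw j (phi m f).
Proof.
move: f; apply: gadd_ext => [f g|f g|a]; rewrite ?swB ?phi_zmod ?swB //.
rewrite swap_monom !phiX swap_expo_o //; case: eqP => _; last by rewrite raddf0.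
by rewrite swap_monom rotl_swap.
Qed.

Lemma phi_dem m f : phi m (dm i f) = dm j (phi m f).
Proof.
apply/esym/(dem_uniq demP); rewrite -phi_swap.
have r0 : rotl (- sroot i) = - sroot j.
  by rewrite (zmorphN rotl_zmod) rotl_sroot.
have s0 : (- sroot i) ord_max = 0 by rewrite expoN sroot_o ?oppr0.
have := congr1 (phi m) (demP i f).
by rewrite phi_zmod mulrBl mul1r phi_zmod !phiXM // r0 mulrBl mul1r.
Qed.
End Shift.

Lemma phi_dn m k f : (k < n)%N -> phi m (dn k f) = dn k.+1 (phi m f).
Proof. by move=> kn; apply: phi_dem; rewrite !inordK //; lia. Qed.
Lemma phi_dnw m w f : all (fun k => k < n)%N w -> phi m (dnw w f) = dnw (map succn w) (phi m f).
Proof. by elim: w => //= k w IH /andP[kn /IH e]; rewrite phi_dn // e. Qed.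

Definition Phi (s : nat -> L) (d : nat) : L := \sum_(m < d.+1) phi m (s (d - m)%N).

End Operators.

(** * Catalan series modulo the kernel *)

Section Recursion.
Variables (n : nat) (L : gring (expo n)).
Local Notation X := (gX L).
Variable dm : 'I_n.+1 -> L -> L.
Hypothesis demP : demazure_op L dm.
Implicit Types (p q : 'I_n.+2) (a b : expo n) (f g : L) (s t : nat -> L).
Local Notation dn := (dn dm).
Local Notation dnw := (dnw dm).
Local Notation x0 c := (X (evec ord0 *+ c)).

Lemma mem_ordfilter (P : pred 'I_n.+2) p : (p \in [seq p <- enum 'I_n.+2 | P p]) = P p.
Proof. by rewrite mem_filter mem_enum andbT. Qed.
Lemma uniq_ordfilter (P : pred 'I_n.+2) : uniq [seq p <- enum 'I_n.+2 | P p].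
Proof. by apply: filter_uniq; apply: enum_uniq. Qed.

Definition from (d : nat) : seq 'I_n.+2 := [seq p : 'I_n.+2 <- enum 'I_n.+2 | (d <= p)%N].

Lemma mem_from d p : (p \in from d) = (d <= p)%N.
Proof. exact: mem_ordfilter. Qed.

Lemma filter_ord_recl d (P : pred 'I_n.+2) (hd : (d < n.+2)%N) : P (Ordinal hd) ->
  (forall p, P p -> (d <= p)%N) -> [seq p <- enum 'I_n.+2 | P p]
   = Ordinal hd :: [seq p <- enum 'I_n.+2 | P p && (d < p)%N].
Proof.
pose lt (p q : 'I_n.+2) := (p < q)%N; have so Q : sorted lt (filter Q (enum 'I_n.+2)).
  apply: sorted_filter; first by move=> y x z; apply: ltn_trans.
  by have := iota_ltn_sorted 0 n.+2; rewrite -val_enum_ord sorted_map.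
move=> Pd Ple; apply: (@irr_sorted_eq _ lt).
- by move=> y x z; apply: ltn_trans.
- by move=> x; rewrite /lt /= ltnn.
- exact: so.
- rewrite /= path_sortedE; last by move=> y x z; apply: ltn_trans.
  apply/andP; split; first by apply/allP => q; rewrite mem_filter => /andP[/andP[]].
  exact: so.
move=> q; rewrite in_cons !mem_ordfilter -val_eqE /=.
have [e|ne] /= := eqVneq (q : nat) d; last first.
  by case Pq: (P q) => //=; have := Ple _ Pq; rewrite leq_eqVlt eq_sym (negbTE ne).
by rewrite (_ : q = Ordinal hd) ?Pd //; apply: val_inj.
Qed.

Lemma from_recl d (hd : (d < n.+2)%N) : from d = Ordinal hd :: from d.+1.
Proof.
rewrite /from (@filter_ord_recl d _ hd) //=; congr (_ :: _).
by apply: eq_filter => p; case: ltngtP.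
Qed.
Lemma from_nil d : (n.+2 <= d)%N -> from d = [::].
Proof.
move=> hd; rewrite /from (eq_filter (a2 := pred0)) ?filter_pred0 // => p.
by apply/negbTE; rewrite -ltnNge (leq_trans (ltn_ord p)).
Qed.

(** The recursion multiplies by powers of x_1, under which the kernel need not be stable, so the
    congruence is required after all of them. Generators with index k > 0 fix x_1 and respect it. *)
Definition eqk0 f g := forall c : nat, ker (x0 c * (f - g)).

Lemma sw_x0 (i : 'I_n.+1) c : (0 < i)%N -> sw i (x0 c) = x0 c.
Proof.
move=> hi; rewrite swap_monom; congr X; apply/ffunP => p; rewrite ffunE !expoMn !evecE; congr (_%:R * _).
case: tpermP => [->|->|//]; rewrite -!val_eqE /= /bump /=; lia.
Qed.

Lemma dn_x0 k c f : (0 < k <= n)%N -> dn k (x0 c * f) = x0 c * dn k f.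
Proof. by move=> hk; apply: (dem_symM demP); apply: sw_x0; rewrite inordK; lia. Qed.

Lemma eqk0_dn k f g : (0 < k <= n)%N -> eqk0 f g -> eqk0 (dn k f) (dn k g).
Proof.
move=> hk h c; rewrite -(dem_zmod demP) -dn_x0 //; exact: ker_dem.
Qed.

Lemma free_sum (P : L -> Prop) f : free_last f -> P 0 ->
  (forall f g, P f -> P g -> P (f + g)) -> (forall f (z : int), P f -> P (f *~ z)) ->
  (forall a, a ord_max = 0 -> P (X a)) -> P f.
Proof.
move=> ff P0 PD Pz PX; rewrite [f]gsumE big_seq; elim/big_ind: _ => // a.
by rewrite gsuppP => /ff a0; apply: Pz; apply: PX.
Qed.

Lemma phi_free m f : free_last f -> (0 < m)%N -> phi m f = 0.
Proof.
move=> ff hm; apply: (@free_sum (fun f => phi m f = 0) _ ff) => [|f1 f2 e1 e2|f1 z e|a a0].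
- exact: zmorph0 (phi_zmod m).
- by rewrite (zmorphD (phi_zmod m)) e1 e2 addr0.
- by rewrite (zmorph_mulz (phi_zmod m)) e mul0rz.
by rewrite phiX a0; case: eqP => // e; move: hm; lia.
Qed.

Lemma rotl_last a : rotl a ord_max = a (posl ord_max).
Proof.
rewrite ffunE; congr (a _); rewrite -ord_pred_posr; congr ord_pred.
by apply: ord_inj; rewrite posrE.
Qed.

Lemma ord_pred_eq p q : (ord_pred p == q) = (p == ordS q).
Proof. by rewrite -{1}[q](ordSK (n := n.+2)) (inj_eq (@ord_pred_inj n.+2)). Qed.
Lemma rotl_evec p : rotl (evec p) = evec (ordS p).
Proof. by apply/ffunP => q; rewrite !ffunE ord_pred_eq. Qed.

Lemma ordSE p : p != ord_max -> ordS p = p.+1 :> nat.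
Proof.
move=> hp; rewrite /= modn_small //; move: hp; rewrite -val_eqE /=; have := ltn_ord p; lia.
Qed.
Lemma ordS_max : ordS (ord_max : 'I_n.+2) = ord0.
Proof. by apply: val_inj; rewrite /= modnn. Qed.

(** Without x_l in x^a, exactly one term of pi_{l-1} x^a contains x_l^m, and its rotation is the
    monomial on the left. *)
Lemma geom_last_monom m a : a ord_max = 0 ->
  eqk0 (xr L ord_max ^+ m * phi 0 (X a)) (phi m (dn n (X a))).
Proof.
move=> a0 c; rewrite phiX a0 eqxx.
have -> : xr L ord_max ^+ m = X ((evec ord0 - evec ord_max) *+ m).
  by elim: m => [|m IH]; rewrite ?mulr0n ?expr0 ?gX0 // exprS IH -gXD mulrS.
rewrite -gXD; set v := _ + rotl a.
pose i : 'I_n.+1 := inord n.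
have ei : i = ord_max by apply: val_inj; rewrite /= inordK.
have er : posr i = ord_max by apply: ord_inj; rewrite posrE ei.
have v_last : v ord_max = a (posl i) - m%:Z.
  rewrite expoD expoMn expoB !evecE eqxx rotl_last ei.
  by have -> : (ord_max == ord0 :> 'I_n.+2) = false by []; lia.
have rv k : rotl (a - sroot i *+ k) = (evec ord0 - evec ord_max) *+ k + rotl a.
  have rs : rotl (sroot i) = evec ord_max - evec ord0.
    rewrite /sroot rotl_zmod !rotl_evec er ordS_max; congr (evec _ - _).
    have hi : nat_of_ord i = n by rewrite ei.
    by apply: ord_inj; rewrite ordSE -?val_eqE /= hi //; lia.
  have -> : rotl (a - sroot i *+ k) = rotl a - rotl (sroot i) *+ k.
    by apply/ffunP => q; rewrite !(ffunE, expoB, expoMn).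
  by rewrite rs -[evec ord0 - _]opprB mulNrn addrC.
rewrite /dn (dem_monomE demP) -/i.
have phiE b : phi m (X b) = if b ord_max == m%:Z then X (rotl b) else 0 := phiX L m b.
(* If the exponent of x_{l-1} is below m, no term of pi_{l-1} x^a contains x_l^m, while the left
   monomial has a negative last exponent and so lies in the kernel. *)
have [neg|nneg] := ltP (v ord_max) 0.
  have -> : phi m (dem_monom L i a) = 0.
    rewrite /dem_monom er a0 subr0; case E: (a (posl i)) => [k|k]; move: neg; rewrite v_last E => neg.
      rewrite (zmorph_sum (phi_zmod m)) big1 // => j _; rewrite phiE -er !expoB expoMn sroot_r er a0.
      by case: eqP => // ej; have := ltn_ord j; lia.
    rewrite (zmorphN (phi_zmod m)) (zmorph_sum (phi_zmod m)) big1 ?oppr0 // => j _.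
    by rewrite phiE -er !expoD expoMn sroot_r er a0; case: eqP => // ej; lia.
  rewrite subr0 -gXD; apply: (@ker_tail _ _ n.+1); apply: supp_inX.
  rewrite tailD /tail (bigD1 ord_max) //= big1 ?addr0; last first.
    move=> q /andP[h1 /eqP h2]; case: h2; apply: val_inj => /=; have := ltn_ord q; lia.
  rewrite expoMn evecE (_ : (ord_max == ord0 :> 'I_n.+2) = false) // mul0r add0r.
  rewrite (bigD1 ord_max) //= big1 ?addr0 // => q /andP[h1 /eqP h2]; case: h2; apply: val_inj => /=.
  by have := ltn_ord q; lia.
have -> : phi m (dem_monom L i a) = X v; last by rewrite subrr mulr0; apply: ker0.
rewrite /dem_monom er a0 subr0; case E: (a (posl i)) => [k|k]; move: nneg; rewrite v_last E => nneg.
  have mk : (m < k.+1)%N by lia.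
  rewrite (zmorph_sum (phi_zmod m)) (bigD1 (Ordinal mk)) //= big1 ?addr0 => [|j ne].
    by rewrite phiE -er !expoB expoMn sroot_r er a0 (_ : _ == _) ?rv //; lia.
  rewrite phiE -er !expoB expoMn sroot_r er a0; case: eqP => // ej.
  by case/eqP: ne; apply: val_inj => /=; lia.
by lia.
Qed.

Lemma geom_last m f : free_last f ->
  eqk0 (xr L ord_max ^+ m * phi 0 f) (phi m (dn n f)).
Proof.
move=> ff; have dB := dem_zmod demP (inord n); have pB := phi_zmod (n := n) (L := L).
apply: (@free_sum (fun f => eqk0 (xr L ord_max ^+ m * phi 0 f) (phi m (dn n f))) _ ff) => [|f1 f2 e1 e2|f1 z e|a a0] c.
- by rewrite /dn (zmorph0 dB) !(zmorph0 (pB _)) mulr0 subrr mulr0; apply: ker0.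
- rewrite /dn (zmorphD dB) !(zmorphD (pB _)).
  rewrite [X in ker X](_ : _ = x0 c * (xr L ord_max ^+ m * phi 0 f1 - phi m (dn n f1))
    + x0 c * (xr L ord_max ^+ m * phi 0 f2 - phi m (dn n f2))); last by rewrite /dn; ring.
  by apply: kerD; [apply: e1|apply: e2].
- rewrite /dn (zmorph_mulz dB) !(zmorph_mulz (pB _)) mulrzAr -mulrzBl mulrzAr.
  exact: ker_mulz.
exact: geom_last_monom.
Qed.

Lemma sw_xr_o (i : 'I_n.+1) p : (0 < i)%N -> p != posl i -> p != posr i -> sw i (xr L p) = xr L p.
Proof.
move=> hi pl pr; rewrite /xr swap_monom swap_expo_zmod !swap_evec !tpermD // 1?eq_sym //.
by rewrite -val_eqE /=; lia.
Qed.
Lemma sw_xr_l (i : 'I_n.+1) : (0 < i)%N -> sw i (xr L (posl i)) = xr L (posr i).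
Proof.
move=> hi; rewrite /xr swap_monom swap_expo_zmod !swap_evec tpermL tpermD //.
by rewrite -val_eqE /=; lia.
Qed.
Lemma sw_xr_r (i : 'I_n.+1) : (0 < i)%N -> sw i (xr L (posr i)) = xr L (posl i).
Proof. by move=> hi; rewrite -sw_xr_l // swapK. Qed.

Lemma dm_geoms_o (i : 'I_n.+1) J s : (0 < i)%N -> posl i \notin J -> posr i \notin J ->
  (fun d => dm i (geoms J s d)) = geoms J (fun d => dm i (s d)).
Proof.
move=> hi; elim: J => //= p J IH; rewrite !inE !negb_or => /andP[pl plJ] /andP[pr prJ].
by rewrite (dm_geom demP) ?IH // sw_xr_o // eq_sym.
Qed.

(** Since d <= k, both factors that s_k exchanges are present; since k > 0, x_1 and all other
    factors are fixed. *)
Lemma dn_geoms k d s : (0 < d <= k)%N -> (k <= n)%N ->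
  (fun e => dn k (geoms (from d) s e)) = geoms (from d) (fun e => dn k (s e)).
Proof.
move=> hk kn; rewrite /dn; set i : 'I_n.+1 := inord k.
have ik : i = k :> nat by rewrite inordK.
have i0 : (0 < i)%N by rewrite ik; lia.
pose J := [seq p <- from d | (p != posl i) && (p != posr i)].
have pJ : perm_eq (from d) [:: posl i, posr i & J].
  apply: uniq_perm => /=; first by apply: filter_uniq; apply: enum_uniq.
    rewrite !inE [_ \in J]mem_filter [_ \in J]mem_filter !eqxx ?andbF /= !orbF posl_posr /=.
    by do 2! apply: filter_uniq; apply: enum_uniq.
  move=> p; rewrite !in_cons [_ \in J]mem_filter !mem_from.
  have [->|] /= := eqVneq p (posl i); first by rewrite ik; lia.
  have [->|] := eqVneq p (posr i); last by [].
  by rewrite posrE ik /=; lia.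
rewrite !(geoms_perm _ pJ) /= (dm_geom2 demP) ?sw_xr_l ?sw_xr_r //.
by rewrite dm_geoms_o // mem_filter !eqxx ?andbF.
Qed.

Lemma sw_of_dem i f : dm i f = f -> sw i f = f.
Proof. by move=> e; rewrite -{1}e (swap_dem demP). Qed.

(** The exponents at the two exchanged positions are -1 and 0: this is the case of [dem_monom] where
    the sum is empty. *)
Lemma dm_xr (i : 'I_n.+1) : (0 < i)%N -> dm i (xr L (posl i)) = 0.
Proof.
move=> hi; rewrite /xr (dem_monomE demP) /dem_monom !expoB !evecE eqxx.
have -> : (posl i == ord0) = false by rewrite -val_eqE /=; lia.
have -> : (posr i == ord0) = false by [].
by rewrite [_ == posl i]eq_sym (negbTE (posl_posr i)) /= big_ord0 oppr0.
Qed.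

(* The step applies pi_d: the operator fixes everything symmetric in
   x_d, x_{d+1} and kills x_d^-1, which restores the missing factor. *)
Lemma geoms_Phi m s : (m <= n.+1)%N -> (forall e, free_last (s e)) ->
  (forall k e, (n.+1 - m <= k < n)%N -> dn k (s e) = s e) -> forall D,
  eqk0 (geoms (from (n.+2 - m)) (fun e => phi 0 (s e)) D)
    (Phi (fun e => dnw (iota (n.+1 - m) m) (s e)) D).
Proof.
elim: m => [|m IH] hm sf ss D.
  rewrite from_nil //= /Phi big_ord_recl subn0 big1 ?addr0 => [c|j _].
    by rewrite subrr mulr0; apply: ker0.
  by apply: phi_free.
have [m0|m0] := posnP m.
  subst m; rewrite subSS subn0 subn1 /=.
  rewrite (from_recl (ltnSn n.+1)) from_nil //= (_ : Ordinal _ = ord_max); last exact: val_inj.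
  move=> c; rewrite -geom_psmul /Phi -sumrB mulr_sumr; apply: ker_sum => k _.
  by apply: geom_last.
set d := (n.+2 - m.+1)%N; have hd : (d < n.+2)%N by lia.
have d_n : (d <= n)%N by lia.
have ed : (n.+2 - m = d.+1)%N by lia.
have ek : (n.+1 - m = d)%N by lia.
have ek' : (n.+1 - m.+1 = d.-1)%N by lia.
have {}IH := IH (ltnW hm) sf _ D.
have IH' := IH ltac:(move=> k e hk; apply: ss; lia).
move: IH'; rewrite ed ek ek' => /(@eqk0_dn d _ _ ltac:(lia)).
set U := geoms (from d) (fun e => phi 0 (s e)).
have Usym e : dn d (U e) = U e.
  rewrite -[LHS]/((fun e => dn d (U e)) e) dn_geoms //; last by lia.
  congr (geoms _ _ e); apply: funext => e'.
  have -> : d = d.-1.+1 by lia.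
  by rewrite -(phi_dn demP) ?ss //; lia.
set i : 'I_n.+1 := inord d.
have id_ : i = d :> nat by rewrite inordK.
have -> : dn d (geoms (from d.+1) (fun e => phi 0 (s e)) D) = U D.
  have e1 : geoms (from d.+1) (fun e => phi 0 (s e)) = dif (xr L (posl i)) U.
    rewrite /U (from_recl hd) /= (_ : Ordinal hd = posl i) ?geomK //.
    by apply: val_inj; rewrite /= id_.
  rewrite e1; case: D {IH} => [|D] /=; first exact: Usym.
  rewrite /dn (dem_zmod demP) -!/(dn d _) Usym mulrC /dn (dem_symM demP) -/i.
    by rewrite dm_xr ?mulr0 ?subr0 //; lia.
  by apply: sw_of_dem; exact: Usym.
have -> : dn d (Phi (fun e => dnw (iota d m) (s e)) D)
    = Phi (fun e => dnw (iota d.-1 m.+1) (s e)) D; last by [].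
rewrite /Phi /dn (zmorph_sum (dem_zmod demP _)); apply: eq_bigr => k _.
rewrite -/(dn d _) /= (_ : d.-1.+1 = d); last by lia.
have {1}-> : d = d.-1.+1 by lia.
by rewrite -(phi_dn demP) //; lia.
Qed.

Definition beyond r a := forall p, (r <= p)%N -> a p = 0.

(** Dividing by a variable that does not occur in s creates only negative tails, invisible modulo
    the kernel. Hence a row of roots may be prolonged to all later columns. *)
Lemma geoms_beyond r J s : (0 < r)%N -> (forall p, p \in J -> (r <= p)%N) ->
  (forall e, supp_in (beyond r) (s e)) -> forall e,
  supp_in (fun a => (tail r a < 0)%O) (geoms J s e - s e).
Proof.
move=> hr; elim: J => [|p J IH] hJ hs e; first by rewrite subrr; apply: supp_in0.
have hp : (r <= p)%N by apply: hJ; rewrite mem_head.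
have {}IH : forall e, supp_in (fun a => (tail r a < 0)%O) (geoms J s e - s e).
  by apply: IH => // q qJ; apply: hJ; rewrite inE qJ orbT.
have t0 e' : supp_in (fun a => (tail r a <= 0)%O) (geoms J s e').
  rewrite -[geoms J s e'](subrK (s e')); apply: supp_inD.
    by apply: supp_inW (IH e') => a; apply: ltW.
  by apply: supp_inW (hs e') => a ha; rewrite /tail big1.
have tx : supp_in (fun a => (tail r a = -1)%O) (xr L p).
  apply: supp_inX; rewrite tailD tailN !tail_evec hp.
  by case: (r) hr.
have t1 e' : supp_in (fun a => (tail r a <= 0)%O) (geom (xr L p) (geoms J s) e').
  elim: e' => [|e' IHe] /=; first exact: t0.
  apply: supp_inD => //; apply: supp_inM tx IHe => a b ha hb; rewrite tailD; lia.
case: e => [|e] /=; first exact: IH.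
rewrite -addrAC; apply: supp_inD; first exact: IH.
by apply: supp_inM tx (t1 e) => a b ha hb; rewrite tailD; lia.
Qed.

Lemma phi0M f g : free_last f -> phi 0 (f * g) = phi 0 f * phi 0 g.
Proof.
move=> ff; have pB := phi_zmod (n := n) (L := L) 0.
apply: (@free_sum (fun f => phi 0 (f * g) = phi 0 f * phi 0 g) _ ff) => [|f1 f2 e1 e2|f1 z e|a a0].
- by rewrite mul0r !(zmorph0 pB) mul0r.
- by rewrite mulrDl !(zmorphD pB) e1 e2 mulrDl.
- by rewrite mulrzAl !(zmorph_mulz pB) e mulrzAl.
by rewrite phiXM // phiX a0 eqxx.
Qed.

Definition Dlow : L := \prod_(r : 'I_n.+2 * 'I_n.+2 | pos_roots r && (r.2 != ord_max)) root_fac L r.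

Lemma Dlow_free : free_last Dlow.
Proof.
rewrite /Dlow; elim/big_ind: _ => [|f g|[p q] /andP[/= pq qm]].
- by rewrite -gX0; apply: supp_inX; rewrite expo0.
- by apply: supp_inM => a b; rewrite expoD => -> ->.
rewrite /root_fac -gX0; apply: supp_inB; apply: supp_inX; rewrite ?expo0 // expoB !evecE.
have -> : (ord_max == p :> 'I_n.+2) = false.
  by apply/negbTE; rewrite -val_eqE /=; move: pq; rewrite /pos_roots /=; have := ltn_ord q; lia.
by rewrite eq_sym (negbTE qm) subrr.
Qed.

(** The roots x_p/x_l form a factor unipotent for the last coordinate, so for f free of x_l the
    coefficients with last exponent 0 are those of f times [Dlow]. *)
Lemma ker_free_low f : free_last f -> ker f ->
  supp_in (fun a => a ord_max = 0 /\ exists p, (a p < 0)%O) (f * Dlow).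
Proof.
move=> ff kf; have fl : free_last (f * Dlow).
  by apply: supp_inM ff Dlow_free => a b; rewrite expoD => -> ->.
move=> a ha; have a0 := fl _ ha; split=> //.
have [/existsP //|/existsPn h] := boolP [exists p, (a p < 0)%O].
case/eqP: ha.
have nn : nonneg a by move=> p; rewrite leNgt.
have := kf _ nn; rewrite /Delta (bigID (fun r : 'I_n.+2 * 'I_n.+2 => r.2 != ord_max)) /= -/Dlow mulrA.
set E := \prod_(_ | _) _.
have hE : unipotent (fun c : expo n => c ord_max) E.
  rewrite /E; elim/big_ind: _ => [|g g' hg hg'|[p q] /andP[/= pq /negPn /eqP qm]].
  - exact: unipotent1.
  - by apply: unipotentM => // x y; rewrite expoD.
  apply: unipotent_subX; last by rewrite expo0.
  rewrite expoB !evecE qm eqxx; have -> : (ord_max == p :> 'I_n.+2) = false; last by [].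
  by apply/negbTE; rewrite -val_eqE /=; move: pq; rewrite /pos_roots /= qm /=; lia.
case: hE => E1 Es; rewrite gcf_mul => <-.
have [sa|sa] := boolP (a \in gsupp (f * Dlow)); last first.
  move: (sa); rewrite gsuppP negbK => /eqP ->; rewrite big1_seq // => b /andP[_ sb].
  have := sb; rewrite gsuppP => /fl b0.
  have [->|/Es [/eqP|]] := eqVneq (gcf E (a - b)) 0; first by rewrite mulr0.
    by rewrite subr_eq0 => /eqP e; rewrite -e (negbTE sa) in sb.
  by rewrite expoB a0 b0 subrr ltxx.
rewrite (bigD1_seq a) ?gsupp_uniq //= subrr E1 mulr1 big1_seq ?addr0 // => b /andP[ba].
rewrite gsuppP => /fl b0; have [->|/Es [/eqP|]] := eqVneq (gcf E (a - b)) 0; first by rewrite mulr0.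
  by rewrite subr_eq0 eq_sym (negbTE ba).
by rewrite expoB a0 b0 subrr ltxx.
Qed.

Lemma phi0_Dlow : phi 0 Dlow = \prod_(r | pos_roots r && (r.1 != ord0)) root_fac L r.
Proof.
have -> : phi 0 Dlow = \prod_(r : 'I_n.+2 * 'I_n.+2 | pos_roots r && (r.2 != ord_max)) phi 0 (root_fac L r).
  have fr (r : 'I_n.+2 * 'I_n.+2) : pos_roots r && (r.2 != ord_max) -> free_last (root_fac L r).
    case: r => p q /andP[/= pq qm]; rewrite /root_fac -gX0; apply: supp_inB; apply: supp_inX; rewrite ?expo0 //.
    rewrite expoB !evecE; have -> : (ord_max == p :> 'I_n.+2) = false.
      by apply/negbTE; rewrite -val_eqE /=; move: pq; rewrite /pos_roots /=; have := ltn_ord q; lia.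
    by rewrite eq_sym (negbTE qm) subrr.
  rewrite /Dlow; elim: (index_enum _) => [|r rs IH].
    by rewrite !big_nil -gX0 phiX expo0 eqxx (zmorph0 (@rotl_zmod n)).
  rewrite !big_cons; case: ifP => // hr; rewrite phi0M ?IH //; exact: fr.
pose h (r : 'I_n.+2 * 'I_n.+2) := (ordS r.1, ordS r.2).
have hinj : injective h.
  by move=> [p q] [p' q'] /eqP; rewrite xpair_eqE /= => /andP[/eqP/ordS_inj -> /eqP/ordS_inj ->].
rewrite [RHS](reindex_inj hinj) /=; apply: eq_big => [[p q]|[p q] /andP[/= pq qm]].
  rewrite /pos_roots /h /=; have [->|pm] := eqVneq p ord_max.
    rewrite ordS_max eqxx andbF; apply/negbTE; rewrite negb_and -leqNgt; have := ltn_ord q; rewrite /=; lia.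
  have [->|qm] := eqVneq q ord_max.
    by rewrite andbF /= modnn.
  have hp : (p.+1 %% n.+2 = p.+1)%N by rewrite -[RHS]ordSE.
  have hq : (q.+1 %% n.+2 = q.+1)%N by rewrite -[RHS]ordSE.
  rewrite andbT hp hq.
  have -> : ordS p != ord0 by rewrite -val_eqE /= hp.
  by rewrite andbT.
have pm : p != ord_max.
  by rewrite -val_eqE /=; move: pq; rewrite /pos_roots /=; have := ltn_ord q; lia.
have z : (evec p - evec q) ord_max = 0.
  by rewrite expoB !evecE ![ord_max == _]eq_sym (negbTE pm) (negbTE qm) subrr.
rewrite /root_fac (phi_zmod 0) -gX0 !phiX expo0 z eqxx /h /=.
by rewrite (zmorph0 (@rotl_zmod n)) rotl_zmod !rotl_evec.
Qed.

(** After the rotation the negative coordinate sits at a position other than the first. Powers of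
    x_1 and the remaining roots x_1/x_q never raise such a coordinate, so it stays negative. *)
Lemma ker_phi0 f : free_last f -> ker f -> forall c, ker (x0 c * phi 0 f).
Proof.
move=> ff kf c b hb; rewrite /Delta (bigID (fun r : 'I_n.+2 * 'I_n.+2 => r.1 != ord0)) /=.
rewrite -phi0_Dlow -mulrA (mulrA (phi 0 f)) -phi0M // mulrA mulrAC.
pose P (a : expo n) := exists2 p, p != ord0 & (a p < 0)%O.
suff : supp_in P (phi 0 (f * Dlow) * (x0 c * \prod_(r : 'I_n.+2 * 'I_n.+2 | pos_roots r && ~~ (r.1 != ord0)) root_fac L r)).
  rewrite mulrA mulrAC (mulrC (x0 c)) => h; apply/eqP/negPn/negP.
  by move/h => [p _]; have := hb p; lia.
pose Q (a : expo n) := forall p, p != ord0 -> (a p <= 0)%O.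
have s1 : supp_in P (phi 0 (f * Dlow)).
  apply: (supp_in_additive (phi_zmod 0)) (ker_free_low ff kf) => a [a0 [p ap]] c'.
  rewrite phiX a0 eqxx; move: c'; apply: supp_inX; exists (ordS p).
    apply: contraTneq ap => e; have : p = ord_max by apply: ordS_inj; rewrite e ordS_max.
    by move=> ->; rewrite a0 ltxx.
  by rewrite ffunE ordSK.
apply: (supp_inM (Q := Q)) s1 _ => [a b' [p p0 ap] hq|].
  by exists p => //; rewrite expoD; have := hq p p0; lia.
have QD x y : Q x -> Q y -> Q (x + y).
  by move=> hx hy p p0; rewrite expoD; have := hx p p0; have := hy p p0; lia.
apply: (supp_inM QD).
  by apply: supp_inX => p p0; rewrite expoMn evecE (negbTE p0) mul0r.
elim/big_ind: _ => [|g g'|[p q] /andP[/= pq /negPn /eqP p0]].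
- by rewrite -gX0; apply: supp_inX => p _; rewrite expo0.
- exact: supp_inM.
rewrite /root_fac -gX0; apply: supp_inB; apply: supp_inX => r r0; rewrite ?expo0 // expoB !evecE p0.
by rewrite (negbTE r0) sub0r; case: eqP.
Qed.

(** The factor x_1/x_p splits into a power of x_1, allowed by the hypothesis, and x_p^(-1), which
    preserves the kernel. *)
Lemma ker_geoms J s : (forall e c, ker (x0 c * s e)) -> forall e c, ker (x0 c * geoms J s e).
Proof.
move=> hs; elim: J => //= p J IH; elim=> [|e IHe] c /=; first exact: IH.
rewrite mulrDr; apply: kerD; first exact: IH.
have -> : x0 c * (xr L p * geom (xr L p) (geoms J s) e)
   = X (- evec p) * (x0 c.+1 * geom (xr L p) (geoms J s) e).
  by rewrite !mulrA /xr -!gXD mulrSr addrA [in RHS]addrC.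
by apply: ker_XN => // q; rewrite evecE; case: (q == p).
Qed.

Lemma x0_coord c p : (0 < p)%N -> (evec ord0 *+ c : expo n) p = 0.
Proof. by move=> hp; rewrite expoMn evecE; case: eqP => [e|]; rewrite ?mul0r //; rewrite e in hp. Qed.

Definition const f : nat -> L := fun d => if d is 0 then f else 0.
Definition upto (d r : nat) : seq 'I_n.+2 := [seq p : 'I_n.+2 <- enum 'I_n.+2 | (d <= p <= r)%N].

(** The Catalan series built row by row: an entry (d, m') gives the first column d, counted from 0,
    of the current row and the next part of mu. The later rows form the same kind of series, shifted
    by one position through [phi 0]. *)
Fixpoint Tser (m : nat) (r : seq (nat * nat)) : nat -> L :=
  if r is (d, m') :: r' then
    fun D => x0 m * geoms (upto d (size r)) (fun e => phi 0 (Tser m' r' e)) D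
  else const (x0 m).

(** The operator recursion; generators are numbered from 0 here, so [desc d.-1 (n.+2 - d)] is the
    word of c(d). *)
Fixpoint Oser (m : nat) (r : seq (nat * nat)) : nat -> L :=
  if r is (d, m') :: r' then
    fun D => x0 m * Phi (fun e => dnw (desc d.-1 (n.+2 - d)) (Oser m' r' e)) D
  else const (x0 m).

(* For the root ideal rows from k on: d = nr_k, and nr_{k+1} >= nr_k - 1. *)
Fixpoint rows_ok (r : seq (nat * nat)) : bool :=
  if r is (d, _) :: r' then
    [&& (0 < d <= (size r).+1)%N, if r' is (d', _) :: _ then (d.-1 <= d')%N else true & rows_ok r']
  else true.

Lemma Tser_beyond m r e : supp_in (beyond (size r).+1) (Tser m r e).
Proof.
elim: r m e => [|[d m'] r IH] m e /=.
  case: e => [|e]; last exact: supp_in0.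
  by apply: supp_inX => p hp; rewrite x0_coord.
have bD N x y : beyond N x -> beyond N y -> beyond N (x + y).
  by move=> hx hy p hp; rewrite expoD hx ?hy.
apply: (supp_inM (bD _)).
  by apply: supp_inX => p hp; rewrite x0_coord //; lia.
have hs e' : supp_in (beyond (size r).+2) (phi 0 (Tser m' r e')).
  apply: (supp_in_additive (phi_zmod 0)) (IH m' e') => a ha c.
  rewrite phiX; case: ifP => [/eqP a0|_]; last by rewrite gcf0 eqxx.
  move: c; apply: supp_inX => p hp; rewrite ffunE.
  have [e0|p0] := eqVneq p ord0; first by rewrite e0 in hp.
  have [i ei] : exists i : 'I_n.+1, p = posr i.
    by have := unlift_some (h := ord0) (i := p); rewrite eq_sym => /(_ p0) [i -> _]; exists i.
  by rewrite ei ord_pred_posr ha // poslE; move: hp; rewrite ei posrE.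
have : all (fun p : 'I_n.+2 => p < (size r).+2)%N (upto d (size r).+1).
  by apply/allP => p; rewrite mem_ordfilter => /andP[].
elim: (upto _ _) e => //= p J IHJ e /andP[hp hJ]; elim: e => [|e IHe] /=; first exact: IHJ.
apply: supp_inD; first exact: IHJ.
apply: (supp_inM (bD _)) IHe; apply: supp_inX => q hq; rewrite expoB !evecE.
have -> : (q == ord0) = false by apply/negbTE; rewrite -val_eqE /=; lia.
by have -> : (q == p) = false by apply/negbTE; rewrite -val_eqE /=; lia.
Qed.

Lemma const_ispoly f : ispoly f -> forall e, ispoly (const f e).
Proof. by move=> hf [|e] //=; apply: supp_in0. Qed.
Lemma x0_ispoly m : ispoly (x0 m).
Proof. by apply: supp_inX => p; rewrite expoMn evecE; case: (p == _); lia. Qed.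

Lemma Phi_supp (P Q : expo n -> Prop) s e :
  (forall a, P a -> (0 <= a ord_max)%O -> Q (rotl a)) ->
  (forall d, supp_in P (s d)) -> supp_in Q (Phi s e).
Proof.
move=> h hs; apply: supp_in_sum => k _.
apply: (supp_in_additive (phi_zmod k)) (hs (e - k)%N) => a pa c.
rewrite phiX; case: ifP => [/eqP a0|_]; last by rewrite gcf0 eqxx.
by move: c; apply: supp_inX; apply: h => //; rewrite a0.
Qed.

Lemma nonnegD a b : nonneg a -> nonneg b -> nonneg (a + b).
Proof. by move=> ha hb p; rewrite expoD addr_ge0. Qed.
Lemma dnw_ispoly w f : ispoly f -> ispoly (dnw w f).
Proof. by move=> hf; elim: w => //= k w IH; apply: (ispoly_dem demP). Qed.

Lemma Oser_ispoly m r e : ispoly (Oser m r e).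
Proof.
elim: r m e => [|[d m'] r IH] m e /=; first exact/const_ispoly/x0_ispoly.
apply: (supp_inM (P := nonneg (n := n)) (Q := nonneg (n := n))); [exact: nonnegD|exact: x0_ispoly|].
apply: (Phi_supp (P := nonneg (n := n))) => [a ha _ p|d']; last first.
  by apply: dnw_ispoly; apply: IH.
by rewrite ffunE.
Qed.

Lemma poly_part_ex f : exists2 P, ispoly P & eqk f P.
Proof.
have [c ->] := keyL_span demP f; have [hP hk] := poly_part_spec demP c.
by exists (\sum_(a <- gsupp c | [forall k, (0 <= a k)%O]) keyL dm a *~ gcf c a).
Qed.

Lemma dn_free k f : (k < n)%N -> free_last f -> free_last (dn k f).
Proof.
move=> kn; apply: (supp_dem demP) => a a0 c [ho _ _ _]; rewrite ho //.
  by rewrite -val_eqE /= inordK; lia.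
by rewrite -val_eqE /= /bump /= inordK; lia.
Qed.

Lemma dnw_free w f : all (fun k => k < n)%N w -> free_last f -> free_last (dnw w f).
Proof. by move=> + hf; elim: w => //= k w IH /andP[kn /IH]; apply: dn_free. Qed.

Lemma map_succ_longest k m : map succn (longest k m) = longest k.+1 m.
Proof.
elim: m => //= m IH; rewrite map_cat IH; congr (_ ++ _).
rewrite /desc map_rev; congr rev; rewrite -[LHS]/(map (addn 1) _) -iotaDl; congr iota.
Qed.

Lemma dnw_x0 w c f : all (fun k => 0 < k <= n)%N w -> dnw w (x0 c * f) = x0 c * dnw w f.
Proof. by elim: w => //= k w IH /andP[hk /IH ->]; rewrite dn_x0. Qed.

Lemma dnw_geoms w d s : (0 < d)%N -> all (fun k => d <= k <= n)%N w ->
  (fun e => dnw w (geoms (from d) s e)) = geoms (from d) (fun e => dnw w (s e)).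
Proof.
move=> hd; elim: w => //= k w IH /andP[/andP[dk kn] /IH e]; rewrite -dn_geoms ?hd //.
by rewrite -e.
Qed.

Lemma dnw_zmod w : zmod_morphism (dnw w).
Proof. by elim: w => [|k w IH] f g //=; rewrite IH; exact: (dem_zmod demP). Qed.

Lemma eqk_dnw w f g : eqk f g -> eqk (dnw w f) (dnw w g).
Proof.
rewrite /eqk -dnw_zmod; elim: w => //= k w IH /IH; exact: (ker_dem demP).
Qed.

Lemma longest_asc_desc d f : (0 < d <= n.+2)%N ->
  dnw (iota d.-1 (n.+2 - d)) (dnw (longest d.-1 (n.+1 - d)) f) = dnw (longest d.-1 (n.+2 - d)) f.
Proof.
move=> hd; have [e|ne] := eqVneq d n.+2.
  by rewrite e subnn (_ : (n.+1 - n.+2 = 0)%N) //; lia.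
rewrite (_ : (n.+2 - d = (n.+1 - d).+1)%N); last by lia.
by rewrite (asc_longest demP) //; lia.
Qed.

(** The two series agree modulo the kernel only after symmetrization by the parabolic of s_{dd+1},
    ..., s_{l-1}, which tameness provides for the first row and the inductive step for the
    others. *)
Lemma Tser_Oser m r : (size r <= n.+1)%N -> rows_ok r ->
  forall dd, (if r is (d, _) :: _ then (dd <= d)%N else true) ->
  forall D, eqk (dnw (longest dd (n.+1 - dd)) (Tser m r D)) (dnw (longest dd (n.+1 - dd)) (Oser m r D)).
Proof.
elim: r m => [|[d m'] r IH] m hsz ok dd hle D; first exact: eqk_refl.
(* The longest element for dd absorbs the one for d >= dd, so it suffices to treat dd = d. *)
have {hle}: eqk (dnw (longest d (n.+1 - d)) (Tser m ((d, m') :: r) D))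
     (dnw (longest d (n.+1 - d)) (Oser m ((d, m') :: r) D)) ->
   eqk (dnw (longest dd (n.+1 - dd)) (Tser m ((d, m') :: r) D))
     (dnw (longest dd (n.+1 - dd)) (Oser m ((d, m') :: r) D)).
  have [e|ne] := boolP (n.+1 <= dd)%N.
    have -> : (n.+1 - dd = 0)%N by lia.
    by have -> : (n.+1 - d = 0)%N by lia.
  move/(eqk_dnw (longest dd (n.+1 - dd))); rewrite !(longest_absw demP) //; try lia.
    by apply/allP => k /mem_longest; lia.
  by apply/allP => k /mem_longest; lia.
apply.
case/and3P: ok => hd hd' ok; move: hd hsz => /= hd hsz.
set w := longest d (n.+1 - d); set w' := longest d.-1 (n.+1 - d).
have ww : w = map succn w' by rewrite map_succ_longest /w; congr longest; lia.
have hw : all (fun k => d <= k <= n)%N w by apply/allP => k /mem_longest; lia.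
have hw0 : all (fun k => 0 < k <= n)%N w by apply: sub_all hw => k; lia.
have hw' : all (fun k => k < n)%N w' by apply/allP => k /mem_longest; lia.
pose T e := Tser m' r e; pose O e := Oser m' r e.
have Tfree e : free_last (T e).
  by move=> a ha; apply: (Tser_beyond ha).
have hP e : exists P, ispoly P /\ eqk (T e) P by have [P] := poly_part_ex (T e); exists P.
(* The tail is replaced by its polynomial part: [eqk_free] keeps it free of the last variable, and a
   congruence between polynomials is an equality. *)
pose P e := epsilon (inhabits 0) (fun P => ispoly P /\ eqk (T e) P).
have Pspec e : ispoly (P e) /\ eqk (T e) (P e) := epsilon_spec (inhabits 0) _ (hP e).
have Pfree e : free_last (P e).
  by case: (Pspec e) => pP; apply: eqk_free.
(* The row is prolonged to all columns from d on, so that its factors are permuted by s_d, ...,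
   s_{l-1}. *)
have s1 : eqk (x0 m * geoms (from d) (fun e => phi 0 (T e)) D) (Tser m ((d, m') :: r) D).
  rewrite /eqk /= -mulrBr.
  have pf : perm_eq (from d) (from (maxn d (size r).+2) ++ upto d (size r).+1).
    apply: uniq_perm; first exact: uniq_ordfilter.
      rewrite cat_uniq !uniq_ordfilter andbT /=; apply/hasPn => p.
      by rewrite mem_from mem_ordfilter geq_max; lia.
    by move=> p; rewrite mem_cat !mem_from mem_ordfilter geq_max; lia.
  rewrite (geoms_perm _ pf) geoms_cat.
  apply: (@ker_tail _ _ (size r).+2).
  apply: (supp_inM (P := fun a => tail (size r).+2 a = 0)); last first.
  - apply: (@geoms_beyond (size r).+2) => [//|p|e].
      by rewrite mem_from geq_max => /andP[].
    have := @Tser_beyond 0 ((d, m') :: r) e.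
    by rewrite /= mulr0n gX0 mul1r.
  - apply: supp_inX; rewrite /tail big1 // => p hp; rewrite x0_coord //; lia.
  by move=> a b ha hb; rewrite tailD ha add0r.
apply: (eqk_trans (eqk_sym (eqk_dnw w s1))).
rewrite dnw_x0 // -[dnw w _]/((fun e => dnw w (geoms (from d) (fun e => phi 0 (T e)) e)) D).
rewrite dnw_geoms //; last by lia.
have -> : (fun e => dnw w (phi 0 (T e))) = (fun e => phi 0 (dnw w' (T e))).
  by apply: funext => e; rewrite (phi_dnw demP) // -ww.
have s2 : eqk (x0 m * geoms (from d) (fun e => phi 0 (dnw w' (T e))) D)
   (x0 m * geoms (from d) (fun e => phi 0 (dnw w' (P e))) D).
  rewrite /eqk -mulrBr -[X in x0 m * X]/((fun e => geoms (from d) (fun e => phi 0 (dnw w' (T e))) e - geoms (from d) (fun e => phi 0 (dnw w' (P e))) e) D).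
  rewrite -geomsB; apply: ker_geoms => e c; rewrite -(phi_zmod 0) -dnw_zmod.
  apply: ker_phi0; first by apply: dnw_free => //; exact: (supp_inB (Tfree e) (Pfree e)).
  rewrite dnw_zmod; apply: eqk_dnw; exact: (Pspec e).2.
apply: (eqk_trans s2).
(* The whole row of geometric factors is traded for an ascending word under [Phi], which completes
   the longest word of the next parabolic. *)
have s3 : eqk (x0 m * geoms (from d) (fun e => phi 0 (dnw w' (P e))) D)
   (x0 m * Phi (fun e => dnw (longest d.-1 (n.+2 - d)) (P e)) D).
  rewrite /eqk -mulrBr.
  have := @geoms_Phi (n.+2 - d) (fun e => dnw w' (P e)) _ _ _ D m.
  rewrite (_ : (n.+2 - (n.+2 - d) = d)%N); last by lia.
  rewrite (_ : (n.+1 - (n.+2 - d) = d.-1)%N); last by lia.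
  have -> : (fun e => dnw (iota d.-1 (n.+2 - d)) (dnw w' (P e))) = (fun e => dnw (longest d.-1 (n.+2 - d)) (P e)).
    by apply: funext => e; rewrite longest_asc_desc //; lia.
  apply; [lia|by move=> e; apply: dnw_free|].
  by move=> k e hk; apply: (longest_absl demP); lia.
apply: (eqk_trans s3).
(* The induction hypothesis is used at dd = d - 1, allowed by nr_{k+1} >= nr_k - 1; both sides being
   polynomials, it becomes an equality. *)
have PO e : dnw (longest d.-1 (n.+2 - d)) (P e) = dnw (longest d.-1 (n.+2 - d)) (O e).
  have := IH m' (ltnW hsz) ok d.-1 hd' e.
  rewrite (_ : (n.+1 - d.-1 = n.+2 - d)%N); last by lia.
  move=> h; apply: ispoly_eqk; [apply: dnw_ispoly; exact: (Pspec e).1|apply: dnw_ispoly; exact: Oser_ispoly|].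
  by apply: (eqk_trans _ h); apply: eqk_sym; apply: eqk_dnw; exact: (Pspec e).2.
rewrite /= dnw_x0 // /eqk.
have -> : dnw w (Phi (fun e => dnw (desc d.-1 (n.+2 - d)) (Oser m' r e)) D)
   = Phi (fun e => dnw (longest d.-1 (n.+2 - d)) (O e)) D.
  rewrite /Phi (zmorph_sum (dnw_zmod w)); apply: eq_bigr => k _.
  rewrite ww -(phi_dnw demP) // -dnw_cat; congr (phi _ (dnw _ _)).
  have [e|ne] := eqVneq d n.+2; first by rewrite /w' e subnn (_ : (n.+1 - n.+2 = 0)%N) //; lia.
  by rewrite (_ : (n.+2 - d = (n.+1 - d).+1)%N); last by lia.
have -> : (fun e => dnw (longest d.-1 (n.+2 - d)) (P e)) = (fun e => dnw (longest d.-1 (n.+2 - d)) (O e)).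
  exact: funext.
by rewrite subrr; apply: ker0.
Qed.

End Recursion.

(** * Unrolling the row recursion into a product over roots; finiteness in q *)

Section SeriesExpansion.
Variables (n : nat) (L : gring (expo n)).
Local Notation X := (gX L).
Implicit Types (p q : 'I_n.+2) (a b : expo n) (f g : L) (s t : nat -> L).
Local Notation var p := (gX L (evec p)).
Local Notation x0 c := (X (evec ord0 *+ c)).

Lemma dem_exists (i : 'I_n.+1) f : exists g : L, (var (posl i) - var (posr i)) * g
      = var (posl i) * f - var (posr i) * sw i f.
Proof.
apply: (gring_ind (P := fun f => exists g : L, (var (posl i) - var (posr i)) * g
      = var (posl i) * f - var (posr i) * sw i f)) => [|f1 f2 [g1 e1] [g2 e2]|a].
- by exists 0; rewrite raddf0 !mulr0 subr0.
- by exists (g1 - g2); rewrite swB [LHS]mulrBr e1 e2; ring.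
by exists (dem_monom L i a); rewrite var_eq var_eq' -mulrA dem_monomP swap_monom.
Qed.

Lemma dem_normalize (i : 'I_n.+1) f g : (var (posl i) - var (posr i)) * g
      = var (posl i) * f - var (posr i) * sw i f ->
  (1 - X (- sroot i)) * g = f - X (- sroot i) * sw i f.
Proof. by rewrite var_eq var_eq' -mulrA => /gX_inj. Qed.

Definition rfac (r : 'I_n.+2 * 'I_n.+2) : L := X (evec r.1 - evec r.2).
Definition geomsR (R : seq ('I_n.+2 * 'I_n.+2)) s := foldr (fun r => geom (rfac r)) s R.
Definition shiftR (R : seq ('I_n.+2 * 'I_n.+2)) := [seq (ordS r.1, ordS r.2) | r <- R].

Lemma geomsR_perm R R' s : perm_eq R R' -> geomsR R s = geomsR R' s.
Proof. by apply: perm_foldrC => x y u; exact: geomC. Qed.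

Lemma phi0_geom f f' s : (forall g, phi 0 (f * g) = f' * phi 0 g) ->
  (fun e => phi 0 (geom f s e)) = geom f' (fun e => phi 0 (s e)).
Proof.
move=> h; apply: funext; elim=> //= e <-.
by rewrite (zmorphD (phi_zmod 0)) h.
Qed.

Lemma phi0_geomsR R s : all (fun r => (r.1 != ord_max) && (r.2 != ord_max)) R ->
  (fun e => phi 0 (geomsR R s e)) = geomsR (shiftR R) (fun e => phi 0 (s e)).
Proof.
elim: R => //= r R IH /andP[/andP[h1 h2] /IH <-]; apply: phi0_geom => g.
rewrite /rfac phiXM ?rotl_zmod ?rotl_evec //.
by rewrite expoB !evecE ![ord_max == _]eq_sym (negbTE h1) (negbTE h2) subrr.
Qed.

Fixpoint troots (r : seq (nat * nat)) : seq ('I_n.+2 * 'I_n.+2) :=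
  if r is (d, _) :: r' then [seq (ord0, p) | p <- upto n d (size r)] ++ shiftR (troots r')
  else [::].
Fixpoint texp (m : nat) (r : seq (nat * nat)) : expo n :=
  if r is (_, m') :: r' then evec ord0 *+ m + rotl (texp m' r') else evec ord0 *+ m.

Lemma troots_bound r : (size r <= n.+1)%N -> all (fun q : 'I_n.+2 * 'I_n.+2 => (q.1 <= size r)%N && (q.2 <= size r)%N) (troots r).
Proof.
elim: r => //= [[d m] r] IH hsz; rewrite all_cat; apply/andP; split.
  by apply/allP => q /mapP [p + ->]; rewrite mem_ordfilter /= => /andP[].
rewrite all_map; apply: sub_all (IH (ltnW hsz)) => q /= /andP[h1 h2].
by rewrite !modn_small //; lia.
Qed.

Lemma ord_pred_pos p : (0 < p)%N -> ord_pred p = p.-1 :> nat.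
Proof.
move=> hp; have -> : nat_of_ord (ord_pred p) = ((p + n.+2).-1 %% n.+2)%N by [].
have -> : ((p + n.+2).-1 = p.-1 + n.+2)%N by lia.
by rewrite modnDr modn_small //; have := ltn_ord p; lia.
Qed.

Lemma texp_beyond m r : (size r <= n.+1)%N -> beyond (size r).+1 (texp m r).
Proof.
elim: r m => [|[d m'] r IH] m hsz p hp /=; first by rewrite x0_coord.
rewrite expoD x0_coord ?add0r ?ffunE; last by move: hp => /=; lia.
by apply: IH; rewrite ?ord_pred_pos //; move: hp hsz => /=; lia.
Qed.

Lemma geoms_map J s : geoms J s = geomsR [seq (ord0, p) | p <- J] s.
Proof. by elim: J => //= p J ->. Qed.

Lemma Tser_geomsR m r : (size r <= n.+1)%N ->
  Tser L m r = geomsR (troots r) (const (X (texp m r))).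
Proof.
elim: r m => //= [[d m'] r] IH m hsz.
rewrite /geomsR foldr_cat -!/(geomsR _ _).
have -> : Tser L m' r = geomsR (troots r) (const (X (texp m' r))) by apply: IH; lia.
rewrite -geoms_map -geomsM; congr geoms.
have := @phi0_geomsR (troots r) (const (X (texp m' r))).
move=> /(_ _)/(congr1 (fun s e => x0 m * s e)) -> //; last first.
  apply: sub_all (troots_bound (ltnW hsz)) => q /andP[h1 h2].
  by rewrite -!val_eqE /=; lia.
elim: (shiftR _) => [|q R IHR] /=; last by rewrite -IHR geomM.
apply: funext => -[|e] /=.
  have tl : texp m' r ord_max = 0 by apply: texp_beyond => /=; lia.
  by rewrite phiX tl eqxx gXD.
by rewrite (zmorph0 (phi_zmod 0)) mulr0.
Qed.

Variable dm : 'I_n.+1 -> L -> L.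
Hypothesis demP : demazure_op L dm.

(** Degree and nonnegativity are kept by the operators pi_i and by the rotation; they bound the last
    exponent and so the powers of q produced by one rotation. *)
Definition homog (M : int) a := nonneg a /\ \sum_p a p = M.

Lemma supp_homog_dem i M f : supp_in (homog M) f -> supp_in (homog M) (dm i f).
Proof.
apply: (supp_dem demP) => a [ha aM] c [ho hs h1 h2]; split.
  have := ha (posl i); have := ha (posr i).
  by move=> ? ?; apply: (posP (i := i)) => [||p pl pr]; [lia|lia|rewrite ho].
rewrite -aM (bigD1 (posl i)) //= (bigD1 (posr i)) 1?eq_sym ?posl_posr //=.
rewrite [RHS](bigD1 (posl i)) //= [X in _ = _ + X](bigD1 (posr i)) 1?eq_sym ?posl_posr //=.
rewrite !addrA hs; congr (_ + _); apply: eq_bigr => p /andP[pl pr]; exact: ho.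
Qed.

Lemma supp_homog_dnw w M f : supp_in (homog M) f -> supp_in (homog M) (dnw dm w f).
Proof. by move=> hf; elim: w => //= k w IH; apply: supp_homog_dem. Qed.

Lemma sum_rotl a : \sum_p rotl a p = \sum_p a p.
Proof.
rewrite [RHS](reindex_inj (@ord_pred_inj n.+2)) /=.
by apply: eq_bigr => p _; rewrite ffunE.
Qed.

Definition rows_sum m (r : seq (nat * nat)) : nat := m + sumn (map snd r).

Lemma homog_x0 m : homog m%:Z (evec ord0 *+ m).
Proof.
split=> [p|]; first by rewrite expoMn evecE; case: (p == _); lia.
rewrite (bigD1 ord0) //= big1 ?addr0 => [|p p0]; rewrite expoMn evecE ?eqxx ?mul1r //.
by rewrite (negbTE p0) mul0r.
Qed.

Lemma homogD M N a b : homog M a -> homog N b -> homog (M + N) (a + b).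
Proof.
move=> [ha <-] [hb <-]; split=> [p|]; first by rewrite expoD addr_ge0.
by rewrite -big_split; apply: eq_bigr => p _; rewrite expoD.
Qed.

Lemma Oser_homog m r e : supp_in (homog (rows_sum m r)%:Z) (Oser dm m r e).
Proof.
elim: r m e => [|[d m'] r IH] m e /=.
  rewrite /rows_sum /= addn0; case: e => [|e] /=; last exact: supp_in0.
  by apply: supp_inX; exact: homog_x0.
rewrite /rows_sum /= PoszD; apply: supp_inM (@homogD _ _) _ _; first by apply: supp_inX; exact: homog_x0.
apply: (Phi_supp (P := homog (rows_sum m' r)%:Z)) => [a [ha aM] _|d'].
  by split=> [p|]; rewrite ?ffunE // sum_rotl aM.
by apply: supp_homog_dnw; apply: IH.
Qed.

(** A rotation raises the q-degree by at most the total degree of its argument, so the series is a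
    polynomial in q. *)
Lemma Oser_vanish m r : exists N, forall D, (N <= D)%N -> Oser dm m r D = 0.
Proof.
elim: r m => [|[d m'] r IH] m; first by exists 1%N => -[].
have [N hN] := IH m'; exists (N + (rows_sum m' r).+1)%N => D hD /=.
rewrite /Phi big1 ?mulr0 // => k _.
have [le|lt] := leqP N (D - k).
  rewrite hN // (zmorph0 (dnw_zmod demP _)); exact: zmorph0 (phi_zmod k).
have := @supp_homog_dnw (desc d.-1 (n.+2 - d)) _ _ (@Oser_homog m' r (D - k)%N).
set f := dnw _ _ _ => hf; apply: gext => b; rewrite gcf0; apply/eqP/negPn/negP => hb.
apply: (supp_in_additive (Q := fun _ => False) (phi_zmod k)) hf _ hb => a [ha aM] c.
rewrite phiX; case: ifP => [/eqP a0|_]; last by rewrite gcf0 eqxx.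
have : (a ord_max <= \sum_p a p)%O by rewrite (bigD1 ord_max) //= lerDl sumr_ge0.
by rewrite a0 aM; lia.
Qed.

End SeriesExpansion.

(** * The operator formula for H(Psi; mu; w) *)

Section CatalanOperators.
Variable n : nat.
Let LG := group_gring (expo n).

Lemma demazureP (i : 'I_n.+1) (f : LG) :
  (1 - gX LG (- sroot i)) * (demazure i f : LG) = f - gX LG (- sroot i) * sw i f.
Proof.
apply: (@dem_normalize n LG i f (demazure i f)).
exact: (epsilon_spec (inhabits (0 : laurent n)) _ (@dem_exists n LG i f)).
Qed.

Lemma polypartP (f : LG) : ispoly (L := LG) (polypart f) /\ eqk (L := LG) f (polypart f).
Proof.
have ex : exists c : {malg int[expo n]}, f = \sum_(a <- msupp c) key a *~ c@_a.
  by have [c e] := keyL_span demazureP f; exists c; rewrite e glinE.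
have e := epsilon_spec (inhabits 0) _ ex.
have := poly_part_spec demazureP (key_coef f : LG).
by rewrite glinE -[\sum_(a <- _) _]e.
Qed.

Lemma catalan_seriesE Psi (gamma : expo n) :
  catalan_series Psi gamma = geomsR (L := LG) (enum Psi) (const (gX LG gamma)).
Proof.
rewrite /catalan_series /geomsR; elim: (enum _) => //= r R ->.
exact: (@geom_psmul n LG).
Qed.

Variables (Psi : {set 'I_n.+2 * 'I_n.+2}) (mu : n.+2.-tuple nat).
Hypothesis hPsi : root_ideal Psi.

Lemma card_interval (N a b : nat) : (b <= N)%N -> #|[set k : 'I_N | (a <= k < b)%N]| = (b - a)%N.
Proof.
move=> hb; rewrite -sum1dep_card -(big_mkord (fun k => (a <= k < b)%N) (fun=> 1%N)).
have := sum_nat_const_nat a b 1; rewrite muln1 (big_nat_widenl a 0) // (big_nat_widen 0 b N) //= => <-; exact: eq_bigl.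
Qed.

(** In a root ideal each row is a final segment, so the count of non-roots is the offset of its
    first root; both directions compare cardinals of intervals. *)
Lemma nr_root (i j : 'I_n.+2) : (i <= j)%N -> ((i, j) \in Psi) = (i + nr Psi i <= j)%N.
Proof.
move=> ij; case: hPsi => hlt hup; rewrite /nr; set A := [set _ | _].
apply/idP/idP => h.
  have : A \subset [set k : 'I_n.+2 | (i <= k < j)%N].
    apply/subsetP => k; rewrite !inE => /andP[ik nk]; rewrite ik ltnNge; apply: contraNN nk => jk.
    by apply: (hup _ _ _ _ h) => //; exact: leq_trans (hlt _ _ h) jk.
  by move/subset_leq_card; rewrite card_interval; [lia|exact: ltnW].
apply: contraTT h => nij; rewrite -ltnNge.
have : [set k : 'I_n.+2 | (i <= k < j.+1)%N] \subset A.
  apply/subsetP => k; rewrite !inE => /andP[ik kj]; rewrite ik /=.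
  by apply: contraNN nij => hk; apply: (hup _ _ _ _ hk) => //; exact: leq_trans (hlt _ _ hk) _.
by move/subset_leq_card; rewrite card_interval //; lia.
Qed.

Lemma nr_gt0 i : (0 < nr Psi i)%N.
Proof.
case: hPsi => hlt _; rewrite lt0n; apply/eqP => e.
by have := nr_root (leqnn i); rewrite e addn0 leqnn => /hlt; rewrite ltnn.
Qed.

Lemma nr_le (i : 'I_n.+2) : (i + nr Psi i <= n.+2)%N.
Proof.
have : [set j : 'I_n.+2 | (i <= j)%N && ((i, j) \notin Psi)] \subset [set k : 'I_n.+2 | (i <= k < n.+2)%N].
  by apply/subsetP => k; rewrite !inE => /andP[-> _] /=.
by move/subset_leq_card; rewrite card_interval // -/(nr Psi i); have := ltn_ord i; lia.
Qed.

Lemma nr_next (i j : 'I_n.+2) : j = i.+1 :> nat -> (nr Psi i <= (nr Psi j).+1)%N.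
Proof.
move=> ij; case: hPsi => hlt hup; rewrite leqNgt; apply/negP => lt.
have hk : (j + nr Psi j < n.+2)%N by have := nr_le i; lia.
have := nr_root (i := j) (j := Ordinal hk); rewrite /= leqnn leq_addr => /(_ isT) h.
have := hup _ _ i (Ordinal hk) h; rewrite nr_root /=; last by lia.
by move=> /(_ ltac:(lia) ltac:(lia) (leqnn _)); lia.
Qed.

Definition rows k len := [seq (nr Psi (inord j), nth 0%N mu j.+1) | j <- iota k len].

Lemma rows_okP k len : (k + len = n.+1)%N -> rows_ok (rows k len).
Proof.
elim: len k => //= len IH k e; rewrite IH; last by lia.
rewrite andbT size_map size_iota; apply/andP; split.
  by rewrite nr_gt0 /=; have := nr_le (inord k); rewrite inordK; lia.
case: len e {IH} => //= len e; rewrite -ltnS prednK ?nr_gt0 //.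
by apply: nr_next; rewrite !inordK; lia.
Qed.

Lemma mem_shiftR (R : seq ('I_n.+2 * 'I_n.+2)) (p q : 'I_n.+2) :
  all (fun r => (r.1 != ord_max) && (r.2 != ord_max)) R ->
  ((p, q) \in shiftR R) = [&& (0 < p)%N, (0 < q)%N & (ord_pred p, ord_pred q) \in R].
Proof.
move=> hR; apply/mapP/and3P => [[[x y] hxy [-> ->]]|[hp hq h]].
  have /andP[/= h1 h2] := allP hR _ hxy.
  have e1 : (x.+1 %% n.+2 = x.+1)%N by rewrite -[RHS](ordSE h1).
  have e2 : (y.+1 %% n.+2 = y.+1)%N by rewrite -[RHS](ordSE h2).
  by rewrite /= e1 e2 !ordSK.
by exists (ord_pred p, ord_pred q) => //; rewrite !ord_predK.
Qed.

Lemma mem_troots k len (p q : 'I_n.+2) : (k + len = n.+1)%N ->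
  ((p, q) \in troots n (rows k len)) =
  [&& (p + k < n.+2)%N, (q + k < n.+2)%N & (inord (p + k), inord (q + k)) \in Psi].
Proof.
case: (hPsi) => hlt _; elim: len k p q => [|len IH] k p q e /=.
  apply/esym/negbTE; apply/and3P => -[h1 h2 /hlt]; rewrite !inordK //; lia.
rewrite mem_cat size_map size_iota mem_shiftR; last first.
  have := @troots_bound n (rows k.+1 len); rewrite size_map size_iota => /(_ ltac:(lia)).
  by apply: sub_all => r; rewrite -!val_eqE /=; lia.
have e1 : ((p, q) \in [seq (ord0, p0) | p0 <- upto n (nr Psi (inord k)) len.+1])
   = (p == ord0) && (nr Psi (inord k) <= q <= len.+1)%N.
  apply/mapP/andP => [[x + [-> ->]]|[/eqP -> h]]; first by rewrite mem_ordfilter eqxx.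
  by exists q => //; rewrite mem_ordfilter.
rewrite e1 IH; last by lia.
have [->|p0] := eqVneq p ord0.
  rewrite /= orbF add0n; have -> : (k < n.+2)%N by lia.
  apply/andP/andP => -[h1 h2]; last first.
    case/andP: h2 => hq h2; have := nr_root (i := inord k) (j := inord (q + k)).
    by rewrite h2 !inordK //; lia.
  by split=> //; rewrite nr_root !inordK //; lia.
have p1 : (0 < p)%N by move: p0; rewrite -val_eqE /=; lia.
rewrite orFb p1 (ord_pred_pos p1) !andTb; have [q0|q1] := posnP q.
  rewrite q0 /=; apply/esym/negbTE; apply/and3P => -[h1 h2 /hlt]; rewrite !inordK //; lia.
rewrite (ord_pred_pos q1) !andTb.
by rewrite (_ : p.-1 + k.+1 = p + k)%N 1?(_ : q.-1 + k.+1 = q + k)%N //; lia.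
Qed.

Lemma troots_uniq k len : (k + len = n.+1)%N -> uniq (troots n (rows k len)).
Proof.
elim: len k => //= len IH k e; rewrite cat_uniq map_inj_uniq; last by move=> x y [].
rewrite uniq_ordfilter /=; apply/andP; split.
  apply/hasPn => q /mapP [x hx ->]; apply/mapP => -[y _ [e1 _]].
  have := @troots_bound n (rows k.+1 len); rewrite size_map size_iota => /(_ ltac:(lia)) /allP /(_ _ hx).
  by move=> /andP[h1 _]; have := e1; rewrite modn_small //; lia.
rewrite map_inj_uniq; first by apply: IH; lia.
by move=> [x y] [x' y'] /eqP; rewrite xpair_eqE /= => /andP[/eqP/ordS_inj -> /eqP/ordS_inj ->].
Qed.

Lemma troots_perm : perm_eq (troots n (rows 0 n.+1)) (enum Psi).
Proof.
apply: uniq_perm; [exact: troots_uniq|exact: enum_uniq|move=> [p q]].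
by rewrite mem_troots // mem_enum !addn0 !inord_val !ltn_ord.
Qed.

Lemma texp_rows k len : (k + len = n.+1)%N -> forall p : 'I_n.+2,
  texp n (nth 0%N mu k) (rows k len) p = (nth 0%N mu (p + k))%:Z.
Proof.
elim: len k => [|len IH] k e p /=.
  have [->|p0] := eqVneq p ord0; first by rewrite expoMn evecE eqxx mul1r.
  rewrite x0_coord; last by move: p0; rewrite -val_eqE /=; lia.
  by rewrite nth_default // size_tuple; move: p0; rewrite -val_eqE /=; lia.
rewrite expoD ffunE; have [->|p0] := eqVneq p ord0.
  rewrite expoMn evecE eqxx mul1r ord_pred_0 IH; last by lia.
  by rewrite [nth _ _ (ord_max + _)]nth_default ?addr0 // size_tuple /=; lia.
have p1 : (0 < p)%N by move: p0; rewrite -val_eqE /=; lia.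
rewrite x0_coord // add0r IH; last by lia.
by rewrite ord_pred_pos // (_ : p.-1 + k.+1 = p + k)%N //; lia.
Qed.

Lemma catalan_series_Tser d :
  catalan_series Psi (mu_expo mu) d = Tser LG (nth 0%N mu 0) (rows 0 n.+1) d.
Proof.
rewrite catalan_seriesE Tser_geomsR; last by rewrite size_map size_iota.
rewrite (geomsR_perm _ troots_perm); congr (geomsR _ (const (gX LG _)) d).
by apply/ffunP => p; rewrite texp_rows // addn0 ffunE (tnth_nth 0%N).
Qed.

Lemma dnw_map (dm : 'I_n.+1 -> LG -> LG) w f : dnw dm w f = dmw dm [seq inord k | k <- w] f.
Proof. by elim: w => //= k w ->. Qed.

Variable w : seq 'I_n.+1.
Hypothesis htame : tame Psi w.

(** Tameness lets w absorb the longest element for which [Tser_Oser] holds; both sides are then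
    polynomials congruent modulo the kernel, hence equal. *)
Lemma catalanE d : (catalan Psi (mu_expo mu) w)`_d
  = demazure_word w (Oser (L := LG) (@demazure n) (nth 0%N mu 0) (rows 0 n.+1) d).
Proof.
pose d0 := nr Psi ord0.
pose O := Oser (L := LG) (@demazure n) (nth 0%N mu 0) (rows 0 n.+1).
have absorb (f : LG) : demazure_word w f
    = demazure_word w (dnw (L := LG) (@demazure n) (longest d0 (n.+1 - d0)) f).
  have := @mem_longest d0 (n.+1 - d0); elim: (longest _ _) f => //= k s IH f hs.
  have hk : (d0 <= k < n.+1)%N by have := hs k (mem_head _ _); lia.
  rewrite {1}IH; last by move=> x xs; apply: hs; rewrite inE xs orbT.
  have ht := htame (i := inord k); rewrite inordK in ht; last by lia.
  have := dmw_hecke demazureP (ht ltac:(rewrite /d0 in hk; lia)) (dnw (L := LG) (@demazure n) s f).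
  by rewrite -cats1 dmw_cat => e; exact: (esym e).
have key d' : demazure_word w (polypart (catalan_series Psi (mu_expo mu) d')) = demazure_word w (O d').
  have [pP hP] := polypartP (catalan_series Psi (mu_expo mu) d').
  rewrite absorb [RHS]absorb; congr demazure_word.
  apply: (@ispoly_eqk n LG).
  - exact: (dnw_ispoly demazureP).
  - by apply: (dnw_ispoly demazureP); exact: (Oser_ispoly demazureP).
  apply: (eqk_trans (eqk_sym (eqk_dnw demazureP _ hP))).
  rewrite catalan_series_Tser; apply: (Tser_Oser demazureP); first by rewrite size_map size_iota.
    exact: rows_okP.
  by rewrite /= /d0 (_ : inord 0 = ord0) //; apply: val_inj; rewrite /= inordK.
(* The choice in [catalan] is meaningful only because the truncated series has finitely many
   terms. *)
have ex : exists h : {poly laurent n}, forall d', h`_d' = demazure_word w (polypart (catalan_series Psi (mu_expo mu) d')).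
  have [N hN] := Oser_vanish demazureP (nth 0%N mu 0) (rows 0 n.+1).
  exists (\poly_(d' < N) demazure_word w (O d')) => d'; rewrite coef_poly key; case: ltnP => // le.
  by rewrite /O hN //; apply/esym; exact: (zmorph0 (dmw_zmod demazureP w)).
by rewrite (epsilon_spec (inhabits 0) _ ex d) key.
Qed.

End CatalanOperators.

(** * Free modules and the base field *)

Record fmod (K : fieldType) (T : choiceType) := FMod {
  fm_sort :> lmodType K;
  fbas : T -> fm_sort;
  fcf : fm_sort -> T -> K;
  fsupp : fm_sort -> seq T;
  flin : forall M : lmodType K, (T -> M) -> fm_sort -> M;
  fcfP : forall a x y t, fcf (a *: x + y) t = a * fcf x t + fcf y t;
  fcfb : forall s t, fcf (fbas s) t = (s == t)%:R;
  fext : forall x y, fcf x =1 fcf y -> x = y;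
  fsum : forall x, x = \sum_(t <- fsupp x) fcf x t *: fbas t;
  fsupp_uniq : forall x, uniq (fsupp x);
  fsuppP : forall x t, (t \in fsupp x) = (fcf x t != 0);
  flinP : forall (M : lmodType K) (F : T -> M) a x y, flin F (a *: x + y) = a *: flin F x + flin F y;
  flinb : forall (M : lmodType K) (F : T -> M) t, flin F (fbas t) = F t }.

(* Opaque, so that the implementation never unfolds. *)
Lemma free_module_exists (K : fieldType) (T : choiceType) : inhabited (fmod K T).
Proof.
constructor; pose A : lmodType K := {malg K[T]}.
pose ln (M : lmodType K) (F : T -> M) (x : A) : M := \sum_(t <- msupp x) x@_t *: F t.
have lnw (M : lmodType K) (F : T -> M) (x : A) (d : {fset T}) :
    (msupp x `<=` d)%fset -> ln M F x = \sum_(t <- d) x@_t *: F t.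
  move=> le; rewrite /ln (big_fset_incl _ le) //= => k _ /mcoeff_outdom ->.
  by rewrite scale0r.
apply: (@FMod K T A (fun t => << (1 : K) *g t >>) (fun x t => x@_t) (fun x => msupp x) ln).
- by move=> a x y t; rewrite mcoeffD mcoeffZ.
- by move=> s t; rewrite mcoeffU.
- by move=> x y h; apply/malgP.
- move=> x; rewrite {1}[x]monalgE; apply: eq_bigr => t _; apply/malgP => s.
  by rewrite mcoeffZ !mcoeffU mulr_natr.
- by move=> x; exact: fset_uniq.
- by move=> x t; rewrite mcoeff_neq0.
- move=> M F a x y; pose d := (msupp x `|` msupp y)%fset.
  rewrite (@lnw _ _ (a *: x + y) d); last first.
    apply: fsubset_trans (msuppD_le _ _) _; apply: fsetSU; exact: msuppZ_le.
  rewrite (@lnw _ _ x d) ?fsubsetUl // (@lnw _ _ y d) ?fsubsetUr // scaler_sumr -big_split /=; apply: eq_bigr => t _.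
  by rewrite mcoeffD mcoeffZ scalerDl scalerA.
move=> M F t; rewrite (@lnw _ _ _ [fset t]%fset) ?msuppU_le // big_seq_fset1 mcoeffU eqxx.
by rewrite scale1r.
Qed.

Definition freeM (K : fieldType) (T : choiceType) : fmod K T :=
  epsilon (free_module_exists K T) (fun _ => True).

Section LinearFunctions.
Variables (K : fieldType) (M N : lmodType K) (g : M -> N).
Hypothesis glin : linear g.
Lemma lin_0 : g 0 = 0.
Proof. by have := glin (-1) 0 0; rewrite !scaleN1r oppr0 addr0 addNr. Qed.
Lemma lin_D x y : g (x + y) = g x + g y. Proof. by rewrite -[x]scale1r glin !scale1r. Qed.
Lemma lin_Z a x : g (a *: x) = a *: g x. Proof. by rewrite -[_ *: x]addr0 glin lin_0 !addr0. Qed.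
Lemma lin_B x y : g (x - y) = g x - g y. Proof. by rewrite -scaleN1r lin_D lin_Z scaleN1r. Qed.
Lemma lin_sum (I : Type) (r : seq I) (P : pred I) (F : I -> M) :
  g (\sum_(i <- r | P i) F i) = \sum_(i <- r | P i) g (F i).
Proof. exact: (big_morph g lin_D lin_0). Qed.
End LinearFunctions.

Section FreeModule.
Variables (K : fieldType) (T : choiceType).
Local Notation A := (freeM K T).
Implicit Types (x y : A) (s t : T).
Local Notation cf := (@fcf K T A).

Lemma flin_is_linear (M : lmodType K) (F : T -> M) : linear (@flin K T A M F).
Proof. by move=> a x y; rewrite flinP. Qed.
HB.instance Definition _ (M : lmodType K) (F : T -> M) :=
  GRing.isLinear.Build K A M _ (@flin K T A M F) (flin_is_linear F).

Lemma fcf0 t : cf 0 t = 0.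
Proof. have := fcfP (-1) (0 : A) 0 t; rewrite scaleN1r oppr0 addr0 mulN1r addNr; exact. Qed.
Lemma fcfZ a x t : cf (a *: x) t = a * cf x t.
Proof. by rewrite -[a *: x]addr0 fcfP fcf0 addr0. Qed.
Lemma fcfD x y t : cf (x + y) t = cf x t + cf y t.
Proof. by rewrite -[x]scale1r fcfP mul1r scale1r. Qed.
Lemma fcfN x t : cf (- x) t = - cf x t.
Proof. by rewrite -scaleN1r fcfZ mulN1r. Qed.
Lemma fcfB x y t : cf (x - y) t = cf x t - cf y t.
Proof. by rewrite fcfD fcfN. Qed.
Lemma fcf_sum (I : Type) (r : seq I) (P : pred I) (F : I -> A) t :
  cf (\sum_(i <- r | P i) F i) t = \sum_(i <- r | P i) cf (F i) t.
Proof. exact: (big_morph (cf^~ t) (fun x y => fcfD x y t) (fcf0 t)). Qed.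

Lemma fmod_ind (P : A -> Prop) : P 0 -> (forall a x y, P x -> P y -> P (a *: x + y)) ->
  (forall t, P (fbas A t)) -> forall x, P x.
Proof.
move=> P0 PD Pb x; rewrite [x]fsum; elim: (fsupp x) => [|t r IH]; first by rewrite big_nil.
by rewrite big_cons; apply: PD.
Qed.

Lemma fmod_ext (M : lmodType K) (F H : A -> M) : linear F -> linear H ->
  (forall t, F (fbas A t) = H (fbas A t)) -> F =1 H.
Proof.
move=> lF lH FH; apply: fmod_ind => // [|a x y Fx Fy]; last by rewrite lF lH Fx Fy.
by have := lF (-1) 0 0; have := lH (-1) 0 0; rewrite !scaleN1r oppr0 addr0 !addNr => -> ->.
Qed.

Definition fcfE := (fcfD, fcfN, fcfZ, fcf0).

End FreeModule.

Lemma fcf_lin (K : fieldType) (T T' : choiceType) (F : T -> freeM K T') (x : freeM K T) (t' : T') :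
  fcf (flin F x) t' = \sum_(t <- fsupp x) fcf x t * fcf (F t) t'.
Proof.
rewrite {1}[x]fsum linear_sum fcf_sum.
by apply: eq_bigr => t _; rewrite linearZ /= flinb fcfZ.
Qed.

(** A field with the local ring at q = 0. The last axiom says that the residue field is formally
    real: a sum of squares divisible by q has each of its terms divisible by q. *)
Record qfield := QField {
  qK :> fieldType;
  qv : qK;
  qreg : qK -> Prop;
  qv_neq0 : qv != 0;
  qreg1 : qreg 1;
  qregB : forall x y, qreg x -> qreg y -> qreg (x - y);
  qregM : forall x y, qreg x -> qreg y -> qreg (x * y);
  qreg_v : qreg qv;
  qv_notinv : ~ qreg qv^-1;
  qreg_val : forall x, x != 0 -> exists (k : int) u, [/\ qreg u, qreg u^-1, u != 0 & x = qv ^ k * u];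
  qreg_squares : forall s : seq qK, (forall x, x \in s -> qreg x) ->
    qreg ((\sum_(x <- s) x ^+ 2) / qv) -> forall x, x \in s -> qreg (x / qv) }.

(** * The field Q(q) and its local ring at q = 0 *)

Section RationalFunctions.
Variables (K : fieldType) (tf : {rmorphism {poly rat} -> K}).
Hypothesis tf_inj : injective tf.
Hypothesis tf_surj : forall x, exists p r : {poly rat}, r != 0 /\ x = tf p / tf r.
Let q := tf 'X.
Let reg x := exists p r : {poly rat}, r.[0] != 0 /\ x = tf p / tf r.

Lemma tf_neq0 p : p != 0 -> tf p != 0.
Proof. by move=> p0; apply: contra_neq p0 => e; apply: tf_inj; rewrite e rmorph0. Qed.
Lemma tf_horner_neq0 (r : {poly rat}) : r.[0] != 0 -> tf r != 0.
Proof. by move=> h; apply: tf_neq0; apply: contraNneq h => ->; rewrite horner0. Qed.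

Lemma rq_neq0 : q != 0. Proof. by apply: tf_neq0; rewrite polyX_eq0. Qed.

Lemma reg_poly p : reg (tf p).
Proof. by exists p, 1; rewrite hornerC oner_neq0 rmorph1 divr1. Qed.

Lemma regB x y : reg x -> reg y -> reg (x - y).
Proof.
move=> [p [r [hr ->]]] [p' [r' [hr' ->]]].
exists (p * r' - p' * r), (r * r'); rewrite hornerM mulf_neq0 //; split=> //.
rewrite rmorphB !rmorphM /=; field.
by rewrite !tf_horner_neq0.
Qed.

Lemma regM x y : reg x -> reg y -> reg (x * y).
Proof.
move=> [p [r [hr ->]]] [p' [r' [hr' ->]]]; exists (p * p'), (r * r').
by rewrite hornerM mulf_neq0 //; split=> //; rewrite !rmorphM invfM mulrACA.
Qed.

Lemma reg_divq (p r : {poly rat}) : r.[0] != 0 -> reg (tf p / tf r / q) -> p.[0] = 0.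
Proof.
move=> hr [p' [r' [hr' e]]].
have : tf (p * r') = tf (p' * r * 'X).
  rewrite !rmorphM /= -/q; have h1 := tf_horner_neq0 hr; have h2 := tf_horner_neq0 hr'; have h3 := rq_neq0.
  have -> : tf p = tf p' / tf r' * q * tf r by rewrite -e; field; rewrite h1 h3.
  by field.
move/tf_inj => /(congr1 (fun z => z.[0])); rewrite !hornerM hornerX mulr0 => /eqP.
by rewrite mulf_eq0 (negbTE hr') orbF => /eqP.
Qed.

Lemma reg_mulX (p r : {poly rat}) : r.[0] != 0 -> p.[0] = 0 -> reg (tf p / tf r / q).
Proof.
move=> hr /eqP p0; have := p0; rewrite -rootE -dvdp_XsubCl subr0 => /dvdpP [p' e].
exists p', r; split=> //; rewrite e rmorphM /= -/q; have h1 := tf_horner_neq0 hr; have h3 := rq_neq0.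
by field; rewrite h1 h3.
Qed.

Lemma rq_notinv : ~ reg q^-1.
Proof.
move=> h; have := @reg_divq 1 1; rewrite hornerC oner_neq0 rmorph1 divr1 mul1r => /(_ isT h) /eqP.
by rewrite oner_eq0.
Qed.

Lemma reg_val x : x != 0 -> exists (k : int) u, [/\ reg u, reg u^-1, u != 0 & x = q ^ k * u].
Proof.
have fact (p : {poly rat}) : p != 0 -> exists m p', p'.[0] != 0 /\ p = p' * 'X ^+ m.
  move=> p0; have [m [p' h e]] := multiplicity_XsubC p 0.
  exists m, p'; rewrite p0 /= in h; split; first by move: h; rewrite rootE.
  by rewrite e subr0.
have [p [r [hr ->]]] := tf_surj x; move=> x0.
have p0 : p != 0 by apply: contraNneq x0 => ->; rewrite rmorph0 mul0r.
have [a [p' [hp ep]]] := fact _ p0; have [b [r' [hr' er]]] := fact _ hr.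
exists (a%:Z - b%:Z), (tf p' / tf r'); split.
- by exists p', r'.
- by exists r', p'; rewrite invf_div.
- by rewrite mulf_neq0 ?invr_eq0 ?tf_horner_neq0.
rewrite ep er !rmorphM !rmorphXn /= -/q expfzDr ?rq_neq0 // -exprnP -exprnN.
have h1 := tf_horner_neq0 hr'; have h3 := rq_neq0.
by field; rewrite h1 expf_neq0.
Qed.

(** Evaluation at q = 0 turns the hypothesis into a vanishing sum of squares of rational numbers. *)
Lemma reg_squares (s : seq K) : (forall x, x \in s -> reg x) ->
  reg ((\sum_(x <- s) x ^+ 2) / q) -> forall x, x \in s -> reg (x / q).
Proof.
pose res x (a : rat) := exists p r : {poly rat}, [/\ r.[0] != 0, x = tf p / tf r & a = p.[0] / r.[0]].
have ex x : reg x -> exists a, res x a by move=> [p [r [hr ->]]]; exists (p.[0] / r.[0]), p, r.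
have resq x a : res x a -> reg (x / q) <-> a = 0.
  move=> [p [r [hr -> ->]]]; split=> [/(reg_divq hr) ->|/eqP]; first by rewrite mul0r.
  rewrite mulf_eq0 invr_eq0 (negbTE hr) orbF => /eqP; exact: reg_mulX.
have resD x y a b : res x a -> res y b -> res (x ^+ 2 + y) (a ^+ 2 + b).
  move=> [p [r [hr -> ->]]] [p' [r' [hr' -> ->]]].
  exists (p ^+ 2 * r' + p' * r ^+ 2), (r ^+ 2 * r'); split.
  - by rewrite hornerM horner_exp mulf_neq0 ?expf_neq0.
  - rewrite rmorphD !rmorphM /=; have h1 := tf_horner_neq0 hr; have h2 := tf_horner_neq0 hr'.
    by field; rewrite h1 h2.
  by rewrite hornerD !hornerM; field; rewrite hr hr'.
have sumres t : (forall x, x \in t -> reg x) -> exists (f : K -> rat),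
    (forall x, x \in t -> res x (f x)) /\ res (\sum_(x <- t) x ^+ 2) (\sum_(x <- t) f x ^+ 2).
  move=> ht; pose f x := epsilon (inhabits 0) (res x).
  have hf x : x \in t -> res x (f x) by move/ht/ex/(epsilon_spec (inhabits 0)).
  exists f; split=> //; elim: t {ht} hf => [|x t IH] hf.
    by rewrite !big_nil; exists 0, 1; rewrite !hornerE oner_neq0 rmorph0 ?mul0r.
  rewrite !big_cons; apply: resD; first by apply: hf; rewrite mem_head.
  by apply: IH => y yt; apply: hf; rewrite inE yt orbT.
move=> hs; have [f [hf hsum]] := sumres s hs.
move/(resq _ _ hsum) => s0 x xs; apply/(resq _ _ (hf _ xs)).
move/eqP: s0; rewrite psumr_eq0; last by move=> y _; apply: sqr_ge0.
by move/allP => /(_ _ xs); rewrite /= sqrf_eq0 => /eqP.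
Qed.

End RationalFunctions.

Lemma Qq_surj (x : Qq) : exists p r : {poly rat}, r != 0 /\ x = tofrac p / tofrac r.
Proof.
elim/quotW: x => f; exists \n_f, \d_f; split; first exact: denom_ratioP.
have d0 : tofrac \d_f != 0 by rewrite tofrac_eq0 denom_ratioP.
apply: (mulIf d0); rewrite divfK //.
unlock FracField.tofrac; rewrite -[LHS]FracField.pi_mul; apply/eqmodP; rewrite /= FracField.equivfE /FracField.mulf.
by rewrite !numden_Ratio ?mulf_neq0 ?oner_neq0 ?denom_ratioP // !mulr1 mulrC.
Qed.

Lemma tofrac_poly_inj : injective (@tofrac {poly rat}).
Proof. by move=> p r /eqP; rewrite tofrac_eq => /eqP. Qed.

Definition Qqf : qfield := @QField Qq qq regular0 (rq_neq0 tofrac_poly_inj)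
  (@reg_poly Qq (@tofrac {poly rat}) 1) (@regB Qq (@tofrac {poly rat}) tofrac_poly_inj)
  (@regM Qq (@tofrac {poly rat})) (@reg_poly Qq (@tofrac {poly rat}) 'X)
  (@rq_notinv Qq (@tofrac {poly rat}) tofrac_poly_inj) (@reg_val Qq (@tofrac {poly rat}) tofrac_poly_inj Qq_surj)
  (@reg_squares Qq (@tofrac {poly rat}) tofrac_poly_inj).

(** * Tensor powers of the two-dimensional representation *)

Section QIntegers.
Variable Q : qfield.
Local Notation q := (qv Q).

Definition qi (k : nat) : Q := (q ^+ k - q ^- k) / (q - q^-1).
(** The quantum integer rescaled by a power of q into 1 + q^2 + ... + q^(2k-2), which for k > 0 is a
    unit at q = 0. *)
Definition qb (k : nat) : Q := \sum_(j < k) (q ^+ 2) ^+ j.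

Lemma qreg0 : qreg (0 : Q). Proof. by rewrite -(subrr 1); apply/qregB/qreg1/qreg1. Qed.
Lemma qregN x : qreg x -> qreg (- x : Q).
Proof. by move=> hx; rewrite -sub0r; apply: qregB => //; apply: qreg0. Qed.
Lemma qregD x y : qreg x -> qreg y -> qreg (x + y : Q).
Proof. by move=> hx hy; rewrite -[y]opprK; apply: qregB => //; apply: qregN. Qed.
Lemma qreg_sum (I : Type) (r : seq I) (P : pred I) (F : I -> Q) :
  (forall i, P i -> qreg (F i)) -> qreg (\sum_(i <- r | P i) F i).
Proof. by move=> h; elim/big_ind: _ => //; [exact: qreg0|exact: qregD]. Qed.
Lemma qregX k : qreg (q ^+ k).
Proof. by elim: k => [|k IH]; [rewrite expr0; exact: qreg1|rewrite exprS; apply: qregM => //; exact: qreg_v]. Qed.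
Lemma qreg_nat k : qreg (k%:R : Q).
Proof. by elim: k => [|k IH]; [exact: qreg0|rewrite -addn1 natrD; apply: qregD => //; exact: qreg1]. Qed.

Definition qmul (x : Q) : Prop := qreg (x / q).
Lemma qmulB x y : qmul x -> qmul y -> qmul (x - y).
Proof. by rewrite /qmul mulrBl; exact: qregB. Qed.
Lemma qmulD x y : qmul x -> qmul y -> qmul (x + y).
Proof. by rewrite /qmul mulrDl; exact: qregD. Qed.
Lemma qmulMl x y : qreg x -> qmul y -> qmul (x * y).
Proof. by rewrite /qmul -mulrA; exact: qregM. Qed.
Lemma qmulMr x y : qmul x -> qreg y -> qmul (x * y).
Proof. by rewrite mulrC => hx hy; apply: qmulMl. Qed.
Lemma qmul0 : qmul 0. Proof. by rewrite /qmul mul0r; exact: qreg0. Qed.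
Lemma qmulX k : qmul (q ^+ k.+1).
Proof. by rewrite /qmul exprSr mulfK ?qv_neq0 //; exact: qregX. Qed.
Lemma qmul_reg x : qmul x -> qreg x.
Proof. by move=> hx; rewrite -[x](divfK (qv_neq0 Q)); apply: qregM => //; exact: qreg_v. Qed.
Lemma qmul1 : ~ qmul 1. Proof. by rewrite /qmul mul1r; exact: qv_notinv. Qed.
Lemma qmul_sum (I : Type) (r : seq I) (P : pred I) (F : I -> Q) :
  (forall i, P i -> qmul (F i)) -> qmul (\sum_(i <- r | P i) F i).
Proof. by move=> h; elim/big_ind: _ => //; [exact: qmul0|exact: qmulD]. Qed.

Lemma q2k_neq1 k : (0 < k)%N -> (q ^+ 2) ^+ k != 1.
Proof.
case: k => // k _; apply/eqP => e; apply: (@qv_notinv Q).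
have -> : q^-1 = q ^+ (2 * k).+1; last exact: qregX.
apply: (mulIf (qv_neq0 Q)); rewrite mulVf ?qv_neq0 // -exprSr -e -exprM; congr (_ ^+ _); lia.
Qed.
Lemma qq1 : q - q^-1 != 0.
Proof.
apply: contraNneq (q2k_neq1 (isT : 0 < 1)%N) => /eqP; rewrite subr_eq0 => /eqP e.
by rewrite expr1 expr2 {2}e mulfV ?qv_neq0.
Qed.
Lemma qbS k : qb k.+1 = qb k + (q ^+ 2) ^+ k.
Proof. by rewrite /qb big_ord_recr. Qed.
Lemma qbD k m : qb (k + m) = qb k + (q ^+ 2) ^+ k * qb m.
Proof.
elim: m => [|m IH]; first by rewrite addn0 /qb big_ord0 mulr0 addr0.
by rewrite addnS !qbS IH mulrDr addrA exprD.
Qed.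
Lemma qb1 : qb 1 = 1. Proof. by rewrite /qb big_ord1 expr0. Qed.
Lemma qb0 : qb 0 = 0. Proof. by rewrite /qb big_ord0. Qed.
Lemma qiE k : qi k.+1 = q ^- k * qb k.+1.
Proof.
have h0 := qv_neq0 Q; have h1 := qq1.
have e : qb k.+1 * (q ^+ 2 - 1) = (q ^+ 2) ^+ k.+1 - 1.
  elim: k => [|k IH]; first by rewrite qb1 mul1r expr1.
  by rewrite qbS mulrDl IH [in RHS]exprS; ring.
rewrite /qi; have e2 : q - q^-1 = (q ^+ 2 - 1) / q by rewrite mulrBl expr2 mulfK // mul1r.
have h2 : q ^+ 2 - 1 != 0 by apply: contraNneq h1 => h; rewrite e2 h mul0r.
have -> : qb k.+1 = ((q ^+ 2) ^+ k.+1 - 1) / (q ^+ 2 - 1) by rewrite -e mulfK.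
rewrite e2 -exprM mul2n -addnn exprD !exprS.
have hk : q ^+ k != 0 by rewrite expf_neq0.
by move: (q ^+ k) hk h2 => z hz h2; field; rewrite h0 hz h2.
Qed.
Lemma qi0 : qi 0 = 0. Proof. by rewrite /qi expr0 invr1 subrr mul0r. Qed.
Lemma qb_neq0 k : (0 < k)%N -> qb k != 0.
Proof.
case: k => // k _; apply/eqP => e; have := q2k_neq1 (isT : (0 < k.+1)%N); rewrite -subr_eq0.
have -> : (q ^+ 2) ^+ k.+1 - 1 = qb k.+1 * (q ^+ 2 - 1); last by rewrite e mul0r eqxx.
elim: k {e} => [|k IH]; first by rewrite qb1 mul1r expr1.
by rewrite qbS mulrDl -IH [in LHS]exprS; ring.
Qed.
Lemma qi_neq0 k : (0 < k)%N -> qi k != 0.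
Proof. by case: k => // k _; rewrite qiE mulf_neq0 ?invr_eq0 ?expf_neq0 ?qv_neq0 // qb_neq0. Qed.
Lemma qreg_qb k : qreg (qb k).
Proof. by apply: qreg_sum => j _; rewrite -exprM; exact: qregX. Qed.
Lemma qmul_qb k : qmul (qb k.+1 - 1).
Proof.
rewrite -[k.+1]add1n qbD qb1 addrC addKr expr1; apply: qmulMr; last exact: qreg_qb.
exact: qmulX.
Qed.
(** Write x = q^k u with u a unit: k < 0 contradicts regularity of x, and k > 0 would make 1 = x -
    (x - 1) divisible by q. *)
Lemma unit_inv x : qmul (x - 1) -> qreg x^-1.
Proof.
move=> h; have x0 : x != 0.
  apply/eqP => e; apply: qmul1; rewrite -[1]opprK -[- 1]add0r -e opprB; rewrite -opprB.
  by rewrite /qmul mulNr; apply: qregN.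
have [k [u [ru rv u0 e]]] := qreg_val x0.
case: k e => k e; last first.
  exfalso; apply: qmul1.
  have -> : 1 = q ^+ k.+1 * u^-1 * x; last first.
    have rx : qreg x by rewrite -[x](subrK 1); apply: qregD; [exact: qmul_reg|exact: qreg1].
    by apply: qmulMr => //; apply: qmulMr => //; exact: qmulX.
  by rewrite e NegzE -exprnN; have := expf_neq0 k.+1 (qv_neq0 Q); move: (q ^+ k.+1) => z z0; field; rewrite u0 z0.
case: k e => [|k] e; first by rewrite e expr0z mul1r.
exfalso; apply: qmul1; have -> : 1 = x - (x - 1) by rewrite opprB addrC subrK.
by apply: qmulB => //; rewrite e -exprnP; apply: qmulMr => //; exact: qmulX.
Qed.
Lemma qreg_qbV k : (0 < k)%N -> qreg (qb k)^-1.
Proof. by case: k => // k _; apply: unit_inv; exact: qmul_qb. Qed.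

End QIntegers.

(** * The signature rule on words of signs *)

Section Words.
Implicit Types (w s : seq bool).

(** [true] is the upper element of the two-element crystal. [ph], [ep], [fw], [ew] iterate the
    tensor product rule of the statement, the first letter being the left factor. *)
Fixpoint ph w : nat := if w is a :: s then (if a then (ph s).+1 else (ph s).-1) else 0.
Fixpoint ep w : nat := if w is a :: s then (if a then ep s else ep s + (ph s == 0%N))%N else 0.
Fixpoint fw w : seq bool :=
  if w is a :: s then
    if a then (if ph s == 0%N then false :: s else true :: fw s) else false :: fw s
  else [::].
Fixpoint ew w : seq bool :=
  if w is a :: s then
    if a then true :: ew s else (if ph s == 0%N then true :: s else false :: ew s)
  else [::].

Definition wts w : int := (count id w)%:Z - (count negb w)%:Z.

Lemma size_fw w : size (fw w) = size w.
Proof. by elim: w => //= -[] s IH; [case: eqP|] => //=; rewrite IH. Qed.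
Lemma size_ew w : size (ew w) = size w.
Proof. by elim: w => //= -[] s IH; [|case: eqP] => //=; rewrite IH. Qed.

Lemma fwP w : (0 < ph w)%N -> [/\ ph (fw w) = (ph w).-1, ep (fw w) = (ep w).+1 & ew (fw w) = w].
Proof.
elim: w => //= -[] s IH /= h.
  have [e|ne] := eqVneq (ph s) 0%N; first by rewrite /= e /= addn1.
  have [] := IH ltac:(lia) => e1 e2 e3; rewrite /= e1 e2 e3; split=> //; lia.
have [] := IH ltac:(lia) => e1 e2 e3; rewrite e1 e2 e3.
rewrite (_ : (ph s).-1 == 0%N = false); last by lia.
by rewrite (_ : ph s == 0%N = false) ?addn0 //; lia.
Qed.

Lemma ewP w : (0 < ep w)%N -> [/\ ph (ew w) = (ph w).+1, ep (ew w) = (ep w).-1 & fw (ew w) = w].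
Proof.
elim: w => //= -[] s IH /= h.
  have [] := IH h => e1 e2 e3; rewrite e1 e2 e3; split=> //.
have [e|ne] := eqVneq (ph s) 0%N; first by rewrite /= e /= addn1.
move: h; rewrite (negbTE ne) addn0 => h; have [] := IH h => e1 e2 e3.
by rewrite /= e1 e2 e3 /= addn0; split=> //; lia.
Qed.

Lemma wtsE w : wts w = (ph w)%:Z - (ep w)%:Z.
Proof.
rewrite /wts; elim: w => //= -[] s IH /=; first by lia.
by case: eqP; lia.
Qed.

Lemma ph_cat w1 w2 : ph (w1 ++ w2) = (ph w1 + (ph w2 - ep w1))%N.
Proof.
elim: w1 => /= [|[] s ->]; rewrite ?subn0 //.
by case: eqP; lia.
Qed.
Lemma ep_cat w1 w2 : ep (w1 ++ w2) = (ep w2 + (ep w1 - ph w2))%N.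
Proof.
elim: w1 => /= [|[] s IH]; rewrite ?sub0n ?addn0 // IH ph_cat.
by case: eqP; case: eqP; lia.
Qed.
Lemma fw_cat w1 w2 : (0 < ph (w1 ++ w2))%N ->
  fw (w1 ++ w2) = if (ph w2 <= ep w1)%N then fw w1 ++ w2 else w1 ++ fw w2.
Proof.
elim: w1 => [|a s IH] /=; first by rewrite leqn0; case: eqP => // ->.
case: a => /= h.
  rewrite ph_cat; have [e|ne] := eqVneq (ph s + (ph w2 - ep s))%N 0%N.
    rewrite (_ : (ph w2 <= ep s)%N); last by lia.
    by rewrite (_ : ph s == 0%N) //; lia.
  rewrite IH; last by rewrite ph_cat; lia.
  case: ifP => // le; rewrite (_ : ph s == 0%N = false) //; lia.
rewrite IH; last by lia.
move: h; rewrite ph_cat => h; case: ifP => le; case: ifP => le' //.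
  by move: le'; case: eqP; lia.
by move: le'; case: eqP; lia.
Qed.
Lemma ew_cat w1 w2 : (0 < ep (w1 ++ w2))%N ->
  ew (w1 ++ w2) = if (ph w2 < ep w1)%N then ew w1 ++ w2 else w1 ++ ew w2.
Proof.
elim: w1 => [|a s IH] //=; case: a => /= h; first by rewrite IH //; case: ifP.
move: h; rewrite ep_cat ph_cat => h.
have [e|ne] := eqVneq (ph s + (ph w2 - ep s))%N 0%N.
  rewrite (_ : ph s == 0%N); last by lia.
  by rewrite (_ : (ph w2 < ep s + true)%N) //=; lia.
rewrite IH; last by rewrite ep_cat; lia.
case: ifP => le.
  have h1 : (ph s == 0%N) = false by apply/negbTE/eqP => e; move: ne; rewrite e; lia.
  by rewrite h1 addn0 le.
rewrite (_ : (ph w2 < _)%N = false) //; apply/negbTE.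
have [e|ne'] := eqVneq (ph s) 0%N; last by rewrite addn0 le.
move: ne; rewrite e add0n => ne; rewrite -leqNgt addn1; lia.
Qed.
Lemma wts_cons a w : wts (a :: w) = (if a then 1 else -1) + wts w.
Proof. by rewrite /wts; case: a => /=; lia. Qed.
Lemma wts_cat w1 w2 : wts (w1 ++ w2) = wts w1 + wts w2.
Proof. by rewrite /wts !count_cat; lia. Qed.

End Words.

Section WordModule.
Variable Q : qfield.
Local Notation q := (qv Q).
Local Notation W := (freeM Q (seq bool)).
Local Notation bas := (fbas W).
Implicit Types (w s : seq bool) (x y : W).

Definition cns (a : bool) : W -> W := flin (fun w => bas (a :: w)).
HB.instance Definition _ a := GRing.Linear.copy (cns a) (flin (fun w => bas (a :: w)) : W -> W).
Lemma cnsP a : linear (cns a). Proof. by move=> c x y; exact: flinP. Qed.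
Lemma cnsZ a c x : cns a (c *: x) = c *: cns a x. Proof. by rewrite linearZ. Qed.
Lemma cnsb a w : cns a (bas w) = bas (a :: w). Proof. exact: flinb. Qed.

(** The tensor power with coproducts f -> f (x) t + 1 (x) f and e -> e (x) 1 + t^(-1) (x) e,
    matching at q = 0 the tensor rule above. *)
Fixpoint Fb w : W :=
  if w is a :: s then cns a (Fb s) + (if a then q ^ wts s *: bas (false :: s) else 0) else 0.
Fixpoint Eb w : W :=
  if w is a :: s then
    (if a then q^-1 else q) *: cns a (Eb s) + (if a then 0 else bas (true :: s)) else 0.
Definition opFw : W -> W := flin Fb.
Definition opEw : W -> W := flin Eb.
Definition opTw : W -> W := flin (fun w => q ^ wts w *: bas w).
HB.instance Definition _ := GRing.Linear.copy opFw (flin Fb : W -> W).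
HB.instance Definition _ := GRing.Linear.copy opEw (flin Eb : W -> W).
HB.instance Definition _ := GRing.Linear.copy opTw (flin (fun w => q ^ wts w *: bas w) : W -> W).

Lemma opFwZ c x : opFw (c *: x) = c *: opFw x. Proof. by rewrite linearZ. Qed.
Lemma opEwZ c x : opEw (c *: x) = c *: opEw x. Proof. by rewrite linearZ. Qed.
Lemma opTwZ c x : opTw (c *: x) = c *: opTw x. Proof. by rewrite linearZ. Qed.
Lemma opFw_cns a x : opFw (cns a x) = cns a (opFw x) + (if a then cns false (opTw x) else 0).
Proof.
move: x; apply: fmod_ext => [c x y|c x y|w]; rewrite ?linearP //=.
  by case: a; rewrite ?addr0 // scalerDr addrACA.
by rewrite cnsb /opFw !flinb /=; case: a => //; rewrite /opTw flinb linearZ /= cnsb.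
Qed.
Lemma opEw_cns a x : opEw (cns a x) = (if a then q^-1 else q) *: cns a (opEw x) + (if a then 0 else cns true x).
Proof.
move: x; apply: fmod_ext => [c x y|c x y|w]; rewrite ?linearP //=.
  by case: a; rewrite ?scaler0 ?addr0 !scalerA (mulrC c) // addrACA.
by rewrite cnsb /opEw !flinb /=; case: a => //; rewrite cnsb.
Qed.
Lemma opTw_cns a x : opTw (cns a x) = (if a then q else q^-1) *: cns a (opTw x).
Proof.
move: x; apply: fmod_ext => [c x y|c x y|w]; rewrite ?linearP //=.
rewrite cnsb /opTw !flinb linearZ /= cnsb scalerA; congr (_ *: _).
by rewrite wts_cons expfzDr ?qv_neq0 //; case: a; rewrite ?expr1z ?exprN1.
Qed.

(** Weight vectors adapted to V (x) V(m) = V(m+1) + V(m-1). The [true] case and the [false] case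
    with [ph s = 0] give divided powers of the top vector of V(m+1); the remaining case gives those
    of V(m-1), scaled to be congruent to the word modulo q. *)
Fixpoint Xn (n : nat) (w : seq bool) : W :=
  match n, w with
  | n'.+1, a :: s =>
    if a then cns true (Xn n' s) + (if (0 < ep s)%N then q ^+ (ph s).+1 *: cns false (Xn n' (ew s)) else 0)
    else if ph s == 0%N then cns false (Xn n' s)
    else qb Q (ph s) *: cns false (Xn n' s) - (q ^+ ph s * qb Q (ep s).+1) *: cns true (Xn n' (fw s))
  | _, _ => bas [::]
  end.

Lemma Tw_Xn n w : size w = n -> opTw (Xn n w) = q ^ wts w *: Xn n w.
Proof.
elim: n w => [|n IH] [|a s] //=; first by rewrite /opTw flinb.
move=> [hs]; have q0 := qv_neq0 Q; have wt1 := wts_cons a s.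
case: a wt1 => wt1.
  have -> : q ^ wts (true :: s) = q * q ^ wts s by rewrite wt1 expfzDr // expr1z.
  rewrite linearD /= opTw_cns IH // linearZ /= scalerA scalerDr; congr (_ + _).
  case: ifP => [hp|_]; last by rewrite linear0 scaler0.
  have [e1 e2 _] := ewP hp; rewrite linearZ /= opTw_cns IH ?size_ew // cnsZ !scalerA; congr (_ *: _).
  have -> : q ^ wts (ew s) = q ^+ 2 * q ^ wts s.
    by rewrite exprnP -expfzDr // !wtsE e1 e2; congr (_ ^ _); lia.
  by move: (q ^+ (ph s).+1) (q ^ wts s) => y z; field.
case: eqP => [h0|/eqP h0].
  have -> : q ^ wts (false :: s) = q^-1 * q ^ wts s by rewrite wt1 expfzDr // exprN1.
  by rewrite opTw_cns IH // cnsZ scalerA.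
have hp : (0 < ph s)%N by lia.
have [e1 e2 _] := fwP hp.
have ef : q ^ wts (fw s) = q^-1 * q^-1 * q ^ wts s.
  by rewrite -exprN1 -!expfzDr // !wtsE e1 e2; congr (_ ^ _); lia.
have -> : q ^ wts (false :: s) = q^-1 * q ^ wts s by rewrite wt1 expfzDr // exprN1.
rewrite linearB /= !opTwZ !opTw_cns !IH ?size_fw // !cnsZ ef.
by apply: fext => t; rewrite !fcfE; field.
Qed.

Lemma qi_rec k : qi Q k.+1 = q * qi Q k + q ^- k /\ qi Q k.+1 = q^-1 * qi Q k + q ^+ k.
Proof.
have h0 := qv_neq0 Q; have h1 := qq1 Q; rewrite /qi !exprS.
have hk : q ^+ k != 0 by rewrite expf_neq0.
move: (q ^+ k) hk h1 => z hz; rewrite (_ : q - q^-1 = (q ^+ 2 - 1) / q); last by rewrite mulrBl expr2 mulfK // mul1r.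
by rewrite mulf_eq0 invr_eq0 (negbTE h0) orbF => h1; split; field; rewrite h0 hz h1.
Qed.

(** On these vectors f acts exactly as on divided powers along a string, with the combinatorial [ep]
    as position; hence strings of vectors and of words coincide. *)
Lemma Fw_Xn n w : size w = n ->
  opFw (Xn n w) = if (0 < ph w)%N then qi Q (ep w).+1 *: Xn n (fw w) else 0.
Proof.
elim: n w => [|n IH] [|a s] //=; first by rewrite /opFw flinb.
move=> [hs]; have q0 := qv_neq0 Q; have hT := Tw_Xn hs.
case: a.
  rewrite linearD /= opFw_cns IH // hT linearZ /=.
  have e1 : opFw (if (0 < ep s)%N then q ^+ (ph s).+1 *: cns false (Xn n (ew s)) else 0)
      = (q ^+ (ph s).+1 * qi Q (ep s)) *: cns false (Xn n s).
    case: (posnP (ep s)) => [->|hp]; first by rewrite linear0 qi0 mulr0 scale0r.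
    have [a1 a2 a3] := ewP hp; rewrite linearZ /= opFw_cns addr0 IH ?size_ew // a1 /= a2 prednK // a3.
    by rewrite linearZ /= scalerA.
  rewrite e1 -addrA -scalerDl.
  have -> : q ^ wts s + q ^+ (ph s).+1 * qi Q (ep s) = q ^+ ph s * qi Q (ep s).+1.
    rewrite wtsE expfzDr // -exprnP -exprnN (qi_rec _).1 exprS; ring.
  case: (posnP (ph s)) => [h0|hp].
    by rewrite linear0 add0r h0 expr0 mul1r eqxx.
  have [a1 a2 a3] := fwP hp.
  by rewrite cnsZ a1 a2 /= a3 prednK // scalerDr scalerA mulrC.
case: eqP => [h0|/eqP h0].
  by rewrite opFw_cns addr0 IH // h0 /= linear0.
have hp : (0 < ph s)%N by lia.
have [a1 a2 a3] := fwP hp.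
rewrite linearB /= !opFwZ !opFw_cns addr0 !IH ?size_fw // hp Tw_Xn ?size_fw // !cnsZ a1 a2 addn0.
rewrite (wtsE (fw s)) a1 a2 expfzDr // -exprnP -exprnN !qiE.
have ze := expf_neq0 (ep s) q0; case: (ph s) hp => // p _ /=; rewrite qbS -exprM mul2n -addnn exprD.
case: p => [|p] /=; apply: fext => t; rewrite !fcfE ?linear0 ?fcfE ?qb0 ?cnsZ ?fcfE !exprS.
  by move: (q ^+ ep s) ze => z z0; field; rewrite q0 z0.
by move: (q ^+ ep s) ze (q ^+ p) => z z0 y; field; rewrite q0 z0.
Qed.

Lemma Ew_Xn n w : size w = n ->
  opEw (Xn n w) = if (0 < ep w)%N then qi Q (ph w).+1 *: Xn n (ew w) else 0.
Proof.
elim: n w => [|n IH] [|a s] //=; first by rewrite /opEw flinb.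
move=> [hs]; have q0 := qv_neq0 Q.
case: a.
  rewrite linearD /= opEw_cns addr0 IH //.
  case: (posnP (ep s)) => [h0|hp]; first by rewrite /= !linear0 ?scaler0 addr0.
  have [a1 a2 a3] := ewP hp.
  rewrite cnsZ opEwZ opEw_cns IH ?size_ew // a1 a2 (qi_rec (ph s).+1).2.
  case: (posnP (ep s).-1) => [h1|h1]; rewrite ?linear0 ?cnsZ.
    by apply: fext => t; rewrite !fcfE; ring.
  by apply: fext => t; rewrite !fcfE (exprS _ (ph s).+1); field.
case: eqP => [h0|/eqP h0].
  rewrite opEw_cns IH // h0 addn1 /=; case: (posnP (ep s)) => [e0|hp].
    by rewrite linear0 scaler0 add0r /qi expr1 mulfV ?qq1 // scale1r addr0.
  have [a1 a2 a3] := ewP hp; rewrite linearZ /= scalerA.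
  have -> : qi Q 1 = 1 by rewrite /qi expr1 mulfV ?qq1.
  by rewrite mulr1 scale1r expr1 addrC.
have hp : (0 < ph s)%N by lia.
have [a1 a2 a3] := fwP hp.
rewrite linearB /= !opEwZ !opEw_cns !IH ?size_fw // a1 a2 a3 /= addr0 prednK // addn0.
have -> : qb Q (ep s).+1 = 1 + q ^+ 2 * qb Q (ep s) by rewrite -add1n qbD qb1 expr1.
case: (posnP (ep s)) => [e0|he].
  rewrite e0 qb0 !cnsZ linear0; case: (ph s) hp => // p _; rewrite qiE !exprS.
  apply: fext => t; rewrite !fcfE; have := expf_neq0 p q0; move: (q ^+ p) => z z0.
  by field; rewrite q0 z0.
have [b1 b2 b3] := ewP he; rewrite b1 b2 b3 !cnsZ prednK //=.
case: (ph s) hp => // p _; rewrite !qiE !exprS.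
apply: fext => t; rewrite !fcfE; have := expf_neq0 p q0; move: (q ^+ p) => z z0.
by field; rewrite q0 z0.
Qed.

Definition sized n x := forall v, fcf x v != 0 -> size v = n.

Lemma sizedD n x y c : sized n x -> sized n y -> sized n (c *: x + y).
Proof.
move=> hx hy v; rewrite fcfD fcfZ; have [->|nz _] := eqVneq (fcf x v) 0; last exact: hx.
by rewrite mulr0 add0r; exact: hy.
Qed.
Lemma sized0 n : sized n 0. Proof. by move=> v; rewrite fcf0 eqxx. Qed.
Lemma sizedZ n x c : sized n x -> sized n (c *: x).
Proof. by move=> hx; rewrite -[_ *: _]addr0; apply: sizedD => //; exact: sized0. Qed.
Lemma sizedA n x y : sized n x -> sized n y -> sized n (x + y).
Proof. by move=> hx hy; rewrite -[x]scale1r; exact: sizedD. Qed.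
Lemma sizedb w : sized (size w) (bas w).
Proof. by move=> v; rewrite fcfb; have [<-|] := eqVneq w v; rewrite ?eqxx. Qed.
Lemma fcf_cns a x v : fcf (cns a x) v = if v is b :: u then (a == b)%:R * fcf x u else 0.
Proof.
move: x; apply: (@fmod_ext Q _ (GRing.regular Q)) => [c x y|c x y|w].
- by rewrite linearP fcfD fcfZ.
- case: v => [|b u]; first by rewrite scaler0 addr0.
  by rewrite fcfD fcfZ mulrDr mulrCA.
rewrite cnsb fcfb; case: v => [|b u] //; rewrite fcfb -natrM mulnb; congr (_%:R).
Qed.
Lemma sized_cns n a x : sized n x -> sized n.+1 (cns a x).
Proof.
move=> hx [|b u]; rewrite fcf_cns ?eqxx //= mulf_eq0 negb_or => /andP[_ /hx ->] //.
Qed.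

Lemma sized_Xn n w : size w = n -> sized n (Xn n w).
Proof.
elim: n w => [|n IH] [|a s] //=; first by move=> _; exact: (@sizedb [::]).
move=> [hs]; case: a.
  apply: sizedA; first by apply/sized_cns/IH.
  by case: ifP => _; [apply/sizedZ/sized_cns/IH; rewrite size_ew|exact: sized0].
case: ifP => _; first by apply/sized_cns/IH.
apply: sizedA; first by apply/sizedZ/sized_cns/IH.
by rewrite -scaleNr; apply/sizedZ/sized_cns/IH; rewrite size_fw.
Qed.

Definition wreg x := forall v, qreg (fcf x v).
Definition wqmul x := forall v, qmul (fcf x v).

Lemma Xn_modq n w : size w = n -> wqmul (Xn n w - bas w).
Proof.
elim: n w => [|n IH] [|a s] //=; first by rewrite subrr => _ v; rewrite fcf0; exact: qmul0.
move=> [hs] v.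
have IHr w' : size w' = n -> wreg (Xn n w').
  move=> hw u; rewrite -[Xn n w'](subrK (bas w')) fcfD fcfb.
  by apply: qregD; [apply/qmul_reg/IH|exact: qreg_nat].
have cr b x : wreg x -> wreg (cns b x).
  move=> hx [|c u]; rewrite fcf_cns; first exact: qreg0.
  by apply: qregM => //; exact: qreg_nat.
have cq b w' : size w' = n -> qmul (fcf (cns b (Xn n w') - bas (b :: w')) v).
  move=> hw; rewrite -cnsb -linearB fcf_cns; case: v => [|c u]; first exact: qmul0.
  by apply: qmulMl; [exact: qreg_nat|exact: IH].
case: a.
  rewrite addrAC fcfD; apply: qmulD; first exact: cq.
  case: ifP => _; last by rewrite fcf0; exact: qmul0.
  by rewrite fcfZ; apply: qmulMr; [exact: qmulX|apply/cr/IHr; rewrite size_ew].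
case: eqP => [_|/eqP h0]; first exact: cq.
have hp : (0 < ph s)%N by lia.
have -> : qb Q (ph s) *: cns false (Xn n s) = (qb Q (ph s) - 1) *: cns false (Xn n s) + cns false (Xn n s).
  by rewrite scalerBl scale1r subrK.
rewrite addrAC -!addrA fcfD; apply: qmulD.
  by rewrite fcfZ; apply: qmulMr; [rewrite -(prednK hp); exact: qmul_qb|apply/cr/IHr].
rewrite addrA fcfB; apply: qmulB; first exact: cq.
rewrite fcfZ; apply: qmulMr; last by apply/cr/IHr; rewrite size_fw.
by apply: qmulMr; [rewrite -(prednK hp); exact: qmulX|exact: qreg_qb].
Qed.

Definition Xw w := Xn (size w) w.

(** The inverse of the two-by-two blocks occurring in [Xn]. Their determinant [qb] of ph + ep + 1 is
    a unit at q = 0, so the inverse has regular coefficients. *)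
Definition thg (a : bool) s : W :=
  if a then
    if ep s == 0%N then bas (true :: s)
    else (qb Q (ph s + ep s).+1)^-1 *:
      (qb Q (ph s).+1 *: bas (true :: s) - q ^+ (ph s).+1 *: bas (false :: ew s))
  else
    if ph s == 0%N then bas (false :: s)
    else (qb Q (ph s + ep s).+1)^-1 *:
      (bas (false :: s) + (q ^+ ph s * qb Q (ep s).+1) *: bas (true :: fw s)).
Fixpoint th w : W := if w is a :: s then flin (thg a) (th s) else bas [::].

Lemma Xi_thg a s : flin Xw (thg a s) = cns a (Xw s).
Proof.
rewrite /thg; case: a.
  case: eqP => [e0|/eqP e0].
    by rewrite flinb /Xw /= e0 addr0.
  have hp : (0 < ep s)%N by lia.
  have [b1 b2 b3] := ewP hp.
  rewrite linearZ linearB !linearZ /= !flinb /Xw /= size_ew b1 b2 b3 hp /= prednK //.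
  apply: fext => t; rewrite !fcfE; apply: (canLR (mulKf (qb_neq0 _ _))) => //.
  by rewrite -addSn qbD -exprM mul2n -addnn exprD; ring.
case: eqP => [p0|/eqP p0].
  by rewrite flinb /Xw /= p0.
have hp : (0 < ph s)%N by lia.
have [b1 b2 b3] := fwP hp.
rewrite linearZ linearD !linearZ /= !flinb /Xw /= size_fw b1 b2 b3 (negbTE p0) /= prednK //.
apply: fext => t; rewrite !fcfE; apply: (canLR (mulKf (qb_neq0 _ _))) => //.
by rewrite -addnS qbD -exprM mul2n -addnn exprD; ring.
Qed.

Lemma Xi_th w : flin Xw (th w) = bas w.
Proof.
elim: w => [|a s IH] /=; first by rewrite flinb.
rewrite -cnsb -IH; move: (th s); apply: fmod_ext => [c x y|c x y|u]; rewrite ?linearP //.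
by rewrite !flinb Xi_thg.
Qed.

Lemma thg_reg a s : wreg (thg a s).
Proof.
have br w : wreg (bas w) by move=> v; rewrite fcfb; exact: qreg_nat.
move=> v; rewrite /thg; case: a; case: eqP => _; try exact: br.
  rewrite fcfZ fcfB !fcfZ; apply: qregM; first exact: qreg_qbV.
  by apply: qregB; apply: qregM; [exact: qreg_qb|exact: br|exact: qregX|exact: br].
rewrite fcfZ fcfD fcfZ; apply: qregM; first exact: qreg_qbV.
by apply: qregD; [exact: br|apply: qregM; [apply: qregM; [exact: qregX|exact: qreg_qb]|exact: br]].
Qed.

Lemma th_reg w : wreg (th w).
Proof.
elim: w => [|a s IH] v /=; first by rewrite fcfb; exact: qreg_nat.
by rewrite fcf_lin; apply: qreg_sum => u _; apply: qregM; [exact: IH|exact: thg_reg].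
Qed.

Lemma sized_th w : sized (size w) (th w).
Proof.
elim: w => [|a s IH] /=; first exact: (@sizedb [::]).
move=> v; rewrite fcf_lin => h.
have [/hasP [u su hu]|/hasPn h0] := boolP (has (fun u => fcf (thg a u) v != 0) (fsupp (th s))).
  have us : size u = size s by apply: IH; rewrite -fsuppP.
  rewrite -us; move: v hu {h}.
  suff : sized (size u).+1 (thg a u) by [].
  rewrite /thg; case: a; case: eqP => _; try exact: (@sizedb (_ :: _)).
    apply: sizedZ; apply: sizedA; first by apply: sizedZ; exact: (@sizedb (_ :: _)).
    by rewrite -scaleNr; apply: sizedZ; rewrite -(size_ew u); exact: (@sizedb (_ :: _)).
  apply: sizedZ; apply: sizedA; first exact: (@sizedb (_ :: _)).
  by apply: sizedZ; rewrite -(size_fw u); exact: (@sizedb (_ :: _)).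
case/eqP: h; rewrite big1_seq // => u /andP[_ /h0]; rewrite negbK => /eqP ->.
by rewrite mulr0.
Qed.

End WordModule.

(** * Graded modules without Serre relations *)

Opaque alpha.

Section WeightArithmetic.
Variables (V : zmodType) (la a : V) (k : nat).
Lemma wtS1 : la + a *+ k - a *+ k.+1 = la - a. Proof. by rewrite mulrSr opprD addrA addrK. Qed.
Lemma wtS2 : la + a *+ k.+1 - a *+ k = la + a. Proof. by rewrite mulrS addrA addrK. Qed.
Lemma wtS3 : la - a *+ k - a = la - a *+ k.+1. Proof. by rewrite mulrSr opprD addrA. Qed.
Lemma wtS4 : la + a *+ k + a = la + a *+ k.+1. Proof. by rewrite mulrSr addrA. Qed.
Lemma wtS5 : la - a + a *+ k.+1 = la + a *+ k. Proof. by rewrite mulrS addrA subrK. Qed.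
Lemma wtS6 : la + a + a *+ k = la + a *+ k.+1. Proof. by rewrite mulrS addrA. Qed.
End WeightArithmetic.

Section CorootPairing.
Variable n : nat.
Implicit Types (la mu : weight n) (i j : node n).

Lemma pairing_coroot i la : pairing (coroot i) la = la.1 i.
Proof.
rewrite /pairing /= mul0r addr0 (bigD1 i) //= ffunE eqxx mul1r big1 ?addr0 // => j ji.
by rewrite ffunE (negbTE ji) mul0r.
Qed.

Lemma wt1D la mu i : (la + mu).1 i = la.1 i + mu.1 i. Proof. by rewrite /= ffunE. Qed.
Lemma wt1N la i : (- la).1 i = - la.1 i. Proof. by rewrite /= ffunE. Qed.
Lemma wt1Mn la k i : (la *+ k).1 i = la.1 i *+ k.
Proof. by elim: k => [|k IH]; [rewrite /= ffunE|rewrite !mulrSr wt1D IH]. Qed.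

Lemma wt1Mz la (k : int) i : (la *~ k).1 i = la.1 i * k.
Proof.
rewrite -[RHS]mulrzz; case: k => k; first by rewrite -!pmulrn wt1Mn.
by rewrite NegzE !mulrNz wt1N -!pmulrn wt1Mn.
Qed.
Lemma alpha_2 i : (alpha i).2 = 2. Proof. by rewrite alphaE. Qed.
Lemma wt2B la i : (la - alpha i).2 = la.2 - 2. Proof. by rewrite -(alpha_2 i). Qed.
Lemma wt2D la i : (la + alpha i).2 = la.2 + 2. Proof. by rewrite -(alpha_2 i). Qed.

Lemma node1_neq0 : (1 : node n) != 0. Proof. exact: oner_neq0. Qed.

Lemma alpha_diag i : (alpha i).1 i = 2.
Proof.
rewrite alphaE /= !ffunE eqxx.
have h1 : (i == i - 1) = false by rewrite -subr_eq0 opprB addrCA subrr addr0 (negbTE node1_neq0).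
have h2 : (i == i + 1) = false by rewrite -subr_eq0 opprD addNKr oppr_eq0 (negbTE node1_neq0).
by rewrite h1 h2 /= addr0.
Qed.

Lemma alpha_off i j : i != j -> (alpha j).1 i <= 0.
Proof.
move=> ij; rewrite alphaE /= !ffunE (negbTE ij) /=.
by case: (i == _); case: (i == _).
Qed.

Lemma alpha_sym i j : (alpha j).1 i = (alpha i).1 j.
Proof.
have e1 : (i == j - 1) = (j == i + 1) by rewrite eq_sym subr_eq.
have e2 : (i == j + 1) = (j == i - 1) by rewrite [RHS]eq_sym subr_eq.
by rewrite !alphaE /= !ffunE (eq_sym i j) e1 e2; case: (j == i); case: (j == _); case: (j == _).
Qed.

End CorootPairing.

Section SignedQIntegers.
Variable Q : qfield.
Local Notation q := (qv Q).

Definition zq (k : int) : Q := (q ^ k - q ^ (- k)) / (q - q^-1).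

Lemma zq_nat k : zq k%:Z = qi Q k.
Proof. by rewrite /zq /qi -exprnP -exprnN. Qed.

Lemma qi_comb a b : qi Q a.+1 * qi Q b - qi Q a * qi Q b.+1 = zq (b%:Z - a%:Z).
Proof.
have q0 := qv_neq0 Q; have h := qq1 Q.
rewrite /zq /qi opprB !expfzDr // -!exprnP -!exprnN !exprS.
have := expf_neq0 a q0; have := expf_neq0 b q0; move: (q ^+ a) (q ^+ b) => x y y0 x0.
have e2 : q - q^-1 = (q ^+ 2 - 1) / q by rewrite mulrBl expr2 mulfK // mul1r.
move: h; rewrite e2 mulf_eq0 invr_eq0 (negbTE q0) orbF => h.
by field; rewrite q0 x0 y0 h.
Qed.

Lemma expz_inj (a b : int) : q ^ a = q ^ b -> a = b.
Proof.
wlog le : a b / a <= b.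
  by move=> H; case/orP: (le_total a b) => le e; [apply: H|apply/esym/H].
move=> e; apply/eqP; rewrite eq_le le /= leNgt; apply/negP => lt.
have q0 := qv_neq0 Q.
have : q ^ (b - a) = 1 by rewrite expfzDr // -invr_expz -e mulfV // expfz_neq0.
case E : (b - a) => [[|k]|k]; [by lia| |by lia].
move=> e1; have := q2k_neq1 Q (isT : (0 < k.+1)%N); rewrite -exprM mulnC exprM.
by rewrite [q ^+ k.+1]e1 expr1n eqxx.
Qed.

Lemma zq_comb (m : int) k :
  zq (m - k%:Z) * qi Q k.+1 + zq (m - (2 * k.+1)%:Z) = qi Q k.+2 * zq (m - k.+1%:Z).
Proof.
have q0 := qv_neq0 Q; have h1 := qq1 Q.
have z0 : q ^ m != 0 by exact: expfz_neq0.
have E (a : nat) : q ^ (m - a%:Z) = q ^ m / q ^+ a by rewrite expfzDr // -invr_expz.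
rewrite /zq /qi -!invr_expz !E mul2n -addnn !exprD !exprS.
have := expf_neq0 k q0; move: (q ^ m) z0 (q ^+ k) => w w0 y y0.
have e2 : q - q^-1 = (q ^+ 2 - 1) / q by rewrite mulrBl expr2 mulfK // mul1r.
move: h1; rewrite e2 mulf_eq0 invr_eq0 (negbTE q0) orbF => h1.
by field; rewrite q0 w0 y0 h1.
Qed.

Definition qf (k : nat) : Q := \prod_(j < k) qi Q j.+1.
Lemma qfS k : qf k.+1 = qf k * qi Q k.+1.
Proof. by rewrite /qf big_ord_recr. Qed.
Lemma qf0 : qf 0 = 1. Proof. by rewrite /qf big_ord0. Qed.

End SignedQIntegers.

(** Only what decomposition into strings requires, so that the given module, the span of
    configurations and products of such modules are all instances. *)
Record premod (Q : qfield) (n : nat) := PreMod {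
  pm :> lmodType Q;
  pe : node n -> {linear pm -> pm};
  pf : node n -> {linear pm -> pm};
  pwv : weight n -> pm -> Prop;
  pwv_0 : forall la, pwv la 0;
  pwv_lin : forall la c x y, pwv la x -> pwv la y -> pwv la (c *: x + y);
  pwv_e : forall la i x, pwv la x -> pwv (la + alpha i) (pe i x);
  pwv_f : forall la i x, pwv la x -> pwv (la - alpha i) (pf i x);
  pwv_ef : forall la i j x, pwv la x ->
    pe i (pf j x) = pf j (pe i x) + (if i == j then zq Q (la.1 i) else 0) *: x;
  pwv_indep : forall s : seq (weight n * pm), uniq (map fst s) ->
    (forall p, List.In p s -> pwv p.1 p.2) -> \sum_(p <- s) p.2 = 0 ->
    forall p, List.In p s -> p.2 = 0 }.

Arguments pe {Q n p0} _.
Arguments pf {Q n p0} _.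
Arguments pwv {Q n p0} _ _.

Section StringTheory.
Variables (Q : qfield) (n : nat) (M : premod Q n) (i : node n).
Implicit Types (x y v : M) (la : weight n).
Local Notation e := (pe i : M -> M).
Local Notation f := (pf i : M -> M).

Definition dpow (g : M -> M) k x : M := (qf Q k)^-1 *: iter k g x.

Lemma peZ c x : pe i (c *: x) = c *: pe i x. Proof. by rewrite linearZ. Qed.
Lemma pfZ c x : pf i (c *: x) = c *: pf i x. Proof. by rewrite linearZ. Qed.
Lemma dpow0 x : dpow f 0 x = x. Proof. by rewrite /dpow qf0 invr1 scale1r. Qed.
Lemma dpowS k x : f (dpow f k x) = qi Q k.+1 *: dpow f k.+1 x.
Proof.
rewrite /dpow linearZ scalerA qfS invfM mulrA mulrAC; congr (_ *: _).
by rewrite mulfV ?mul1r ?qi_neq0.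
Qed.
Lemma iter_lin (g : {linear M -> M}) k c x y : iter k g (c *: x + y) = c *: iter k g x + iter k g y.
Proof. by elim: k => //= k ->; rewrite linearP. Qed.
Lemma dpow_lin k c x y : dpow f k (c *: x + y) = c *: dpow f k x + dpow f k y.
Proof. by rewrite /dpow iter_lin scalerDr !scalerA mulrC. Qed.
Lemma iter_lin0 (g : {linear M -> M}) k : iter k g 0 = 0.
Proof. by elim: k => //= k ->; rewrite linear0. Qed.
Lemma dpow_0 k : dpow f k 0 = 0. Proof. by rewrite /dpow iter_lin0 scaler0. Qed.

Lemma pwv_iter_f la k x : pwv la x -> pwv (la - alpha i *+ k) (iter k f x).
Proof.
move=> hx; elim: k => [|k IH]; first by rewrite subr0.
by rewrite iterS mulrSr opprD addrA; exact: pwv_f.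
Qed.
Lemma pwvZ la c x : pwv la x -> pwv la (c *: x).
Proof.
move=> hx; by rewrite -[c *: x]addr0; apply: pwv_lin => //; exact: pwv_0.
Qed.
Lemma weight_diag la k : (la + alpha i *+ k).1 i = la.1 i + (2 * k)%:Z.
Proof.
by rewrite wt1D wt1Mn alpha_diag; lia.
Qed.
Lemma weight_diagN la k : (la - alpha i *+ k).1 i = la.1 i - (2 * k)%:Z.
Proof.
have /(congr1 (fun z => z - (2 * k)%:Z)) := weight_diag (la - alpha i *+ k) k.
by rewrite subrK addrK.
Qed.

Lemma e_dpow la k x : pwv la x -> e x = 0 -> e (dpow f k.+1 x) = zq Q (la.1 i - k%:Z) *: dpow f k x.
Proof.
move=> hx ex; elim: k => [|k IH].
  by rewrite /dpow qfS qf0 mul1r linearZ /= (pwv_ef i i hx) ex linear0 add0r eqxx scalerA subr0 invr1 scale1r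
     /qi expr1 mulfV ?qq1 // invr1 mul1r.
have h : pwv (la - alpha i *+ k.+1) (dpow f k.+1 x) by apply/pwvZ/pwv_iter_f.
have := pwv_ef i i h; rewrite eqxx IH dpowS peZ pfZ dpowS scalerA -scalerDl.
move=> E; have nz := qi_neq0 Q (isT : (0 < k.+2)%N).
apply: (scalerI nz); rewrite E scalerA; congr (_ *: _); rewrite weight_diagN.
exact: zq_comb.
Qed.

Lemma e_iter_dpow la (m : nat) x : pwv la x -> e x = 0 -> la.1 i = m%:Z -> forall k, (k <= m)%N ->
  exists2 c, c != 0 & iter k e (dpow f k x) = c *: x.
Proof.
move=> hx ex lm; elim=> [|k IH] lek; first by exists 1; rewrite ?oner_neq0 // scale1r dpow0.
have [c c0 E] := IH (ltnW lek); exists (zq Q (la.1 i - k%:Z) * c).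
  by rewrite mulf_neq0 // lm subzn ?(ltnW lek) // zq_nat qi_neq0 // subn_gt0.
rewrite iterSr (e_dpow _ hx ex) -[RHS]scalerA -E.
by rewrite -[X in iter k e X]addr0 iter_lin iter_lin0 addr0.
Qed.

(** Formulated for a family W stable under e_i and f_i, so that the components stay in W. Induction
    on N: the hypothesis on weights makes e^N f^(N) a nonzero scalar on y = e^N v, and a multiple of
    f^(N) y is split off. *)
Lemma string_exists (W : weight n -> M -> Prop) :
  (forall la x, W la x -> pwv la x) ->
  (forall la c x y, W la x -> W la y -> W la (c *: x + y)) ->
  (forall la x, W la x -> W (la + alpha i) (e x)) ->
  (forall la x, W la x -> W (la - alpha i) (f x)) ->
  (forall la k x, W la x -> iter k e x <> 0 -> e (iter k e x) = 0 -> 0 <= k%:Z + la.1 i) ->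
  forall N la v, W la v -> iter N e v = 0 ->
  exists x : nat -> M,
    (forall k, (k < N)%N -> [/\ e (x k) = 0, W (la + alpha i *+ k) (x k)
       & (k%:Z + la.1 i < 0) -> x k = 0]) /\ v = \sum_(k < N) dpow f k (x k).
Proof.
move=> Wp Wl We Wf Wi; elim=> [|N IH] la v Wv ev; first by exists (fun=> 0); rewrite big_ord0.
have Wie k la' x : W la' x -> W (la' + alpha i *+ k) (iter k e x).
  move=> hx; elim: k => [|k IHk]; first by rewrite addr0.
  by rewrite iterS mulrSr addrA; exact: We.
have Wif k la' x : W la' x -> W (la' - alpha i *+ k) (iter k f x).
  move=> hx; elim: k => [|k IHk]; first by rewrite subr0.
  by rewrite iterS mulrSr opprD addrA; exact: Wf.
have WZ la' c x : W la' x -> W la' (c *: x).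
  move=> hx; have -> : c *: x = (c - 1) *: x + x by rewrite scalerBl scale1r subrK.
  exact: Wl.
pose y := iter N e v; have Wy := Wie N la v Wv; rewrite -/y in Wy.
have ey : e y = 0 by [].
case: (excluded_middle_informative (y = 0)) => [y0|yn0].
  have [x [hx vE]] := IH la v Wv y0.
  exists (fun k => if (k < N)%N then x k else 0); split=> [k lk|].
    case: ifP => [lt|]; first exact: hx.
    move=> nlt; have -> : k = N by lia.
    by rewrite linear0 -y0.
  rewrite big_ord_recr /= ltnn dpow_0 addr0 vE; apply: eq_bigr => k _.
  by rewrite ltn_ord.
have hN := Wi la N v Wv yn0 ey; have [m lm] : exists m : nat, (la + alpha i *+ N).1 i = m%:Z.
  by exists (absz (la.1 i + (2 * N)%:Z)); rewrite weight_diag; lia.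
have lemN : (N <= m)%N by move: lm; rewrite weight_diag; lia.
have [c c0 E] := e_iter_dpow (Wp _ _ Wy) ey lm lemN.
(* The scaling makes e^N f^(N) z equal to e^N v, so that e^N kills v'. *)
pose z := c^-1 *: y; pose v' := v - dpow f N z.
have Wz : W (la + alpha i *+ N) z by apply: WZ.
have ez : e z = 0 by rewrite linearZ /= ey scaler0.
have Wd : W la (dpow f N z) by apply: WZ; rewrite -[la](addrK (alpha i *+ N)); exact: Wif.
have Wv' : W la v' by rewrite /v' addrC -scaleN1r; exact: Wl.
have ev' : iter N e v' = 0.
  rewrite /v' -scaleN1r addrC iter_lin -/y -[z]addr0 dpow_lin dpow_0 addr0 -[c^-1 *: dpow _ _ _]addr0 iter_lin iter_lin0 addr0 E.
  by rewrite !scalerA mulN1r mulNr mulVf // scaleN1r addNr.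
have [x [hx vE]] := IH la v' Wv' ev'.
exists (fun k => if (k < N)%N then x k else z); split=> [k lk|].
  case: ifP => [lt|]; first exact: hx.
  move=> nlt; have -> : k = N by lia.
  by split=> //; lia.
rewrite big_ord_recr /= ltnn -[v](subrK (dpow f N z)) -/v' vE; congr (_ + _).
by apply: eq_bigr => k _; rewrite ltn_ord.
Qed.

End StringTheory.

Section Generated.
Variables (Q : qfield) (n : nat) (M : premod Q n) (La : weight n) (u : M).
Hypothesis uwt : pwv La u.
Hypothesis ue : forall i, pe i u = 0.

Inductive gen : weight n -> M -> Prop :=
| gen_u : gen La u
| gen_0 la : gen la 0
| gen_lin la c x y : gen la x -> gen la y -> gen la (c *: x + y)
| gen_f la i x : gen la x -> gen (la - alpha i) (pf i x).

Lemma genZ la c x : gen la x -> gen la (c *: x).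
Proof. by move=> hx; rewrite -[c *: x]addr0; apply: gen_lin => //; exact: gen_0. Qed.
Lemma genD la x y : gen la x -> gen la y -> gen la (x + y).
Proof. by move=> hx hy; rewrite -[x]scale1r; exact: gen_lin. Qed.

(** Each f_i lowers the delta-coordinate by 2, so only multiples of u can be found at the top
    level. *)
Lemma gen_top la x : gen la x ->
  x = 0 \/ la.2 <= La.2 /\ (la.2 = La.2 -> la = La /\ exists c, x = c *: u).
Proof.
elim=> {la x} [|la|la c x y _ [->|[h1 h2]] _ [->|[h1' h3]]|la i x _ [->|[h1 _]]].
- by right; split=> // _; split=> //; exists 1; rewrite scale1r.
- by left.
- by left; rewrite scaler0 addr0.
- by right; rewrite scaler0 add0r.
- right; rewrite addr0; split=> // /h2 [-> [a ->]]; split=> //.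
  by exists (c * a); rewrite scalerA.
- right; split=> // e; have [-> [a ->]] := h2 e; have [_ [b ->]] := h3 e; split=> //.
  by exists (c * a + b); rewrite scalerDl scalerA.
- by left; rewrite linear0.
by right; rewrite wt2B; split; lia.
Qed.

Lemma gen_wt la x : gen la x -> pwv la x.
Proof.
by elim=> // *; [exact: pwv_0|exact: pwv_lin|exact: pwv_f].
Qed.

Lemma gen_e la i x : gen la x -> gen (la + alpha i) (pe i x).
Proof.
elim=> {la x} [|la|la c x y _ IHx _ IHy|la j x hx IHx].
- by rewrite ue; exact: gen_0.
- by rewrite linear0; exact: gen_0.
- by rewrite linearP; exact: gen_lin.
rewrite (pwv_ef i j (gen_wt hx)); apply: genD; first by rewrite addrAC; exact: gen_f.
case: eqP => [->|_]; first by rewrite subrK; exact: genZ.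
by rewrite scale0r; exact: gen_0.
Qed.

End Generated.

Section ProductModule.
Variables (Q : qfield) (n : nat) (M1 M2 : premod Q n).
Local Notation P := (M1 * M2)%type.

Definition prod_map (g1 : {linear M1 -> M1}) (g2 : {linear M2 -> M2}) (x : P) : P := (g1 x.1, g2 x.2).
Lemma prod_map_linear g1 g2 : linear (prod_map g1 g2).
Proof. by move=> c x y; rewrite /prod_map /= !linearP. Qed.
HB.instance Definition _ g1 g2 := GRing.isLinear.Build Q P P _ (prod_map g1 g2) (prod_map_linear g1 g2).

Lemma sum_pair (I : Type) (s : seq I) (F : I -> P) :
  \sum_(p <- s) F p = (\sum_(p <- s) (F p).1, \sum_(p <- s) (F p).2).
Proof. by elim: s => [|p s IH]; rewrite ?big_nil // !big_cons IH. Qed.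

(** The submodule generated by a pair of highest weight vectors of equal weight is used as a
    relation between two modules, to be shown to be the graph of an isomorphism. *)
Definition prodmod : premod Q n.
Proof.
refine (@PreMod Q n (M1 * M2)%type (fun i => prod_map (pe i) (pe i)) (fun i => prod_map (pf i) (pf i))
  (fun la x => pwv la x.1 /\ pwv la x.2) _ _ _ _ _ _).
- by move=> la; split; exact: pwv_0.
- by move=> la c x y [h1 h2] [h3 h4]; split; exact: pwv_lin.
- by move=> la i x [h1 h2]; split; exact: pwv_e.
- by move=> la i x [h1 h2]; split; exact: pwv_f.
- move=> la i j x [h1 h2]; transitivity ((pe i (pf j x.1), pe i (pf j x.2)) : P) => //.
  by rewrite (pwv_ef i j h1) (pwv_ef i j h2); case: x h1 h2.
move=> s us hs; rewrite sum_pair => -[e1 e2] p ps.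
have h1 := @pwv_indep Q n M1 (map (fun p => (p.1, p.2.1)) s).
have h2 := @pwv_indep Q n M2 (map (fun p => (p.1, p.2.2)) s).
have hmap (T : Type) (g : weight n * P -> weight n * T) : (forall p, (g p).1 = p.1) ->
    map fst (map g s) = map fst s by move=> hg; rewrite -map_comp; apply: eq_map => z; exact: hg.
rewrite [p.2]surjective_pairing; congr (_, _).
  apply: (h1 _ _ _ (p.1, p.2.1)); first by rewrite hmap.
  - by move=> z /List.in_map_iff [z' [<- /hs []]].
  - by rewrite big_map.
  by apply/List.in_map_iff; exists p.
apply: (h2 _ _ _ (p.1, p.2.2)); first by rewrite hmap.
- by move=> z /List.in_map_iff [z' [<- /hs []]].
- by rewrite big_map.
by apply/List.in_map_iff; exists p.
Defined.

End ProductModule.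

(** * Exchange arguments for finite families *)

Section LinearAlgebra.
Variables (K : fieldType) (M : lmodType K).
Implicit Types (s t : seq M).

Definition indep t := forall a : nat -> K, \sum_(k < size t) a k *: t`_k = 0 -> forall k, (k < size t)%N -> a k = 0.
Definition inspan s (x : M) := exists a : nat -> K, x = \sum_(k < size s) a k *: s`_k.

Lemma inspan_mem s (x : M) : x \in s -> inspan s x.
Proof.
move=> xs; exists (fun k => (k == index x s)%:R).
have lt : (index x s < size s)%N by rewrite index_mem.
rewrite (bigD1 (Ordinal lt)) //= eqxx scale1r nth_index // big1 ?addr0 // => k ne.
by rewrite (_ : nat_of_ord k == _ = false) ?scale0r //; apply/negbTE.
Qed.

Lemma inspan_lin s c x y : inspan s x -> inspan s y -> inspan s (c *: x + y).
Proof.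
move=> [a ->] [b ->]; exists (fun k => c * a k + b k).
rewrite scaler_sumr -big_split /=; apply: eq_bigr => k _.
by rewrite scalerDl scalerA.
Qed.
Lemma inspan0 s : inspan s 0.
Proof. by exists (fun=> 0); rewrite big1 // => k _; rewrite scale0r. Qed.
Lemma inspan_sum s (I : Type) (r : seq I) (P : pred I) (F : I -> M) :
  (forall i, P i -> inspan s (F i)) -> inspan s (\sum_(i <- r | P i) F i).
Proof.
move=> h; elim/big_ind: _ => //; first exact: inspan0.
by move=> x y hx hy; rewrite -[x]scale1r; exact: inspan_lin.
Qed.
Lemma inspanZ s c x : inspan s x -> inspan s (c *: x).
Proof. by move=> h; rewrite -[c *: x]addr0; apply: inspan_lin => //; exact: inspan0. Qed.

(** With more vectors than spanning elements, the coefficient matrix has a nonzero row in its left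
    kernel, which is a linear relation. *)
Lemma indep_size_le s t : indep t -> (forall x, x \in t -> inspan s x) -> (size t <= size s)%N.
Proof.
move=> it ts; rewrite leqNgt; apply/negP => lt.
have [C hC] : exists C : 'I_(size t) -> nat -> K, forall k : 'I_(size t), t`_k = \sum_(j < size s) C k j *: s`_j.
  pose C (k : 'I_(size t)) := epsilon (inhabits (fun _ : nat => 0 : K))
    (fun a => t`_k = \sum_(j < size s) a j *: s`_j).
  exists C => k; rewrite /C; apply: (epsilon_spec (inhabits (fun _ : nat => 0 : K))
    (fun a => t`_k = \sum_(j < size s) a j *: s`_j)).
  by apply: ts; apply: mem_nth.
pose A := \matrix_(k < size t, j < size s) C k j.
have : kermx A != 0.
  by rewrite kermx_eq0 /row_free neq_ltn (leq_ltn_trans (rank_leq_col A) lt).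
case/rowV0Pn => v /sub_kermxP vA v0.
case/eqP: v0; apply/rowP => k; rewrite mxE.
pose a j := if insub j is Some k' then v 0 k' else 0 : K.
have aE (j : 'I_(size t)) : a j = v 0 j by rewrite /a valK.
rewrite -aE; apply: (it a) => //.
rewrite (eq_bigr (fun j : 'I_(size t) => \sum_(l < size s) (v 0 j * A j l) *: s`_l)); last first.
  by move=> j _; rewrite aE hC scaler_sumr; apply: eq_bigr => l _; rewrite scalerA mxE.
rewrite exchange_big /= big1 // => l _; rewrite -scaler_suml.
by have /rowP/(_ l) := vA; rewrite !mxE => ->; rewrite scale0r.
Qed.

Lemma dep_inspan t x : indep t -> ~ indep (x :: t) -> inspan t x.
Proof.
move=> it nit; apply: NNPP => nx; apply: nit => a /=; rewrite big_ord_recl /= => h.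
have a0 : a 0%N = 0.
  apply/eqP; apply/negPn/negP => nz; apply: nx.
  exists (fun k => - (a 0%N)^-1 * a k.+1); apply: (scalerI nz); rewrite scaler_sumr.
  move/eqP: h; rewrite addr_eq0 => /eqP ->; rewrite -sumrN; apply: eq_bigr => k _.
  by rewrite scalerA mulrA mulrN mulfV // mulN1r scaleNr.
move: h; rewrite a0 scale0r add0r => h [//|k] lt.
exact: (it (fun k => a k.+1)).
Qed.

Lemma indep_span s t x : indep t -> (forall y, y \in t -> inspan s y) -> (size s <= size t)%N ->
  inspan s x -> inspan t x.
Proof.
move=> it ts le sx; apply: dep_inspan => // ixt.
suff : (size (x :: t) <= size s)%N by rewrite /= ltnNge le.
by apply: indep_size_le => // y; rewrite inE => /orP[/eqP->//|]; exact: ts.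
Qed.

End LinearAlgebra.

(** * Crystals with signatures and their modules *)

(** A set in which every element carries, for each node i, a word of signs that can be replaced
    freely ([put]), the weight following along alpha_i. This is enough to define both the crystal
    operators and the linear ones. *)
Record cset (n : nat) := CSet {
  cT :> choiceType;
  sg : node n -> cT -> seq bool;
  put : node n -> cT -> seq bool -> cT;
  cwt : cT -> weight n;
  sg_put : forall i c s, size s = size (sg i c) -> sg i (put i c s) = s;
  put_sg : forall i c, put i c (sg i c) = c;
  put_put : forall i c s s', size s = size (sg i c) -> size s' = size (sg i c) ->
    put i (put i c s) s' = put i c s';
  cwt_put : forall i c s, size s = size (sg i c) ->
    cwt (put i c s) = cwt c + alpha i *~ ((count id s)%:Z - (count id (sg i c))%:Z);
  cwt_sg : forall i c, (cwt c).1 i = wts (sg i c) }.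

Lemma count_wts (s : seq bool) : (2 * count id s)%:Z = wts s + (size s)%:Z.
Proof. have : (count id s + count negb s = size s)%N by exact: count_predC.
by rewrite /wts; lia. Qed.

Section Crystal.
Variables (n : nat) (T : cset n).
Implicit Types (c : T) (i : node n).

Definition cph i c := ph (sg i c).
Definition cep i c := ep (sg i c).
Definition fo i c : T := put i c (fw (sg i c)).
Definition eo i c : T := put i c (ew (sg i c)).

Lemma foP i c : (0 < cph i c)%N ->
  [/\ cph i (fo i c) = (cph i c).-1, cep i (fo i c) = (cep i c).+1, eo i (fo i c) = c
    & cwt (fo i c) = cwt c - alpha i].
Proof.
move=> h; have [h1 h2 h3] := fwP h.
have hs : size (fw (sg i c)) = size (sg i c) by rewrite size_fw.
rewrite /cph /cep /eo /fo !sg_put // h3 put_put // ?put_sg ?h1 ?h2 //; split=> //.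
rewrite cwt_put //; congr (_ + _); rewrite -mulrN1z; congr (_ *~ _).
by have := count_wts (fw (sg i c)); have := count_wts (sg i c); rewrite size_fw !wtsE h1 h2; lia.
Qed.

Lemma eoP i c : (0 < cep i c)%N ->
  [/\ cph i (eo i c) = (cph i c).+1, cep i (eo i c) = (cep i c).-1, fo i (eo i c) = c
    & cwt (eo i c) = cwt c + alpha i].
Proof.
move=> h; have [h1 h2 h3] := ewP h.
have hs : size (ew (sg i c)) = size (sg i c) by rewrite size_ew.
rewrite /cph /cep /eo /fo !sg_put // h3 put_put // ?put_sg ?h1 ?h2 //; split=> //.
rewrite cwt_put //; congr (_ + _); rewrite -[RHS]mulr1z; congr (_ *~ _).
by have := count_wts (ew (sg i c)); have := count_wts (sg i c); rewrite size_ew !wtsE h1 h2; lia.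
Qed.

Lemma cwt_diag i c : (cwt c).1 i = (cph i c)%:Z - (cep i c)%:Z.
Proof. by rewrite cwt_sg wtsE. Qed.

Lemma iter_foP i c k : (k <= cph i c)%N ->
  [/\ cph i (iter k (fo i) c) = (cph i c - k)%N, cep i (iter k (fo i) c) = (cep i c + k)%N,
      iter k (eo i) (iter k (fo i) c) = c & cwt (iter k (fo i) c) = cwt c - alpha i *+ k].
Proof.
elim: k => [|k IH] lek; first by rewrite subn0 addn0 subr0.
have [h1 h2 h3 h4] := IH (ltnW lek).
have [a1 a2 a3 a4] : _ := @foP i (iter k (fo i) c) ltac:(by rewrite h1; lia).
rewrite (iterS k (fo i)) iterSr a1 a2 a3 a4 h1 h2 h3 h4 mulrSr; split=> //; try lia.
by rewrite -addrA -opprD.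
Qed.

Lemma iter_eoP i c k : (k <= cep i c)%N ->
  [/\ cph i (iter k (eo i) c) = (cph i c + k)%N, cep i (iter k (eo i) c) = (cep i c - k)%N,
      iter k (fo i) (iter k (eo i) c) = c & cwt (iter k (eo i) c) = cwt c + alpha i *+ k].
Proof.
elim: k => [|k IH] lek; first by rewrite subn0 addn0 addr0.
have [h1 h2 h3 h4] := IH (ltnW lek).
have [a1 a2 a3 a4] : _ := @eoP i (iter k (eo i) c) ltac:(by rewrite h2; lia).
rewrite (iterS k (eo i)) iterSr a1 a2 a3 a4 h1 h2 h3 h4 mulrSr; split=> //; try lia.
by rewrite -addrA.
Qed.

End Crystal.

(** * The linear span of a signature crystal *)

Section CrystalModule.
Variables (Q : qfield) (n : nat) (T : cset n).
Local Notation q := (qv Q).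
Local Notation W := (freeM Q (seq bool)).
Local Notation A := (freeM Q T).
Local Notation bas := (fbas A).
Implicit Types (x y : A) (c : T) (i j : node n) (la : weight n).

Lemma sized_ind (P : W -> Prop) m : P 0 -> (forall a (x y : W), P x -> P y -> P (a *: x + y)) ->
  (forall s, size s = m -> P (fbas W s)) -> forall x : W, sized m x -> P x.
Proof.
move=> P0 PD Pb x hx; rewrite [x]fsum.
have : all (fun s => size s == m) (fsupp x) by apply/allP => s; rewrite fsuppP => /hx ->.
elim: (fsupp x) => [|t r IH]; first by rewrite big_nil.
by rewrite big_cons /= => /andP[/eqP ht hr]; apply: PD; [exact: Pb|exact: IH].
Qed.

Lemma sized_Fb s : sized (size s) (Fb Q s).
Proof.
elim: s => [|a s IH] /=; first exact: sized0.
apply: sizedA; first exact: sized_cns.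
case: a; last exact: sized0.
by apply: sizedZ; exact: (@sizedb Q (false :: s)).
Qed.
Lemma sized_Eb s : sized (size s) (Eb Q s).
Proof.
elim: s => [|a s IH] /=; first exact: sized0.
apply: sizedA; first by apply: sizedZ; exact: sized_cns.
case: a; first exact: sized0.
exact: (@sizedb Q (true :: s)).
Qed.

(** The matrices of f and e are transposes up to q^(weight + 1): the source of the contravariant
    form on configurations. *)
Lemma fb_adj s t : fcf (Fb Q s) t = q ^ (wts t + 1) * fcf (Eb Q t) s.
Proof.
have q0 := qv_neq0 Q.
elim: s t => [|a s IH] [|b t] /=.
- by rewrite !fcf0 mulr0.
- rewrite fcf0 fcfD fcfZ fcf_cns mulr0 add0r; case: b; rewrite ?fcf0 ?fcfb ?mulr0 //.
- rewrite fcf0 mulr0 fcfD fcf_cns add0r; case: a; rewrite ?fcf0 ?fcfZ ?fcfb ?mulr0 //.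
rewrite !fcfD fcfZ !fcf_cns IH mulrDr wts_cons (eq_sym a b); congr (_ + _).
  case: (eqVneq b a) => [->|_]; last by rewrite !mul0r !mulr0.
  rewrite !mul1r mulrA; congr (_ * _); case: a => /=.
    by rewrite -[q^-1]exprN1 -expfzDr //; congr (_ ^ _); lia.
  by rewrite -[X in _ * X]expr1z -expfzDr //; congr (_ ^ _); lia.
case: a; case: b => /=; rewrite ?fcf0 ?mulr0 //.
- by rewrite fcfZ fcfb mulr0.
- rewrite fcfZ !fcfb !eqseq_cons /= (eq_sym t s); case: eqP => [->|_]; last by rewrite !mulr0.
  by rewrite !mulr1; congr (_ ^ _); lia.
by rewrite fcfb mulr0.
Qed.

Lemma wts_Xw w v : fcf (Xw Q w) v != 0 -> wts v = wts w.
Proof.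
move=> h; have := @Tw_Xn Q (size w) w erefl; rewrite -/(Xw Q w) => /(congr1 (fun z => fcf z v)).
rewrite fcfZ /opTw.
have -> : fcf (flin (fun w => q ^ wts w *: fbas W w) (Xw Q w)) v = q ^ wts v * fcf (Xw Q w) v.
  move: (Xw Q w); apply: (@fmod_ext Q _ (GRing.regular Q)) => [c x y|c x y|u].
  - by rewrite linearP fcfD fcfZ.
  - by rewrite fcfD fcfZ mulrDr mulrCA.
  by rewrite flinb fcfZ fcfb; case: eqP => [->|]; rewrite ?mulr0.
by move/(mulIf h)/expz_inj.
Qed.

Definition PutL i c : W -> A := flin (fun s => bas (put i c s)).
HB.instance Definition _ i c := GRing.Linear.copy (PutL i c) (flin (fun s => bas (put i c s)) : W -> A).
Lemma PutLb i c s : PutL i c (fbas W s) = bas (put i c s). Proof. exact: flinb. Qed.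
Lemma PutLP i c : linear (PutL i c). Proof. by move=> a x y; exact: flinP. Qed.
Lemma PutLZ i c a (x : W) : PutL i c (a *: x) = a *: PutL i c x. Proof. by rewrite linearZ. Qed.

Lemma PutL_put i c s (x : W) : size s = size (sg i c) -> sized (size (sg i c)) x ->
  PutL i (put i c s) x = PutL i c x.
Proof.
move=> hs; move: x; apply: sized_ind => [|a x y hx hy|t ht].
- by rewrite !linear0.
- by rewrite !PutLP hx hy.
by rewrite !PutLb put_put.
Qed.

Lemma fcf_Put i c (x : W) c' : sized (size (sg i c)) x ->
  fcf (PutL i c x) c' =
  if (size (sg i c') == size (sg i c)) && (put i c (sg i c') == c') then fcf x (sg i c') else 0.
Proof.
move: x; apply: sized_ind => [|a x y hx hy|s hs].
- by rewrite linear0 !fcf0; case: ifP.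
- by rewrite linearP !fcfD !fcfZ hx hy; case: ifP => // _; rewrite mulr0 addr0.
rewrite PutLb !fcfb; have [<-|ne] := eqVneq (put i c s) c'.
  by rewrite sg_put // hs !eqxx.
by case: ifP => // /andP[/eqP h1 /eqP h2]; case: eqP => // e; move: ne; rewrite e h2 eqxx.
Qed.

Definition opF i : A -> A := flin (fun c => PutL i c (Fb Q (sg i c))).
Definition opE i : A -> A := flin (fun c => PutL i c (Eb Q (sg i c))).
HB.instance Definition _ i := GRing.Linear.copy (opF i) (flin (fun c => PutL i c (Fb Q (sg i c))) : A -> A).
HB.instance Definition _ i := GRing.Linear.copy (opE i) (flin (fun c => PutL i c (Eb Q (sg i c))) : A -> A).

Lemma opFP i : linear (opF i). Proof. by move=> a x y; exact: flinP. Qed.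
Lemma opEP i : linear (opE i). Proof. by move=> a x y; exact: flinP. Qed.

Lemma opF_Put i c (x : W) : sized (size (sg i c)) x -> opF i (PutL i c x) = PutL i c (opFw x).
Proof.
move: x; apply: sized_ind => [|a x y hx hy|s hs].
- by rewrite !linear0.
- by rewrite PutLP opFP /opFw flinP PutLP hx hy.
rewrite PutLb /opF /opFw !flinb sg_put //; apply: PutL_put => //.
by rewrite -hs; exact: sized_Fb.
Qed.
Lemma opE_Put i c (x : W) : sized (size (sg i c)) x -> opE i (PutL i c x) = PutL i c (opEw x).
Proof.
move: x; apply: sized_ind => [|a x y hx hy|s hs].
- by rewrite !linear0.
- by rewrite PutLP opEP /opEw flinP PutLP hx hy.
rewrite PutLb /opE /opEw !flinb sg_put //; apply: PutL_put => //.
by rewrite -hs; exact: sized_Eb.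
Qed.

(** The change from configurations to the vectors adapted to i-strings, with [Th] as its inverse. It
    depends on i but is the identity modulo q for every i. *)
Definition Xi i : A -> A := flin (fun c => PutL i c (Xw Q (sg i c))).
Definition Th i : A -> A := flin (fun c => PutL i c (th Q (sg i c))).
HB.instance Definition _ i := GRing.Linear.copy (Xi i) (flin (fun c => PutL i c (Xw Q (sg i c))) : A -> A).
HB.instance Definition _ i := GRing.Linear.copy (Th i) (flin (fun c => PutL i c (th Q (sg i c))) : A -> A).
Lemma XiZ i a x : Xi i (a *: x) = a *: Xi i x. Proof. by rewrite linearZ. Qed.

Lemma XiP i : linear (Xi i). Proof. by move=> a x y; exact: flinP. Qed.
Lemma ThP i : linear (Th i). Proof. by move=> a x y; exact: flinP. Qed.
Lemma Xib i c : Xi i (bas c) = PutL i c (Xw Q (sg i c)). Proof. exact: flinb. Qed.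

Lemma Xi_Put i c (x : W) : sized (size (sg i c)) x -> Xi i (PutL i c x) = PutL i c (flin (Xw Q) x).
Proof.
move: x; apply: sized_ind => [|a x y hx hy|s hs].
- by rewrite !linear0.
- by rewrite PutLP XiP flinP PutLP hx hy.
rewrite PutLb Xib flinb sg_put //; apply: PutL_put => //.
by rewrite -hs; exact: sized_Xn.
Qed.

Lemma Th_Xi_can i : cancel (Th i) (Xi i).
Proof.
apply: fmod_ext => [a x y|//|c]; first by rewrite ThP XiP.
rewrite /Th flinb Xi_Put; last exact: sized_th.
by rewrite Xi_th PutLb put_sg.
Qed.

Definition creg x := forall c, qreg (fcf x c).
Definition cqm x := forall c, qmul (fcf x c).

Lemma cregb c : creg (bas c). Proof. by move=> c'; rewrite fcfb; exact: qreg_nat. Qed.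
Lemma cqm_reg x : cqm x -> creg x. Proof. by move=> h c; exact: qmul_reg. Qed.
Lemma cqmD x y : cqm x -> cqm y -> cqm (x + y).
Proof. by move=> hx hy c; rewrite fcfD; exact: qmulD. Qed.
Lemma cqmB x y : cqm x -> cqm y -> cqm (x - y).
Proof. by move=> hx hy c; rewrite fcfB; exact: qmulB. Qed.
Lemma cregD x y : creg x -> creg y -> creg (x + y).
Proof. by move=> hx hy c; rewrite fcfD; exact: qregD. Qed.
Lemma cregZ a x : qreg a -> creg x -> creg (a *: x).
Proof. by move=> ha hx c; rewrite fcfZ; exact: qregM. Qed.
Lemma creg0 : creg 0. Proof. by move=> c; rewrite fcf0; exact: qreg0. Qed.
Lemma cqm0 : cqm 0. Proof. by move=> c; rewrite fcf0; exact: qmul0. Qed.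
Lemma cqm_sym x y : cqm (x - y) -> cqm (y - x).
Proof. by move=> h; rewrite -opprB => c; rewrite fcfN /qmul mulNr; apply: qregN; exact: h. Qed.
Lemma cqm_trans x y z : cqm (x - y) -> cqm (y - z) -> cqm (x - z).
Proof. by move=> h1 h2; rewrite -[x](subrK y) -addrA; exact: cqmD. Qed.
Lemma creg_mod x y : cqm (x - y) -> creg y -> creg x.
Proof. by move=> h hy; rewrite -[x](subrK y); apply: cregD => //; exact: cqm_reg. Qed.
Lemma cqm_mod x y : cqm (x - y) -> cqm y -> cqm x.
Proof. by move=> h hy; rewrite -[x](subrK y); apply: cqmD. Qed.
Lemma creg_flin (F : T -> A) x : (forall c, creg (F c)) -> creg x -> creg (flin F x).
Proof. by move=> hF hx c; rewrite fcf_lin; apply: qreg_sum => t _; apply: qregM; [exact: hx|exact: hF]. Qed.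
Lemma cqm_flin (F : T -> A) x : (forall c, creg (F c)) -> cqm x -> cqm (flin F x).
Proof. by move=> hF hx c; rewrite fcf_lin; apply: qmul_sum => t _; apply: qmulMr; [exact: hx|exact: hF]. Qed.
Lemma cqm_flin_id (F : T -> A) x : (forall c, cqm (F c - bas c)) -> creg x -> cqm (flin F x - x).
Proof.
move=> hF hx c.
have -> : flin F x - x = flin (fun t => F t - bas t) x.
  move: x {hx}; apply: fmod_ext => [a x y|a x y|t]; rewrite ?linearP //= ?flinb //.
  by rewrite scalerBr scalerN addrACA.
by rewrite fcf_lin; apply: qmul_sum => t _; apply: qmulMl; [exact: hx|exact: hF].
Qed.

Lemma Xib_mod i c : cqm (Xi i (bas c) - bas c).
Proof.
have -> : Xi i (bas c) - bas c = PutL i c (Xw Q (sg i c) - fbas W (sg i c)).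
  by rewrite Xib (lin_B (PutLP i c)) PutLb put_sg.
move=> c'; rewrite fcf_Put; last first.
  apply: sizedA; first exact: sized_Xn.
  by rewrite -scaleN1r; apply: sizedZ; exact: sizedb.
by case: ifP => _; [exact: Xn_modq|exact: qmul0].
Qed.
Lemma Xi_mod i x : creg x -> cqm (Xi i x - x).
Proof. by move=> hx; apply: cqm_flin_id => // c; have := @Xib_mod i c; rewrite Xib. Qed.
Lemma Xi_reg i x : creg x -> creg (Xi i x).
Proof. by move=> hx; apply: (creg_mod (Xi_mod i hx)). Qed.
Lemma Th_reg i x : creg x -> creg (Th i x).
Proof.
apply: creg_flin => c c'; rewrite fcf_Put; last exact: sized_th.
by case: ifP => _; [exact: th_reg|exact: qreg0].
Qed.
Lemma Th_mod i x : creg x -> cqm (Th i x - x).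
Proof.
move=> hx; rewrite -{2}[x](Th_Xi_can i); apply: cqm_sym.
by apply: Xi_mod; exact: Th_reg.
Qed.

Lemma unit_nmul (a : Q) : qreg a^-1 -> a != 0 -> ~ qmul a.
Proof. by move=> ha a0 h; apply: (@qmul1 Q); rewrite -(mulVf a0); apply: qmulMl. Qed.

(** Takes m to be the least valuation of the nonzero entries; after division by q^m all are regular
    and one is not divisible by q. *)
Lemma seq_val (s : seq Q) : (exists2 a, a \in s & a != 0) ->
  exists m : int, (forall a, a \in s -> qreg (q ^ (- m) * a)) /\ exists2 a, a \in s & ~ qmul (q ^ (- m) * a).
Proof.
have q0 := qv_neq0 Q.
elim: s => [[]//|a s IH] hex.
have [/hasP [b bs b0]|/hasPn h0] := boolP (has (fun b => b != 0) s); last first.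
  have a0 : a != 0.
    by case: hex => b; rewrite inE => /orP[/eqP -> //|/h0]; rewrite negbK => /eqP -> /eqP.
  have [k [w [rw rw' w0 e]]] := qreg_val a0; exists k.
  have e' : q ^ (- k) * a = w by rewrite e mulrA -expfzDr // addNr mul1r.
  split=> [b|]; last by exists a; rewrite ?mem_head // e'; apply: unit_nmul.
  rewrite inE => /orP[/eqP ->|/h0]; first by rewrite e'.
  by rewrite negbK => /eqP ->; rewrite mulr0; exact: qreg0.
have [m [h1 [d ds h2]]] := IH (ex_intro2 _ _ b bs b0).
have [->|a0] := eqVneq a 0.
  exists m; split=> [e|]; last by exists d; rewrite // inE ds orbT.
  by rewrite inE => /orP[/eqP ->|/h1 //]; rewrite mulr0; exact: qreg0.
have [k [w [rw rw' w0 e]]] := qreg_val a0.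
have e' : q ^ (- k) * a = w by rewrite e mulrA -expfzDr // addNr mul1r.
have [le|lt] := leP m k.
  exists m; split=> [z|]; last by exists d; rewrite // inE ds orbT.
  rewrite inE => /orP[/eqP ->|/h1 //]; rewrite e mulrA -expfzDr //.
  have [p ->] : exists p : nat, - m + k = p%:Z by exists (absz (k - m)); lia.
  by apply: qregM => //; rewrite -exprnP; exact: qregX.
exists k; split=> [z|]; last by exists a; rewrite ?mem_head // e'; apply: unit_nmul.
rewrite inE => /orP[/eqP ->|/h1 hz]; first by rewrite e'.
have -> : q ^ (- k) * z = q ^ (m - k) * (q ^ (- m) * z).
  by rewrite mulrA -expfzDr //; congr (_ ^ _ * _); lia.
have [p ->] : exists p : nat, m - k = p%:Z by exists (absz (m - k)); lia.
by apply: qregM => //; rewrite -exprnP; exact: qregX.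
Qed.

Lemma primitive x : x <> 0 -> exists (m : int) y, [/\ x = q ^ m *: y, creg y & ~ cqm y].
Proof.
move=> x0; have [m [h1 [a as_ h2]]] : exists m : int,
    (forall a, a \in map (fcf x) (fsupp x) -> qreg (q ^ (- m) * a)) /\
    exists2 a, a \in map (fcf x) (fsupp x) & ~ qmul (q ^ (- m) * a).
  apply: seq_val; case E: (fsupp x) => [|c r].
    by case: x0; rewrite [x]fsum E big_nil.
  exists (fcf x c); first by rewrite mem_head.
  by rewrite -fsuppP E mem_head.
exists m, (q ^ (- m) *: x); split.
- by rewrite scalerA -expfzDr ?qv_neq0 // subrr scale1r.
- move=> c; rewrite fcfZ; have [cs|] := boolP (c \in fsupp x); first by apply: h1; apply: map_f.
  by rewrite fsuppP negbK => /eqP ->; rewrite mulr0; exact: qreg0.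
by case/mapP: as_ => c _ e h; apply: h2; rewrite e -fcfZ; exact: h.
Qed.

(** A nonzero kernel vector can be scaled to be regular and nonzero modulo q, where [Xi] is the
    identity. Injectivity then turns the right inverse [Th] into a two-sided one. *)
Lemma Xi_eq0 i y : Xi i y = 0 -> y = 0.
Proof.
move=> h; apply: NNPP => y0; have [m [z [e rz nz]]] := primitive y0; apply: nz.
have z0 : Xi i z = 0.
  by apply/eqP; move/eqP: h; rewrite e XiZ scaler_eq0 expfz_eq0 (negbTE (qv_neq0 Q)) andbF.
by have := cqm_sym (Xi_mod i rz); rewrite z0 subr0.
Qed.
Lemma Xi_Th_can i : cancel (Xi i) (Th i).
Proof.
move=> y; apply/eqP; rewrite -subr_eq0; apply/eqP/(@Xi_eq0 i).
by rewrite (lin_B (XiP i)) Th_Xi_can subrr.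
Qed.

(** Coordinates in the basis adapted to i; there e_i and f_i are weighted partial injections along
    combinatorial strings. *)
Definition co i x c := fcf (Th i x) c.
Lemma co_ext i x y : (forall c, co i x c = co i y c) -> x = y.
Proof. by move=> h; apply: (can_inj (Th_Xi_can i)); apply: fext. Qed.
Lemma coZ i a x c : co i (a *: x) c = a * co i x c.
Proof. by rewrite /co (lin_Z (ThP i)) fcfZ. Qed.
Lemma co0 i c : co i 0 c = 0. Proof. by rewrite /co (lin_0 (ThP i)) fcf0. Qed.
Lemma coD i x y c : co i (x + y) c = co i x c + co i y c.
Proof. by rewrite /co (lin_D (ThP i)) fcfD. Qed.
Lemma coB i x y c : co i (x - y) c = co i x c - co i y c.
Proof. by rewrite /co (lin_B (ThP i)) fcfB. Qed.

Definition pinj (P : pred T) (a : T -> Q) (g : T -> T) : A -> A :=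
  flin (fun c => if P c then a c *: bas (g c) else 0).
HB.instance Definition _ P a g := GRing.Linear.copy (pinj P a g)
  (flin (fun c => if P c then a c *: bas (g c) else 0) : A -> A).

Lemma pinjP P a g : linear (pinj P a g). Proof. by move=> k x y; exact: flinP. Qed.

Lemma fcf_pinj (P P' : pred T) a g g' x c :
  (forall c, P c -> P' (g c) /\ g' (g c) = c) -> (forall c, P' c -> P (g' c) /\ g (g' c) = c) ->
  fcf (pinj P a g x) c = if P' c then a (g' c) * fcf x (g' c) else 0.
Proof.
move=> h1 h2; move: x; apply: (@fmod_ext Q _ (GRing.regular Q)) => [k x y|k x y|t].
- by rewrite pinjP fcfD fcfZ.
- by case: ifP => _; rewrite ?scaler0 ?addr0 // fcfD fcfZ mulrDr mulrCA.
rewrite /pinj flinb; case: (boolP (P t)) => [pt|npt].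
  have [p1 p2] := h1 _ pt; rewrite fcfZ !fcfb; have [<-|ne] := eqVneq (g t) c.
    by rewrite p1 p2 eqxx.
  rewrite mulr0; case: ifP => // /h2 [_ e]; case: eqP => [e'|]; last by rewrite mulr0.
  by move: ne; rewrite e' e eqxx.
rewrite fcf0 fcfb; case: ifP => // /h2 [p e]; case: eqP => [e'|]; last by rewrite mulr0.
by move: npt; rewrite e' p.
Qed.

Definition F0 i := pinj (fun c => 0 < cph i c)%N (fun c => qi Q (cep i c).+1) (fo i).
Definition E0 i := pinj (fun c => 0 < cep i c)%N (fun c => qi Q (cph i c).+1) (eo i).
Definition KF0 i := pinj (fun c => 0 < cph i c)%N (fun=> 1) (fo i).
Definition KE0 i := pinj (fun c => 0 < cep i c)%N (fun=> 1) (eo i).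
(** The Kashiwara operator: in coordinates adapted to i, the unweighted shift along strings. *)
Definition kf i x := Xi i (KF0 i (Th i x)).
Definition ke i x := Xi i (KE0 i (Th i x)).

Lemma fo_pinj i c : (0 < cph i c)%N -> (0 < cep i (fo i c))%N /\ eo i (fo i c) = c.
Proof. by move/foP => [_ -> -> _]. Qed.
Lemma eo_pinj i c : (0 < cep i c)%N -> (0 < cph i (eo i c))%N /\ fo i (eo i c) = c.
Proof. by move/eoP => [-> _ -> _]. Qed.

Lemma Th_F i x : Th i (opF i x) = F0 i (Th i x).
Proof.
apply: (can_inj (Xi_Th_can i)); rewrite Th_Xi_can -{1}[x](Th_Xi_can i).
move: (Th i x); apply: fmod_ext => [a y z|a y z|c]; rewrite ?XiP ?opFP /F0 ?pinjP ?XiP //.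
rewrite Xib opF_Put; last exact: sized_Xn.
rewrite Fw_Xn // /pinj flinb /cph; case: ifP => h; last by rewrite (lin_0 (PutLP i c)) (lin_0 (XiP i)).
rewrite PutLZ XiZ Xib /fo sg_put ?size_fw // PutL_put ?size_fw //; last first.
  by rewrite -(size_fw (sg i c)); exact: sized_Xn.
by rewrite /Xw size_fw.
Qed.
Lemma Th_E i x : Th i (opE i x) = E0 i (Th i x).
Proof.
apply: (can_inj (Xi_Th_can i)); rewrite Th_Xi_can -{1}[x](Th_Xi_can i).
move: (Th i x); apply: fmod_ext => [a y z|a y z|c]; rewrite ?XiP ?opEP /E0 ?pinjP ?XiP //.
rewrite Xib opE_Put; last exact: sized_Xn.
rewrite Ew_Xn // /pinj flinb /cep; case: ifP => h; last by rewrite (lin_0 (PutLP i c)) (lin_0 (XiP i)).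
rewrite PutLZ XiZ Xib /eo sg_put ?size_ew // PutL_put ?size_ew //; last first.
  by rewrite -(size_ew (sg i c)); exact: sized_Xn.
by rewrite /Xw size_ew.
Qed.

Lemma coF i x c : co i (opF i x) c = if (0 < cep i c)%N then qi Q (cep i c) * co i x (eo i c) else 0.
Proof.
rewrite /co Th_F (fcf_pinj _ _ _ (@fo_pinj i) (@eo_pinj i)).
by case: ifP => // h; have [_ -> _ _] := eoP h; rewrite prednK.
Qed.
Lemma coE i x c : co i (opE i x) c = if (0 < cph i c)%N then qi Q (cph i c) * co i x (fo i c) else 0.
Proof.
rewrite /co Th_E (fcf_pinj _ _ _ (@eo_pinj i) (@fo_pinj i)).
by case: ifP => // h; have [-> _ _ _] := foP h; rewrite prednK.
Qed.
Lemma cokf i x c : co i (kf i x) c = if (0 < cep i c)%N then co i x (eo i c) else 0.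
Proof. by rewrite /co /kf Xi_Th_can (fcf_pinj _ _ _ (@fo_pinj i) (@eo_pinj i)) mul1r. Qed.
Lemma coke i x c : co i (ke i x) c = if (0 < cph i c)%N then co i x (fo i c) else 0.
Proof. by rewrite /co /ke Xi_Th_can (fcf_pinj _ _ _ (@eo_pinj i) (@fo_pinj i)) mul1r. Qed.

Lemma kf_lin i : linear (kf i). Proof. by move=> a x y; rewrite /kf ThP /KF0 pinjP XiP. Qed.
Lemma ke_lin i : linear (ke i). Proof. by move=> a x y; rewrite /ke ThP /KE0 pinjP XiP. Qed.

Lemma pinj_reg P g c : creg (if P c then 1 *: bas (g c) else 0).
Proof. by case: (P c); [rewrite scale1r; exact: cregb|exact: creg0]. Qed.

(** The adapted basis agrees modulo q with the configurations, so the operator reduces to the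
    combinatorial [fo] there. *)
Lemma kf_mod i x : creg x -> cqm (kf i x - KF0 i x).
Proof.
move=> hx; have hT := Th_reg i hx; have hK : creg (KF0 i (Th i x)).
  by apply: creg_flin => // c; exact: (pinj_reg (fun c => 0 < cph i c)%N).
apply: cqm_trans (Xi_mod i hK) _; rewrite -(lin_B (pinjP _ _ _)); apply: cqm_flin; last exact: Th_mod.
by move=> c; exact: (pinj_reg (fun c => 0 < cph i c)%N).
Qed.
Lemma ke_mod i x : creg x -> cqm (ke i x - KE0 i x).
Proof.
move=> hx; have hT := Th_reg i hx; have hK : creg (KE0 i (Th i x)).
  by apply: creg_flin => // c; exact: (pinj_reg (fun c => 0 < cep i c)%N).
apply: cqm_trans (Xi_mod i hK) _; rewrite -(lin_B (pinjP _ _ _)); apply: cqm_flin; last exact: Th_mod.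
by move=> c; exact: (pinj_reg (fun c => 0 < cep i c)%N).
Qed.
Lemma kf_reg i x : creg x -> creg (kf i x).
Proof.
by move=> hx; apply: Xi_reg; apply: creg_flin; [move=> c; exact: (pinj_reg (fun c => 0 < cph i c)%N)|exact: Th_reg].
Qed.
Lemma KF0_mod i x y : cqm (x - y) -> cqm (KF0 i x - KF0 i y).
Proof.
by move=> h; rewrite -(lin_B (pinjP _ _ _)); apply: cqm_flin => // c; exact: (pinj_reg (fun c => 0 < cph i c)%N).
Qed.
Lemma KE0_mod i x y : cqm (x - y) -> cqm (KE0 i x - KE0 i y).
Proof.
by move=> h; rewrite -(lin_B (pinjP _ _ _)); apply: cqm_flin => // c; exact: (pinj_reg (fun c => 0 < cep i c)%N).
Qed.
Lemma kf_modb i x c : cqm (x - bas c) -> cqm (kf i x - (if (0 < cph i c)%N then bas (fo i c) else 0)).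
Proof.
move=> h; have hx := creg_mod h (cregb c); apply: cqm_trans (kf_mod i hx) _.
by have := KF0_mod i h; rewrite {2}/KF0 /pinj flinb scale1r.
Qed.
Lemma ke_modb i x c : cqm (x - bas c) -> cqm (ke i x - (if (0 < cep i c)%N then bas (eo i c) else 0)).
Proof.
move=> h; have hx := creg_mod h (cregb c); apply: cqm_trans (ke_mod i hx) _.
by have := KE0_mod i h; rewrite {2}/KE0 /pinj flinb scale1r.
Qed.

Definition wv la x := forall c, fcf x c != 0 -> cwt c = la.
Definition pr la := pinj (fun c => cwt c == la) (fun=> 1) id.

Lemma fcf_pr la x c : fcf (pr la x) c = if cwt c == la then fcf x c else 0.
Proof. by rewrite /pr (@fcf_pinj _ (fun c => cwt c == la) _ _ id) ?mul1r. Qed.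
Lemma wv_pr la x : wv la x <-> pr la x = x.
Proof.
split=> [h|<- c]; last by rewrite fcf_pr; case: ifP => [/eqP //|_]; rewrite eqxx.
apply: fext => c; rewrite fcf_pr; case: eqP => // ne; apply/esym/eqP/negPn/negP => /h; exact: ne.
Qed.
Lemma Xi_pr i la x : Xi i (pr la x) = pr la (Xi i x).
Proof.
move: x; apply: fmod_ext => [a y z|a y z|c]; rewrite ?XiP /pr ?pinjP ?XiP //.
have hw : wv (cwt c) (Xi i (bas c)).
  move=> c'; rewrite Xib fcf_Put; last exact: sized_Xn.
  case: ifP => [/andP[/eqP h1 /eqP <-]|]; last by rewrite eqxx.
  rewrite sg_put // => /wts_Xw h; rewrite cwt_put //.
  have -> : (count id (sg i c'))%:Z - (count id (sg i c))%:Z = 0.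
    by have := count_wts (sg i c'); have := count_wts (sg i c); rewrite h h1; lia.
  by rewrite mulr0z addr0.
rewrite [in LHS]/pinj flinb scale1r -/(pr la (Xi i (bas c))); case: eqP => [<-|ne]; first by apply/esym/wv_pr.
rewrite (lin_0 (XiP i)); apply: fext => c'; rewrite fcf0 fcf_pr; case: eqP => // e.
by apply/esym/eqP/negPn/negP => /hw e'; apply: ne; rewrite -e' e.
Qed.
Lemma Th_pr i la x : Th i (pr la x) = pr la (Th i x).
Proof. by apply: (can_inj (Xi_Th_can i)); rewrite Xi_pr !Th_Xi_can. Qed.
Lemma wv_co i la x : wv la x <-> (forall c, co i x c != 0 -> cwt c = la).
Proof.
rewrite wv_pr; split=> [h c|h].
  by rewrite /co -h Th_pr fcf_pr; case: ifP => [/eqP //|_]; rewrite eqxx.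
apply: (can_inj (Th_Xi_can i)); rewrite Th_pr; apply/wv_pr; exact: h.
Qed.

Lemma wv0 la : wv la 0. Proof. by move=> c; rewrite fcf0 eqxx. Qed.
Lemma wvb c : wv (cwt c) (bas c).
Proof. by move=> c'; rewrite fcfb; have [<-|] := eqVneq c c'; rewrite ?eqxx. Qed.
Lemma wv_lin la a x y : wv la x -> wv la y -> wv la (a *: x + y).
Proof.
move=> hx hy c; rewrite fcfD fcfZ; have [->|nz _] := eqVneq (fcf x c) 0; last exact: hx.
by rewrite mulr0 add0r; exact: hy.
Qed.
Lemma wv_opF la i x : wv la x -> wv (la - alpha i) (opF i x).
Proof.
move=> /(wv_co i) h; apply/(wv_co i) => c; rewrite coF; case: ifP => [hp|]; last by rewrite eqxx.
rewrite mulf_eq0 negb_or => /andP[_ /h <-]; have [_ _ _ ->] := eoP hp.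
by rewrite addrK.
Qed.
Lemma wv_opE la i x : wv la x -> wv (la + alpha i) (opE i x).
Proof.
move=> /(wv_co i) h; apply/(wv_co i) => c; rewrite coE; case: ifP => [hp|]; last by rewrite eqxx.
rewrite mulf_eq0 negb_or => /andP[_ /h <-]; have [_ _ _ ->] := foP hp.
by rewrite subrK.
Qed.

Lemma opEF la i x : wv la x -> opE i (opF i x) = opF i (opE i x) + zq Q (la.1 i) *: x.
Proof.
move=> /(wv_co i) h; apply: (co_ext (i := i)) => c; rewrite coD coZ.
have -> : co i (opE i (opF i x)) c = qi Q (cph i c) * qi Q (cep i c).+1 * co i x c.
  rewrite coE coF; case: (posnP (cph i c)) => [->|hp]; first by rewrite qi0 !mul0r.
  by have [_ -> -> _] := foP hp; rewrite mulrA.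
have -> : co i (opF i (opE i x)) c = qi Q (cep i c) * qi Q (cph i c).+1 * co i x c.
  rewrite coF coE; case: (posnP (cep i c)) => [->|hp]; first by rewrite qi0 !mul0r.
  by have [-> _ -> _] := eoP hp; rewrite mulrA.
have [->|/h <-] := eqVneq (co i x c) 0; first by rewrite !mulr0 addr0.
by rewrite cwt_diag -qi_comb; ring.
Qed.

Lemma opE_nilp i x : exists N, iter N (opE i) x = 0.
Proof.
have coEN N c : exists a, co i (iter N (opE i) x) c = a * co i x (iter N (fo i) c) /\ (a != 0 -> (N <= cph i c)%N).
  elim: N c => [|N IH] c; first by exists 1; rewrite mul1r.
  rewrite iterS coE; case: (posnP (cph i c)) => [h|h].
    by exists 0; rewrite mul0r eqxx.
  have [a [-> ha]] := IH (fo i c); exists (qi Q (cph i c) * a); rewrite mulrA -iterSr; split=> //.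
  by rewrite mulf_eq0 negb_or => /andP[_ /ha]; have [-> _ _ _] := foP h; lia.
exists (\max_(c <- fsupp (Th i x)) (cep i c)).+1.
set N := (\max_(c <- fsupp (Th i x)) cep i c).
apply: (co_ext (i := i)) => c; rewrite co0; have [a [-> ha]] := coEN N.+1 c.
have [->|a0] := eqVneq a 0; first by rewrite mul0r.
have [_ h _ _] := iter_foP (ha a0).
apply/eqP; rewrite mulf_eq0 (negbTE a0) /=; apply/negPn/negP; rewrite -fsuppP => hc.
have := @leq_bigmax_seq _ (fsupp (Th i x)) xpredT (cep i) _ hc isT; rewrite h -/N; lia.
Qed.

(** A nonzero coordinate of the last vector sits at the top of a combinatorial string ([cep] = 0)
    admitting k steps down, so its weight la_i + 2k is at least k. *)
Lemma opE_top la i k x : wv la x -> iter k (opE i) x <> 0 -> opE i (iter k (opE i) x) = 0 -> 0 <= k%:Z + la.1 i.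
Proof.
move=> hx nz ez; have hy : wv (la + alpha i *+ k) (iter k (opE i) x).
  elim: k {nz ez} => [|k IH]; first by rewrite addr0.
  by rewrite iterS mulrSr addrA; exact: wv_opE.
have coEN N c : co i (iter N (opE i) x) c != 0 -> (N <= cph i c)%N.
  elim: N c => [|N IH] c //; rewrite iterS coE; case: (posnP (cph i c)) => [h|h]; first by rewrite eqxx.
  by rewrite mulf_eq0 negb_or => /andP[_ /IH]; have [-> _ _ _] := foP h; lia.
have [c hc] : exists c, co i (iter k (opE i) x) c != 0.
  apply: NNPP => h; apply: nz; apply: (co_ext (i := i)) => c; rewrite co0.
  by apply/eqP/negPn/negP => hc; apply: h; exists c.
have e0 : cep i c = 0%N.
  apply/eqP; rewrite -leqn0 leqNgt; apply/negP => h.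
  have := congr1 (fun z => co i z (eo i c)) ez; rewrite coE co0.
  have [-> _ -> _] := eoP h; move/eqP; rewrite mulf_eq0 (negbTE hc) orbF.
  by rewrite (negbTE (qi_neq0 Q _)).
have := congr1 (fun z : weight n => z.1 i) ((wv_co i _ _).1 hy _ hc); rewrite weight_diag cwt_diag e0.
by have := coEN _ _ hc; lia.
Qed.

Lemma wv_indep (s : seq (weight n * A)) : uniq (map fst s) ->
  (forall p, List.In p s -> wv p.1 p.2) -> \sum_(p <- s) p.2 = 0 -> forall p, List.In p s -> p.2 = 0.
Proof.
elim: s => [|[la x] s IH] //= /andP[la_s us] hs; rewrite big_cons /= => h.
have x0 : x = 0.
  apply: fext => c; rewrite fcf0; apply/eqP/negPn/negP => hc.
  have cla : cwt c = la by apply: (hs (la, x)) => //; left.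
  have := congr1 (fun z => fcf z c) h; rewrite fcfD fcf0 fcf_sum.
  have -> : \sum_(p <- s) fcf p.2 c = 0.
    elim: s la_s {IH us h} hs => [|p s IHs] /=; first by rewrite big_nil.
    rewrite inE negb_or => /andP[h1 h2] hs; rewrite big_cons IHs //; last first.
      by move=> p' [<-|h]; apply: hs; [left|right; right].
    rewrite addr0; apply/eqP/negPn/negP => hp; move: h1; rewrite -cla.
    by rewrite (hs p) ?eqxx //; right; left.
  by rewrite addr0 => /eqP; rewrite (negbTE hc).
move=> p [<-//|ps]; apply: IH => //; first by move=> p' h'; apply: hs; right.
by move: h; rewrite x0 add0r.
Qed.

(** The symmetric bilinear form for which configurations are orthonormal. *)
Definition form x y : Q := flin (fun c => fcf y c : GRing.regular Q) x.
Lemma form_linl a x x' y : form (a *: x + x') y = a * form x y + form x' y.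
Proof. by rewrite /form linearP. Qed.
Lemma formb c y : form (bas c) y = fcf y c. Proof. by rewrite /form flinb. Qed.
Lemma formE x y : form x y = \sum_(c <- fsupp x) fcf x c * fcf y c.
Proof. by rewrite /form {1}[x]fsum linear_sum; apply: eq_bigr => c _; rewrite linearZ /= flinb. Qed.
Lemma form_linr a x y y' : form x (a *: y + y') = a * form x y + form x y'.
Proof.
move: x; apply: (@fmod_ext Q _ (GRing.regular Q)) => [k x x'|k x x'|c].
- by rewrite form_linl.
- by rewrite !form_linl -[_ *: _]/(_ * _); ring.
by rewrite !formb fcfD fcfZ.
Qed.
Lemma formC x y : form x y = form y x.
Proof.
move: x; apply: (@fmod_ext Q _ (GRing.regular Q)) => [a x x'|a x x'|c].
- by rewrite form_linl.
- by rewrite form_linr.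
rewrite formb; move: y; apply: (@fmod_ext Q _ (GRing.regular Q)) => [a x x'|a x x'|c'].
- by rewrite fcfD fcfZ.
- by rewrite form_linl.
by rewrite formb !fcfb eq_sym.
Qed.
Lemma form0l y : form 0 y = 0. Proof. by rewrite /form linear0. Qed.
Lemma form0r x : form x 0 = 0. Proof. by rewrite formC form0l. Qed.
Lemma formBl x x' y : form (x - x') y = form x y - form x' y.
Proof. by rewrite addrC -scaleN1r form_linl mulN1r addrC. Qed.
Lemma formBr x y y' : form x (y - y') = form x y - form x y'.
Proof. by rewrite formC formBl !(formC x). Qed.
Lemma formZZ a x : form (a *: x) (a *: x) = a * a * form x x.
Proof. by rewrite -[a *: x]addr0 form_linl form_linr !form0r form0l !addr0 mulrA. Qed.
Lemma form_qmul x y : creg x -> cqm y -> qmul (form x y).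
Proof. by move=> hx hy; rewrite formE; apply: qmul_sum => c _; apply: qmulMl; [exact: hx|exact: hy]. Qed.

(** The norm is the sum of the squares of the coordinates, so the reality of the residue field
    applies. *)
Lemma form_self_qmul x : creg x -> qmul (form x x) -> cqm x.
Proof.
move=> hx; rewrite formE => h c; have [cs|] := boolP (c \in fsupp x); last first.
  by rewrite fsuppP negbK => /eqP ->; exact: qmul0.
apply: (@qreg_squares Q (map (fcf x) (fsupp x))) (map_f _ cs) => [a /mapP [d _ ->]//|].
by rewrite big_map; under eq_bigr do rewrite expr2.
Qed.
Lemma form_eq0 x : form x x = 0 -> x = 0.
Proof.
move=> h; apply: NNPP => x0; have [m [y [e ry ny]]] := primitive x0; apply: ny.
apply: form_self_qmul => //; move/eqP: h; rewrite e formZZ mulf_eq0 mulf_eq0 orbb expfz_eq0 (negbTE (qv_neq0 Q)) andbF /=.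
by move/eqP ->; exact: qmul0.
Qed.
Lemma form_modb x y c c' : cqm (x - bas c) -> cqm (y - bas c') -> qmul (form x y - (c == c')%:R).
Proof.
move=> hx hy; have ry := creg_mod hy (cregb c').
have -> : form x y - (c == c')%:R = form (x - bas c) y + form (bas c) (y - bas c').
  by rewrite formBl formBr !formb fcfb eq_sym addrA subrK.
by apply: qmulD; [rewrite formC|]; apply: form_qmul => //; exact: cregb.
Qed.

Lemma form_adj la i x y : wv la y -> form (opF i x) y = q ^ (la.1 i + 1) * form x (opE i y).
Proof.
move=> hy; move: x; apply: (@fmod_ext Q _ (GRing.regular Q)) => [a x x'|a x x'|c].
- by rewrite opFP form_linl.
- by rewrite form_linl mulrDr mulrCA.
rewrite formb formC formE /opE fcf_lin mulr_sumr [LHS]big_seq [RHS]big_seq; apply: eq_bigr => c'; rewrite fsuppP => hc'.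
rewrite mulrCA; congr (_ * _); rewrite /opF flinb !fcf_Put; try exact: sized_Fb; try exact: sized_Eb.
rewrite -(hy _ hc') cwt_sg eq_sym; case: eqP => [e|_] /=; last by rewrite mulr0.
have -> : (put i c (sg i c') == c') = (put i c' (sg i c) == c).
  by apply/eqP/eqP => <-; rewrite put_put ?sg_put ?put_sg.
by case: eqP => _; rewrite ?mulr0 // fb_adj.
Qed.

End CrystalModule.

Section Families.
Variables (K : fieldType) (M : lmodType K) (T : eqType).
Implicit Types (s : seq T) (g : T -> M).

Definition famspan g s (x : M) := exists a : T -> K, x = \sum_(c <- s) a c *: g c.
Definition famindep g s := forall a : T -> K, \sum_(c <- s) a c *: g c = 0 -> forall c, c \in s -> a c = 0.

Lemma famspan_inspan g s x : famspan g s x -> inspan (map g s) x.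
Proof.
move=> [a ->]; rewrite big_seq; apply: inspan_sum => c cs.
by apply: inspanZ; apply: inspan_mem; apply: map_f.
Qed.

Lemma inspan_famspan g s x : uniq s -> inspan (map g s) x -> famspan g s x.
Proof.
move=> us [a ->]; exists (fun c => a (index c s)); rewrite size_map.
case: s us => [|c0 s] us; first by rewrite big_ord0 big_nil.
rewrite (big_nth c0) big_mkord; apply: eq_bigr => k _.
by rewrite (nth_map c0) // index_uniq.
Qed.

Lemma famindep_indep g s : uniq s -> famindep g s -> indep (map g s).
Proof.
move=> us h a; rewrite size_map => e k lt.
case: s us h e lt => [|c0 s] us h e lt //; rewrite -(index_uniq c0 lt us).
apply: (h (fun c => a (index c (c0 :: s)))); last exact: mem_nth.
rewrite -[RHS]e (big_nth c0) big_mkord; apply: eq_bigr => l _.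
by rewrite (nth_map c0) // index_uniq.
Qed.

(** Two families with the same index list: an independent one inside the span of the other must span
    it, by counting. *)
Lemma fam_span g g' s x : uniq s -> famindep g' s -> (forall c, c \in s -> famspan g s (g' c)) ->
  famspan g s x -> famspan g' s x.
Proof.
move=> us ig' sg' sx; apply: inspan_famspan => //.
apply: (@indep_span _ _ (map g s)); rewrite ?size_map //; first exact: famindep_indep.
  by move=> y /mapP [c cs ->]; apply: famspan_inspan; apply: sg'.
exact: famspan_inspan.
Qed.

Lemma famspan_lin g s a x y : famspan g s x -> famspan g s y -> famspan g s (a *: x + y).
Proof.
move=> [b ->] [d ->]; exists (fun c => a * b c + d c).
rewrite scaler_sumr -big_split /=; apply: eq_bigr => c _; by rewrite scalerDl scalerA.
Qed.
Lemma famspan0 g s : famspan g s 0.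
Proof. by exists (fun=> 0); rewrite big1 // => c _; rewrite scale0r. Qed.
Lemma famspan_sum g s (I : Type) (r : seq I) (P : pred I) (F : I -> M) :
  (forall i, P i -> famspan g s (F i)) -> famspan g s (\sum_(i <- r | P i) F i).
Proof.
move=> h; elim/big_ind: _ => //; first exact: famspan0.
by move=> x y hx hy; rewrite -[x]scale1r; exact: famspan_lin.
Qed.
Lemma famspanZ g s a x : famspan g s x -> famspan g s (a *: x).
Proof. by move=> h; rewrite -[a *: x]addr0; apply: famspan_lin => //; exact: famspan0. Qed.
Lemma famspan_mem g s c : uniq s -> c \in s -> famspan g s (g c).
Proof.
move=> us cs; exists (fun d => (d == c)%:R); rewrite (bigD1_seq c) //= eqxx scale1r big1 ?addr0 // => d.
by move/negbTE ->; rewrite scale0r.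
Qed.

End Families.

(** * Divided powers, string components and regular vectors *)

Section CrystalLattice.
Variables (Q : qfield) (n : nat) (T : cset n).
Local Notation q := (qv Q).
Local Notation A := (freeM Q T).
Local Notation bas := (fbas A).
Implicit Types (x y : A) (c : T) (i j : node n) (la : weight n).

Definition dF i k x : A := (qf Q k)^-1 *: iter k (opF i) x.
Lemma dF0 i x : dF i 0 x = x. Proof. by rewrite /dF qf0 invr1 scale1r. Qed.
Lemma dF_lin i k : linear (dF i k).
Proof.
move=> a x y; rewrite /dF; have -> : iter k (opF i) (a *: x + y) = a *: iter k (opF i) x + iter k (opF i) y.
  by elim: k => //= k ->; rewrite opFP.
by rewrite scalerDr !scalerA mulrC.
Qed.
Lemma dFS i k x : opF i (dF i k x) = qi Q k.+1 *: dF i k.+1 x.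
Proof.
rewrite /dF (lin_Z (opFP i)) scalerA qfS invfM mulrA mulrAC; congr (_ *: _).
by rewrite mulfV ?mul1r ?qi_neq0.
Qed.

Lemma opE0_ep i x c : opE i x = 0 -> co i x c != 0 -> cep i c = 0%N.
Proof.
move=> ex hc; apply/eqP; rewrite -leqn0 leqNgt; apply/negP => h.
have := congr1 (fun z => co i z (eo i c)) ex; rewrite coE co0.
have [-> _ -> _] := eoP h; move/eqP; rewrite mulf_eq0 (negbTE hc) orbF.
by rewrite (negbTE (qi_neq0 Q _)).
Qed.

Lemma ep0_opE i x : (forall c, co i x c != 0 -> cep i c = 0%N) -> opE i x = 0.
Proof.
move=> h; apply: (co_ext (i := i)) => c; rewrite coE co0; case: ifP => // hp.
have [_ e1 _ _] := foP hp; have [->|/h] := eqVneq (co i x (fo i c)) 0; first by rewrite mulr0.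
by rewrite e1.
Qed.

(** On vectors killed by e_i the quantum integers cancel against the divided power, so f_i^(k) only
    moves coordinates k steps down their strings. *)
Lemma co_dF i k x c : opE i x = 0 ->
  co i (dF i k x) c = if cep i c == k then co i x (iter k (eo i) c) else 0.
Proof.
move=> ex; elim: k c => [|k IH] c.
  rewrite dF0; case: ifP => // /negP h; apply/eqP/negPn/negP => hc; apply: h.
  by rewrite (opE0_ep ex hc).
have nz := qi_neq0 Q (isT : (0 < k.+1)%N).
have -> : dF i k.+1 x = (qi Q k.+1)^-1 *: opF i (dF i k x) by rewrite dFS scalerA mulVf // scale1r.
rewrite coZ coF; case: (posnP (cep i c)) => [->|h]; first by rewrite mulr0.
rewrite IH; have [_ -> _ _] := eoP h; rewrite -iterSr.
rewrite (_ : ((cep i c).-1 == k) = (cep i c == k.+1)); last by lia.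
by case: eqP => [->|_]; rewrite ?mulr0 // mulrA mulVf // mul1r.
Qed.

Lemma kf_dF i k x : opE i x = 0 -> kf i (dF i k x) = dF i k.+1 x.
Proof.
move=> ex; apply: (co_ext (i := i)) => c; rewrite cokf !co_dF //; case: (posnP (cep i c)) => [->//|h].
have [_ -> _ _] := eoP h; rewrite -iterSr.
by rewrite (_ : ((cep i c).-1 == k) = (cep i c == k.+1)) //; lia.
Qed.
Lemma iter_kf_dF i k x : opE i x = 0 -> iter k (kf i) x = dF i k x.
Proof. by move=> ex; elim: k => [|k IH]; rewrite ?dF0 // iterS IH kf_dF. Qed.
Lemma ke_dF i k la x : wv la x -> opE i x = 0 -> (k < absz (la.1 i))%N -> 0 <= la.1 i ->
  ke i (dF i k.+1 x) = dF i k x.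
Proof.
move=> hx ex lk l0; apply: (co_ext (i := i)) => c; rewrite coke co_dF // [RHS]co_dF //.
case: (posnP (cph i c)) => [h|h]; last first.
  by have [_ h1 h2 _] := foP h; rewrite h1 eqSS iterSr h2.
case: eqP => // e; apply/esym/eqP/negPn/negP => hc.
have [a1 a2 _ _] : [/\ _, _, _ & _] := @iter_eoP n T i c k ltac:(by rewrite e).
have := congr1 (fun z : weight n => z.1 i) ((wv_co i _ _).1 hx _ hc); rewrite cwt_diag a1 a2; lia.
Qed.
Lemma ke_dF0 i x : opE i x = 0 -> ke i x = 0.
Proof.
move=> ex; apply: (co_ext (i := i)) => c; rewrite coke co0; case: ifP => // h.
have [_ e _ _] := foP h; apply/eqP/negPn/negP => hc.
by move: (opE0_ep ex hc); rewrite e.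
Qed.
Lemma dF_top i k la x : wv la x -> opE i x = 0 -> (absz (la.1 i) < k)%N -> 0 <= la.1 i -> dF i k x = 0.
Proof.
move=> hx ex lk l0; apply: (co_ext (i := i)) => c; rewrite co0 co_dF //; case: eqP => // e.
apply/eqP/negPn/negP => hc.
have [a1 a2 _ _] : [/\ _, _, _ & _] := @iter_eoP n T i c k ltac:(by rewrite e).
have := congr1 (fun z : weight n => z.1 i) ((wv_co i _ _).1 hx _ hc); rewrite cwt_diag a1 a2; lia.
Qed.

Lemma kf_string i N (z : nat -> A) : (forall k, (k < N)%N -> opE i (z k) = 0) ->
  kf i (\sum_(k < N) dF i k (z k)) = \sum_(k < N) dF i k.+1 (z k).
Proof. by move=> h; rewrite (lin_sum (kf_lin i)); apply: eq_bigr => k _; rewrite kf_dF ?h. Qed.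

Lemma ke_string i N la (z : nat -> A) :
  (forall k, (k < N.+1)%N -> [/\ opE i (z k) = 0, wv (la + alpha i *+ k) (z k) & k%:Z + la.1 i < 0 -> z k = 0]) ->
  ke i (\sum_(k < N.+1) dF i k (z k)) = \sum_(k < N) dF i k (z k.+1).
Proof.
move=> h; rewrite (lin_sum (ke_lin i)) big_ord_recl /= dF0 ke_dF0 ?add0r; last by have [] := h 0%N isT.
apply: eq_bigr => k _; have [h1 h2 h3] := h k.+1 (ltn_ord k); rewrite /bump /= add1n.
have [lt|ge] := ltP (k.+1%:Z + la.1 i) 0.
  by rewrite h3 // (lin_0 (dF_lin i _)) (lin_0 (ke_lin i)) (lin_0 (dF_lin i _)).
by apply: (ke_dF h2 h1); rewrite weight_diag; lia.
Qed.

(** The component of x killed by e_i: it keeps exactly the coordinates at tops of i-strings and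
    annihilates the image of f_i. *)
Definition P0 i x := x - kf i (ke i x).
Lemma P0_lin i : linear (P0 i).
Proof. by move=> a x y; rewrite /P0 ke_lin kf_lin scalerBr opprD addrACA. Qed.
Lemma coP0 i x c : co i (P0 i x) c = if cep i c == 0%N then co i x c else 0.
Proof.
rewrite /P0 coB cokf; case: (posnP (cep i c)) => [_|h]; first by rewrite subr0.
by rewrite coke; have [-> _ -> _] := eoP h; rewrite subrr.
Qed.
Lemma opE_P0 i x : opE i (P0 i x) = 0.
Proof. by apply: ep0_opE => c; rewrite coP0; case: (cep i c == 0%N) / eqP => // _; rewrite eqxx. Qed.
Lemma wv_P0 i la x : wv la x -> wv la (P0 i x).
Proof.
by move=> /(wv_co i) h; apply/(wv_co i) => c; rewrite coP0; case: ifP => [_ /h//|_]; rewrite eqxx.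
Qed.

Hypothesis cross : forall i j, i != j -> forall c, opE i (opF j (bas c)) = opF j (opE i (bas c)).

Lemma opEF_cross i j x : i != j -> opE i (opF j x) = opF j (opE i x).
Proof.
move=> ij; move: x; apply: fmod_ext => [a x y|a x y|c]; last exact: cross.
  by rewrite opFP opEP.
by rewrite opEP opFP.
Qed.

Definition amod : premod Q n.
Proof.
refine (@PreMod Q n A (fun i => opE i) (fun i => opF i) (@wv Q n T) (@wv0 Q n T) (@wv_lin Q n T) _ _ _ _).
- by move=> la i x; exact: wv_opE.
- by move=> la i x; exact: wv_opF.
- move=> la i j x hx; case: eqP => [<-|/eqP ne]; first exact: opEF.
  by rewrite scale0r addr0; exact: opEF_cross.
exact: wv_indep.
Defined.

Lemma graded_strings (M : premod Q n) (R : weight n -> prodmod M amod -> Prop) i :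
  (forall la k (v : M), pwv la v -> iter k (pe i) v <> 0 -> pe i (iter k (pe i) v) = 0 -> 0 <= k%:Z + la.1 i) ->
  (forall v : M, exists N, iter N (pe i) v = 0) ->
  (forall la p, R la p -> pwv la p) ->
  (forall la a p p', R la p -> R la p' -> R la (a *: p + p')) ->
  (forall la p, R la p -> R (la + alpha i) (pe i p)) ->
  (forall la p, R la p -> R (la - alpha i) (pf i p)) ->
  forall la p, R la p -> exists N (z : nat -> prodmod M amod),
    (forall k, (k < N)%N -> [/\ pe i (z k) = 0, R (la + alpha i *+ k) (z k) & k%:Z + la.1 i < 0 -> z k = 0])
    /\ p = \sum_(k < N) dpow (pf i) k (z k).
Proof.
move=> Mt Mn Rw Rl Re Rf la p Rp.
have itp k (v : prodmod M amod) : iter k (pe i) v = (iter k (pe i) v.1, iter k (opE i) v.2).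
  by elim: k => [|k IH] /=; [case: v|rewrite IH].
have [N1 h1] := Mn p.1; have [N2 h2] := opE_nilp i p.2.
have hN : iter (N1 + N2) (pe i) p = 0.
  rewrite itp addnC iterD h1 addnC iterD h2 (iter_lin0 (pe i : {linear M -> M})).
  by rewrite (@iter_lin0 Q n amod (pe i)).
have Ri la' k v : R la' v -> iter k (pe i) v <> 0 -> pe i (iter k (pe i) v) = 0 -> 0 <= k%:Z + la'.1 i.
  move=> Rv; rewrite !itp => nz [ez1 ez2]; have [w1 w2] := Rw _ _ Rv.
  have [e1|n1] := excluded_middle_informative (iter k (pe i) v.1 = 0); last exact: Mt w1 n1 ez1.
  by apply: (opE_top w2) ez2 => e2; apply: nz; rewrite e1 e2.
have [z hz] := string_exists Rw Rl Re Rf Ri Rp hN.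
by exists (N1 + N2)%N, z.
Qed.

(** If the least valuation of the coefficients were negative, clearing it would give a combination
    divisible by q whose reduction, read in the basis of configurations, is nonzero. *)
Lemma comb_reg (g : T -> A) (s : seq T) (a : T -> Q) : uniq s -> (forall c, c \in s -> cqm (g c - bas c)) ->
  creg (\sum_(c <- s) a c *: g c) -> forall c, c \in s -> qreg (a c).
Proof.
move=> us hg hx c cs; have [/hasP [d ds d0]|/hasPn h0] := boolP (has (fun d => a d != 0) s); last first.
  by move: (h0 _ cs); rewrite negbK => /eqP ->; exact: qreg0.
have q0 := qv_neq0 Q.
have [m [h1 [e]]] : exists m : int, (forall e, e \in map a s -> qreg (q ^ (- m) * e)) /\
    exists2 e, e \in map a s & ~ qmul (q ^ (- m) * e).
  by apply: seq_val; exists (a d) => //; apply: map_f.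
case/mapP => t ts -> {e} nt.
have aE e : a e = q ^ m * (q ^ (- m) * a e) by rewrite mulrA -expfzDr // subrr mul1r.
case: m h1 nt aE => m h1 nt aE.
  by rewrite aE -exprnP; apply: qregM; [exact: qregX|apply: h1; apply: map_f].
exfalso; apply: nt; set a' := fun e => q ^ (- Negz m) * a e.
have e1 : fcf (q ^+ m.+1 *: (\sum_(e <- s) a e *: g e)) t = \sum_(e <- s) a' e * fcf (g e) t.
  rewrite fcfZ fcf_sum mulr_sumr; apply: eq_bigr => e _; rewrite fcfZ mulrA; congr (_ * _).
have hq : qmul (\sum_(e <- s) a' e * fcf (g e) t).
  by rewrite -e1 fcfZ; apply: qmulMr; [exact: qmulX|exact: hx].
have -> : q ^ (- Negz m) * a t = \sum_(e <- s) a' e * fcf (g e) t - \sum_(e <- s) a' e * fcf (g e - bas e) t.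
  rewrite -sumrB (eq_bigr (fun e => a' e * (e == t)%:R)); last first.
    by move=> e _; rewrite -mulrBr fcfB fcfb opprB addrC subrK.
  rewrite (bigD1_seq t) //= eqxx mulr1 big1 ?addr0 // => e /negbTE ->.
  by rewrite mulr0.
apply: qmulB => //; rewrite big_seq; apply: qmul_sum => e es; apply: qmulMl; first by apply: h1; apply: map_f.
exact: hg.
Qed.

(** A vanishing combination stays zero after scaling by any power of q, so [comb_reg] makes every
    coefficient infinitely divisible by q. *)
Lemma famindep_mod (g : T -> A) (s : seq T) : uniq s -> (forall c, c \in s -> cqm (g c - bas c)) -> famindep g s.
Proof.
move=> us hg a e c cs; apply/eqP/negPn/negP => a0; have q0 := qv_neq0 Q.
have [v [w [rw rw' w0 av]]] := qreg_val a0.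
have h (m : int) : qreg (q ^ m * a c).
  apply: (@comb_reg g s (fun c => q ^ m * a c)) => //.
  rewrite (_ : \sum_(d <- s) _ = q ^ m *: \sum_(d <- s) a d *: g d); last first.
    by rewrite scaler_sumr; apply: eq_bigr => d _; rewrite scalerA.
  by rewrite e scaler0; exact: creg0.
have := h (-1 - v); rewrite av mulrA -expfzDr // subrK exprN1 => h'.
by apply: (@qv_notinv Q); rewrite -[q^-1]mulr1 -(mulfV w0) mulrA; apply: qregM.
Qed.

End CrystalLattice.

Lemma InP (T : eqType) (x : T) (s : seq T) : reflect (List.In x s) (x \in s).
Proof.
elim: s => [|y s IH] /=; first by rewrite in_nil; constructor.
rewrite inE; apply: (iffP orP) => -[]; [move/eqP ->; by left|move/IH; by right|move->; by left|by move/IH; right].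
Qed.

(** * Comparison of two highest weight components *)

Section Commutation.
Variables (Q : qfield) (n : nat) (T : cset n).
Local Notation q := (qv Q).
Local Notation A := (freeM Q T).
Local Notation bas := (fbas A).
Implicit Types (x y : A) (c : T) (i j : node n) (la : weight n).
Hypothesis cross : forall i j, i != j -> forall c, opE i (opF j (bas c)) = opF j (opE i (bas c)).
Local Notation AM := (amod cross).
Local Notation PM := (prodmod AM AM).

Variables (c0 c1 : T).
Hypothesis e0 : forall i, opE i (bas c0) = 0.
Hypothesis e1 : forall i, opE i (bas c1) = 0.
Hypothesis w01 : cwt c0 = cwt c1.

(** Pairs obtained from (c0, c1) by the same combinations of f's: the candidate graph of the
    isomorphism between the two components. *)
Definition crel := @gen Q n PM (cwt c0) (bas c0, bas c1).

Lemma crel_u : pwv (cwt c0) ((bas c0, bas c1) : PM).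
Proof. by split; [|rewrite w01]; exact: wvb. Qed.
Lemma crel_e0 i : pe i ((bas c0, bas c1) : PM) = 0.
Proof. by apply: (@eq_trans _ _ ((opE i (bas c0), opE i (bas c1)) : PM)) => //; rewrite e0 e1. Qed.
Lemma crel_wt la p : crel la p -> wv la p.1 /\ wv la p.2.
Proof. exact: (gen_wt crel_u). Qed.

(** Adjunction moves each f_i to an e_i on the other side; at the top only multiples of the
    generating pair remain, and both of its entries have norm 1. *)
Lemma crel_form la p p' : crel la p -> crel la p' -> form p.1 p'.1 = form p.2 p'.2.
Proof.
move=> hp; elim: hp p' => {la p} [|la|la a x y _ IHx _ IHy|la i x hx IHx] p' hp'.
- case: (gen_top hp') => [->|[_ /(_ erefl) [_ [a ->]]]]; first by rewrite !form0r.
  by rewrite !formb [LHS]fcfZ [RHS]fcfZ !fcfb !eqxx.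
- by rewrite !form0l.
- by rewrite [LHS]form_linl [RHS]form_linl IHx // IHy.
have [w1 w2] := crel_wt hp'.
rewrite [LHS](form_adj i _ w1) [RHS](form_adj i _ w2); congr (_ * _).
by apply: (IHx (pe i p')); have := gen_e crel_u crel_e0 i hp'; rewrite subrK.
Qed.

Lemma dpow_pair i k (p : PM) : dpow (pf i) k p = (dF i k p.1, dF i k p.2).
Proof.
rewrite /dpow /dF; have -> : iter k (pf i) p = (iter k (opF i) p.1, iter k (opF i) p.2) :> PM by elim: k => [|k IH] /=; [case: p|rewrite IH].
by [].
Qed.

Lemma sum_dpow_pair i N (d : nat -> nat) (z : nat -> PM) :
  \sum_(k < N) dpow (pf i) (d k) (z k) = (\sum_(k < N) dF i (d k) (z k).1, \sum_(k < N) dF i (d k) (z k).2).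
Proof.
rewrite (eq_bigr (fun k : 'I_N => (dF i (d k) (z k).1, dF i (d k) (z k).2) : PM)) ?sum_pair // => k _.
exact: dpow_pair.
Qed.

Lemma crel_dpow la i k p : crel la p -> crel (la - alpha i *+ k) (dpow (pf i) k p).
Proof.
move=> hp; apply: genZ; elim: k => [|k IH]; first by rewrite subr0.
by rewrite iterS -wtS3; exact: gen_f.
Qed.

Lemma crel_sum la (I : Type) (r : seq I) (P : pred I) (F : I -> PM) :
  (forall k, P k -> crel la (F k)) -> crel la (\sum_(k <- r | P k) F k).
Proof. by move=> h; elim/big_ind: _ => //; [exact: gen_0|move=> *; exact: genD]. Qed.

Lemma crel_strings la i p : crel la p -> exists N (z : nat -> PM),
    (forall k, (k < N)%N -> [/\ pe i (z k) = 0, crel (la + alpha i *+ k) (z k) & k%:Z + la.1 i < 0 -> z k = 0])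
    /\ p = \sum_(k < N) dpow (pf i) k (z k).
Proof.
apply: graded_strings.
- by move=> la' k v; exact: opE_top.
- exact: opE_nilp.
- exact: crel_wt.
- exact: gen_lin.
- by move=> la' p'; exact: (gen_e crel_u crel_e0).
by move=> la' p'; exact: gen_f.
Qed.

Lemma crel_kf la i p : crel la p -> crel (la - alpha i) (kf i p.1, kf i p.2).
Proof.
move=> /(crel_strings i) [N [z [hz ->]]].
have -> : (kf i (\sum_(k < N) dpow (pf i) k (z k)).1, kf i (\sum_(k < N) dpow (pf i) k (z k)).2) =
    \sum_(k < N) dpow (pf i) k.+1 (z k).
  rewrite (sum_dpow_pair i N id z) (sum_dpow_pair i N S z); congr (_, _); first by apply: (@kf_string _ _ _ i N (fun k => (z k).1)) => k /hz [[]].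
  by apply: (@kf_string _ _ _ i N (fun k => (z k).2)) => k /hz [[]].
apply: crel_sum => k _; have [_ h _] := hz k (ltn_ord k).
by rewrite -(wtS1 la (alpha i) k); exact: crel_dpow.
Qed.

Lemma crel_ke la i p : crel la p -> crel (la + alpha i) (ke i p.1, ke i p.2).
Proof.
move=> /(crel_strings i) [[|N] [z [hz ->]]].
  by rewrite big_ord0 /= !(lin_0 (ke_lin i)); exact: gen_0.
have -> : (ke i (\sum_(k < N.+1) dpow (pf i) k (z k)).1, ke i (\sum_(k < N.+1) dpow (pf i) k (z k)).2) =
    \sum_(k < N) dpow (pf i) k (z k.+1).
  rewrite (sum_dpow_pair i N.+1 id z) (sum_dpow_pair i N id (fun k => z k.+1)); congr (_, _).
    apply: (@ke_string _ _ _ i N la (fun k => (z k).1)).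
    by move=> k /hz [[h1 _] /crel_wt [h2 _] h3]; split=> // /h3 ->.
  apply: (@ke_string _ _ _ i N la (fun k => (z k).2)).
  by move=> k /hz [[_ h1] /crel_wt [_ h2] h3]; split=> // /h3 ->.
apply: crel_sum => k _; have [_ h _] := hz k.+1 (ltn_ord k).
by rewrite -(wtS2 la (alpha i) k); exact: crel_dpow.
Qed.

(** The isomorphism reduced modulo q: c and c' correspond when some related pair of vectors reduces
    to them. *)
Definition theta c c' := exists la p, [/\ crel la p, cqm (p.1 - bas c) & cqm (p.2 - bas c')].

Lemma cqm_bas_neq0 y c : cqm (y - bas c) -> fcf y c != 0.
Proof.
move=> /(_ c); rewrite fcfB fcfb eqxx => h; apply/eqP => e; apply: (@qmul1 Q).
by move: h; rewrite e sub0r /qmul mulNr => /qregN; rewrite opprK.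
Qed.
Lemma cqm_bas y c : cqm (y - bas c) -> ~ cqm y.
Proof.
move=> h hy; apply: (@qmul1 Q); have := qmulB (hy c) (h c).
by rewrite fcfB fcfb eqxx opprB addrC subrK.
Qed.

Lemma theta_wt c c' : theta c c' -> cwt c = cwt c'.
Proof.
move=> [la [p [/crel_wt [w1 w2] h1 h2]]].
by rewrite (w1 _ (cqm_bas_neq0 h1)) (w2 _ (cqm_bas_neq0 h2)).
Qed.

Lemma theta_base : theta c0 c1.
Proof.
exists (cwt c0), (bas c0, bas c1); rewrite !subrr; split; [exact: gen_u|exact: cqm0|exact: cqm0].
Qed.

(** Inner products are the same on both sides, and modulo q they equal 1 or 0 according to whether
    the configurations coincide. *)
Lemma theta_eq c c' d d' : theta c c' -> theta d d' -> (c == d) = (c' == d').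
Proof.
move=> tc td; have key la p p' : crel la p -> crel la p' -> cqm (p.1 - bas c) -> cqm (p.2 - bas c') ->
    cqm (p'.1 - bas d) -> cqm (p'.2 - bas d') -> (c == d) = (c' == d').
  move=> hp hp' a1 a2 b1 b2; have := form_modb a1 b1; have := form_modb a2 b2.
  rewrite -(crel_form hp hp') => h1 h2; have := qmulB h1 h2.
  rewrite opprB addrC addrA subrK => h.
  case: (c == d) h; case: (c' == d') => //; rewrite ?subr0 ?sub0r => h; exfalso; first exact: (qmul1 h).
  by apply: (@qmul1 Q); rewrite -[1]opprK /qmul mulNr; apply: qregN.
have [la [p [hp a1 a2]]] := tc; have [la' [p' [hp' b1 b2]]] := td.
have [v1 v2] := crel_wt hp; have [v1' v2'] := crel_wt hp'.
have wc := v1 _ (cqm_bas_neq0 a1); have wd := v1' _ (cqm_bas_neq0 b1).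
have [e|ne] := eqVneq la la'; first by move: hp' ; rewrite -e => hp'; apply: (key la p p').
have wc' := v2 _ (cqm_bas_neq0 a2); have wd' := v2' _ (cqm_bas_neq0 b2).
case: eqP => [e|_]; first by move: ne; rewrite -wc -wd e eqxx.
by case: eqP => // e; move: ne; rewrite -wc' -wd' e eqxx.
Qed.

(** If the operator gave 0 modulo q on one side only, the equal norms would be divisible by q on one
    side and not on the other. *)
Lemma theta_fe (k : A -> A) (P : pred T) (g : T -> T) :
  (forall c y, cqm (y - bas c) -> cqm (k y - (if P c then bas (g c) else 0))) ->
  (forall la p, crel la p -> exists la', crel la' (k p.1, k p.2)) ->
  forall c c', theta c c' -> P c = P c' /\ (P c -> theta (g c) (g c')).
Proof.
move=> hk hc c c' [la [p [hp a1 a2]]]; have [la' hp'] := hc _ _ hp.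
have := hk _ _ a1; have := hk _ _ a2; have f := crel_form hp' hp'; rewrite /= in f.
case: (P c); case: (P c') => b2 b1.
- by split=> // _; exists la', (k p.1, k p.2).
- exfalso; apply: (cqm_bas b1); apply: form_self_qmul; first exact: creg_mod b1 (cregb _ _).
  by rewrite f; rewrite subr0 in b2; apply: form_qmul => //; exact: cqm_reg.
- exfalso; apply: (cqm_bas b2); apply: form_self_qmul; first exact: creg_mod b2 (cregb _ _).
  by rewrite -f; rewrite subr0 in b1; apply: form_qmul => //; exact: cqm_reg.
by split.
Qed.

Lemma theta_fo i c c' : theta c c' ->
  (0 < cph i c)%N = (0 < cph i c')%N /\ ((0 < cph i c)%N -> theta (fo i c) (fo i c')).
Proof.
apply: (@theta_fe (kf i) (fun c => 0 < cph i c)%N (fo i)) => [d y|la p hp]; first exact: kf_modb.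
by exists (la - alpha i); exact: crel_kf.
Qed.
Lemma theta_eo i c c' : theta c c' ->
  (0 < cep i c)%N = (0 < cep i c')%N /\ ((0 < cep i c)%N -> theta (eo i c) (eo i c')).
Proof.
apply: (@theta_fe (ke i) (fun c => 0 < cep i c)%N (eo i)) => [d y|la p hp]; first exact: ke_modb.
by exists (la + alpha i); exact: crel_ke.
Qed.
Lemma theta_ph i c c' : theta c c' -> cph i c = cph i c' /\ cep i c = cep i c'.
Proof.
move=> h; have e1' : cph i c = cph i c'.
  elim: {c}(cph i c) {-2}c c' h (erefl (cph i c)) => [|k IH] c c' h e.
    by have [+ _] := theta_fo i h; rewrite -e => /esym; lia.
  have hp : (0 < cph i c)%N by rewrite -e.
  have [hp' /(_ hp) ht] := theta_fo i h; have [p1 _ _ _] := foP hp.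
  have [p2 _ _ _] : [/\ _, _, _ & _] := @foP n T i c' ltac:(by rewrite -hp').
  by have := IH _ _ ht; rewrite p1 p2 -e => /(_ erefl); move: hp' hp; lia.
by split=> //; have := congr1 (fun z : weight n => z.1 i) (theta_wt h); rewrite !cwt_diag e1'; lia.
Qed.

End Commutation.

(** * Bases of Demazure submodules reducing to combinatorial subsets *)

Section DemazureFiltration.
Variables (Q : qfield) (n : nat) (T : cset n).
Local Notation q := (qv Q).
Local Notation A := (freeM Q T).
Local Notation bas := (fbas A).
Implicit Types (x y : A) (c : T) (i j : node n) (la : weight n) (w : seq (node n)).
Hypothesis cross : forall i j, i != j -> forall c, opE i (opF j (bas c)) = opF j (opE i (bas c)).
Local Notation AM := (amod cross).

Definition FS i (S : T -> Prop) (c' : T) := exists c k, [/\ S c, (k <= cph i c)%N & c' = iter k (fo i) c].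
(** The string property in local form: once S contains an element below the top of an i-string, it
    contains the whole string. *)
Definition good (S : T -> Prop) i := (forall c, S c -> (0 < cep i c)%N -> S (eo i c)) /\
  (forall c, S c -> (0 < cep i c)%N -> (0 < cph i c)%N -> S (fo i c)).

Lemma FS_list i (S : T -> Prop) (s : seq T) : (forall c, c \in s <-> S c) ->
  exists2 s' : seq T, uniq s' & forall c, c \in s' <-> FS i S c.
Proof.
move=> hs; exists (undup (flatten [seq [seq iter k (fo i) c | k <- iota 0 (cph i c).+1] | c <- s])).
  exact: undup_uniq.
move=> c'; rewrite mem_undup; split.
  case/flatten_mapP => c cs /mapP [k]; rewrite mem_iota add0n ltnS => lek ->.
  by exists c, k; split=> //; apply/hs.
move=> [c [k [/hs cs lek ->]]]; apply/flatten_mapP; exists c => //; apply/mapP; exists k => //.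
by rewrite mem_iota add0n ltnS.
Qed.

Variables (c0 : T).
Hypothesis e0 : forall i, opE i (bas c0) = 0.
Definition Sw w : T -> Prop := foldr FS (eq c0) w.
Hypothesis Sgood : forall w i, good (Sw w) i.

(** The weight spaces of the Demazure-type subspace for w: all powers of f_i applied to the subspace
    of the shorter word. *)
Fixpoint Ew w la (a : A) : Prop :=
  if w is i :: w' then exists N (z : nat -> A),
    (forall k, Ew w' (la + alpha i *+ k) (z k)) /\ a = \sum_(k < N) iter k (opF i) (z k)
  else exists k, a = k *: bas c0 /\ (a = 0 \/ la = cwt c0).

Lemma Ew_consP i w la a : Ew (i :: w) la a <-> exists N (z : nat -> A),
    (forall k, Ew w (la + alpha i *+ k) (z k)) /\ a = \sum_(k < N) iter k (opF i) (z k).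
Proof. by []. Qed.
Lemma iterF_lin i k : linear (iter k (opF i) : A -> A).
Proof. by elim: k => [|k IH] a x y //=; rewrite IH opFP. Qed.

Lemma Ew_0 w la : Ew w la 0.
Proof.
elim: w la => [|i w IH] la /=; first by exists 0; rewrite scale0r; split=> //; left.
by exists 0%N, (fun=> 0); rewrite big_ord0.
Qed.
Lemma Ew_lin w la a x y : Ew w la x -> Ew w la y -> Ew w la (a *: x + y).
Proof.
elim: w la a x y => [|i w IH] la a x y /=.
  move=> [k [-> hx]] [l [-> hy]]; exists (a * k + l); rewrite scalerDl scalerA; split=> //.
  by case: hx => [h|]; [|by right]; case: hy => [h'|]; [left; rewrite -scalerA h scaler0 h' addr0|by right].
move=> [N1 [z1 [h1 ->]]] [N2 [z2 [h2 ->]]].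
exists (N1 + N2)%N, (fun k => a *: (if (k < N1)%N then z1 k else 0) + (if (k < N2)%N then z2 k else 0)); split.
  by move=> k; apply: IH; case: ifP => _ //; exact: Ew_0.
have ext N M (z : nat -> A) : \sum_(k < N) iter k (opF i) (z k) =
    \sum_(k < N + M) iter k (opF i) (if (k < N)%N then z k else 0).
  rewrite big_split_ord /= [X in _ + X]big1 ?addr0; last first.
    by move=> k _; rewrite ltnNge leq_addr /= (lin_0 (iterF_lin i _)).
  by apply: eq_bigr => k _; rewrite ltn_ord.
rewrite (ext N1 N2) (ext N2 N1) addnC scaler_sumr [X in _ + X](_ : _ = \sum_(k < N1 + N2) iter k (opF i) (if (k < N2)%N then z2 k else 0)); last by rewrite addnC.
rewrite addnC -big_split /=; apply: eq_bigr => k _.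
by rewrite (iterF_lin i).
Qed.
Lemma EwZ w la a x : Ew w la x -> Ew w la (a *: x).
Proof. by move=> h; rewrite -[a *: x]addr0; apply: Ew_lin => //; exact: Ew_0. Qed.
Lemma Ew_sum w la (I : Type) (r : seq I) (P : pred I) (F : I -> A) :
  (forall k, P k -> Ew w la (F k)) -> Ew w la (\sum_(k <- r | P k) F k).
Proof.
move=> h; elim/big_ind: _ => //; first exact: Ew_0.
by move=> x y hx hy; rewrite -[x]scale1r; exact: Ew_lin.
Qed.
Lemma Ew_F i w la k x : Ew w (la + alpha i *+ k) x -> Ew (i :: w) la (iter k (opF i) x).
Proof.
move=> h; exists k.+1, (fun l => if l == k then x else 0); split.
  by move=> l; case: eqP => [->//|_]; exact: Ew_0.
rewrite big_ord_recr /= eqxx big1 ?add0r // => l _.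
by rewrite (_ : nat_of_ord l == k = false) ?(lin_0 (iterF_lin i _)) //; apply/eqP; have := ltn_ord l; lia.
Qed.
Lemma Ew_cons i w la x : Ew w la x -> Ew (i :: w) la x.
Proof. by move=> h; apply: (@Ew_F i w la 0); rewrite addr0. Qed.
Lemma Ew_f i w la x : Ew (i :: w) la x -> Ew (i :: w) (la - alpha i) (opF i x).
Proof.
move=> /Ew_consP [N [z [hz ->]]]; rewrite (lin_sum (opFP i)); apply: Ew_sum => k _; rewrite -iterS.
by apply: Ew_F; rewrite wtS5.
Qed.
Lemma wv_iterF i la k x : wv la x -> wv (la - alpha i *+ k) (iter k (opF i) x).
Proof. exact: (@pwv_iter_f Q n AM i la k x). Qed.
Lemma Ew_wv w la x : Ew w la x -> wv la x.
Proof.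
elim: w la x => [|i w IH] la x /=.
  by move=> [k [-> [->|->]]]; [exact: wv0|rewrite -[_ *: _]addr0; apply: wv_lin; [exact: wvb|exact: wv0]].
move=> [N [z [hz ->]]]; elim/big_ind: _ => [|x' y' hx hy|k _]; first exact: wv0.
  by rewrite -[x']scale1r; exact: wv_lin.
by have := @wv_iterF i _ k _ (IH _ _ (hz k)); rewrite addrK.
Qed.

(** Moving e_j past f_i costs nothing if i and j differ and a scalar on a weight vector otherwise;
    this is why the subspaces are graded by weight. *)
Lemma Ew_e w j la x : Ew w la x -> Ew w (la + alpha j) (opE j x).
Proof.
elim: w la x => [|i w IH] la x.
  by move=> [k [-> _]]; exists 0; rewrite (lin_Z (opEP j)) e0 scaler0 scale0r; split=> //; left.
move=> /Ew_consP [N [z [hz ->]]]; rewrite (lin_sum (opEP j)); apply: Ew_sum => k _.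
move: (z k) (hz k) => {z hz} x'; elim: {k}(nat_of_ord k) x' la => [|k IHk] x' la hx.
  by apply: Ew_cons; apply: IH; rewrite addr0 in hx.
rewrite iterS; have hw := @wv_iterF i _ k _ (Ew_wv hx).
have hx1 : Ew w (la + alpha i + alpha i *+ k) x' by rewrite wtS6.
have h1 : Ew (i :: w) (la + alpha i + alpha j) (opE j (iter k (opF i) x')) by exact: IHk.
have h2 : Ew (i :: w) (la + alpha j) (opF i (opE j (iter k (opF i) x'))).
  by have := Ew_f h1; rewrite addrAC addrK.
have [e|ne] := eqVneq j i; last by rewrite (opEF_cross cross).
rewrite e in h2 *; rewrite (opEF i hw); rewrite -[opF i (opE i _)]scale1r; apply: Ew_lin => //.
by apply: EwZ; apply: Ew_F.
Qed.

Lemma Ew_strings i w la a : Ew (i :: w) la a -> exists N (z : nat -> A),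
  (forall k, (k < N)%N -> [/\ opE i (z k) = 0, Ew (i :: w) (la + alpha i *+ k) (z k) & k%:Z + la.1 i < 0 -> z k = 0])
  /\ a = \sum_(k < N) dF i k (z k).
Proof.
move=> ha; have [N hN] := opE_nilp i a.
have [z [hz e]] := @string_exists Q n AM i (Ew (i :: w)) (@Ew_wv (i :: w)) (@Ew_lin (i :: w))
  (fun la x => @Ew_e (i :: w) i la x) (fun la x => @Ew_f i w la x)
  (fun la k x hx => opE_top (Ew_wv hx)) N la a ha hN.
by exists N, z.
Qed.

Lemma Ew_iterF i w la k x : Ew (i :: w) la x -> Ew (i :: w) (la - alpha i *+ k) (iter k (opF i) x).
Proof.
move=> hx; elim: k => [|k IH]; first by rewrite subr0.
by rewrite iterS -wtS3; exact: Ew_f.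
Qed.
Lemma Ew_kf i w la a : Ew (i :: w) la a -> Ew (i :: w) (la - alpha i) (kf i a).
Proof.
move=> /Ew_strings [N [z [hz ->]]]; rewrite kf_string; last by move=> k /hz [].
apply: Ew_sum => k _; have [_ h _] := hz k (ltn_ord k).
by rewrite -(wtS1 la (alpha i) k); apply: EwZ; exact: Ew_iterF.
Qed.
Lemma Ew_P0 i w la a : Ew (i :: w) la a -> Ew (i :: w) la (P0 i a).
Proof.
move=> /Ew_strings [[|N] [z [hz ->]]].
  by rewrite big_ord0 (lin_0 (P0_lin i)); exact: Ew_0.
rewrite /P0 (@ke_string _ _ _ _ _ la); last by move=> k /hz [h1 /Ew_wv h2 h3].
rewrite (@kf_string _ _ _ i N (fun k => z k.+1)); last by move=> k lt; have [] := hz k.+1 lt.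
rewrite big_ord_recl /= addrK dF0; have [_ + _] := hz 0%N isT; by rewrite addr0.
Qed.

(** In each weight, vectors lifting the elements of s modulo q span E. Their independence is
    automatic by [famindep_mod]. *)
Definition dbase (E : weight n -> A -> Prop) (s : seq T) := exists g : T -> A,
  (forall c, c \in s -> E (cwt c) (g c) /\ cqm (g c - bas c)) /\
  (forall la a, E la a -> famspan g [seq c <- s | cwt c == la] a).

Lemma iterE_lin i k : linear (iter k (opE i) : A -> A).
Proof. by elim: k => [|k IH] a x y //=; rewrite IH opEP. Qed.

Lemma co_iterE i k x c : exists2 a, co i (iter k (opE i) x) c = a * co i x (iter k (fo i) c)
  & (a != 0) = (k <= cph i c)%N.
Proof.
elim: k c => [|k IH] c; first by exists 1; rewrite ?mul1r ?oner_neq0.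
rewrite iterS coE; case: (posnP (cph i c)) => [h|h]; first by exists 0; rewrite ?mul0r ?eqxx ?h.
have [a -> ha] := IH (fo i c); exists (qi Q (cph i c) * a); first by rewrite mulrA -iterSr.
by rewrite mulf_eq0 negb_or qi_neq0 //= ha; have [-> _ _ _] := foP h; lia.
Qed.

Lemma iterE_inj i (m : nat) la x : wv la x -> la.1 i = - (m.+1)%:Z - 1 -> iter m.+1 (opE i) x = 0 -> x = 0.
Proof.
move=> hx hl e; apply: (co_ext (i := i)) => c; rewrite co0; apply/eqP/negPn/negP => hc.
have wc := congr1 (fun z : weight n => z.1 i) ((wv_co i _ _).1 hx _ hc); rewrite cwt_diag hl in wc.
have le : (m.+1 <= cep i c)%N by lia.
have [p1 _ p3 _] := iter_eoP le.
have [a ha na] := co_iterE i m.+1 x (iter m.+1 (eo i) c).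
have : a != 0 by rewrite na p1 leq_addl.
by move: ha; rewrite e co0 p3 => /esym/eqP; rewrite mulf_eq0 (negbTE hc) orbF => ->.
Qed.

Lemma P0_mod i x c : cqm (x - bas c) -> cep i c = 0%N -> cqm (P0 i x - bas c).
Proof.
move=> h ec; rewrite /P0 addrAC; apply: cqmB => //.
have := ke_modb i h; rewrite ec subr0 => hk; apply: cqm_mod (kf_mod i (cqm_reg hk)) _.
by apply: cqm_flin => // d; exact: (pinj_reg Q (fun c => 0 < cph i c)%N).
Qed.

Lemma good_iter_e i (S : T -> Prop) c k : good S i -> S c -> (k <= cep i c)%N -> S (iter k (eo i) c).
Proof.
move=> [he _] sc; elim: k => // k IH lek; rewrite iterS; apply: he; first by apply: IH; lia.
by have [_ -> _ _] := iter_eoP (ltnW lek); lia.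
Qed.
Lemma good_iter_f i (S : T -> Prop) c k : good S i -> S c -> (0 < cep i c)%N -> (k <= cph i c)%N -> S (iter k (fo i) c).
Proof.
move=> [_ hf] sc ec; elim: k => // k IH lek; rewrite iterS; have [p1 p2 _ _] := iter_foP (ltnW lek).
by apply: hf; [apply: IH; lia|rewrite p2; lia|rewrite p1; lia].
Qed.

(* Weyl group symmetry of strings: the elements of weight nu in S that are not at the top
   of their i-string inject into the weight space of nu - (m+1) alpha_i, on which e_i^(m+1) is injective. *)
Lemma heads_span i w (s : seq T) (g : T -> A) : uniq s -> (forall c, c \in s <-> Sw w c) ->
  (forall c, c \in s -> Ew w (cwt c) (g c) /\ cqm (g c - bas c)) ->
  (forall la a, Ew w la a -> famspan g [seq c <- s | cwt c == la] a) ->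
  forall nu x, Ew (i :: w) nu x -> opE i x = 0 ->
  famspan (fun c => P0 i (g c)) [seq c <- s | (cwt c == nu) && (cep i c == 0%N)] x.
Proof.
move=> us hs hg sp nu x hx ex.
have [->|xn0] := excluded_middle_informative (x = 0); first exact: famspan0.
have /Ew_consP [N [z [hz xE]]] := hx.
case: N xE => [|N] xE; first by case: xn0; rewrite xE big_ord0.
(* Being killed by e_i, x equals its own projection, and the projection annihilates all terms
   containing f_i. *)
have xz : x = P0 i (z 0%N).
  apply: (co_ext (i := i)) => c; rewrite coP0; case: eqP => [ec|/eqP ec]; last first.
    by apply/eqP/negPn/negP => hc; move: ec; rewrite (opE0_ep ex hc).
  rewrite xE big_ord_recl /= coD [X in _ + X](_ : _ = 0) ?addr0 //.
  rewrite /co (lin_sum (ThP i)) fcf_sum big1 // => k _; rewrite -/(co _ _ _) coF ec //.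
have [m nuE] : exists m : nat, nu.1 i = m%:Z.
  have [c hc] : exists c, co i x c != 0.
    apply: NNPP => h; apply: xn0; apply: (co_ext (i := i)) => c; rewrite co0.
    by apply/eqP/negPn/negP => hc; apply: h; exists c.
  exists (cph i c); rewrite -((wv_co i _ _).1 (Ew_wv hx) _ hc) cwt_diag (opE0_ep ex hc); lia.
set sn := [seq c <- s | cwt c == nu].
have usn : uniq sn by exact: filter_uniq.
pose up c := iter m.+1 (fo i) c.
(* A second family with the same index set, better suited to the projection: an element below the
   top is lifted by e_i^(m+1) from its mirror image under the string reflection shifted by alpha_i,
   and [P0] kills such lifts. *)
pose g' c := if cep i c == 0%N then g c else iter m.+1 (opE i) (g (up c)).
have snP c : c \in sn -> [/\ c \in s, cwt c = nu & cph i c = (m + cep i c)%N].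
  rewrite mem_filter => /andP[/eqP wc cs]; split=> //.
  have := cwt_diag i c; rewrite wc nuE; lia.
have upP c : c \in sn -> cep i c != 0%N -> [/\ up c \in s, cwt (up c) = nu - alpha i *+ m.+1 & iter m.+1 (eo i) (up c) = c].
  move=> /snP [cs wc pc] ec; have le : (m.+1 <= cph i c)%N by rewrite pc; lia.
  have [_ _ p3 p4] := iter_foP le; split; rewrite ?p3 ?p4 ?wc //.
  by apply/hs; apply: (good_iter_f (Sgood w i)) => //; [exact/hs|lia].
have P0g' c : cep i c != 0%N -> c \in sn -> P0 i (g' c) = 0.
  move=> ec csn; rewrite /g' (negbTE ec); apply: (co_ext (i := i)) => d; rewrite coP0 co0; case: eqP => // ed.
  have [a -> na] := co_iterE i m.+1 (g (up c)) d.
  have [us' wup _] := upP _ csn ec.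
  have [->|nz] := eqVneq (co i (g (up c)) (iter m.+1 (fo i) d)) 0; first by rewrite mulr0.
  have [->|a0] := eqVneq a 0; first by rewrite mul0r.
  exfalso; move: na; rewrite a0 => /esym le; have [_ _ _ p4] := iter_foP le.
  have [/Ew_wv hw _] := hg _ us'.
  have := (wv_co i _ _).1 hw _ nz; rewrite p4 wup => /addIr wd.
  by have := cwt_diag i d; rewrite wd nuE ed; move: le; lia.
have ig' : famindep g' sn.
  move=> a e.
  (* Projecting a relation leaves only the heads, whose images are independent modulo q; the rest is
     then treated by injectivity of e_i^(m+1). *)
  have hd c : c \in sn -> cep i c == 0%N -> a c = 0.
    move=> csn ec.
    have ih : famindep (fun c => P0 i (g c)) [seq c <- sn | cep i c == 0%N].
      apply: famindep_mod; first exact: filter_uniq.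
      move=> d; rewrite mem_filter => /andP[/eqP ed /snP [ds _ _]].
      by apply: P0_mod => //; have [] := hg _ ds.
    apply: (ih a); last by rewrite mem_filter ec.
    have := congr1 (P0 i) e; rewrite (lin_0 (P0_lin i)) (lin_sum (P0_lin i)) => e'.
    rewrite -[RHS]e' big_filter big_mkcond [RHS]big_seq [LHS]big_seq; apply: eq_bigr => d dsn.
    rewrite (lin_Z (P0_lin i)); case: ifP => ed; first by rewrite /g' ed.
    by rewrite P0g' ?ed // scaler0.
  move=> c csn; have [ec|ec] := boolP (cep i c == 0%N); first exact: hd.
  pose sm := [seq c <- sn | cep i c != 0%N].
  have smP d : d \in sm -> cep i d != 0%N /\ d \in sn by rewrite (mem_filter _ d) => /andP.
  have iu : famindep g (map up sm).
    apply: famindep_mod.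
      rewrite map_inj_in_uniq ?filter_uniq // => d d' /smP [h1 h2] /smP [h3 h4] E.
      by have [_ _ <-] := upP _ h2 h1; have [_ _ <-] := upP _ h4 h3; rewrite E.
    move=> d /mapP [d' /smP [h1 h2] ->]; have [h3 _ _] := upP _ h2 h1.
    by have [] := hg _ h3.
  have csm : c \in sm by rewrite mem_filter ec.
  have := iu (fun d => a (iter m.+1 (eo i) d)) _ (up c) (map_f up csm).
  have [_ _ ->] := upP _ csn ec; apply.
  rewrite big_map; set y := \sum_(d <- _) _.
  have yE : y = \sum_(d <- sm) a d *: g (up d).
    rewrite /y !big_seq; apply: eq_bigr => d /smP [h1 h2].
    by have [_ _ ->] := upP _ h2 h1.
  apply: (@iterE_inj i m (nu - alpha i *+ m.+1)); last first.
  - rewrite yE (lin_sum (iterE_lin i _)) -[RHS]e /sm big_filter big_mkcond [RHS]big_seq [LHS]big_seq.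
    apply: eq_bigr => d dsn; case: ifP => ed; last by rewrite hd ?scale0r //; move: ed => /negbT; rewrite negbK.
    by rewrite (lin_Z (iterE_lin i _)) /g' (negbTE ed).
  - by rewrite weight_diagN nuE; lia.
  rewrite yE big_seq; elim/big_ind: _ => [|u v hu hv|d]; first exact: wv0.
    by rewrite -[u]scale1r; exact: wv_lin.
  move=> /smP [h1 h2]; have [h3 h4 _] := upP _ h2 h1.
  rewrite -[_ *: _]addr0; apply: wv_lin; last exact: wv0.
  by rewrite -h4; apply: (@Ew_wv w); have [] := hg _ h3.
have zs : famspan g sn (z 0%N) by apply: sp; have := hz 0%N; rewrite addr0.
have Ee k la y : Ew w la y -> Ew w (la + alpha i *+ k) (iter k (opE i) y).
  move=> hy; elim: k => [|k IHk]; first by rewrite addr0.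
  by rewrite iterS -wtS4; exact: Ew_e.
have [b zE] : famspan g' sn (z 0%N).
  apply: (fam_span usn ig') zs => c csn; apply: sp; rewrite /g'.
  have [cs wc _] := snP _ csn; case: ifP => ec; first by rewrite -wc; have [] := hg _ cs.
  have [us' wup _] := upP _ csn (negbT ec).
  by have := Ee m.+1 _ _ (hg _ us').1; rewrite wup subrK.
exists b; rewrite xz zE (lin_sum (P0_lin i)).
have -> : [seq c <- s | (cwt c == nu) && (cep i c == 0%N)] = [seq c <- sn | cep i c == 0%N].
  by rewrite /sn -filter_predI; apply: eq_filter => c /=; rewrite andbC.
rewrite [RHS]big_filter [RHS]big_mkcond [RHS]big_seq [LHS]big_seq; apply: eq_bigr => c csn.
rewrite (lin_Z (P0_lin i)); case: ifP => ec; first by rewrite /g' ec.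
by rewrite P0g' ?ec // scaler0.
Qed.

(** The lift of an element of F_i S is obtained from the head of its i-string: project the lift of
    the head to the kernel of e_i, then apply the Kashiwara operator. Strings and [heads_span] show
    that these lifts span. *)
Lemma dbase_Ew w : exists s, [/\ uniq s, forall c, c \in s <-> Sw w c & dbase (Ew w) s].
Proof.
elim: w => [|i w [s [us hs [g [hg sp]]]]].
  exists [:: c0]; split=> //; first by move=> c; rewrite inE; split=> [/eqP ->|->].
  exists (fun=> bas c0); split=> [c|la a].
    rewrite inE => /eqP ->; split; last by rewrite subrr; exact: cqm0.
    by exists 1; rewrite scale1r; split=> //; right.
  move=> [k [-> [->|->]]]; first exact: famspan0.
  by rewrite /= eqxx; exists (fun=> k); rewrite big_seq1.
have [s' us' hs'] := FS_list i hs.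
exists s'; split=> //.
(* The string property ensures that heads of strings met by F_i S already belong to S. *)
pose top c := iter (cep i c) (eo i) c.
pose G c := iter (cep i c) (kf i) (P0 i (g (top c))).
have topS c : c \in s' -> top c \in s /\ cep i (top c) = 0%N.
  move=> /hs' [d [k [sd lek ->]]]; have [p1 p2 p3 p4] := iter_foP lek.
  have -> : top (iter k (fo i) d) = iter (cep i d) (eo i) d.
    by rewrite /top p2 iterD p3.
  split; first by apply/hs; by apply: (good_iter_e (Sgood w i)).
  by have [_ -> _ _] := iter_eoP (leqnn (cep i d)); rewrite subnn.
have Ge c : c \in s' -> G c = dF i (cep i c) (P0 i (g (top c))) by move=> cs; rewrite /G iter_kf_dF // opE_P0.
have Ekf k mu y : Ew (i :: w) mu y -> Ew (i :: w) (mu - alpha i *+ k) (iter k (kf i) y).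
  move=> hy; elim: k => [|k IH]; first by rewrite subr0.
  by rewrite iterS -wtS3; exact: Ew_kf.
have kfmod k y d : cqm (y - bas d) -> (k <= cph i d)%N -> cqm (iter k (kf i) y - bas (iter k (fo i) d)).
  move=> hy; elim: k => // k IH lek; have := kf_modb i (IH (ltnW lek)).
  by have [-> _ _ _] := iter_foP (ltnW lek); rewrite subn_gt0 lek.
exists G; split=> [c cs'|la a ha].
  have [ts te] := topS _ cs'; have [ht1 ht2] := hg _ ts; have [p1 _ p3 p4] := iter_eoP (leqnn (cep i c)).
  split.
    have h : Ew (i :: w) (cwt c + alpha i *+ cep i c) (P0 i (g (top c))).
      by rewrite -p4; apply: Ew_P0; apply: Ew_cons.
    by have := Ekf (cep i c) _ _ h; rewrite addrK.
  by have := kfmod (cep i c) _ _ (P0_mod ht2 te); rewrite /top p1 leq_addl p3; exact.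
have [N [z [hz ->]]] := Ew_strings ha; apply: famspan_sum => k _.
have [z1 z2 z3] := hz k (ltn_ord k); have [b ->] := heads_span us hs hg sp z2 z1.
rewrite (lin_sum (dF_lin i k)) big_seq; apply: famspan_sum => c.
rewrite mem_filter => /andP[/andP[/eqP wc /eqP ec] cs]; rewrite (lin_Z (dF_lin i k)); apply: famspanZ.
have [lek|gtk] := leqP k (cph i c).
  have [q1 q2 q3 q4] := iter_foP lek; rewrite ec add0n in q2.
  have c's : iter k (fo i) c \in s' by apply/hs'; exists c, (nat_of_ord k); split=> //; apply/hs.
  have -> : dF i k (P0 i (g c)) = G (iter k (fo i) c) by rewrite Ge // /top q2 q3.
  apply: famspan_mem; first exact: filter_uniq.
  by rewrite mem_filter c's q4 wc addrK eqxx.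
have wP : wv (cwt c) (P0 i (g c)) by apply: wv_P0; have [/Ew_wv] := hg _ cs.
have := cwt_diag i c; rewrite ec => wd.
by rewrite (dF_top wP (opE_P0 i _)) ?wd //; [exact: famspan0|lia].
Qed.

Inductive Kv : A -> Prop :=
| Kv0 : Kv (bas c0)
| KvS i y : Kv y -> Kv (kf i y).

Lemma Ew_b w : Ew w (cwt c0) (bas c0).
Proof.
elim: w => [|i w IH]; last exact: Ew_cons.
by exists 1; rewrite scale1r; split=> //; right.
Qed.
Lemma Ew_cat w1 w2 la x : Ew w1 la x -> Ew (w2 ++ w1) la x.
Proof. by move=> h; elim: w2 => // i w2 IH; exact: Ew_cons. Qed.
Lemma Ew_cat' w1 w2 la x : Ew w2 la x -> Ew (w2 ++ w1) la x.
Proof.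
elim: w2 la x => [|i w2 IH] la x.
  move=> [k [-> [->|->]]]; first exact: Ew_0.
  by apply: EwZ; exact: Ew_b.
by move=> /Ew_consP [N [z [hz ->]]]; exists N, z; split=> // k; apply: IH.
Qed.
Lemma gen_Ew la a : @gen Q n AM (cwt c0) (bas c0) la a -> exists w, Ew w la a.
Proof.
elim=> {la a} [|la|la a x y _ [w1 h1] _ [w2 h2]|la i x _ [w h]].
- by exists [::]; exact: (Ew_b [::]).
- by exists [::]; exact: (Ew_0 [::]).
- by exists (w2 ++ w1); apply: Ew_lin; [exact: Ew_cat|exact: Ew_cat'].
by exists (i :: w); apply: Ew_f; apply: Ew_cons.
Qed.

Lemma Sw_Kv w c : Sw w c -> exists y, [/\ Kv y, Ew w (cwt c) y & cqm (y - bas c)].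
Proof.
elim: w c => [|i w IH] c /=.
  by move=> <-; exists (bas c0); rewrite subrr; split; [exact: Kv0|exact: (Ew_b [::])|exact: cqm0].
move=> [d [k [sd lek ->]]]; elim: k lek => [|k IHk] lek.
  by have [y [h1 h2 h3]] := IH _ sd; exists y; split=> //; exact: Ew_cons.
have [y [h1 h2 h3]] := IHk (ltnW lek); have [q1 _ _ _] := iter_foP (ltnW lek).
have pos : (0 < cph i (iter k (fo i) d))%N by rewrite q1 subn_gt0.
exists (kf i y); split; first exact: KvS.
  by rewrite iterS; have [_ _ _ ->] := foP pos; exact: Ew_kf.
by have := kf_modb i h3; rewrite pos.
Qed.

(** Kashiwara monomials inside the subspace reduce to the same elements as the basis, hence form a
    basis too; coefficients of a regular vector in it are regular by [comb_reg]. *)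
Lemma Ew_lattice w la a : Ew w la a -> creg a -> exists r : seq (Q * A),
  (forall p, List.In p r -> qreg p.1 /\ Kv p.2) /\ a = \sum_(p <- r) p.1 *: p.2.
Proof.
move=> ha ra; have [s [us hs [g [hg sp]]]] := dbase_Ew w.
pose Y c := epsilon (inhabits (0 : A)) (fun y => [/\ Kv y, Ew w (cwt c) y & cqm (y - bas c)]).
have YP c : c \in s -> [/\ Kv (Y c), Ew w (cwt c) (Y c) & cqm (Y c - bas c)].
  by move=> /hs /Sw_Kv /(epsilon_spec (inhabits (0 : A))).
set sl := [seq c <- s | cwt c == la].
have usl : uniq sl by exact: filter_uniq.
have slP c : c \in sl -> c \in s /\ cwt c = la by rewrite mem_filter => /andP[/eqP].
have Ymod c : c \in sl -> cqm (Y c - bas c) by move=> /slP [/YP []].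
have [b aE] : famspan Y sl a.
  apply: (fam_span usl (famindep_mod usl Ymod)) (sp _ _ ha) => c /slP [/YP [_ h _] wc].
  by apply: sp; rewrite -wc.
have rb : forall c, c \in sl -> qreg (b c) by apply: (comb_reg usl Ymod); rewrite -aE.
exists [seq (b c, Y c) | c <- sl]; split; last by rewrite big_map.
move=> p /List.in_map_iff [c [<- /InP cs]]; split; first exact: rb.
by have [/YP []] := slP _ cs.
Qed.

End DemazureFiltration.

(** * Fock space: Maya diagrams *)

Lemma supp_sum (V : zmodType) (r r' : seq int) (F : int -> V) : uniq r -> uniq r' ->
  (forall x, F x != 0 -> (x \in r) = (x \in r')) -> \sum_(x <- r) F x = \sum_(x <- r') F x.
Proof.
move=> ur ur' h.
have E (s : seq int) : \sum_(x <- s) F x = \sum_(x <- [seq x <- s | F x != 0]) F x.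
  by rewrite big_filter [RHS]big_mkcond; apply: eq_bigr => x _; case: eqP.
rewrite (E r) (E r'); apply: perm_big; apply: uniq_perm; rewrite ?filter_uniq // => x.
by rewrite !mem_filter; case: (boolP (F x == 0)) => //= /h.
Qed.

Section Maya.
Variable n : nat.
(** A nominal charge c and the finite set of positions where the diagram differs from the vacuum
    that fills all p < c. *)
Definition maya : choiceType := (int * {fset int})%type.
Implicit Types (m : maya) (i j : node n) (p r x : int) (s : seq bool).

Definition occ m p : bool := (p < m.1) (+) (p \in m.2).
Definition cl p : node n := p%:~R.

Lemma clD1 p : cl (p + 1) = cl p + 1. Proof. by rewrite /cl rmorphD. Qed.
Lemma clB1 p : cl (p - 1) = cl p - 1. Proof. by rewrite /cl rmorphB. Qed.
Lemma clD1_neq p : (cl (p + 1) == cl p) = false.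
Proof. by rewrite clD1 -subr_eq0 addrAC subrr add0r oner_eq0. Qed.
Lemma clB1_neq p : (cl (p - 1) == cl p) = false.
Proof. by rewrite -[in RHS](clD1_neq (p - 1)) subrK eq_sym. Qed.

Lemma maya_ext m m' : m.1 = m'.1 -> occ m =1 occ m' -> m = m'.
Proof.
case: m m' => c d [c' d'] /= -> h; congr (_, _); apply/fsetP => x.
by have := h x; rewrite /occ /=; case: (x < c'); case: (x \in d); case: (x \in d').
Qed.

Definition mk (c : int) (f : int -> bool) (X : seq int) : maya :=
  (c, [fset x in [seq x <- X | f x != (x < c)]]%fset).
Lemma occ_mk c f (X : seq int) : (forall x, x \notin X -> f x = (x < c)) -> occ (mk c f X) =1 f.
Proof.
move=> h x; rewrite /occ /= !inE mem_filter; case: (boolP (x \in X)) => [_|/h ->]; last by rewrite andbF addbF.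
by rewrite andbT; case: (f x); case: (x < c).
Qed.

Definition cand m : seq int := undup (m.1 :: (m.2 : seq int) ++ [seq p + 1 | p <- (m.2 : seq int)]).
(** Positions p of residue i where a particle can hop between p - 1 and p; f_i moves it to p, e_i
    back, and the sign is the occupation of p - 1. *)
Definition sites i m : seq int :=
  sort <=%O [seq p <- cand m | (cl p == i) && (occ m (p - 1) != occ m p)].

Lemma cand_occ m p : occ m (p - 1) != occ m p -> p \in cand m.
Proof.
move=> h; rewrite /cand mem_undup inE mem_cat; apply: contraNT h; rewrite !negb_or => /and3P[h1 h2 h3].
have h4 : (p - 1 \in m.2) = false.
  by apply: contraNF h3 => h; apply/mapP; exists (p - 1); rewrite ?subrK.
rewrite /occ (negbTE h2) h4 !addbF; apply/eqP; move: h1; case: ltgtP; lia.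
Qed.
Lemma mem_sites i m p : (p \in sites i m) = (cl p == i) && (occ m (p - 1) != occ m p).
Proof.
rewrite mem_sort mem_filter; case: (boolP (_ != _)) => [/cand_occ ->|]; rewrite ?andbT ?andbF //.
Qed.
Lemma sites_uniq i m : uniq (sites i m).
Proof. by rewrite sort_uniq filter_uniq // undup_uniq. Qed.
Lemma sites_sorted i m : sorted <%O (sites i m).
Proof. by rewrite sort_lt_sorted filter_uniq // undup_uniq. Qed.
Lemma sites_eq i m i' m' : sites i m =i sites i' m' -> sites i m = sites i' m'.
Proof. by move=> h; apply: lt_sorted_eq => //; exact: sites_sorted. Qed.

Definition msg i m : seq bool := [seq occ m (p - 1) | p <- sites i m].
Definition pval i m s p : bool :=
  if p \in sites i m then ~~ nth false s (index p (sites i m))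
  else if p + 1 \in sites i m then nth false s (index (p + 1) (sites i m)) else occ m p.
Definition mput i m s : maya :=
  mk m.1 (pval i m s) ((m.2 : seq int) ++ sites i m ++ [seq p - 1 | p <- sites i m]).

Lemma occ_put i m s : occ (mput i m s) =1 pval i m s.
Proof.
apply: occ_mk => x; rewrite !mem_cat !negb_or => /and3P[h1 h2 h3].
rewrite /pval (negbTE h2) (_ : x + 1 \in _ = false); last first.
  by apply: contraNF h3 => h; apply/mapP; exists (x + 1); rewrite ?addrK.
by rewrite /occ (negbTE h1) addbF.
Qed.

Lemma site_nsucc i m p : p \in sites i m -> (p + 1 \in sites i m) = false.
Proof. by rewrite !mem_sites => /andP[/eqP <- _]; rewrite clD1_neq. Qed.
Lemma site_npred i m p : p \in sites i m -> (p - 1 \in sites i m) = false.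
Proof. by rewrite !mem_sites => /andP[/eqP <- _]; rewrite clB1_neq. Qed.
Lemma pval_pred i m s p : p \in sites i m -> pval i m s (p - 1) = nth false s (index p (sites i m)).
Proof. by move=> h; rewrite /pval (site_npred h) subrK h. Qed.
Lemma pval_site i m s p : p \in sites i m -> pval i m s p = ~~ nth false s (index p (sites i m)).
Proof. by move=> h; rewrite /pval h. Qed.

Lemma sites_put i m s : sites i (mput i m s) = sites i m.
Proof.
apply: sites_eq => p; rewrite mem_sites !occ_put.
case: (boolP (p \in sites i m)) => h.
  have hp := h; rewrite pval_pred // pval_site //; move: hp; rewrite mem_sites => /andP[-> _] /=.
  by case: (nth _ _ _).
have [ci|] //= := eqVneq (cl p) i; move: h; rewrite mem_sites ci eqxx /= => h.
have h1 : p \in sites i m = false by rewrite mem_sites ci eqxx (negbTE h).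
have h2 : p + 1 \in sites i m = false by rewrite mem_sites -ci clD1_neq.
have h3 : p - 1 \in sites i m = false by rewrite mem_sites -ci clB1_neq.
by rewrite /pval h1 h2 h3 subrK h1 (negbTE h).
Qed.

Lemma msg_put i m s : size s = size (msg i m) -> msg i (mput i m s) = s.
Proof.
rewrite size_map => hs; apply: (@eq_from_nth _ false); rewrite size_map sites_put ?hs // => k lt.
rewrite (nth_map 0) ?sites_put ?hs // occ_put pval_pred; last by apply: mem_nth.
by rewrite index_uniq ?sites_uniq.
Qed.

Lemma mput_msg i m : mput i m (msg i m) = m.
Proof.
apply: maya_ext => // p; rewrite occ_put /pval; case: ifP => [h|h1].
  have lt : (index p (sites i m) < size (sites i m))%N by rewrite index_mem.
  rewrite (nth_map 0) // nth_index //; move: h; rewrite mem_sites => /andP[_].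
  by case: (occ m _); case: (occ m _).
case: ifP => // h; have lt : (index (p + 1)%R (sites i m) < size (sites i m))%N by rewrite index_mem.
by rewrite (nth_map 0) // nth_index // addrK.
Qed.

Lemma mput_put i m s s' : size s = size (msg i m) -> size s' = size (msg i m) ->
  mput i (mput i m s) s' = mput i m s'.
Proof.
move=> hs hs'; apply: maya_ext => // p; rewrite !occ_put /pval sites_put.
by case: ifP => // h1; case: ifP => // h2; rewrite occ_put /pval h1 h2.
Qed.

Definition bz (b : bool) : int := (nat_of_bool b)%:Z.
(** The weight of a particle at p, arranged so that a hop from p - 1 to p subtracts alpha; the
    delta-term comes from every alpha_i having delta-coordinate 2. *)
Definition eps (c p : int) : weight n := Lam (cl (p + 1)) - Lam (cl p) - delta_frac n (2 * (p - c)).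
Definition mwt m : weight n := Lam (cl m.1) +
  \sum_(p <- (m.2 : seq int)) eps m.1 p *~ (bz (occ m p) - bz (p < m.1)).

Lemma eps_diff c p : eps c (p - 1) - eps c p = alpha (cl p).
Proof.
rewrite alphaE /eps subrK clB1 clD1 /delta_frac; apply/pair_eqP/andP; split; apply/eqP => /=.
  by apply/ffunP => k; rewrite !ffunE; lia.
by lia.
Qed.

Lemma mwtE m (Y : seq int) : uniq Y -> {subset (m.2 : seq int) <= Y} ->
  mwt m = Lam (cl m.1) + \sum_(p <- Y) eps m.1 p *~ (bz (occ m p) - bz (p < m.1)).
Proof.
move=> uY sY; congr (_ + _); apply: supp_sum => //; first exact: fset_uniq.
move=> p h; suff pm : p \in m.2 by rewrite (sY _ pm) pm.
by apply: contraNT h => h; rewrite /occ (negbTE h) addbF subrr mulr0z eqxx.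
Qed.

Lemma msg_sum i m (G : bool -> int) : \sum_(b <- msg i m) G b = \sum_(p <- sites i m) G (occ m (p - 1)).
Proof. by rewrite big_map. Qed.
Lemma count_sum s : (count id s)%:Z = \sum_(b <- s) bz b.
Proof. by elim: s => [|b s IH]; rewrite ?big_nil // big_cons -IH /bz /=; case: b => /=; lia. Qed.

(** Both weights are summed over one common list of positions; a changed sign at a site p moves one
    particle between p - 1 and p, and [eps_diff] contributes alpha_i. *)
Lemma mwt_put i m s : size s = size (msg i m) ->
  mwt (mput i m s) = mwt m + alpha i *~ ((count id s)%:Z - (count id (msg i m))%:Z).
Proof.
move=> hs; set m' := mput i m s.
pose Y := undup ((m.2 : seq int) ++ (m'.2 : seq int) ++ sites i m ++ [seq p - 1 | p <- sites i m]).
have uY : uniq Y by exact: undup_uniq.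
have s1 : {subset (m.2 : seq int) <= Y} by move=> x h; rewrite mem_undup mem_cat h.
have s2 : {subset (m'.2 : seq int) <= Y} by move=> x h; rewrite mem_undup !mem_cat h orbT.
have s3 : {subset sites i m <= Y} by move=> x h; rewrite mem_undup !mem_cat h !orbT.
have s4 p : p + 1 \in sites i m -> p \in Y.
  by move=> h; rewrite mem_undup !mem_cat; apply/orP; right; apply/orP; right; apply/orP; right;
     apply/mapP; exists (p + 1); rewrite ?addrK.
rewrite (mwtE uY s2) (mwtE uY s1) -addrA; congr (_ + _).
rewrite -[LHS](addrNK (\sum_(p <- Y) eps m.1 p *~ (bz (occ m p) - bz (p < m.1)))) addrC; congr (_ + _).
rewrite -sumrB.
pose G p : int := bz (nth false s (index p (sites i m))) - bz (occ m (p - 1)).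
have E p : eps m'.1 p *~ (bz (occ m' p) - bz (p < m'.1)) - eps m.1 p *~ (bz (occ m p) - bz (p < m.1)) =
    eps m.1 p *~ (if p + 1 \in sites i m then G (p + 1) else 0) - eps m.1 p *~ (if p \in sites i m then G p else 0).
  rewrite -!mulrzBr; congr (_ *~ _); rewrite occ_put /pval /G addrK /bz.
  have [h|h] := boolP (p \in sites i m).
    rewrite (site_nsucc h); move: h; rewrite mem_sites => /andP[_].
    by case: (occ m (p - 1)); case: (occ m p); case: (nth _ _ _) => //= _; lia.
  by rewrite -[m'.1]/(m.1); case: ifP => _; [case: (nth false s _)|]; case: (occ m p); case: (p < m.1).
rewrite (eq_bigr _ (fun p _ => E p)) sumrB.
have -> : \sum_(p <- Y) eps m.1 p *~ (if p \in sites i m then G p else 0) = \sum_(p <- sites i m) eps m.1 p *~ G p.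
  rewrite [RHS](eq_big_seq (fun p => eps m.1 p *~ (if p \in sites i m then G p else 0))); last by move=> p ->.
  apply: supp_sum => //; first exact: sites_uniq.
  by move=> p; case: ifP => [h _|_]; [rewrite (s3 _ h)|rewrite mulr0z eqxx].
have -> : \sum_(p <- Y) eps m.1 p *~ (if p + 1 \in sites i m then G (p + 1) else 0) =
    \sum_(p <- sites i m) eps m.1 (p - 1) *~ G p.
  have -> : \sum_(p <- sites i m) eps m.1 (p - 1) *~ G p =
      \sum_(p <- [seq p - 1 | p <- sites i m]) eps m.1 p *~ (if p + 1 \in sites i m then G (p + 1) else 0).
    by rewrite big_map !big_seq; apply: eq_bigr => p hp; rewrite subrK hp.
  apply: supp_sum => //; first by rewrite map_inj_uniq ?sites_uniq // => a b /addIr.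
  move=> p; case: ifP => [h _|_]; last by rewrite mulr0z eqxx.
  by rewrite (s4 _ h); apply/esym/mapP; exists (p + 1); rewrite ?addrK.
rewrite -sumrB (eq_big_seq (fun p => alpha i *~ G p)); last first.
  by move=> p; rewrite mem_sites => /andP[/eqP <- _]; rewrite -mulrzBl eps_diff.
rewrite -mulrz_sumr; congr (_ *~ _); rewrite !count_sum msg_sum.
have -> : \sum_(b <- s) bz b = \sum_(p <- sites i m) bz (nth false s (index p (sites i m))).
  rewrite size_map in hs; rewrite (big_nth false) [RHS](big_nth 0) hs !big_mkord; apply: eq_bigr => k _.
  by rewrite index_uniq ?sites_uniq.
by rewrite -sumrB.
Qed.

Lemma wts_sum s : wts s = \sum_(b <- s) (if b then 1 else -1).
Proof. by elim: s => [|b s IH]; rewrite ?big_nil // big_cons -IH wts_cons. Qed.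

(** The signs at residue i add up the jumps of occupation from p - 1 to p; subtracting the vacuum,
    whose only jump is at the charge, leaves a finite sum that reindexes into the weight. *)
Lemma mwt_sg i m : (mwt m).1 i = wts (msg i m).
Proof.
rewrite wts_sum msg_sum.
pose D p : int := if cl p == i then bz (occ m (p - 1)) - bz (occ m p) else 0.
pose v p : int := bz (occ m p) - bz (p < m.1).
have v0 p : p \notin m.2 -> v p = 0 by move=> h; rewrite /v /occ (negbTE h) addbF subrr.
have -> : \sum_(p <- sites i m) (if occ m (p - 1) then 1 else -1) = \sum_(p <- cand m) D p.
  rewrite (eq_big_seq D); last first.
    by move=> p; rewrite mem_sites /D => /andP[->]; case: (occ m _); case: (occ m _).
  apply: supp_sum; [exact: sites_uniq|exact: undup_uniq|move=> p].
  rewrite mem_sites /D; case: ifP => [ci h|_]; last by rewrite eqxx.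
  rewrite (cand_occ (m := m)) ?ci /=; last first.
    by apply: contraNneq h => ->; rewrite subrr.
  by apply: contraNneq h => ->; rewrite subrr.
have DE p : D p = (if p == m.1 then bz (cl m.1 == i) else 0) +
    ((if cl p == i then v (p - 1) else 0) - (if cl p == i then v p else 0)).
  rewrite /D /v /bz; case: (eqVneq p m.1) => [->|ne].
    by case: (cl m.1 == i) => //=; rewrite ltrBlDr ltrDl ltr01 ltxx /=; lia.
  case: (cl p == i) => //=; have -> : (p - 1 < m.1) = (p < m.1) by move: ne; lia.
  by case: (occ m (p - 1)); case: (occ m p); case: (p < m.1).
rewrite (eq_bigr _ (fun p _ => DE p)) big_split sumrB.
have -> : \sum_(p <- cand m) (if p == m.1 then bz (cl m.1 == i) else 0) = bz (cl m.1 == i).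
  have mc : m.1 \in cand m by rewrite mem_undup mem_head.
  by rewrite (bigD1_seq m.1) ?undup_uniq //= eqxx big1 ?addr0 // => p /negbTE ->.
have -> : \sum_(p <- cand m) (if cl p == i then v (p - 1) else 0) = \sum_(p <- (m.2 : seq int)) v p * bz (cl (p + 1) == i).
  have -> : \sum_(p <- (m.2 : seq int)) v p * bz (cl (p + 1) == i) =
      \sum_(p <- [seq p + 1 | p <- (m.2 : seq int)]) (if cl p == i then v (p - 1) else 0).
    by rewrite big_map; apply: eq_bigr => p _; rewrite addrK; case: (cl _ == i); rewrite ?mulr1 ?mulr0.
  apply: supp_sum; [exact: undup_uniq|by rewrite map_inj_uniq ?fset_uniq // => a b /addIr|move=> p].
  case: ifP => // _ h; have hm : p - 1 \in m.2 by apply: contraNT h => /v0 ->.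
  have hp : p \in [seq p + 1 | p <- (m.2 : seq int)] by apply/mapP; exists (p - 1); rewrite ?subrK.
  by rewrite hp mem_undup inE mem_cat hp !orbT.
have -> : \sum_(p <- cand m) (if cl p == i then v p else 0) = \sum_(p <- (m.2 : seq int)) v p * bz (cl p == i).
  rewrite [RHS](eq_bigr (fun p => if cl p == i then v p else 0)); last by move=> p _; case: ifP; rewrite ?mulr1 ?mulr0.
  apply: supp_sum; [exact: undup_uniq|exact: fset_uniq|move=> p].
  case: ifP => // _ h; have hm : p \in m.2 by apply: contraNT h => /v0 ->.
  by rewrite hm mem_undup inE mem_cat hm !orbT.
rewrite -sumrB /mwt wt1D; congr (_ + _); first by rewrite /= ffunE eq_sym /bz; case: (_ == _).
have -> : (\sum_(p <- (m.2 : seq int)) eps m.1 p *~ v p).1 i = \sum_(p <- (m.2 : seq int)) (eps m.1 p *~ v p).1 i.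
  by elim: (m.2 : seq int) => [|p r IH]; rewrite ?big_nil ?big_cons /= ?ffunE // -IH.
apply: eq_bigr => p _.
have -> : (eps m.1 p *~ v p).1 i = (eps m.1 p).1 i * v p.
  exact: wt1Mz.
by rewrite /eps !wt1D !wt1N /= !ffunE !(eq_sym i) /bz; case: (cl (p + 1) == i); case: (cl p == i) => /=; ring.
Qed.

Definition mcset : cset n := CSet msg_put mput_msg mput_put mwt_put mwt_sg.

End Maya.

Section WordSums.
Variable Q : qfield.
Local Notation q := (qv Q).
Local Notation W := (freeM Q (seq bool)).

Lemma expN_wts_cons a s : q ^ (- wts (a :: s)) = (if a then q^-1 else q) * q ^ (- wts s).
Proof.
rewrite wts_cons; move: (wts s) => z; rewrite opprD expfzDr ?qv_neq0 //.
by case: a; rewrite ?opprK ?expr1z ?exprN1.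
Qed.

Lemma Fb_sum w : Fb Q w = \sum_(k < size w)
  (if nth false w k then q ^ wts (drop k.+1 w) *: fbas W (set_nth false w k false) else 0).
Proof.
elim: w => [|a s IH] /=; first by rewrite big_ord0.
rewrite big_ord_recl /= drop0 addrC; congr (_ + _); rewrite IH.
rewrite linear_sum; apply: eq_bigr => k _; rewrite /bump /= add1n /=.
by case: ifP => _; rewrite ?linear0 // cnsZ cnsb.
Qed.

Lemma Eb_sum w : Eb Q w = \sum_(k < size w)
  (if nth false w k then 0 else q ^ (- wts (take k w)) *: fbas W (set_nth false w k true)).
Proof.
elim: w => [|a s IH]; first by rewrite /= big_ord0.
rewrite [LHS]/= [size _]/= big_ord_recl addrC; congr (_ + _).
  by case: a => //=; rewrite (_ : - wts [::] = 0) // expr0z scale1r.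
rewrite IH linear_sum scaler_sumr; apply: eq_bigr => k _; rewrite !lift0 /=.
case: (nth false s k); first by rewrite (lin_0 (@cnsP Q a)) scaler0.
by rewrite cnsZ cnsb scalerA expN_wts_cons.
Qed.

Lemma sorted_drop (s : seq int) k : sorted <%O s -> (k < size s)%N -> drop k.+1 s = [seq r <- s | nth 0 s k < r].
Proof.
elim: s k => [|a s IH] // [|k] /= ps lt.
  rewrite drop0 ltxx; apply/esym/all_filterP; exact: (order_path_min lt_trans ps).
have ps' := path_sorted ps; rewrite IH //; case: ifP => // h.
have /allP/(_ _ (mem_nth 0 lt)) := order_path_min lt_trans ps; by move=> h'; have := lt_trans h h'; rewrite ltxx.
Qed.
Lemma sorted_take (s : seq int) k : sorted <%O s -> (k < size s)%N -> take k s = [seq r <- s | r < nth 0 s k].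
Proof.
elim: s k => [|a s IH] // [|k] /= ps lt.
  rewrite ltxx -(@filter_pred0 _ s); apply/eq_in_filter => r rs /=; apply/esym/negbTE; rewrite -leNgt.
  by have /allP/(_ _ rs) := order_path_min lt_trans ps; exact: ltW.
have ps' := path_sorted ps; rewrite IH //; case: ifP => // h.
by have /allP/(_ _ (mem_nth 0 lt)) := order_path_min lt_trans ps; rewrite h.
Qed.

End WordSums.

(** * Commutation of e_i and f_j on one Maya diagram *)

Section MayaCross.
Variables (Q : qfield) (n : nat).
Local Notation q := (qv Q).
Local Notation MS := (mcset n).
Local Notation A := (freeM Q MS).
Local Notation bas := (fbas A).
Implicit Types (m : maya) (i j : node n) (p r x : int) (P : seq int).
Local Notation cl := (cl n).

Definition fl p m : maya := mk m.1 (fun x => occ m x (+) ((x == p) || (x == p - 1))) ((m.2 : seq int) ++ [:: p; p - 1]).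
Lemma occ_fl p m x : occ (fl p m) x = occ m x (+) ((x == p) || (x == p - 1)).
Proof.
rewrite /fl occ_mk // => y; rewrite mem_cat !inE !negb_or => /and3P[h1 /negbTE h2 /negbTE h3].
by rewrite h2 h3 addbF /occ (negbTE h1) addbF.
Qed.
Lemma fl_fl p r m : fl p (fl r m) = fl r (fl p m).
Proof. by apply: maya_ext => // x; rewrite !occ_fl addbAC. Qed.

Lemma mput_fl i m k b : (k < size (sites i m))%N -> b = ~~ nth false (msg i m) k ->
  mput i m (set_nth false (msg i m) k b) = fl (nth 0 (sites i m) k) m.
Proof.
move=> lt ->; set p := nth 0 _ k; have hp : p \in sites i m by exact: mem_nth.
apply: maya_ext => // x; rewrite occ_put occ_fl /pval.
have nE y : y \in sites i m -> nth false (set_nth false (msg i m) k (~~ nth false (msg i m) k)) (index y (sites i m)) =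
    occ m (y - 1) (+) (y == p).
  move=> hy; rewrite nth_set_nth /=; have ly : (index y (sites i m) < size (sites i m))%N by rewrite index_mem.
  have [e|ne] := eqVneq (index y (sites i m)) k.
    have -> : y = p by rewrite /p -e nth_index.
    by rewrite eqxx /msg (nth_map 0) // addbT.
  rewrite (nth_map 0) // nth_index //; case: eqP => [e|_]; last by rewrite addbF.
  by move: ne; rewrite e /p index_uniq ?sites_uniq // eqxx.
case: ifP => [hx|hx].
  rewrite nE // (_ : x == p - 1 = false) ?orbF; last by apply/negbTE/eqP => e; move: hx; rewrite e (site_npred hp).
  by move: hx; rewrite mem_sites => /andP[_]; case: (occ m (x - 1)); case: (occ m x); case: (x == p).
have xp : (x == p) = false by apply/negbTE/eqP => e; move: hx; rewrite e hp.
case: ifP => [hx1|hx1]; first by rewrite nE // addrK xp [x == p - 1]eq_sym subr_eq [p == _]eq_sym.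
rewrite xp (_ : x == p - 1 = false) ?addbF //; apply/negbTE/eqP => e.
by move: hx1; rewrite e subrK hp.
Qed.

Definition sgn (b : bool) : int := if b then 1 else -1.
(** The exponent of q that f_i acquires from the sites to the right of p; [Ll] is its counterpart
    for e_i on the left. *)
Definition Rr i p m : int := \sum_(r <- sites i m | p < r) sgn (occ m (r - 1)).
Definition Ll i p m : int := \sum_(r <- sites i m | r < p) sgn (occ m (r - 1)).

Lemma opF_sites i m : opF i (bas m) =
  \sum_(p <- sites i m) (if occ m (p - 1) then q ^ Rr i p m *: bas (fl p m) else 0).
Proof.
rewrite /opF flinb Fb_sum (lin_sum (@PutLP Q n MS i m)) size_map [RHS](big_nth 0) big_mkord; apply: eq_bigr => k _.
have lt := ltn_ord k; rewrite (nth_map 0) //; case: ifP => h; last by rewrite (lin_0 (@PutLP Q n MS i m)).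
rewrite PutLZ PutLb [put _ _ _]mput_fl ?(nth_map 0) ?h //; congr (_ ^ _ *: _).
by rewrite -map_drop wts_sum big_map (sorted_drop (sites_sorted i m)) // big_filter.
Qed.
Lemma opE_sites i m : opE i (bas m) =
  \sum_(p <- sites i m) (if occ m (p - 1) then 0 else q ^ (- Ll i p m) *: bas (fl p m)).
Proof.
rewrite /opE flinb Eb_sum (lin_sum (@PutLP Q n MS i m)) size_map [RHS](big_nth 0) big_mkord; apply: eq_bigr => k _.
have lt := ltn_ord k; rewrite (nth_map 0) //; case: ifP => h; first by rewrite (lin_0 (@PutLP Q n MS i m)).
rewrite PutLZ PutLb [put _ _ _]mput_fl ?(nth_map 0) ?h //; congr (_ ^ (- _) *: _).
by rewrite -map_take wts_sum big_map (sorted_take (sites_sorted i m)) // big_filter.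
Qed.

Definition indf i m p := [&& cl p == i, occ m (p - 1) & ~~ occ m p].
Definition inde i m p := [&& cl p == i, ~~ occ m (p - 1) & occ m p].

Lemma sites_sum (V : zmodType) P i m (F G : int -> V) : uniq P -> {subset sites i m <= P} ->
  {in sites i m, F =1 G} -> (forall p, G p != 0 -> p \in sites i m) ->
  \sum_(p <- sites i m) F p = \sum_(p <- P) G p.
Proof.
move=> uP sP e h; rewrite (eq_big_seq _ e); apply: supp_sum => //; first exact: sites_uniq.
by move=> p /h hp; rewrite hp (sP _ hp).
Qed.

Lemma opF_P P i m : uniq P -> {subset sites i m <= P} -> opF i (bas m) =
  \sum_(p <- P) (if indf i m p then q ^ Rr i p m *: bas (fl p m) else 0).
Proof.
move=> uP sP; rewrite opF_sites; apply: sites_sum => // p; rewrite mem_sites /indf; first move=> /andP[->];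
  by case: (_ == i); case: (occ m _); case: (occ m p); rewrite //= eqxx.
Qed.
Lemma opE_P P i m : uniq P -> {subset sites i m <= P} -> opE i (bas m) =
  \sum_(p <- P) (if inde i m p then q ^ (- Ll i p m) *: bas (fl p m) else 0).
Proof.
move=> uP sP; rewrite opE_sites; apply: sites_sum => // p; rewrite mem_sites /inde; first move=> /andP[->];
  by case: (_ == i); case: (occ m _); case: (occ m p); rewrite //= eqxx.
Qed.
Lemma sgn_P P i m (c : pred int) : uniq P -> {subset sites i m <= P} ->
  \sum_(r <- sites i m | c r) sgn (occ m (r - 1)) =
  \sum_(r <- P) (if (cl r == i) && c r then bz (occ m (r - 1)) - bz (occ m r) else 0).
Proof.
move=> uP sP; rewrite big_mkcond; apply: sites_sum => // r; rewrite mem_sites; first move=> /andP[->];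
  by case: (_ == i); case: (c r); case: (occ m _); case: (occ m r).
Qed.

Lemma sum_pick P (a : int) (F : int -> int) : uniq P -> a \in P ->
  \sum_(r <- P) (if r == a then F r else 0) = F a.
Proof. by move=> uP aP; rewrite (bigD1_seq a) //= eqxx big1 ?addr0 // => r /negbTE ->. Qed.

Lemma sites_fl i p m r : r \in sites i (fl p m) -> r \in sites i m \/ r \in [:: p - 1; p; p + 1].
Proof.
rewrite !mem_sites !occ_fl => /andP[-> h] /=; case: (boolP (r \in [:: p - 1; p; p + 1])) => h'; [by right|left].
move: h'; rewrite !inE !negb_or => /and3P[h1 h2 h3]; move: h.
have -> : (r - 1 == p) = false by apply/negbTE; apply: contraNneq h3 => <-; rewrite subrK.
have -> : (r - 1 == p - 1) = false by apply/negbTE; apply: contraNneq h2 => /addIr ->.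
by rewrite (negbTE h1) (negbTE h2) !addbF.
Qed.

(** A hop at a site p of another residue alters occupations only at p - 1 and p, hence the signs of
    residue i only at the neighbours p - 1 and p + 1. *)
Lemma hop_sum P (s : bool) i m p (c : pred int) : uniq P -> p - 1 \in P -> p \in P -> p + 1 \in P ->
  {subset sites i m <= P} -> {subset sites i (fl p m) <= P} ->
  occ m (p - 1) = s -> occ m p = ~~ s -> cl p != i ->
  \sum_(r <- sites i (fl p m) | c r) sgn (occ (fl p m) (r - 1)) =
  \sum_(r <- sites i m | c r) sgn (occ m (r - 1)) +
    sgn s * (bz ((cl (p - 1) == i) && c (p - 1)) + bz ((cl (p + 1) == i) && c (p + 1))).
Proof.
move=> uP P1 P2 P3 s1 s2 o1 o2 ci; rewrite !(@sgn_P P) //.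
apply/eqP; rewrite addrC -subr_eq -sumrB; apply/eqP.
pose F r : int := (if r == p - 1 then sgn s * bz ((cl r == i) && c r) else 0) +
  (if r == p + 1 then sgn s * bz ((cl r == i) && c r) else 0).
rewrite (eq_bigr F); first by rewrite big_split /= !sum_pick // mulrDr.
move=> r _; rewrite /F !occ_fl.
have e1 : (r - 1 == p) = (r == p + 1) by rewrite subr_eq.
have e2 : (r - 1 == p - 1) = (r == p) by rewrite (inj_eq (addIr _)).
rewrite e1 e2; have [->|n1] := eqVneq r p.
  rewrite (negbTE ci) /= subrr; have -> : (p == p - 1) = false by lia.
  by have -> : (p == p + 1) = false by lia.
have [->|n2] := eqVneq r (p - 1).
  rewrite (_ : p - 1 == p + 1 = false); last by lia.
  by rewrite o1; case: ifP => _; case: (occ m _); case: (s).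
have [->|n3] := eqVneq r (p + 1).
  by rewrite addrK o2; case: ifP => _; case: (occ m _); case: (s).
by rewrite !orbF !addbF subrr.
Qed.

Lemma maya_cross i j : i != j -> forall m, opE i (opF j (bas m)) = opF j (opE i (bas m)).
Proof.
move=> ij m.
pose S0 := sites i m ++ sites j m.
pose P := undup (flatten [seq [:: p - 1; p; p + 1] | p <- S0]).
have uP : uniq P by exact: undup_uniq.
have nb p : p \in S0 -> {subset [:: p - 1; p; p + 1] <= P}.
  by move=> h x hx; rewrite mem_undup; apply/flatten_mapP; exists p.
have S0P : {subset S0 <= P} by move=> p h; apply: (nb p h); rewrite !inE eqxx orbT.
have si : {subset sites i m <= P} by move=> p h; apply: S0P; rewrite mem_cat h.
have sj : {subset sites j m <= P} by move=> p h; apply: S0P; rewrite mem_cat h orbT.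
have sfl k p : (k == i) || (k == j) -> p \in S0 -> {subset sites k (fl p m) <= P}.
  move=> hk hp x /sites_fl [|h]; last exact: (nb p hp).
  by case/orP: hk => /eqP ->; [exact: si|exact: sj].
have fS p : indf j m p -> p \in S0.
  by case/and3P => h1 h2 h3; rewrite mem_cat !mem_sites h1 h2 (negbTE h3) orbT.
have eS r : inde i m r -> r \in S0.
  by case/and3P => h1 h2 h3; rewrite mem_cat !mem_sites h1 h3 (negbTE h2).
rewrite (opF_P uP sj) (opE_P uP si) (lin_sum (opEP i)) (lin_sum (opFP j)).
transitivity (\sum_(p <- P) \sum_(r <- P) (if indf j m p && inde i (fl p m) r
   then (q ^ Rr j p m * q ^ (- Ll i r (fl p m))) *: bas (fl r (fl p m)) else 0)).
  apply: eq_bigr => p _; case: ifP => h; last by rewrite (lin_0 (opEP i)) big1.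
  rewrite (lin_Z (opEP i)) (opE_P uP) ?scaler_sumr; last by apply: sfl; rewrite ?eqxx ?fS.
  by apply: eq_bigr => r _; case: ifP => _; rewrite ?scaler0 // scalerA.
transitivity (\sum_(r <- P) \sum_(p <- P) (if inde i m r && indf j (fl r m) p
   then (q ^ (- Ll i r m) * q ^ Rr j p (fl r m)) *: bas (fl p (fl r m)) else 0)); last first.
  apply: eq_bigr => r _; case: ifP => h; last by rewrite (lin_0 (opFP j)) big1.
  rewrite (lin_Z (opFP j)) (opF_P uP) ?scaler_sumr; last by apply: sfl; rewrite ?eqxx ?orbT ?eS.
  by apply: eq_bigr => p _; rewrite andTb; case: (indf j _ p); rewrite ?scaler0 // scalerA.
rewrite exchange_big; apply: eq_bigr => r _; apply: eq_bigr => p _.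
(* Hops at adjacent sites compete for one position, so neither order is possible; otherwise they do
   not interact. *)
have indE : indf j m p && inde i (fl p m) r = inde i m r && indf j (fl r m) p.
  rewrite /indf /inde !occ_fl.
  case: (eqVneq (cl p) j) => [cp|]; last by rewrite andbF.
  case: (eqVneq (cl r) i) => [cr|]; last by rewrite andbF.
  have pr : (p == r) = false by apply/negbTE/eqP => e; move: ij; rewrite -cp -cr e eqxx.
  rewrite /= !(inj_eq (addIr _)) ![r == p]eq_sym pr !orbF /=.
  have [e1|n1] := eqVneq (r - 1) p.
    have -> : (r == p - 1) = false by lia.
    have -> : (p - 1 == r) = false by lia.
    by rewrite -e1; case: (occ m (r - 1)); case: (occ m r); rewrite /= ?andbF.
  have [e2|n2] := eqVneq (p - 1) r.
    rewrite -e2; by case: (occ m (p - 1)); case: (occ m p); rewrite /= ?andbF.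
  by rewrite !addbF; case: (occ m _); case: (occ m _); case: (occ m _); case: (occ m _).
rewrite -indE; case: ifP => // h; have /andP[hf he'] := h; move: h; rewrite indE => /andP[he hf'].
rewrite fl_fl; congr (_ *: _).
have /and3P[/eqP cp op1 op2] := hf; have /and3P[/eqP cr or1 or2] := he.
have pS := fS _ hf; have rS := eS _ he.
have nbp x : x \in [:: p - 1; p; p + 1] -> x \in P by exact: nb.
have nbr x : x \in [:: r - 1; r; r + 1] -> x \in P by exact: nb.
have eL : Ll i r (fl p m) = Ll i r m + (bz ((cl (p - 1) == i) && (p - 1 < r)) + bz ((cl (p + 1) == i) && (p + 1 < r))).
  rewrite /Ll (@hop_sum P true) ?mul1r //; try by apply: nbp; rewrite !inE eqxx ?orbT.
  - by apply: sfl; rewrite ?eqxx.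
  - by rewrite (negbTE op2).
  by rewrite cp eq_sym.
have eR : Rr j p (fl r m) = Rr j p m - (bz ((cl (r - 1) == j) && (p < r - 1)) + bz ((cl (r + 1) == j) && (p < r + 1))).
  rewrite /Rr (@hop_sum P false) ?mulN1r //; try by apply: nbr; rewrite !inE eqxx ?orbT.
  - by apply: sfl; rewrite ?eqxx ?orbT.
  - by rewrite (negbTE or1).
  by rewrite cr.
rewrite eL eR mulrC -!expfzDr ?qv_neq0 //; congr (_ ^ _).
(* The correction to the e-exponent from the f-hop equals that to the f-exponent from the e-hop:
   adjacency of residues and the order of p and r are symmetric conditions. *)
have c1 : (cl (p - 1) == i) = (cl (r + 1) == j) by rewrite clB1 clD1 cp cr subr_eq eq_sym.
have c2 : (cl (p + 1) == i) = (cl (r - 1) == j) by rewrite clB1 clD1 cp cr subr_eq eq_sym.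
have l1 : (p - 1 < r) = (p < r + 1) by rewrite ltrBlDr.
have l2 : (p + 1 < r) = (p < r - 1) by rewrite ltrBrDr.
by rewrite c1 c2 l1 l2 opprD; ring.
Qed.

End MayaCross.

(** * Tuples of Maya diagrams, with concatenated signatures *)

Section Configurations.
Variable n : nat.
Local Notation cl := (cl n).
Implicit Types (m : maya) (i j : node n) (c : seq maya) (s : seq bool).

Definition csg i c : seq bool := flatten [seq msg i m | m <- c].
Fixpoint cput i c s : seq maya :=
  if c is m :: c' then mput i m (take (size (msg i m)) s) :: cput i c' (drop (size (msg i m)) s) else [::].
Definition confwt c : weight n := \sum_(m <- c) mwt n m.

Lemma csg_put i c s : size s = size (csg i c) -> csg i (cput i c s) = s.
Proof.
elim: c s => [|m c IH] s /=; first by move/size0nil.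
rewrite /csg /= size_cat => hs; have h1 : size (take (size (msg i m)) s) = size (msg i m) by rewrite size_takel // hs leq_addr.
by rewrite -/(csg i (cput i c _)) msg_put // IH ?cat_take_drop // size_drop hs addKn.
Qed.
Lemma cput_csg i c : cput i c (csg i c) = c.
Proof. by elim: c => [|m c IH] //=; rewrite take_size_cat // drop_size_cat // mput_msg IH. Qed.
Lemma cput_put i c s s' : size s = size (csg i c) -> size s' = size (csg i c) ->
  cput i (cput i c s) s' = cput i c s'.
Proof.
elim: c s s' => [|m c IH] s s' //=; rewrite /csg /= !size_cat => hs hs'.
have h1 : size (take (size (msg i m)) s) = size (msg i m) by rewrite size_takel // hs leq_addr.
have h2 : size (take (size (msg i m)) s') = size (msg i m) by rewrite size_takel // hs' leq_addr.
by rewrite msg_put // h1 mput_put // IH // size_drop ?hs ?hs' addKn.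
Qed.
Lemma confwt_put i c s : size s = size (csg i c) ->
  confwt (cput i c s) = confwt c + alpha i *~ ((count id s)%:Z - (count id (csg i c))%:Z).
Proof.
rewrite /confwt; elim: c s => [|m c IH] s /=.
  by move/size0nil => ->; rewrite !big_nil subrr mulr0z addr0.
rewrite /csg /= size_cat => hs; have h1 : size (take (size (msg i m)) s) = size (msg i m) by rewrite size_takel // hs leq_addr.
rewrite !big_cons mwt_put // IH; last by rewrite size_drop hs addKn.
rewrite -/(csg i c) count_cat -[in RHS](cat_take_drop (size (msg i m)) s) count_cat addrACA -mulrzDr.
by congr (_ + _ *~ _); lia.
Qed.
Lemma confwt_sg i c : (confwt c).1 i = wts (csg i c).
Proof.
rewrite /confwt; elim: c => [|m c IH]; first by rewrite big_nil /= ffunE.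
by rewrite big_cons wt1D IH /csg /= wts_cat mwt_sg.
Qed.

Definition ccset : cset n := @CSet n (seq maya) csg cput confwt csg_put cput_csg cput_put confwt_put confwt_sg.

End Configurations.

Section WordCat.
Variable Q : qfield.
Local Notation q := (qv Q).
Local Notation W := (freeM Q (seq bool)).
Definition catr (w1 : seq bool) : W -> W := flin (fun s => fbas W (w1 ++ s)).
Definition catl (w2 : seq bool) : W -> W := flin (fun s => fbas W (s ++ w2)).
Lemma catrP w : linear (catr w). Proof. by move=> c x y; exact: flinP. Qed.
Lemma catlP w : linear (catl w). Proof. by move=> c x y; exact: flinP. Qed.
Lemma cns_catr a w y : cns a (catr w y) = catr (a :: w) y.
Proof.
move: y; apply: fmod_ext => [c x y|c x y|s]; rewrite ?catrP ?cnsP //.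
by rewrite /catr !flinb cnsb.
Qed.
Lemma cns_catl a w y : cns a (catl w y) = catl w (cns a y).
Proof.
move: y; apply: fmod_ext => [c x y|c x y|s]; rewrite ?catlP ?cnsP ?catlP //.
by rewrite /catl cnsb !flinb cnsb.
Qed.
Lemma catr_nil y : catr [::] y = y.
Proof. by move: y; apply: fmod_ext => [c x y|//|s]; rewrite ?catrP // /catr flinb. Qed.

Lemma Fb_cat w1 w2 : Fb Q (w1 ++ w2) = catr w1 (Fb Q w2) + q ^ wts w2 *: catl w2 (Fb Q w1).
Proof.
elim: w1 => [|a s IH] /=; first by rewrite catr_nil (lin_0 (catlP w2)) scaler0 addr0.
rewrite IH (lin_D (cnsP a)) (lin_Z (cnsP a)) cns_catr cns_catl (lin_D (catlP w2)) scalerDr addrA; congr (_ + _).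
case: a; last by rewrite (lin_0 (catlP w2)) scaler0.
by rewrite (lin_Z (catlP w2)) /catl flinb scalerA wts_cat addrC expfzDr ?qv_neq0.
Qed.
Lemma Eb_cat w1 w2 : Eb Q (w1 ++ w2) = q ^ (- wts w1) *: catr w1 (Eb Q w2) + catl w2 (Eb Q w1).
Proof.
elim: w1 => [|a s IH].
  by rewrite /= catr_nil (lin_0 (catlP w2)) addr0 (_ : - wts [::] = 0) // expr0z scale1r.
rewrite /= IH (lin_D (cnsP a)) (lin_Z (cnsP a)) cns_catr cns_catl (lin_D (catlP w2)) scalerDr -addrA; congr (_ + _).
  by rewrite scalerA expN_wts_cons.
rewrite (lin_Z (catlP w2)); congr (_ + _); case: a; first by rewrite (lin_0 (catlP w2)).
by rewrite /catl flinb.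
Qed.
End WordCat.

Section ConfigurationCross.
Variables (Q : qfield) (n : nat).
Local Notation q := (qv Q).
Local Notation W := (freeM Q (seq bool)).
Local Notation M := (freeM Q (mcset n)).
Local Notation A := (freeM Q (ccset n)).
Implicit Types (x : M) (y : A) (i j : node n) (la : weight n).

Lemma wv_ind (T : cset n) (P : freeM Q T -> Prop) la : P 0 -> (forall a (x y : freeM Q T), P x -> P y -> P (a *: x + y)) ->
  (forall c, cwt c = la -> P (fbas (freeM Q T) c)) -> forall x : freeM Q T, wv la x -> P x.
Proof.
move=> h0 hl hb x hx; rewrite [x]fsum.
have : all (fun c => cwt c == la) (fsupp x) by apply/allP => c; rewrite fsuppP => /hx ->.
elim: (fsupp x) => [|c r IH]; first by rewrite big_nil.
by rewrite big_cons /= => /andP[/eqP wc hr]; apply: hl; [exact: hb|exact: IH].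
Qed.

Definition tens x y : A := flin (fun m : mcset n => flin (fun c : ccset n => fbas A ((m : maya) :: c)) y) x.
Lemma tens_l y : linear (tens^~ y). Proof. by move=> a x x'; exact: flinP. Qed.
Lemma tens_r x : linear (tens x).
Proof.
move=> a y y'; move: x; apply: fmod_ext => [b x x'|b x x'|m].
- by rewrite tens_l.
- by rewrite !(tens_l _ b x x') scalerDr !scalerA (mulrC a) -!scalerA addrACA -scalerDr.
by rewrite /tens !flinb flinP.
Qed.
Lemma tensb m c : tens (fbas M m) (fbas A c) = fbas A ((m : maya) :: c).
Proof. by rewrite /tens !flinb. Qed.

Lemma Put_catr i m c (x : W) : PutL (T := ccset n) i (m :: c) (catr (msg i m) x) = tens (fbas M m) (PutL (T := ccset n) i c x).
Proof.
move: x; apply: fmod_ext => [a x y|a x y|s].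
- by rewrite catrP PutLP.
- by rewrite PutLP tens_r.
by rewrite /catr flinb !PutLb tensb [put _ _ _]/= take_size_cat // drop_size_cat // mput_msg.
Qed.
Lemma Put_catl i m c (x : W) : sized (size (msg i m)) x ->
  PutL (T := ccset n) i (m :: c) (catl (csg i c) x) = tens (PutL (T := mcset n) i m x) (fbas A c).
Proof.
move: x; apply: sized_ind => [|a x y hx hy|s hs].
- by rewrite (lin_0 (catlP _)) !(lin_0 (PutLP _ _)) (lin_0 (tens_l _)).
- by rewrite catlP !PutLP tens_l hx hy.
by rewrite /catl flinb !PutLb tensb [put _ _ _]/= take_size_cat // drop_size_cat // cput_csg.
Qed.

Lemma opF_tensb i m c : opF (T := ccset n) i (fbas A ((m : maya) :: c)) =
  tens (fbas M m) (opF i (fbas A c)) + q ^ (confwt n c).1 i *: tens (opF i (fbas M m)) (fbas A c).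
Proof.
rewrite /opF !flinb [sg _ _]/= -/(csg i c) Fb_cat (lin_D (PutLP _ _)) (lin_Z (PutLP _ _)) Put_catr Put_catl; last exact: sized_Fb.
by rewrite confwt_sg.
Qed.
Lemma opE_tensb i m c : opE (T := ccset n) i (fbas A ((m : maya) :: c)) =
  q ^ (- (mwt n m).1 i) *: tens (fbas M m) (opE i (fbas A c)) + tens (opE i (fbas M m)) (fbas A c).
Proof.
rewrite /opE !flinb [sg _ _]/= -/(csg i c) Eb_cat (lin_D (PutLP _ _)) (lin_Z (PutLP _ _)) Put_catr Put_catl; last exact: sized_Eb.
by rewrite mwt_sg.
Qed.

Lemma opF_tens i la x y : wv la y -> opF i (tens x y) = tens x (opF i y) + q ^ la.1 i *: tens (opF i x) y.
Proof.
move: y; apply: wv_ind => [|a y y' hy hy'|c wc].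
- by rewrite (lin_0 (opFP i)) !(lin_0 (tens_r _)) (lin_0 (opFP i)) scaler0 addr0.
- by rewrite opFP !tens_r opFP hy hy' !scalerDr !scalerA (mulrC a) addrACA.
move: x; apply: fmod_ext => [a x x'|a x x'|m].
- by rewrite tens_l opFP.
- by rewrite opFP !tens_l !scalerDr !scalerA (mulrC a) addrACA.
by rewrite tensb opF_tensb -wc.
Qed.
Lemma opE_tens i la x y : wv la x -> opE i (tens x y) = q ^ (- la.1 i) *: tens x (opE i y) + tens (opE i x) y.
Proof.
move: x; apply: wv_ind => [|a x x' hy hy'|m wc].
- by rewrite (lin_0 (opEP i)) !(lin_0 (tens_l _)) (lin_0 (opEP i)) scaler0 addr0.
- by rewrite opEP !tens_l opEP hy hy' !scalerDr !scalerA (mulrC a) addrACA.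
move: y; apply: fmod_ext => [a x x'|a x x'|c].
- by rewrite tens_r opEP.
- by rewrite opEP !tens_r !scalerDr !scalerA (mulrC a) addrACA.
by rewrite tensb opE_tensb -wc.
Qed.

(** Induction on the tuple by the coproduct: the cross terms acquire q to the powers <alpha_i^vee,
    alpha_j> and <alpha_j^vee, alpha_i>, equal by symmetry of the Cartan matrix. *)
Lemma conf_cross i j : i != j -> forall c, opE i (opF j (fbas A c)) = opF j (opE i (fbas A c)).
Proof.
move=> ij; elim=> [|m c IH].
  by rewrite /opF /opE !flinb /= !(lin_0 (PutLP _ _)) !linear0.
have wm : wv (mwt n m) (fbas M m) := @wvb Q n (mcset n) m.
have wc : wv (confwt n c) (fbas A c) := @wvb Q n (ccset n) c.
rewrite -tensb (opF_tens j _ wc) (opE_tens i _ wm) !(lin_D (opEP i)) !(lin_D (opFP j)) (lin_Z (opEP i)) (lin_Z (opFP j)) (opE_tens i _ wm) (opE_tens i _ (wv_opF (i := j) wm)) (opF_tens j _ wc) (opF_tens j _ (wv_opE (i := i) wc)).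
rewrite IH (maya_cross Q ij).
have -> : (mwt n m - alpha j).1 i = (mwt n m).1 i - (alpha j).1 i by rewrite wt1D wt1N.
have -> : (confwt n c + alpha i).1 j = (confwt n c).1 j + (alpha i).1 j by rewrite wt1D.
rewrite (alpha_sym j i); move: ((mwt n m).1 i) ((confwt n c).1 j) ((alpha j).1 i) => u v w.
move: (tens _ _) (tens _ _) (tens _ _) (tens _ _) => t1 t2 t3 t4.
rewrite opprB !expfzDr ?qv_neq0 // -!invr_expz.
have hq k : q ^ k != 0 :> Q by rewrite expfz_neq0 // qv_neq0.
move: (q ^ u) (q ^ v) (q ^ w) (hq u) (hq v) (hq w) => qu qv' qw h1 h2 h3.
have e : qv' * (qw / qu) = qu^-1 * (qv' * qw) by rewrite mulrA [RHS]mulrC.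
by rewrite !scalerDr !scalerA e -!addrA; congr (_ + _); rewrite addrCA.
Qed.

End ConfigurationCross.

Section Concatenation.
Variable n : nat.
Local Notation T := (ccset n).
Local Notation cl := (cl n).
Local Notation fo := (fo (T := T)).
Local Notation eo := (eo (T := T)).
Local Notation cph := (cph (T := T)).
Local Notation cep := (cep (T := T)).
Implicit Types (i j : node n) (c d : seq maya) (p : int).

Lemma csg_cat i c d : csg i (c ++ d) = csg i c ++ csg i d.
Proof. by rewrite /csg map_cat flatten_cat. Qed.
Lemma cput_cat i c d s t : size s = size (csg i c) -> cput i (c ++ d) (s ++ t) = cput i c s ++ cput i d t.
Proof.
elim: c s => [|m c IH] s /=; first by move/size0nil ->.
rewrite /csg /= size_cat => hs; have le : (size (msg i m) <= size s)%N by rewrite hs leq_addr.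
rewrite takel_cat // drop_cat; case: ltnP => h; first by rewrite IH // size_drop hs addKn.
have e : size (msg i m) = size s by apply/eqP; rewrite eqn_leq le.
have h0 : size (csg i c) = 0%N by move: hs; rewrite e -/(csg i c); lia.
by rewrite e subnn drop0 drop_size -(IH [::]) // h0.
Qed.
Lemma cph_cat i c d : cph i (c ++ d) = (cph i c + (cph i d - cep i c))%N.
Proof. by rewrite /cph [sg _ _]csg_cat ph_cat. Qed.
Lemma cep_cat i c d : cep i (c ++ d) = (cep i d + (cep i c - cph i d))%N.
Proof. by rewrite /cep [sg _ _]csg_cat ep_cat. Qed.
Lemma fo_cat i c d : (0 < cph i (c ++ d))%N -> fo i (c ++ d) =
  if (cph i d <= cep i c)%N then fo i c ++ d else c ++ fo i d.
Proof.
rewrite /cph /fo [sg _ _]csg_cat => /fw_cat ->; rewrite -/(cph i d) -/(cep i c).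
by case: ifP => _; rewrite [put _ _ _]cput_cat ?size_fw // cput_csg.
Qed.
Lemma eo_cat i c d : (0 < cep i (c ++ d))%N -> eo i (c ++ d) =
  if (cph i d < cep i c)%N then eo i c ++ d else c ++ eo i d.
Proof.
rewrite /cep /eo [sg _ _]csg_cat => /ew_cat ->; rewrite -/(cph i d) -/(cep i c).
by case: ifP => _; rewrite [put _ _ _]cput_cat ?size_ew // cput_csg.
Qed.
Lemma size_cput i c s : size (cput i c s) = size c.
Proof. by elim: c s => //= m c IH s; rewrite IH. Qed.
Lemma confwt_cat c d : confwt n (c ++ d) = confwt n c + confwt n d.
Proof. by rewrite /confwt big_cat. Qed.

Definition vac p : maya := (p, fset0).
Definition bv (cs : seq int) : seq maya := map vac cs.

Lemma occ_vac p x : occ (vac p) x = (x < p). Proof. by rewrite /occ /= in_fset0 addbF. Qed.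
Lemma sites_vac i p : sites i (vac p) = if cl p == i then [:: p] else [::].
Proof.
apply: lt_sorted_eq; [exact: sites_sorted|by case: ifP|move=> x].
rewrite mem_sites !occ_vac; have -> : ((x - 1 < p) != (x < p)) = (x == p).
  by apply/idP/eqP => [|->]; lia.
case: (eqVneq x p) => [->|ne]; rewrite ?andbT ?andbF; first by case: ifP; rewrite ?inE ?eqxx.
by case: ifP; rewrite ?inE // (negbTE ne).
Qed.
Lemma msg_vac i p : msg i (vac p) = nseq (cl p == i) true.
Proof. by rewrite /msg sites_vac; case: ifP => //= _; rewrite occ_vac; congr [:: _]; lia. Qed.
Lemma mwt_vac p : mwt n (vac p) = Lam (cl p).
Proof. by rewrite /mwt /= big_seq_fset0 addr0. Qed.
Lemma csg_bv i cs : csg i (bv cs) = nseq (count (fun p => cl p == i) cs) true.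
Proof. by elim: cs => //= p cs IH; rewrite /csg /= -/(csg i (bv cs)) msg_vac IH; case: (cl p == i). Qed.
Lemma ph_nseq k : ph (nseq k true) = k. Proof. by elim: k => //= k ->. Qed.
Lemma ep_nseq k : ep (nseq k true) = 0%N. Proof. by elim: k. Qed.
Lemma cph_bv i cs : cph i (bv cs) = count (fun p => cl p == i) cs.
Proof. by rewrite /cph [sg _ _]csg_bv ph_nseq. Qed.
Lemma cep_bv i cs : cep i (bv cs) = 0%N.
Proof. by rewrite /cep [sg _ _]csg_bv ep_nseq. Qed.
Lemma confwt_bv cs : confwt n (bv cs) = \sum_(p <- cs) Lam (cl p).
Proof. by rewrite /confwt big_map; apply: eq_bigr => p _; rewrite mwt_vac. Qed.
Lemma confwt_bv2 cs : (confwt n (bv cs)).2 = 0.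
Proof. by rewrite confwt_bv; elim: cs => [|p cs IH]; rewrite ?big_nil // big_cons /= IH. Qed.
Lemma opE_bv (Q : qfield) i cs : opE i (fbas (freeM Q T) (bv cs)) = 0.
Proof.
rewrite /opE flinb [sg _ _]csg_bv.
have -> : Eb Q (nseq (count (fun p => cl p == i) cs) true) = 0; last exact: (lin_0 (PutLP _ _)).
by elim: (count _ _) => //= k ->; rewrite (lin_0 (@cnsP Q true)) scaler0 addr0.
Qed.

(** Linear input for a combinatorial fact: e_i kills f_j^(k) of a vacuum tuple, and this vector
    reduces modulo q to the configuration in question. *)
Lemma cep_comm_vac (Q : qfield) i j js k : i != j -> (k <= cph j (bv js))%N ->
  cep i (iter k (fo j) (bv js)) = 0%N.
Proof.
move=> ij lek; pose b := fbas (freeM Q T) (bv js).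
have kfmod l : (l <= cph j (bv js))%N -> cqm (iter l (kf j) b - fbas (freeM Q T) (iter l (fo j) (bv js))).
  elim: l => [|l IH] lel; first by rewrite subrr; exact: cqm0.
  have := kf_modb j (IH (ltnW lel)); have [-> _ _ _] := iter_foP (ltnW lel).
  by rewrite subn_gt0 lel.
have hY := kfmod k lek; rewrite iter_kf_dF in hY; last exact: opE_bv.
have ey : opE i (dF j k b) = 0.
  rewrite /dF (lin_Z (opEP i)); have -> : opE i (iter k (opF j) b) = iter k (opF j) (opE i b).
    by elim: k {lek hY} => //= k IH; rewrite (opEF_cross (@conf_cross Q n)) // IH.
  by rewrite opE_bv (lin_0 (iterF_lin (Q := Q) j k)) scaler0.
apply: (opE0_ep ey); apply: (@cqm_bas_neq0 Q n T).
have hr := creg_mod hY (cregb _ _); exact: cqm_trans (Th_mod i hr) hY.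
Qed.

End Concatenation.

(** * The string property of generalized Demazure subsets *)

Section StringProperty.
Variables (Q : qfield) (n : nat).
Local Notation T := (ccset n).
Local Notation cl := (cl n).
Local Notation fo := (fo (T := T)).
Local Notation eo := (eo (T := T)).
Local Notation cph := (cph (T := T)).
Local Notation cep := (cep (T := T)).
Implicit Types (i j : node n) (c x y z : seq maya) (S : seq maya -> Prop) (cs : seq int).

Lemma size_fo i c : size (fo i c) = size c. Proof. exact: size_cput. Qed.
Lemma size_eo i c : size (eo i c) = size c. Proof. exact: size_cput. Qed.
Lemma size_iter_fo i k c : size (iter k (fo i) c) = size c.
Proof. by elim: k => //= k <-; rewrite size_fo. Qed.

(** The steps building generalized Demazure subsets: apply F_i, or append one vacuum diagram on the
    right. *)
Inductive op := OF of node n | OA of int.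
Definition app_set (d : int) S c' := exists2 c, S c & c' = c ++ [:: vac d].
Definition op_set (o : op) S : seq maya -> Prop :=
  match o with OF i => FS (T := T) i S | OA d => app_set d S end.
Definition ops_set (os : seq op) S := foldr op_set S os.

Lemma op_ext o S S' : (forall c, S c <-> S' c) -> forall c, op_set o S c <-> op_set o S' c.
Proof.
move=> h c; case: o => [i|d] /=; split.
- by move=> [d [k [/h s le ->]]]; exists d, k.
- by move=> [d [k [/h s le ->]]]; exists d, k.
- by move=> [x /h hx ->]; exists x.
by move=> [x /h hx ->]; exists x.
Qed.
Lemma ops_ext os S S' : (forall c, S c <-> S' c) -> forall c, ops_set os S c <-> ops_set os S' c.
Proof. by move=> h; elim: os => //= o os IH; exact: op_ext. Qed.

Section Prefix.
Variable nu : seq int.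
(** Vacua placed on the left have [cep] = 0, so the tensor rule sends every operator to the right
    part as long as that part can move; extra vacua thus do not disturb a set. *)
Definition pref S S' := (forall x, S x <-> S' (bv nu ++ x)) /\ (forall x, S' x -> (size nu <= size x)%N).

Lemma iter_fo_cat_vac i k x : (k <= cph i x)%N -> iter k (fo i) (bv nu ++ x) = bv nu ++ iter k (fo i) x.
Proof.
elim: k => // k IH lek; rewrite iterS IH ?(ltnW lek) //; have [h _ _ _] := iter_foP (ltnW lek).
have h' : (0 < cph i (iter k (fo i) x))%N by rewrite h subn_gt0.
rewrite fo_cat; last by rewrite cph_cat cep_bv subn0 addn_gt0 h' orbT.
by rewrite cep_bv leqNgt h'.
Qed.
Lemma iter_eo_cat_vac i k x : (k <= cep i x)%N -> iter k (eo i) (bv nu ++ x) = bv nu ++ iter k (eo i) x.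
Proof.
elim: k => // k IH lek; rewrite iterS IH ?(ltnW lek) //; have [_ h _ _] := iter_eoP (ltnW lek).
rewrite eo_cat; last by rewrite cep_cat cep_bv sub0n addn0 h subn_gt0.
by rewrite cep_bv.
Qed.

Lemma pref_ops os S S' : pref S S' -> pref (ops_set os S) (ops_set os S').
Proof.
move=> hS; elim: os => //= o os [IH1 IH2]; case: o => [i|d] /=; split.
- move=> x; split.
    move=> [c [k [/IH1 hc lek ->]]]; exists (bv nu ++ c), k; split=> //; last by rewrite iter_fo_cat_vac.
    by rewrite cph_cat cep_bv subn0; apply: leq_trans (leq_addl _ _).
  move=> [c' [k [hc lek e]]]; have [_ h2 h3 _] := iter_foP lek.
  have le : (k <= cep i x)%N.
    by have := cep_cat i (bv nu) x; rewrite cep_bv sub0n addn0 => <-; rewrite e h2 leq_addl.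
  exists (iter k (eo i) x), k; have [p1 _ p3 _] := iter_eoP le; split; rewrite ?p3 ?p1 ?leq_addl //.
  by apply/IH1; rewrite -iter_eo_cat_vac // e h3.
- by move=> x [c [k [/IH2 hc _ ->]]]; rewrite size_iter_fo.
- move=> x; split; first by move=> [c /IH1 hc ->]; exists (bv nu ++ c) => //; rewrite catA.
  move=> [c hc e]; have hs := IH2 _ hc.
  have sx : (size nu <= size c)%N := hs.
  have e1 : bv nu = take (size nu) c.
    have := congr1 (take (size nu)) e; rewrite takel_cat ?size_map // take_oversize ?size_map // => ->.
    by rewrite takel_cat.
  exists (drop (size nu) c); first by apply/IH1; rewrite e1 cat_take_drop.
  have := congr1 (drop (size nu)) e; rewrite drop_cat size_map ltnn subnn drop0 => ->.
  rewrite drop_cat; case: ltnP => // h; have -> : size nu = size c by apply/eqP; rewrite eqn_leq sx.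
  by rewrite subnn drop0 drop_size.
by move=> x [c /IH2 hc ->]; rewrite size_cat; apply: leq_trans (leq_addr _ _).
Qed.
End Prefix.

(** * Transport of subsets between highest weight configurations of equal weight *)

Section Transport.
Variables (c0 c1 : seq maya) (K : nat).
Hypothesis e0 : forall i, opE i (fbas (freeM Q T) c0) = 0.
Hypothesis e1 : forall i, opE i (fbas (freeM Q T) c1) = 0.
Hypothesis w01 : confwt n c0 = confwt n c1.
Hypothesis s0 : size c0 = K.
Hypothesis s1 : size c1 = K.
Local Notation th := (theta (@conf_cross Q n) c0 c1).
(** The isomorphism acts on the first K diagrams only; those appended later are common to both
    sides. *)
Definition thc x x' := exists y y' z, [/\ th y y', size y = K, size y' = K, x = y ++ z & x' = y' ++ z].

Lemma thc_ph i x x' : thc x x' -> cph i x = cph i x' /\ cep i x = cep i x'.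
Proof.
move=> [y [y' [z [h _ _ -> ->]]]]; have [h1 h2] := theta_ph e0 e1 w01 i h.
by rewrite !cph_cat !cep_cat h1 h2.
Qed.
Lemma thc_wt x x' : thc x x' -> confwt n x = confwt n x'.
Proof.
move=> [y [y' [z [h _ _ -> ->]]]]; rewrite !confwt_cat; congr (_ + _).
exact: (@theta_wt Q n T (@conf_cross Q n) c0 c1 w01 y y' h).
Qed.
Lemma thc_inj x y x' : thc x x' -> thc y x' -> x = y.
Proof.
move=> [a [a' [z [h1 h2 h3 -> ->]]]] [b [b' [t [g1 g2 g3 ->]]]] /eqP.
rewrite eqseq_cat ?h3 ?g3 // => /andP[/eqP e /eqP ->]; congr (_ ++ _); apply/eqP.
by rewrite (theta_eq e0 e1 w01 h1 g1) e.
Qed.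
Lemma thc_fo i x x' : thc x x' -> (0 < cph i x)%N -> thc (fo i x) (fo i x').
Proof.
move=> h hp; have [e _] := thc_ph i h; have hp' := hp; rewrite e in hp'.
case: h e hp hp' => y [y' [z [h h2 h3 -> ->]]] e hp hp'; have [p1 p2] := theta_ph e0 e1 w01 i h.
rewrite !fo_cat // p2; case: ifP => hc; last by exists y, y', (fo i z).
exists (fo i y), (fo i y'), z; rewrite !size_fo; split=> //.
apply: (theta_fo e0 e1 w01 i h).2; move: hp; rewrite cph_cat p2; lia.
Qed.
Lemma thc_eo i x x' : thc x x' -> (0 < cep i x)%N -> thc (eo i x) (eo i x').
Proof.
move=> h hp; have [_ e] := thc_ph i h; have hp' := hp; rewrite e in hp'.
case: h e hp hp' => y [y' [z [h h2 h3 -> ->]]] e hp hp'; have [p1 p2] := theta_ph e0 e1 w01 i h.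
rewrite !eo_cat // p2; case: ifP => hc; last by exists y, y', (eo i z).
exists (eo i y), (eo i y'), z; rewrite !size_eo; split=> //.
by apply: (theta_eo e0 e1 w01 i h).2; rewrite p2; lia.
Qed.
Lemma thc_iter_fo i k x x' : thc x x' -> (k <= cph i x)%N -> thc (iter k (fo i) x) (iter k (fo i) x').
Proof.
move=> h; elim: k => // k IH lek; rewrite !iterS; apply: thc_fo; first by apply: IH; lia.
by have [-> _ _ _] := iter_foP (ltnW lek); rewrite subn_gt0.
Qed.

Lemma thc_ops os : (forall x, ops_set os (eq c0) x -> exists2 x', ops_set os (eq c1) x' & thc x x') /\
  (forall x', ops_set os (eq c1) x' -> exists2 x, ops_set os (eq c0) x & thc x x').
Proof.
elim: os => [|o os [IH1 IH2]] /=.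
  by split=> _ <-; [exists c1|exists c0] => //; exists c0, c1, [::]; rewrite !cats0; split=> //; exact: theta_base.
case: o => [i|d] /=; split.
- move=> x [c [k [hc lek ->]]]; have [c' hc' ht] := IH1 _ hc.
  exists (iter k (fo i) c'); last exact: thc_iter_fo.
  by exists c', k; split=> //; have [<- _] := thc_ph i ht.
- move=> x [c [k [hc lek ->]]]; have [c' hc' ht] := IH2 _ hc; have [e _] := thc_ph i ht.
  exists (iter k (fo i) c'); last by apply: thc_iter_fo; rewrite ?e.
  by exists c', k; rewrite e.
- move=> x [c hc ->]; have [c' hc' [y [y' [z [h1 h2 h3 e1' e2']]]]] := IH1 _ hc.
  exists (c' ++ [:: vac d]); first by exists c'.
  by exists y, y', (z ++ [:: vac d]); rewrite e1' e2' !catA.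
move=> x [c hc ->]; have [c' hc' [y [y' [z [h1 h2 h3 e1' e2']]]]] := IH2 _ hc.
exists (c' ++ [:: vac d]); first by exists c'.
by exists y, y', (z ++ [:: vac d]); rewrite e1' e2' !catA.
Qed.

Lemma good_transport os i x x' : thc x x' -> ops_set os (eq c0) x ->
  ((0 < cep i x')%N -> ops_set os (eq c1) (eo i x')) ->
  ((0 < cep i x')%N -> (0 < cph i x')%N -> ops_set os (eq c1) (fo i x')) ->
  ((0 < cep i x)%N -> ops_set os (eq c0) (eo i x)) /\
  ((0 < cep i x)%N -> (0 < cph i x)%N -> ops_set os (eq c0) (fo i x)).
Proof.
move=> ht hx he hf; have [p1 p2] := thc_ph i ht; rewrite -p1 -p2 in he hf.
split=> [h|h1 h2].
  have [y hy ht'] := (thc_ops os).2 _ (he h); have := thc_eo ht h.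
  by move=> ht2; rewrite (thc_inj ht2 ht').
have [y hy ht'] := (thc_ops os).2 _ (hf h1 h2); have := thc_fo ht h2.
by move=> ht2; rewrite (thc_inj ht2 ht').
Qed.

End Transport.

Lemma iter_fo_lev i c a : (a <= cph i c)%N -> (confwt n (iter a (fo i) c)).2 = (confwt n c).2 - (2 * a)%:Z.
Proof.
elim: a => [|a IH] le; first by rewrite subr0.
have [h _ _ _] := iter_foP (ltnW le).
have [_ _ _ e] := @foP n T i (iter a (fo i) c) ltac:(by rewrite h subn_gt0).
have {e}e : confwt n (fo i (iter a (fo i) c)) = confwt n (iter a (fo i) c) - alpha i := e.
by rewrite iterS e wt2B IH ?(ltnW le) //; lia.
Qed.

(** * Separating the block on which the innermost F_j acts *)

Section Splitting.
Variables (j : node n) (js rest : seq int) (N : nat).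
Hypothesis jsj : all (fun p => cl p == j) js.
Hypothesis restj : all (fun p => cl p != j) rest.
Hypothesis restN : forall i, i != j -> (N <= count (fun p => cl p == i) rest)%N.
Local Notation M := (size js).
Local Notation Y k := (iter k (fo j) (bv js)).
Local Notation lev x := (confwt n x).2.

Lemma cph_js : cph j (bv js) = M.
Proof. by rewrite cph_bv; apply/eqP; rewrite -all_count. Qed.
Lemma cph_rest : cph j (bv rest) = 0%N.
Proof. by rewrite cph_bv; apply/eqP; rewrite -leqn0 leqNgt -has_count -all_predC. Qed.
Lemma YP k : (k <= M)%N -> [/\ cph j (Y k) = (M - k)%N, cep j (Y k) = k & lev (Y k) = - (2 * k)%:Z].
Proof.
rewrite -cph_js => le; have [-> -> _ _] := iter_foP le; rewrite cep_bv; split=> //.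
by rewrite iter_fo_lev // confwt_bv2 sub0r.
Qed.
Lemma Y_cep i k : i != j -> (k <= M)%N -> cep i (Y k) = 0%N.
Proof. by move=> ij le; apply: (cep_comm_vac Q) => //; rewrite cph_js. Qed.

(** Each f lowers the level by 2 and any coroot pairing by at most 2, starting from level 0 and
    pairings at least N; appending vacua only increases the pairings. *)
Lemma rest_inv os z : ops_set os (eq (bv rest)) z -> forall i, i != j -> N%:Z + lev z <= (confwt n z).1 i.
Proof.
elim: os z => [|o os IH] z /=.
  by move=> <- i ij; rewrite confwt_bv2 addr0 confwt_sg csg_bv wtsE ph_nseq ep_nseq; have := restN ij; lia.
case: o => [k|d] /=; last first.
  move=> [c /IH hc ->] i ij; have := hc i ij; rewrite confwt_cat wt1D.
  have -> : (confwt n c + confwt n [:: vac d]).2 = lev c + lev [:: vac d] by [].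
  rewrite (confwt_bv2 n [:: d]) (confwt_bv n [:: d]) big_seq1 /= ffunE.
  by case: (i == _) => /=; lia.
move=> [c [a [/IH hc le ->]]] i ij; elim: a le => [|a IHa] le; first exact: hc.
have pos : (0 < cph k (iter a (fo k) c))%N by have [-> _ _ _] := iter_foP (ltnW le); rewrite subn_gt0.
have [_ _ _ h] := foP pos; have := IHa (ltnW le).
have {h} h : confwt n (fo k (iter a (fo k) c)) = confwt n (iter a (fo k) c) - alpha k := h.
rewrite iterS h wt2B; have -> : (confwt n (iter a (fo k) c) - alpha k).1 i = (confwt n (iter a (fo k) c)).1 i - (alpha k).1 i by rewrite wt1D wt1N.
move: (confwt n _) => z0; have [->|ki] := eqVneq (i : node n) k; first by rewrite alpha_diag; move: (z0.1 _ : int) (z0.2 : int) => u v; lia.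
by have := alpha_off ki; move: (z0.1 _ : int) (z0.2 : int) ((alpha k).1 i : int) => u v w; lia.
Qed.

Lemma rest_ph os z i : ops_set os (eq (bv rest)) z -> i != j -> - N%:Z < lev z -> (0 < cph i z)%N.
Proof.
move=> /rest_inv h /h {h}; have h : (confwt n z).1 i = _ := cwt_diag (T := T) i z.
by rewrite h; move: (confwt n z) => la; lia.
Qed.

Lemma lev_cat x y : lev (x ++ y) = lev x + lev y. Proof. by rewrite confwt_cat. Qed.

Lemma fo_right i x y : (cep i x < cph i y)%N -> fo i (x ++ y) = x ++ fo i y.
Proof. by move=> h; rewrite fo_cat ?cph_cat; [rewrite leqNgt h|lia]. Qed.
Lemma fo_left i x y : (cph i y <= cep i x)%N -> (0 < cph i x)%N -> fo i (x ++ y) = fo i x ++ y.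
Proof. by move=> h h'; rewrite fo_cat ?cph_cat; [rewrite h|lia]. Qed.
Lemma iter_right i x y a b : (cep i x + a <= cph i y - b)%N ->
  iter a (fo i) (x ++ iter b (fo i) y) = x ++ iter (a + b) (fo i) y.
Proof.
elim: a => [|a IH] h //; rewrite iterS IH; last by lia.
by have [e _ _ _] := @iter_foP n T i y (a + b) ltac:(lia); rewrite fo_right // e; lia.
Qed.
Lemma iter_left k z l : (cph j z <= k)%N -> (k + l <= M)%N -> iter l (fo j) (Y k ++ z) = Y (k + l) ++ z.
Proof.
move=> h; elim: l => [|l IH] le; first by rewrite addn0.
rewrite iterS IH ?addnS; last by lia.
by have [h1 h2 _] := @YP (k + l) ltac:(lia); rewrite fo_left ?h1 ?h2 //; lia.
Qed.

(** The difficulty is i = j, where the tensor rule may send f_j to the left block; the remedy is to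
    start from a different power of f_j on that block. *)
Lemma split_sup os k z : (k <= M)%N -> ops_set os (eq (bv rest)) z ->
  ops_set os (FS (T := T) j (eq (bv (js ++ rest)))) (Y k ++ z).
Proof.
elim: os k z => [|o os IH] k z le /=.
  move=> <-; exists (bv (js ++ rest)), k; rewrite /bv map_cat -!/(bv _); split=> //.
    by rewrite cph_cat cep_bv cph_rest cph_js addn0.
  by rewrite (@iter_left 0) // cph_rest.
case: o => [i|d] /=; last by move=> [c hc ->]; exists (Y k ++ c); [exact: IH|rewrite catA].
move=> [z1 [a [hz le_a ->]]]; have [ej|ij] := eqVneq i j; last first.
  exists (Y k ++ z1), a; split; first exact: IH.
    by rewrite cph_cat Y_cep // subn0; lia.
  by have := @iter_right i (Y k) z1 a 0; rewrite addn0 => -> //; rewrite Y_cep //; lia.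
rewrite {i}ej in le_a *; have [hk1 hk2 _] := YP le.
have [->|a_gt0] := posnP a; first by exists (Y k ++ z1), 0%N; split=> //; exact: IH.
case: (leqP a (cph j z1 - k)) => ha.
  exists (Y k ++ z1), a; split; first exact: IH.
    by rewrite cph_cat hk2; lia.
  by have := @iter_right j (Y k) z1 a 0; rewrite addn0 => -> //; rewrite hk2; lia.
(* With this smaller k' exactly a applications of f_j go to the right, and the remaining k - k' then
   go to the left. *)
pose k' := (cph j z1 - a)%N; have lek' : (k' <= M)%N by rewrite /k'; lia.
have [h1 h2 _] := YP lek'; have [z2 _ _ _] := iter_foP le_a.
exists (Y k' ++ z1), (k - k' + a)%N; split; first exact: IH.
  by rewrite cph_cat h1 h2 /k'; lia.
rewrite iterD; have := @iter_right j (Y k') z1 a 0; rewrite addn0 => ->; last by rewrite h2 /k'; lia.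
by rewrite iter_left ?z2 //; [congr (iter _ _ _ ++ _); rewrite /k'; lia|rewrite /k'; lia].
Qed.

(** Above level -N the right part has positive [cph i] for each i different from j, and the left
    block has [cep i] = 0, so f_i never acts on the left block. *)
Lemma split_sub os x : ops_set os (FS (T := T) j (eq (bv (js ++ rest)))) x -> - N%:Z < lev x ->
  exists k z, [/\ (k <= M)%N, ops_set os (eq (bv rest)) z & x = Y k ++ z].
Proof.
elim: os x => [|o os IH] x /=.
  move=> [c [k [<- le ->]]] _; rewrite /bv map_cat -!/(bv _) in le *.
  rewrite cph_cat cep_bv cph_rest cph_js addn0 in le.
  by exists k, (bv rest); rewrite (@iter_left 0) // cph_rest.
case: o => [i|d] /=; last first.
  move=> [c hc ->]; rewrite lev_cat (confwt_bv2 n [:: d]) addr0 => hl.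
  have [k [z [le hz ->]]] := IH _ hc hl; exists k, (z ++ [:: vac d]); rewrite catA; split=> //.
  by exists z.
move=> [c [a [hc le_a ->]]]; rewrite iter_fo_lev // => hl.
have [k [z [le hz ec]]] := IH _ hc ltac:(lia); rewrite {c hc}ec in le_a hl *.
suff : exists k' b, [/\ (k' <= M)%N, (b <= cph i z)%N & iter a (fo i) (Y k ++ z) = Y k' ++ iter b (fo i) z].
  by move=> [k' [b [h1 h2 ->]]]; exists k', (iter b (fo i) z); split=> //; exists z, b.
have [ej|ij] := eqVneq i j.
  rewrite {i}ej in le_a *; elim: a le_a {hl} => [|a IHa] le_a; first by exists k, 0%N.
  have [k' [b [h1 h2 h3]]] := IHa (ltnW le_a).
  have [p _ _ _] := iter_foP (ltnW le_a); have [f1 f2 _ _] := iter_foP h2.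
  have [y1 y2 _] := YP h1; move: p; rewrite h3 cph_cat f1 y1 y2 => p; rewrite iterS h3.
  case: (leqP (cph j z - b) k') => hb.
    by exists k'.+1, b; rewrite fo_left ?f1 ?y1 ?y2 //; [split=> //; lia|lia].
  by exists k', b.+1; rewrite fo_right ?f1 ?y2 //; split=> //; lia.
suff h b : (b <= a)%N -> (b <= cph i z)%N /\ iter b (fo i) (Y k ++ z) = Y k ++ iter b (fo i) z.
  by have [h1 h2] := h a (leqnn _); exists k, a.
elim: b => [|b IHb] leb //; have [h1 h2] := IHb (ltnW leb).
have pos : (0 < cph i (iter b (fo i) z))%N.
  apply: (@rest_ph (OF i :: os)) => //; first by exists z, b.
  have hY : lev (Y k) <= 0 by have [_ _ ->] := YP le; lia.
  by rewrite iter_fo_lev //; move: hl; rewrite lev_cat; lia.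
have [f1 _ _ _] := iter_foP h1; rewrite f1 in pos.
by rewrite !iterS h2 fo_right; [split=> //; lia|rewrite Y_cep // f1].
Qed.

Lemma split_good os x i : (forall i, good (T := T) (ops_set os (eq (bv rest))) i) ->
  let S := ops_set os (FS (T := T) j (eq (bv (js ++ rest)))) in S x -> - N%:Z < lev x ->
  ((0 < cep i x)%N -> S (eo i x)) /\ ((0 < cep i x)%N -> (0 < cph i x)%N -> S (fo i x)).
Proof.
move=> gZ S hx hl; have [k [z [le hz e]]] := split_sub hx hl; rewrite {x hx}e in hl *.
have lz : - N%:Z < lev z.
  have hY : lev (Y k) <= 0 by have [_ _ ->] := YP le; lia.
  by move: hl; rewrite lev_cat; lia.
have [g1 g2] := gZ i; have [ej|ij] := eqVneq i j; last first.
  have Yc := Y_cep ij le; rewrite cep_cat Yc sub0n addn0; have pz := rest_ph hz ij lz.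
  split=> [h|h _].
    by rewrite eo_cat ?cep_cat ?Yc ?addn0 // ltn0; apply: split_sup => //; apply: g1.
  by rewrite fo_right ?Yc //; apply: split_sup => //; apply: g2.
rewrite {i}ej in g1 g2 *; have [y1 y2 _] := YP le; rewrite cep_cat cph_cat y1 y2; split=> [h|h h'].
  rewrite eo_cat ?cep_cat ?y2 //; case: ltnP => hk.
    case: k le {y1 y2 hl h} hk => [|k] le hk //; rewrite iterS.
    have [y1 _ _] := YP (ltnW le).
    by have [_ _ -> _] := @foP n T j (Y k) ltac:(rewrite y1; lia); apply: split_sup => //; lia.
  by apply: split_sup => //; apply: g1 => //; lia.
case: (leqP (cph j z) k) => hk.
  by rewrite fo_left ?y1 ?y2 //; [apply: (@split_sup os k.+1) => //; lia|lia].
by rewrite fo_right ?y2 //; apply: split_sup => //; apply: g2 => //; lia.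
Qed.

End Splitting.

(** Induction on the number of steps by removing the innermost one. An appended vacuum joins the
    initial tuple; an F_j is isolated on a block of residue j, after adding and permuting vacua, and
    the rest is covered by induction. *)
Lemma ops_set_good os cs i : good (T := T) (ops_set os (eq (bv cs))) i.
Proof.
move: {2}(size os) (leqnn (size os)) cs i => m; elim: m os => [|m IHm] os.
  by case: os => // _ cs i; split=> c /= <-; rewrite cep_bv.
case/lastP: os => [|os o]; first by move=> _ cs i; split=> c /= <-; rewrite cep_bv.
rewrite size_rcons ltnS => les cs i.
have eS S : ops_set (rcons os o) S = ops_set os (op_set o S) by rewrite /ops_set foldr_rcons.
case: o eS => [j|d] eS; last first.
  rewrite eS; have [g1 g2] := IHm os les (cs ++ [:: d]) i.
  have h c : ops_set os (op_set (OA d) (eq (bv cs))) c <-> ops_set os (eq (bv (cs ++ [:: d]))) c.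
    apply: ops_ext => x /=; rewrite /bv map_cat; split; first by move=> [y <- ->].
    by move=> <-; exists (bv cs).
  by split=> c /h hc p; [|move=> p']; apply/h; [apply: g1|apply: g2].
suff key x : ops_set (rcons os (OF j)) (eq (bv cs)) x ->
    ((0 < cep i x)%N -> ops_set (rcons os (OF j)) (eq (bv cs)) (eo i x)) /\
    ((0 < cep i x)%N -> (0 < cph i x)%N -> ops_set (rcons os (OF j)) (eq (bv cs)) (fo i x)).
  by split=> c /key [h1 h2].
(* N exceeds the depth of the one element x under study, which is all that the level condition in
   the splitting asks for. *)
move=> hx; pose N := (absz (confwt n x).2).+1.
(* N vacua of every residue, prepended so that each residue other than j occurs at least N times in
   the right part. *)
pose nu := flatten (nseq N [seq Posz k | k <- iota 0 n.+2]).
pose js := [seq p <- nu ++ cs | cl p == j]; pose rest := [seq p <- nu ++ cs | cl p != j].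
have jsj : all (fun p => cl p == j) js by exact: filter_all.
have restj : all (fun p => cl p != j) rest by exact: filter_all.
have restN k : k != j -> (N <= count (fun p => cl p == k) rest)%N.
  move=> kj; rewrite count_filter; rewrite (eq_count (a2 := fun p => cl p == k)); last first.
    by move=> p /=; case: eqVneq => [->|] //.
  rewrite count_cat; apply: leq_trans (leq_addr _ _); rewrite /nu.
  have hr : has (fun p => cl p == k) [seq Posz k | k <- iota 0 n.+2].
    rewrite has_map; apply/hasP; exists (k : nat); first by rewrite mem_iota ltn_ord.
    by rewrite /preim /cl inE /= -pmulrn; apply/eqP; exact: natr_Zp.
  move: (map _ _) hr => r hr.
  elim: (N) => // N' IH; rewrite [flatten _]/= count_cat -[N'.+1]add1n; apply: leq_add => //.
  by rewrite -has_count.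
have pnu : pref nu (eq (bv cs)) (eq (bv (nu ++ cs))).
  split=> y; rewrite /bv map_cat; last by move=> <-; rewrite size_cat size_map leq_addr.
  by split=> [-> //|/eqP]; rewrite eqseq_cat // eqxx /= => /eqP.
have [pr1 _] := pref_ops (rcons os (OF j)) pnu.
have cx : cep i (bv nu ++ x) = cep i x by rewrite cep_cat cep_bv sub0n addn0.
have hx' : ops_set (rcons os (OF j)) (eq (bv (nu ++ cs))) (bv nu ++ x) by apply/pr1.
have pe : perm_eq (nu ++ cs) (js ++ rest) by rewrite perm_sym; apply/permPl; exact: perm_filterC.
have w01 : confwt n (bv (nu ++ cs)) = confwt n (bv (js ++ rest)) by rewrite !confwt_bv; apply: perm_big.
have s1 : size (bv (nu ++ cs)) = size (nu ++ cs) by rewrite size_map.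
have s2 : size (bv (js ++ rest)) = size (nu ++ cs) by rewrite size_map (perm_size pe).
have E0 cs' k : opE k (fbas (freeM Q T) (bv cs')) = 0 by exact: opE_bv.
have [x' hx1 ht] := (thc_ops (E0 _) (E0 _) w01 s1 s2 (rcons os (OF j))).1 _ hx'.
have lx' : - N%:Z < (confwt n x').2.
  rewrite -(thc_wt w01 ht) confwt_cat.
  have -> : (confwt n (bv nu) + confwt n x).2 = (confwt n (bv nu)).2 + (confwt n x).2 by [].
  by rewrite confwt_bv2 /N; move: (confwt n x).2 => z; lia.
have := @split_good j js rest N jsj restj restN os x' i (IHm os les rest).
rewrite eS in hx1; move=> /(_ hx1 lx'); rewrite -eS => -[h1 h2].
have [t1 t2] := good_transport (E0 _) (E0 _) w01 s1 s2 ht hx' h1 h2.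
split=> [p|p p'].
  by apply/pr1; have := @iter_eo_cat_vac nu i 1 x p => /= <-; apply: t1; rewrite cx.
apply/pr1; have := @iter_fo_cat_vac nu i 1 x p' => /= <-; apply: t2; first by rewrite cx.
by rewrite cph_cat cep_bv subn0 addn_gt0 p' orbT.
Qed.

End StringProperty.

(** * The diagram rotation on configurations *)

Section Rotation.
Variable n : nat.
Local Notation T := (ccset n).
Local Notation cl := (cl n).
Implicit Types (i : node n) (m : maya) (p : int) (c : seq maya) (la : weight n).

Lemma tau_zmod : zmod_morphism (@tau_weight n).
Proof. by move=> la mu; rewrite /tau_weight; congr (_, _); apply/ffunP => j; rewrite !ffunE. Qed.
Lemma tau_weightD la mu : tau_weight (la + mu) = tau_weight la + tau_weight mu.
Proof. exact: (zmorphD tau_zmod). Qed.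
Lemma tau_weightN la : tau_weight (- la) = - tau_weight la.
Proof. exact: (zmorphN tau_zmod). Qed.
Lemma tau_weight0 : tau_weight (0 : weight n) = 0.
Proof. exact: (zmorph0 tau_zmod). Qed.
Lemma tau_weight_Lam i : tau_weight (Lam i) = Lam (i + 1).
Proof. by rewrite /tau_weight /Lam; congr (_, _); apply/ffunP => j; rewrite !ffunE subr_eq. Qed.
Lemma tau_weight_delta k : tau_weight (delta_frac n k) = delta_frac n k.
Proof. by rewrite /tau_weight /delta_frac; congr (_, _); apply/ffunP => j; rewrite !ffunE. Qed.
Lemma tau_weightMn la k : tau_weight (la *+ k) = tau_weight la *+ k.
Proof. by rewrite !pmulrn (zmorph_mulz tau_zmod). Qed.
Lemma tau_weightMz la (k : int) : tau_weight (la *~ k) = tau_weight la *~ k.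
Proof. exact: (zmorph_mulz tau_zmod). Qed.

Definition sh m : maya := (m.1 + 1, [fset (p + 1)%R | p in m.2]%fset).
Definition csh c := map sh c.

Lemma occ_sh m p : occ (sh m) p = occ m (p - 1).
Proof.
rewrite /occ /= ltrBlDr; congr (_ (+) _); apply/imfsetP/idP => [[r /= hr ->]|h]; first by rewrite addrK.
by exists (p - 1); rewrite ?subrK.
Qed.
Lemma sites_sh i m : sites (i + 1) (sh m) = [seq p + 1 | p <- sites i m].
Proof.
apply: lt_sorted_eq; first exact: sites_sorted.
  by rewrite sorted_map; apply: sub_sorted (sites_sorted i m) => x y; rewrite /= ltrD2r.
move=> p; rewrite mem_sites !occ_sh; apply/idP/mapP => [h|[r hr ->]].
  exists (p - 1); last by rewrite subrK.
  by rewrite mem_sites clB1 subr_eq.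
by move: hr; rewrite mem_sites clD1 (inj_eq (addIr 1)) addrK.
Qed.
Lemma msg_sh i m : msg (i + 1) (sh m) = msg i m.
Proof. by rewrite /msg sites_sh -map_comp; apply: eq_map => p /=; rewrite occ_sh addrK. Qed.
Lemma mput_sh i m s : mput (i + 1) (sh m) s = sh (mput i m s).
Proof.
apply: maya_ext => // p; rewrite occ_sh !occ_put /pval sites_sh.
have inj : injective (fun p : int => p + 1) by exact: addIr.
have e r : r - 1 \in sites i m = (r \in [seq p + 1 | p <- sites i m]) by rewrite -(mem_map inj) subrK.
have ei r : index r [seq p + 1 | p <- sites i m] = index (r - 1) (sites i m) by rewrite -[RHS](index_map inj) /= subrK.
by rewrite -!e !ei !occ_sh addrK subrK.
Qed.
Lemma mwt_sh m : mwt n (sh m) = tau_weight (mwt n m).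
Proof.
rewrite (@mwtE n (sh m) [seq p + 1 | p <- (m.2 : seq int)]); last 2 first.
- by rewrite map_inj_uniq ?fset_uniq //; exact: addIr.
- by move=> x /imfsetP [p /= hp ->]; exact: map_f.
rewrite /mwt tau_weightD tau_weight_Lam [(sh m).1]/= clD1; congr (_ + _); rewrite big_map.
have -> : forall r : seq int, tau_weight (\sum_(p <- r) eps n m.1 p *~ (bz (occ m p) - bz (p < m.1))) =
    \sum_(p <- r) tau_weight (eps n m.1 p) *~ (bz (occ m p) - bz (p < m.1)).
  by elim=> [|p r IH]; rewrite ?big_nil ?tau_weight0 // !big_cons tau_weightD IH tau_weightMz.
apply: eq_bigr => p _; rewrite occ_sh addrK ltrD2r; congr (_ *~ _).
rewrite /eps tau_weightD tau_weightN tau_weight_delta tau_weightD tau_weightN !tau_weight_Lam !clD1.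
by congr (_ - delta_frac n (2 * _)); rewrite opprD addrACA subrr addr0.
Qed.

Lemma csg_sh i c : csg (i + 1) (csh c) = csg i c.
Proof. by rewrite /csg -map_comp; congr flatten; apply: eq_map => m /=; exact: msg_sh. Qed.
Lemma cput_sh i c s : cput (i + 1) (csh c) s = csh (cput i c s).
Proof. by elim: c s => //= m c IH s; rewrite msg_sh mput_sh IH. Qed.
Lemma cph_sh i c : cph (T := T) (i + 1) (csh c) = cph (T := T) i c.
Proof. by rewrite /cph [sg _ _]csg_sh. Qed.
Lemma fo_sh i c : fo (T := T) (i + 1) (csh c) = csh (fo (T := T) i c).
Proof. by rewrite /fo [sg _ _]csg_sh [put _ _ _]cput_sh. Qed.
Lemma confwt_sh c : confwt n (csh c) = tau_weight (confwt n c).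
Proof.
rewrite /confwt big_map; elim: c => [|m c IH]; first by rewrite !big_nil tau_weight0.
by rewrite !big_cons IH tau_weightD mwt_sh.
Qed.
Lemma csh_bv cs : csh (bv cs) = bv [seq p + 1 | p <- cs].
Proof.
rewrite /csh /bv -!map_comp; apply: eq_map => p /=; rewrite /sh /vac /=; congr (_, _).
by apply/fsetP => x; rewrite in_fset0; apply/negbTE/imfsetP => -[].
Qed.
Lemma sh_inj : injective sh.
Proof.
move=> m m' e; apply: maya_ext; first by have := congr1 fst e; move/addIr.
by move=> p; have := congr1 (fun z => occ z (p + 1)) e; rewrite !occ_sh addrK.
Qed.
Lemma csh_inj : injective csh. Proof. exact: inj_map sh_inj. Qed.

Definition shop (o : op n) : op n := match o with OF i => OF (i + 1) | OA d => OA n (d + 1) end.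
Definition shset (S : seq maya -> Prop) c' := exists2 c, S c & c' = csh c.

Lemma iter_fo_sh i k c : iter k (fo (T := T) (i + 1)) (csh c) = csh (iter k (fo (T := T) i) c).
Proof. elim: k => // k IH; rewrite !iterS IH; exact: fo_sh. Qed.
Lemma shset_ops os S c : shset (ops_set os S) c <-> ops_set (map shop os) (shset S) c.
Proof.
elim: os c => //= o os IH c; have h := op_ext (shop o) IH; rewrite -h {h}.
case: o => [i|d] /=; split.
- move=> [x [y [k [hy le ->]]] ->]; exists (csh y), k; rewrite cph_sh iter_fo_sh; split=> //.
  by exists y.
- move=> [x [k [[y hy ->] le ->]]]; rewrite cph_sh in le; rewrite iter_fo_sh.
  by exists (iter k (fo (T := T) i) y) => //; exists y, k.
- move=> [x [y hy ->] ->]; exists (csh y); first by exists y.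
  by rewrite /csh map_cat; congr (_ ++ _); have := csh_bv [:: d].
move=> [x [y hy ->] ->]; exists (y ++ [:: vac d]); first by exists y.
by rewrite /csh map_cat; congr (_ ++ _); have := csh_bv [:: d].
Qed.

End Rotation.

(** * Embedding an irreducible highest weight module *)

Section ModuleEmbedding.
Variables (n : nat) (U : uqmod n).
Implicit Types (la : weight n) (h : coweight n) (i j : node n) (v x : U).
Local Notation Q := Qqf.

Lemma pairing_addr h la mu : pairing h (la + mu) = pairing h la + pairing h mu.
Proof.
rewrite /pairing mulrDr addrACA -big_split /=; congr (_ + _).
by apply: eq_bigr => i _; rewrite ffunE mulrDr.
Qed.
Lemma pairing_oppr h la : pairing h (- la) = - pairing h la.
Proof.
rewrite /pairing mulrN opprD -sumrN; congr (_ + _).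
by apply: eq_bigr => i _; rewrite ffunE mulrN.
Qed.
Lemma pairing_oppl h la : pairing (- h) la = - pairing h la.
Proof.
rewrite /pairing mulNr opprD -sumrN; congr (_ + _).
by apply: eq_bigr => i _; rewrite ffunE mulNr.
Qed.
Lemma pairing_sep la mu : la != mu -> exists h, pairing h la != pairing h mu.
Proof.
have [e|ne _] := eqVneq la.2 mu.2.
  move=> ne; suff [i hi] : exists i, la.1 i != mu.1 i by exists (coroot i); rewrite !pairing_coroot.
  apply: NNPP => h; case/eqP: ne; rewrite [la]surjective_pairing [mu]surjective_pairing e; congr (_, _).
  by apply/ffunP => i; apply/eqP/negPn/negP => hi; apply: h; exists i.
exists (0, 1); rewrite /pairing !big1; last 2 first.
- by move=> i _; rewrite ffunE mul0r.
- by move=> i _; rewrite ffunE mul0r.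
by rewrite !add0r !mul1r.
Qed.

Lemma qq_neq0 : qq != 0. Proof. exact: (qv_neq0 Q). Qed.

Lemma weight_vec_indep (s : seq (weight n * U)) la x :
  (forall p, List.In p s -> weight_vec p.1 p.2 /\ p.1 != la) -> weight_vec la x ->
  x + \sum_(p <- s) p.2 = 0 -> x = 0.
Proof.
move: {2}(size s) (erefl (size s)) => N; elim: N s x => [|N IH] [|[mu y] s] x //=.
  by rewrite big_nil addr0.
move=> [sz] hs hx; have [hy ne] := hs (mu, y) (or_introl erefl).
(* The operator D kills the component of weight mu and scales the others, which shortens the
   relation. *)
have [h hh] := pairing_sep ne; pose D (z : U) := uq_t h z - qq ^ pairing h mu *: z.
rewrite big_cons /= => e; pose a := qq ^ pairing h la - qq ^ pairing h mu.
have Dw nu (z : U) : weight_vec nu z -> D z = (qq ^ pairing h nu - qq ^ pairing h mu) *: z.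
  by move=> hz; rewrite /D hz scalerBl.
have DD (z1 z2 : U) : D (z1 + z2) = D z1 + D z2 by rewrite /D linearD scalerDr opprD addrACA.
have a0 : a != 0.
  rewrite subr_eq0; apply/eqP => ea; have := @expz_inj Q _ _ ea => ee.
  by rewrite ee eqxx in hh.
suff : a *: x = 0 by move/eqP; rewrite scaler_eq0 (negbTE a0) => /eqP.
apply: (IH [seq (p.1, D p.2) | p <- s]); first by rewrite size_map.
- move=> p /List.in_map_iff [p' [<- hp]]; have [h1 h2] := hs p' (or_intror hp); split=> //=.
  by rewrite (Dw _ _ h1) => h'; rewrite linearZ /= h1 !scalerA mulrC.
- by move=> h'; rewrite linearZ /= hx !scalerA mulrC.
rewrite big_map /= -(Dw la x hx).
have -> : \sum_(p <- s) D p.2 = D (\sum_(p <- s) p.2).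
  elim: (s) => [|p r IHr]; first by rewrite !big_nil /D linear0 scaler0 subr0.
  by rewrite !big_cons DD IHr.
have Dy : D y = 0 by rewrite (Dw _ _ hy) subrr scale0r.
have D0 : D 0 = 0 by rewrite /D linear0 scaler0 subr0.
by have := D0; rewrite -[X in D X]e; rewrite (DD x) (DD y) Dy add0r.
Qed.

Definition umod : premod Q n.
Proof.
refine (@PreMod Q n (uq_space U) (fun i => uq_e i) (fun i => uq_f i) (@weight_vec n U) _ _ _ _ _ _).
- by move=> la h; rewrite linear0 scaler0.
- by move=> la c x y hx hy h; rewrite linearP /= hx hy scalerDr !scalerA mulrC.
- move=> la i x hx h; rewrite uq_te hx linearZ /= scalerA pairing_addr expfzDr ?qq_neq0 //.
  by rewrite mulrC.
- move=> la i x hx h; rewrite uq_tf hx linearZ /= scalerA pairing_addr pairing_oppr expfzDr ?qq_neq0 //.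
  by rewrite mulrC.
- move=> la i j x hx; have := uq_ef i j x; rewrite -[X in _ = X + _](subrK (uq_e i (uq_f j x))).
  move/eqP; rewrite subr_eq => /eqP ->; rewrite addrC; rewrite [X in _ = X + _](_ : _ = uq_f j (uq_e i x)); last by rewrite subrK.
  congr (_ + _); case: eqP => _; last by rewrite scale0r.
  by rewrite !hx pairing_oppl pairing_coroot -scalerBl scalerA mulrC.
move=> s us hs e p ps; apply: (@weight_vec_indep [seq p' <- s | p'.1 != p.1] p.1 p.2); [|exact: hs|].
  move=> p' hp'; have {hp'} [h1 h2] : List.In p' s /\ p'.1 != p.1.
    by move: hp'; rewrite -[filter _ _]/(List.filter (fun p' => p'.1 != p.1) s) => /List.filter_In.
  by split=> //; exact: hs.
rewrite -[RHS]e big_filter.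
elim: s us ps {hs e} => [|p0 s IH] //= /andP[p0s us] [ep|ps].
  rewrite !big_cons ep eqxx /=; congr (_ + _); rewrite ep in p0s.
  elim: s p0s {IH us} => [|p1 s IH] /=; first by rewrite !big_nil.
  by rewrite inE negb_or eq_sym => /andP[h1 h2]; rewrite !big_cons h1 IH.
rewrite !big_cons; have -> : p0.1 != p.1.
  apply: contraNneq p0s => ->; apply/mapP.
  by elim: s ps {IH us} => //= p1 s IH [->|/IH [p2 h ->]]; [exists p|exists p2]; rewrite ?inE ?eqxx ?h ?orbT.
by rewrite addrCA IH.
Defined.

End ModuleEmbedding.

Section Embedding.
Variables (n : nat) (U : uqmod n) (La : weight n) (u : U).
Hypothesis hU : irr_integrable_hw La u.
Local Notation Q := Qqf.
Variables (T : cset n) (c0 : T).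
Local Notation A := (freeM Q T).
Local Notation bas := (fbas A).
Hypothesis cross : forall i j, i != j -> forall c, opE i (opF j (bas c)) = opF j (opE i (bas c)).
Hypothesis e0 : forall i, opE i (bas c0) = 0.
Hypothesis w0 : cwt c0 = La.
Hypothesis Sgood : forall w i, good (Sw c0 w) i.
Local Notation UM := (umod U).
Local Notation AM := (amod cross).
Local Notation PM := (prodmod UM AM).
Local Notation u2 := ((u, bas c0) : PM).
Local Notation gen2 := (@gen Q n PM La u2).
Local Notation WP := (weight n * PM)%type.
Implicit Types (i : node n) (la : weight n) (v : U) (y : A) (p : PM) (d : WP) (s : seq WP).

Lemma u_neq0 : u <> 0. Proof. by case: hU => _ _ []. Qed.
Lemma u2_wt : pwv La u2.
Proof. by split; [case: hU => _ _ []|rewrite /= -w0; exact: wvb]. Qed.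
Lemma u2_e i : pe i u2 = 0.
Proof. by transitivity ((uq_e i u, opE i (bas c0)) : PM) => //; rewrite e0; case: hU => _ _ [_ _ ->]. Qed.
Lemma gen2_wt la p : gen2 la p -> weight_vec la p.1 /\ wv la p.2.
Proof. by move=> h; exact: (gen_wt u2_wt h). Qed.

Lemma gen2_form la p p' : gen2 la p -> gen2 la p' -> (forall i, opE i p.2 = 0) -> la <> La -> form p'.2 p.2 = 0.
Proof.
move=> hp hp' he ne; have : la = la by []; move: hp'; have := (gen2_wt hp).2.
move: {2 4}la => mu wp hp'; elim: hp' wp => {mu p'} [|mu|mu a x x' _ IHx _ IHx'|mu i x hx IHx] wp e.
- by case: ne.
- by rewrite form0l.
- by rewrite [(_ : PM).2]/(a *: x.2 + x'.2) form_linl IHx // IHx' // mulr0 addr0.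
by rewrite [(_ : PM).2]/(opF i x.2) (form_adj _ _ wp) he form0r mulr0.
Qed.

Lemma gen2_e la i p : gen2 la p -> gen2 (la + alpha i) (pe i p).
Proof. by move=> h; exact: (gen_e u2_wt u2_e i h). Qed.

Lemma gen2_La p : gen2 La p -> exists a, p.1 = a *: u /\ p.2 = a *: bas c0.
Proof.
move=> h; have [->|[_ /(_ erefl) [_ [a ->]]]] := gen_top h; last by exists a.
by exists 0; rewrite !scale0r.
Qed.

(** Induction on depth: all e_i p.2 vanish by induction, so below the top p.2 is orthogonal to every
    f_i-image of its weight, itself included, and the form is anisotropic. *)
Lemma gen2_zero1 la p : gen2 la p -> p.1 = 0 -> p.2 = 0.
Proof.
have [m hm] : exists m : nat, La.2 - la.2 <= m%:Z by exists (absz (La.2 - la.2)); lia.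
have top mu (p' : PM) : gen2 mu p' -> p'.1 = 0 -> mu.2 = La.2 -> p'.2 = 0.
  move=> hp hz h2; have [->|[_ /(_ h2) [e _]]] := gen_top hp; first by [].
  rewrite e in hp; have [a [h ->]] := gen2_La hp; move/eqP: h; rewrite hz eq_sym scaler_eq0.
  by case/orP => [/eqP ->|/eqP /u_neq0 //]; rewrite scale0r.
elim: m la p hm => [|m IH] la p hm hp hz; have [->|[h1 _]] := gen_top hp; try by [].
  by apply: top hp hz _; lia.
have [e|ne] := eqVneq la.2 La.2; first exact: top hp hz e.
apply: form_eq0; apply: (gen2_form hp hp) => [i|e]; last by rewrite e eqxx in ne.
apply: (IH (la + alpha i) (pe i p)); first by rewrite wt2D; lia.
  exact: gen2_e.
have -> : (pe i p).1 = uq_e i p.1 by [].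
by rewrite hz linear0.
Qed.

Lemma bas_scale a c : a *: bas c = 0 -> a = 0.
Proof. by move/(congr1 (fun y => fcf y c)); rewrite fcfZ fcfb eqxx mulr1 fcf0. Qed.
Lemma irr_all (W : U -> Prop) : submodule W -> W u -> forall v, W v.
Proof. by move=> hW wu; case: hU => [[_ /(_ W hW) [h|//]] _ _]; case: u_neq0; exact: h. Qed.

Lemma span_submodule (R : weight n -> PM -> Prop) :
  (forall la p, R la p -> gen2 la p) -> (forall la (a : Q) p, R la p -> R la (a *: p)) ->
  (forall la i p, R la p -> R (la + alpha i) (pe i p)) -> (forall la i p, R la p -> R (la - alpha i) (pf i p)) ->
  submodule (fun v => exists s : seq WP, (forall d, List.In d s -> R d.1 d.2) /\ v = \sum_(d <- s) d.2.1).
Proof.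
move=> Rg RZ Re Rf.
have mapP (g : WP -> WP) (s : seq WP) :
    (forall d, R d.1 d.2 -> R (g d).1 (g d).2) -> (forall d, List.In d s -> R d.1 d.2) ->
    forall d, List.In d (map g s) -> R d.1 d.2.
  by move=> hg hs d /List.in_map_iff [d' [<- /hs /hg]].
split.
- by exists [::]; rewrite big_nil.
- move=> a x y [s [hs ->]] [s' [hs' ->]].
  exists ([seq ((d.1, (a : Q) *: d.2) : WP) | d <- s] ++ s'); split.
    by move=> d /List.in_app_iff [|/hs' //]; apply: mapP => // d'; exact: RZ.
  by rewrite big_cat big_map scaler_sumr.
- move=> i x [s [hs ->]]; exists [seq ((d.1 + alpha i, pe i d.2) : WP) | d <- s]; split.
    by apply: mapP => // d'; exact: Re.
  by rewrite big_map linear_sum.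
- move=> i x [s [hs ->]]; exists [seq ((d.1 - alpha i, pf i d.2) : WP) | d <- s]; split.
    by apply: mapP => // d'; exact: Rf.
  by rewrite big_map linear_sum.
move=> h x [s [hs ->]]; exists [seq ((d.1, (qq ^ pairing h d.1 : Q) *: d.2) : WP) | d <- s]; split.
  by apply: mapP => // d'; exact: RZ.
rewrite big_map linear_sum; elim: s hs => [|d s IH] hs; first by rewrite !big_nil.
rewrite !big_cons IH; last by move=> d' h'; apply: hs; right.
by congr (_ + _); have [-> _] := gen2_wt (Rg _ _ (hs d (or_introl erefl))).
Qed.

Lemma gen_component la v s : weight_vec la v -> (forall d, List.In d s -> gen2 d.1 d.2) ->
  v = \sum_(d <- s) d.2.1 -> v = \sum_(d <- s | d.1 == la) d.2.1.
Proof.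
move=> hv hs ev; apply/eqP; rewrite -subr_eq0; apply/eqP.
apply: (@weight_vec_indep n U [seq (d.1, - d.2.1) | d <- [seq d <- s | d.1 != la]] la) => //.
- move=> d /List.in_map_iff [d' [<-]]; rewrite -[filter _ _]/(List.filter (fun d => d.1 != la) s).
  by move/List.filter_In => [/hs h1 h2]; split=> // k; rewrite linearN /= (gen2_wt h1).1 scalerN.
- have : weight_vec la (\sum_(d <- s | d.1 == la) d.2.1).
    elim: s hs {ev} => [|d s IH] hs; first by move=> k; rewrite big_nil linear0 scaler0.
    have {}IH := IH (fun d' h => hs d' (or_intror h)); rewrite big_cons; case: eqP => // <- in IH * => k.
    by rewrite linearD /= IH (gen2_wt (hs d (or_introl erefl))).1 scalerDr.
  by move=> h k; rewrite linearB /= hv h scalerBr.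
by rewrite big_map sumrN big_filter {1}ev (bigID (fun d => d.1 == la)) /= -addrA -opprD subrr.
Qed.

(** First entries of pairs with second entry 0 span a submodule of U; it does not contain u, so by
    irreducibility it is 0. *)
Lemma gen2_zero2 la p : gen2 la p -> p.2 = 0 -> p.1 = 0.
Proof.
move=> hp hz; pose R mu (p' : PM) := gen2 mu p' /\ p'.2 = 0.
have sub : submodule (fun v => exists s : seq WP, (forall d, List.In d s -> R d.1 d.2) /\ v = \sum_(d <- s) d.2.1).
  apply: span_submodule => [mu p' []|mu a p' [h e]|mu i p' [h e]|mu i p' [h e]] //; split.
  - exact: genZ.
  - by have -> : (a *: p').2 = a *: p'.2 by []; rewrite e scaler0.
  - exact: gen2_e.
  - by have -> : (pe i p').2 = opE i p'.2 by []; rewrite e (lin_0 (opEP i)).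
  - exact: gen_f.
  by have -> : (pf i p').2 = opF i p'.2 by []; rewrite e (lin_0 (opFP i)).
case: hU => [[_ /(_ _ sub) [h|h]] _ [_ uw _]].
  by apply: h; exists [:: ((la, p) : WP)]; rewrite big_seq1; split=> // d' [<-|//].
have [s [hs us]] := h u; case: u_neq0.
rewrite (gen_component uw (fun d h => (hs d h).1) us).
elim: s hs {us} => [|d s IH] hs; first by rewrite big_nil.
rewrite big_cons IH; last by move=> d' h'; apply: hs; right.
case: eqP => // e; have [h1 h2] := hs d (or_introl erefl); rewrite e in h1.
have [a [-> h3]] := gen2_La h1; rewrite h3 in h2.
by rewrite (bas_scale h2) scale0r addr0.
Qed.

Definition gsum s := forall d, List.In d s -> gen2 d.1 d.2.

Lemma gen2_sum la s : gsum s -> gen2 la (\sum_(d <- s | d.1 == la) d.2).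
Proof.
elim: s => [|d s IH] hs; first by rewrite big_nil; exact: gen_0.
have h : gen2 la (\sum_(d <- s | d.1 == la) d.2) by apply: IH => d' h'; apply: hs; right.
by rewrite big_cons; case: eqP => [e|_] //; apply: genD => //; rewrite -e; apply: hs; left.
Qed.

Lemma gsum_merge s : gsum s -> exists s' : seq WP,
  [/\ uniq (map fst s'), gsum s', {subset map fst s' <= map fst s} & \sum_(d <- s) d.2 = \sum_(d <- s') d.2].
Proof.
move: {2}(size s) (leqnn (size s)) => m; elim: m s => [|m IH] [|d s] //= sz hs.
- by exists [::].
- by exists [::].
have hs2 : gsum [seq d' <- s | d'.1 != d.1].
  move=> d'; rewrite -[filter _ _]/(List.filter (fun d' => d'.1 != d.1) s) => /List.filter_In [h _].
  by apply: hs; right.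
have [|s' [us' hs' sub e]] := IH _ _ hs2; first by rewrite size_filter; apply: leq_trans (count_size _ _) _.
have dn : d.1 \notin map fst s'.
  apply/negP => /sub /mapP [d']; rewrite mem_filter => /andP[ne _] e'; by rewrite e' eqxx in ne.
exists ((d.1, \sum_(d' <- d :: s | d'.1 == d.1) d'.2) :: s'); split=> /=.
- by rewrite dn.
- by move=> d' [<-|/hs' //]; apply: gen2_sum.
- move=> la; rewrite !inE => /orP[->//|/sub /mapP [d']]; rewrite mem_filter => /andP[_ h] ->.
  by rewrite (map_f fst h) orbT.
rewrite big_cons [in RHS]big_cons /= -e big_filter big_cons eqxx -addrA; congr (_ + _).
by rewrite (bigID (fun d' => d'.1 == d.1)).
Qed.

Lemma gsum_split (M : premod Q n) (f : PM -> M) s : (forall la p, gen2 la p -> pwv la (f p)) ->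
  (forall la p, gen2 la p -> f p = 0 -> p = 0) ->
  uniq (map fst s) -> gsum s -> \sum_(d <- s) f d.2 = 0 -> forall d, List.In d s -> d.2 = 0.
Proof.
move=> fw f0 us hs e d ds; apply: (f0 _ _ (hs _ ds)).
apply: (@pwv_indep Q n M [seq (d.1, f d.2) | d <- s] _ _ _ (d.1, f d.2)).
- by rewrite -map_comp (eq_map (g := fst)).
- by move=> d' /List.in_map_iff [d1 [<- /hs /fw]].
- by rewrite big_map.
by apply/List.in_map_iff; exists d.
Qed.
Lemma gsum0 s : (forall d, List.In d s -> d.2 = 0) -> \sum_(d <- s) d.2 = 0.
Proof.
elim: s => [|d s IH] h; rewrite ?big_nil // big_cons (h d (or_introl erefl)) IH ?addr0 // => d' h'.
by apply: h; right.
Qed.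
Lemma gsum_zero s : gsum s -> \sum_(d <- s) d.2.1 = 0 <-> \sum_(d <- s) d.2.2 = 0.
Proof.
move=> hs; have [s' [us' hs' _ e]] := gsum_merge hs.
have e1 : \sum_(d <- s) d.2.1 = \sum_(d <- s') d.2.1 by have := congr1 fst e; rewrite !sum_pair.
have e2 : \sum_(d <- s) d.2.2 = \sum_(d <- s') d.2.2 by have := congr1 snd e; rewrite !sum_pair.
rewrite e1 e2; split=> h.
  suff: \sum_(d <- s') d.2 = 0 by rewrite sum_pair => -[].
  apply: gsum0; apply: (@gsum_split UM fst) h => // la p; first by case/gen2_wt.
  by move=> /gen2_zero1; case: p => x y /= h1 h2; rewrite h2 h1.
suff: \sum_(d <- s') d.2 = 0 by rewrite sum_pair => -[].
apply: gsum0; apply: (@gsum_split AM snd) h => // la p; first by case/gen2_wt.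
by move=> /gen2_zero2; case: p => x y /= h1 h2; rewrite h2 h1.
Qed.

(** The graph of the embedding: it is total by irreducibility, and single-valued and injective by
    the two vanishing lemmas applied weight by weight. *)
Definition Rel v y := exists2 s, gsum s & v = \sum_(d <- s) d.2.1 /\ y = \sum_(d <- s) d.2.2.

Lemma Rel_total v : exists y, Rel v y.
Proof.
have sub : submodule (fun v => exists s : seq WP, gsum s /\ v = \sum_(d <- s) d.2.1).
  by apply: (span_submodule (R := gen2)) => // *; [exact: genZ|exact: gen2_e|exact: gen_f].
have [|s [hs ->]] := irr_all sub _ v; last by exists (\sum_(d <- s) d.2.2), s.
exists [:: ((La, u2) : WP)]; rewrite big_seq1; split=> // d [<-|//]; exact: gen_u.
Qed.
Lemma Rel_lin a v v' y y' : Rel v y -> Rel v' y' -> Rel (a *: v + v') (a *: y + y').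
Proof.
move=> [s hs [-> ->]] [s' hs' [-> ->]]; exists ([seq ((d.1, (a : Q) *: d.2) : WP) | d <- s] ++ s').
  move=> d /List.in_app_iff [/List.in_map_iff [d' [<- /hs h]]|/hs' //]; exact: genZ.
by rewrite !big_cat !big_map !scaler_sumr.
Qed.
Lemma Rel_e i v y : Rel v y -> Rel (uq_e i v) (opE i y).
Proof.
move=> [s hs [-> ->]]; exists [seq ((d.1 + alpha i, pe i d.2) : WP) | d <- s].
  by move=> d /List.in_map_iff [d' [<- /hs h]]; exact: gen2_e.
by rewrite !big_map linear_sum (lin_sum (opEP i)).
Qed.
Lemma Rel_f i v y : Rel v y -> Rel (uq_f i v) (opF i y).
Proof.
move=> [s hs [-> ->]]; exists [seq ((d.1 - alpha i, pf i d.2) : WP) | d <- s].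
  by move=> d /List.in_map_iff [d' [<- /hs h]]; exact: gen_f.
by rewrite !big_map linear_sum (lin_sum (opFP i)).
Qed.
Lemma Rel_0 v y : Rel v y -> v = 0 <-> y = 0.
Proof. by move=> [s hs [-> ->]]; exact: gsum_zero. Qed.
Lemma Rel_uniq v y y' : Rel v y -> Rel v y' -> y = y'.
Proof.
move=> h h'; have := Rel_0 (Rel_lin (-1) h' h); rewrite !scaleN1r addNr => -[/(_ erefl) e _].
by apply/eqP; rewrite -subr_eq0 addrC; apply/eqP.
Qed.
Definition emb v : A := epsilon (inhabits 0) (Rel v).
Lemma embR v : Rel v (emb v). Proof. by apply: epsilon_spec; exact: Rel_total. Qed.
Lemma emb_lin : linear emb.
Proof. by move=> a v v'; apply: Rel_uniq (embR _) (Rel_lin a (embR v) (embR v')). Qed.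
Lemma emb_e i v : emb (uq_e i v) = opE i (emb v).
Proof. exact: Rel_uniq (embR _) (Rel_e i (embR v)). Qed.
Lemma emb_f i v : emb (uq_f i v) = opF i (emb v).
Proof. exact: Rel_uniq (embR _) (Rel_f i (embR v)). Qed.
Lemma emb_eq0 v : emb v = 0 -> v = 0.
Proof. by move=> h; exact/(Rel_0 (embR v)).2. Qed.
Lemma emb_inj v v' : emb v = emb v' -> v = v'.
Proof.
move=> h; apply/eqP; rewrite -subr_eq0; apply/eqP/emb_eq0.
by rewrite (lin_B emb_lin) h subrr.
Qed.
Lemma emb_gen la p : gen2 la p -> emb p.1 = p.2.
Proof.
move=> h; apply: Rel_uniq (embR _) _; exists [:: ((la, p) : WP)]; last by rewrite !big_seq1.
by move=> d [<-|//].
Qed.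
Lemma emb_u : emb u = bas c0. Proof. by have := emb_gen (gen_u _ _). Qed.

Lemma emb_wt la v : weight_vec la v -> gen2 la ((v, emb v) : PM).
Proof.
move=> hv; have [s hs [e1 _]] := embR v; have [s' [us' hs' _ es]] := gsum_merge hs.
pose p := \sum_(d <- s' | d.1 == la) d.2; have hp : gen2 la p by exact: gen2_sum.
suff e : v = p.1 by rewrite e (emb_gen hp) -surjective_pairing.
have ev : v = \sum_(d <- s') d.2.1 by rewrite e1; have := congr1 fst es; rewrite !sum_pair.
rewrite {1}(gen_component hv hs' ev) /p; elim: (s') => [|d r IH]; rewrite ?big_nil // !big_cons; case: ifP => _ //.
by rewrite IH.
Qed.

Lemma emb_iterf i k v : emb (iter k (uq_f i) v) = iter k (opF i) (emb v).
Proof. by elim: k => //= k IH; rewrite emb_f IH. Qed.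
Lemma emb_itere i k v : emb (iter k (uq_e i) v) = iter k (opE i) (emb v).
Proof. by elim: k => //= k IH; rewrite emb_e IH. Qed.
Lemma emb_divpow i k v : emb (divpow (uq_f i) k v) = dF i k (emb v).
Proof. by rewrite /divpow (lin_Z emb_lin) emb_iterf. Qed.

Lemma dpow_pair2 i k p : dpow (pf i) k p = (divpow (uq_f i) k p.1, dF i k p.2).
Proof.
have h m : iter m (pf i) p = (iter m (uq_f i) p.1, iter m (opF i) p.2).
  by elim: m => [|m IH]; [case: p|rewrite !iterS IH].
by rewrite /dpow h.
Qed.

Lemma gen2_strings la i p : gen2 la p -> exists N (z : nat -> PM),
    (forall k, (k < N)%N -> [/\ pe i (z k) = 0, gen2 (la + alpha i *+ k) (z k) & k%:Z + la.1 i < 0 -> z k = 0])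
    /\ p = \sum_(k < N) dpow (pf i) k (z k).
Proof.
apply: graded_strings.
- move=> mu k x hx nz ez; apply: (@opE_top Q n T mu i k (emb x) (gen2_wt (emb_wt hx)).2).
    by rewrite -emb_itere => /emb_eq0.
  by rewrite -emb_itere -emb_e [uq_e _ _]ez (lin_0 emb_lin).
- by move=> x; case: hU => _ [_ /(_ i x) [k [h _]]] _; exists k.
- by move=> mu p'; exact: gen2_wt.
- by move=> mu a p' p''; exact: gen_lin.
- by move=> mu p'; exact: gen2_e.
by move=> mu p'; exact: gen_f.
Qed.

Lemma string_dec_exists i la v : weight_vec la v -> exists N x, string_dec i la v N x.
Proof.
move=> hv; have [N [z [hz e]]] := gen2_strings i (emb_wt hv).
exists N, (fun k => (z k).1); split=> // [k /hz [h1 h2 h3]|].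
  split; [by have := congr1 fst h1|by have [] := gen2_wt h2|].
  by rewrite pairing_coroot => /h3 ->.
have := congr1 fst e; rewrite [LHS]/= => ->.
rewrite sum_pair; apply: eq_bigr => k _; by rewrite dpow_pair2.
Qed.

Lemma emb_string i la v N x : string_dec i la v N x -> emb v = \sum_(k < N) dF i k (emb (x k)).
Proof. by case=> _ _ ->; rewrite (lin_sum emb_lin); apply: eq_bigr => k _; rewrite emb_divpow. Qed.

Lemma emb_kash_f i v v' : kash_f i v v' -> emb v' = kf i (emb v).
Proof.
move=> [la [N [x [hd ->]]]]; rewrite (emb_string hd) (lin_sum emb_lin).
rewrite (@kf_string _ _ _ i N (fun k => emb (x k))); last by case: hd => _ h _ k /h [h1 _ _]; rewrite -emb_e h1 (lin_0 emb_lin).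
by apply: eq_bigr => k _; rewrite emb_divpow.
Qed.
Lemma emb_kash_e i v v' : kash_e i v v' -> emb v' = ke i (emb v).
Proof.
move=> [la [N [x [hd ->]]]]; rewrite (emb_string hd) (lin_sum emb_lin).
case: N hd => [|N] hd; first by rewrite big_ord0 big_geq // (lin_0 (ke_lin i)).
rewrite (@ke_string _ _ _ i N la (fun k => emb (x k))).
  by rewrite big_add1 /= big_mkord; apply: eq_bigr => k _; rewrite emb_divpow.
case: hd => _ h _ k /h [h1 h2 h3]; split; first by rewrite -emb_e h1 (lin_0 emb_lin).
  by have [_] := gen2_wt (emb_wt h2).
by move: h3; rewrite pairing_coroot => h3 /h3 ->; rewrite (lin_0 emb_lin).
Qed.
Lemma kash_f_exists i la v : weight_vec la v -> exists v', kash_f i v v'.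
Proof.
by move=> /(string_dec_exists i) [N [x hd]]; exists (\sum_(k < N) divpow (uq_f i) k.+1 (x k)), la, N, x.
Qed.
Lemma kash_e_exists i la v : weight_vec la v -> exists v', kash_e i v v'.
Proof.
by move=> /(string_dec_exists i) [N [x hd]]; exists (\sum_(1 <= k < N) divpow (uq_f i) k.-1 (x k)), la, N, x.
Qed.
Lemma string_vec_wt v : string_vec u v -> exists la, weight_vec la v.
Proof.
elim=> [|i x x' _ _ [la [N [y [[h1 h2 h3] ->]]]]]; first by exists La; case: hU => _ _ [].
exists (la - alpha i); apply: (big_ind (weight_vec (la - alpha i))).
- by move=> h; rewrite linear0 scaler0.
- by move=> a b ha hb h; rewrite linearD /= ha hb scalerDr.
move=> k _; have [_ hk _] := h2 k (ltn_ord k); rewrite -(wtS1 la (alpha i) k).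
have hk' := @pwv_iter_f Q n UM i _ k.+1 _ hk.
by move=> h; rewrite /divpow linearZ /= hk' !scalerA mulrC.
Qed.
Lemma string_Kv v : string_vec u v -> Kv c0 (emb v).
Proof. by elim=> [|i x x' _ h /emb_kash_f ->]; [rewrite emb_u; exact: Kv0|exact: KvS]. Qed.
Lemma Kv_string y : Kv c0 y -> exists2 v, string_vec u v & emb v = y.
Proof.
elim=> [|i x _ [v hv <-]]; first by exists u; [exact: string_hw|exact: emb_u].
have [la /(kash_f_exists i) [v' h]] := string_vec_wt hv.
by exists v'; [exact: string_step hv h|exact: emb_kash_f].
Qed.
Lemma Kv_reg y : Kv c0 y -> creg y.
Proof. by elim=> [|i x _ h]; [exact: cregb|exact: kf_reg]. Qed.

Lemma gen2_proj la p : gen2 la p -> @gen Q n AM (cwt c0) (bas c0) la p.2.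
Proof.
rewrite w0; elim=> {la p} [|la|la a p p' _ h _ h'|la i p _ h].
- exact: gen_u.
- exact: gen_0.
- exact: (@gen_lin Q n AM La (bas c0) la a p.2 p'.2).
exact: (@gen_f Q n AM La (bas c0) la i p.2).
Qed.

(** Kashiwara monomials are regular. Conversely a regular vector lies in Demazure subspaces weight
    by weight, where it is a regular combination of monomials that lift back to U. *)
Lemma lattice_reg v : lattice u v <-> creg (emb v).
Proof.
split=> [[s [hs ->]]|hr].
  rewrite (lin_sum emb_lin); elim: s hs => [|p s IH] hs; first by rewrite big_nil; exact: creg0.
  rewrite big_cons; apply: cregD; last by apply: IH => p' h'; apply: hs; right.
  have [h1 h2] := hs p (or_introl erefl); rewrite (lin_Z emb_lin); apply: cregZ => //.
  exact: Kv_reg (string_Kv h2).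
have [s hs [e1 e2]] := embR v; have [s' [us' hs' _ es]] := gsum_merge hs.
have e3 : emb v = \sum_(d <- s') d.2.2 by rewrite e2; have := congr1 snd es; rewrite !sum_pair.
(* Components of different weights involve disjoint sets of configurations, so each inherits
   regularity from the sum. *)
have r d : List.In d s' -> creg d.2.2.
  move=> ds c; have [->|nz] := eqVneq (fcf d.2.2 c) 0; first exact: qreg0.
  have cw := (gen2_wt (hs' _ ds)).2 _ nz; have := hr c; rewrite e3 fcf_sum.
  suff -> : \sum_(d <- s') fcf d.2.2 c = fcf d.2.2 c by [].
  elim: s' us' hs' ds {es e3} => [|d' s' IH] //= /andP[d's us] hs' [ed|ds].
    rewrite big_cons ed; rewrite ed in d's; suff -> : \sum_(d <- s') fcf d.2.2 c = 0 by rewrite addr0.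
    elim: s' d's {IH us} hs' => [|d1 s' IH] /=; first by rewrite big_nil.
    rewrite inE negb_or => /andP[n1 n2] hs'; rewrite big_cons IH //; last by move=> d2 [e|h2]; apply: hs'; [left|right; right].
    rewrite addr0; apply/eqP/negPn/negP => /((gen2_wt (hs' d1 (or_intror (or_introl erefl)))).2) e'.
    by rewrite -cw e' eqxx in n1.
  rewrite big_cons IH //; last by move=> d2 h2; apply: hs'; right.
  suff -> : fcf d'.2.2 c = 0 by rewrite add0r.
  apply/eqP/negPn/negP => /((gen2_wt (hs' d' (or_introl erefl))).2) e'.
  case/negP: d's; apply/mapP; exists d; last by rewrite -cw e'.
  by elim: s' ds {IH us hs'} => //= d1 s' IH [->|/IH]; rewrite inE ?eqxx // => ->; rewrite orbT.
have [L hL eL] : exists2 L : seq (Qq * A), (forall t : Qq * A, List.In t L -> regular0 t.1 /\ Kv c0 t.2) & emb v = \sum_(t <- L) t.1 *: t.2.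
  rewrite e3; elim: s' {us' es e3} hs' r => [|d s' IH] hs' r; first by exists [::]; rewrite ?big_nil.
  have [L hL eL] := IH (fun d' h => hs' d' (or_intror h)) (fun d' h => r d' (or_intror h)).
  have [w hw] := gen_Ew (gen2_proj (hs' d (or_introl erefl))).
  have [r0 [h1 h2]] := Ew_lattice cross e0 Sgood hw (r d (or_introl erefl)).
  exists (r0 ++ L); first by move=> p /List.in_app_iff [/h1|/hL].
  by rewrite big_cons big_cat /= -eL h2.
have [L' hL' eL'] : exists2 L' : seq (Qq * U), (forall t : Qq * U, List.In t L' -> regular0 t.1 /\ string_vec u t.2) & emb v = \sum_(t <- L') t.1 *: emb t.2.
  rewrite eL; elim: L hL {eL} => [|p L IH] hL; first by exists [::]; rewrite ?big_nil.
  have [L' h1 h2] := IH (fun (p' : Qq * A) h => hL p' (or_intror h)).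
  have [r1 /Kv_string [x hx ex]] := hL p (or_introl erefl).
  by exists ((p.1, x) :: L'); [move=> p' [<-|/h1]|rewrite !big_cons h2 /= ex].
exists L'; split=> //; apply: emb_inj; rewrite eL' (lin_sum emb_lin).
by apply: eq_bigr => p _; rewrite (lin_Z emb_lin).
Qed.

Lemma qlattice_cqm v : qlattice u v <-> cqm (emb v).
Proof.
split=> [[x /lattice_reg hx ->] c|h].
  by rewrite (lin_Z emb_lin) fcfZ /qmul mulrC mulrA mulVf ?mul1r //; exact: (qv_neq0 Q).
exists (qq^-1 *: v); last by rewrite scalerA mulfV ?scale1r //; exact: (qv_neq0 Q).
by apply/lattice_reg => c; rewrite (lin_Z emb_lin) fcfZ mulrC; exact: h.
Qed.

Definition comp (x : T) := exists w, Sw c0 w x.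
Lemma comp0 : comp c0. Proof. by exists [::]. Qed.
Lemma comp_fo i x : comp x -> (0 < cph i x)%N -> comp (fo i x).
Proof. by move=> [w hw] h; exists (i :: w), x, 1%N. Qed.
Lemma comp_eo i x : comp x -> (0 < cep i x)%N -> comp (eo i x).
Proof. by move=> [w hw] h; exists w; apply: (Sgood w i).1. Qed.
Lemma cqm_qinv y : cqm y <-> creg ((qv Q)^-1 *: y).
Proof. by split=> h c; have := h c; rewrite fcfZ mulrC. Qed.

(** Modulo q each step either kills the vector or moves its configuration by [fo]. *)
Lemma Kv_comp y : Kv c0 y -> cqm y \/ exists2 x, comp x & cqm (y - bas x).
Proof.
elim=> [|i z _ [h|[x hx h]]].
- by right; exists c0; [exact: comp0|rewrite subrr; exact: cqm0].
- by left; apply/cqm_qinv; rewrite -(lin_Z (kf_lin i)); apply: kf_reg; exact/cqm_qinv.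
have := kf_modb i h; case: ifP => hp h'; last by left; rewrite subr0 in h'.
by right; exists (fo i x) => //; exact: comp_fo.
Qed.

Lemma cqm_bas_inj y x x' : cqm (y - bas x) -> cqm (y - bas x') -> x = x'.
Proof.
move=> h h'; have := cqm_trans (cqm_sym h) h'; move=> /(_ x); rewrite fcfB !fcfb eqxx.
case: eqVneq => // _; rewrite subr0; by move/(@qmul1 Q).
Qed.

(** An element of the crystal basis is a coset; it is named by the configuration to which all its
    members reduce. *)
Definition rep (b : crystal_basis u) x := forall v, sval b v <-> cqm (emb v - bas x).

Lemma qcoset_cqm v x : cqm (emb v - bas x) -> forall v', qcoset u v v' <-> cqm (emb v' - bas x).
Proof.
move=> h v'; rewrite /qcoset qlattice_cqm (lin_B emb_lin); split=> h'; first exact: cqm_trans h' h.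
exact: cqm_trans h' (cqm_sym h).
Qed.
Lemma rep_exists b : exists2 x, comp x & rep b x.
Proof.
case: b => cs [v0 [sv nq ec]]; have := Kv_comp (string_Kv sv); case.
  by move=> /qlattice_cqm.
by move=> [x hx h]; exists x => // v; rewrite /= ec; exact: qcoset_cqm.
Qed.
Lemma comp_string x : comp x -> exists v, [/\ string_vec u v, weight_vec (cwt x) v & cqm (emb v - bas x)].
Proof.
move=> [w hw]; have [y [ky _ hy]] := Sw_Kv cross e0 hw; have [v sv ev] := Kv_string ky.
have [la hla] := string_vec_wt sv; exists v; rewrite ev; split=> //.
suff -> : cwt x = la by [].
by apply: (gen2_wt (emb_wt hla)).2; rewrite /= ev; exact: cqm_bas_neq0 hy.
Qed.
Lemma rep_surj x : comp x -> exists b, rep b x.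
Proof.
move=> hx; have [v [sv _ hv]] := comp_string hx.
have nq : ~ qlattice u v by move=> /qlattice_cqm; exact: cqm_bas hv.
by exists (exist _ (qcoset u v) (ex_intro _ v (And3 sv nq erefl))) => v'; exact: qcoset_cqm.
Qed.
Lemma rep_uniq b x x' : rep b x -> rep b x' -> x = x'.
Proof.
move=> h h'; have [y hy hb] := rep_exists b; have [v [_ _ hv]] := comp_string hy.
have vb := (hb v).2 hv; exact: cqm_bas_inj ((h v).1 vb) ((h' v).1 vb).
Qed.
Lemma rep_comp b x : rep b x -> comp x.
Proof. by move=> h; have [y hy hb] := rep_exists b; rewrite (rep_uniq h hb). Qed.
Lemma rep_inj b b' x : rep b x -> rep b' x -> b = b'.
Proof.
case: b b' => [p hp] [p' hp'] h h'; have e : p = p'.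
  apply: funext => v; apply: propositional_extensionality.
  by have h1 : p v <-> _ := h v; have h2 : p' v <-> _ := h' v; rewrite h1 h2.
by subst p'; rewrite (ProofIrrelevance.proof_irrelevance _ hp hp').
Qed.
Lemma rep_hw b : is_hw_elt b <-> rep b c0.
Proof.
have h0 := @qcoset_cqm u c0; rewrite emb_u subrr in h0; have {}h0 := h0 (@cqm0 Q n T).
split=> [e v|h]; first by rewrite e.
apply: funext => v; apply: propositional_extensionality.
by rewrite h0 (h v).
Qed.
Lemma rep_wt b x : rep b x -> crystal_wt b = cwt x.
Proof.
move=> h; have [v [_ wx hv]] := comp_string (rep_comp h).
have : exists la, exists2 v, sval b v & weight_vec la v by exists (cwt x), v => //; exact/h.
move/(epsilon_spec (inhabits 0)); rewrite -/(crystal_wt b) => -[v' /h hv' wv'].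
by apply/esym/(gen2_wt (emb_wt wv')).2; exact: cqm_bas_neq0 hv'.
Qed.

(** The induced operator is a choice over cosets; its graph is shown to be the single pair predicted
    by the combinatorial operator, or empty. *)
Lemma rep_op (R : U -> U -> Prop) (k : A -> A) (P : pred T) (g : T -> T) :
  (forall v v', R v v' -> emb v' = k (emb v)) -> (forall la v, weight_vec la v -> exists v', R v v') ->
  (forall y x, cqm (y - bas x) -> cqm (k y - (if P x then bas (g x) else 0))) ->
  (forall x, comp x -> P x -> comp (g x)) ->
  forall b x, rep b x -> if P x then exists2 b', induced_op R b = Some b' & rep b' (g x) else induced_op R b = None.
Proof.
move=> Rk Re kP gc b x hb; pose graph (b' : crystal_basis u) := exists v v', [/\ sval b v, R v v' & sval b' v'].
have gr b' x' : rep b' x' -> graph b' <-> P x /\ x' = g x.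
  move=> hb'; split.
    move=> [v [v' [/hb hv hR /hb' hv']]]; rewrite (Rk _ _ hR) in hv'; have := kP _ _ hv; case: ifP => px h.
      by split=> //; exact: cqm_bas_inj hv' h.
    by rewrite subr0 in h; case: (cqm_bas hv').
  move=> [px ex]; have [v [_ wx hv]] := comp_string (rep_comp hb); have [v' hR] := Re _ _ wx.
  exists v, v'; split=> //; [exact/hb|apply/hb'; rewrite (Rk _ _ hR) ex].
  by have := kP _ _ hv; rewrite px.
have ex : exists o, if o is Some b' then graph b' else forall b', ~ graph b'.
  have [[b' hg]|h] := excluded_middle_informative (exists b', graph b'); first by exists (Some b').
  by exists None => b' hg; apply: h; exists b'.
have := epsilon_spec (inhabits None) _ ex; rewrite -/(induced_op R b).
case: ifP => px; case: (induced_op R b) => [b'|] h.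
- by exists b' => //; have [x' _ hx'] := rep_exists b'; have [_ <-] := (gr _ _ hx').1 h.
- have [b' hb'] := rep_surj (gc _ (rep_comp hb) px); case: (h b'); exact/(gr _ _ hb').
- by have [x' _ hx'] := rep_exists b'; have [] := (gr _ _ hx').1 h; rewrite px.
by [].
Qed.
Lemma rep_f i b x : rep b x -> if (0 < cph i x)%N then exists2 b', induced_op (@kash_f n U i) b = Some b' & rep b' (fo i x)
  else induced_op (@kash_f n U i) b = None.
Proof.
apply: (@rep_op _ (kf i) (fun x => 0 < cph i x)%N (fo i)).
- exact: emb_kash_f.
- by move=> la v; exact: kash_f_exists.
- by move=> y x'; exact: kf_modb.
by move=> x'; exact: comp_fo.
Qed.
Lemma rep_e i b x : rep b x -> if (0 < cep i x)%N then exists2 b', induced_op (@kash_e n U i) b = Some b' & rep b' (eo i x)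
  else induced_op (@kash_e n U i) b = None.
Proof.
apply: (@rep_op _ (ke i) (fun x => 0 < cep i x)%N (eo i)).
- exact: emb_kash_e.
- by move=> la v; exact: kash_e_exists.
- by move=> y x'; exact: ke_modb.
by move=> x'; exact: comp_eo.
Qed.

Lemma crystal_model : exists rho : crystal_basis u -> T,
  [/\ injective rho, forall x, comp x <-> exists b, rho b = x, forall b, is_hw_elt b <-> rho b = c0,
      forall b, crystal_wt b = cwt (rho b)
    & forall i b, (if (0 < cph i (rho b))%N then exists2 b', induced_op (@kash_f n U i) b = Some b' & rho b' = fo i (rho b)
         else induced_op (@kash_f n U i) b = None) /\
       (if (0 < cep i (rho b))%N then exists2 b', induced_op (@kash_e n U i) b = Some b' & rho b' = eo i (rho b)
         else induced_op (@kash_e n U i) b = None)].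
Proof.
pose rho b := epsilon (inhabits c0) (rep b).
have rhoP b : rep b (rho b) by apply: epsilon_spec; have [x _ h] := rep_exists b; exists x.
have rhoE b x : rep b x -> rho b = x by move=> h; exact: rep_uniq (rhoP b) h.
exists rho; split.
- by move=> b b' e; apply: (rep_inj (rhoP b)); rewrite e; exact: rhoP.
- move=> x; split=> [/rep_surj [b h]|[b <-]]; last exact: rep_comp (rhoP b).
  by exists b; exact: rhoE.
- by move=> b; split=> [/rep_hw /rhoE //|e]; apply/rep_hw; rewrite -e; exact: rhoP.
- by move=> b; exact: rep_wt.
move=> i b; split.
  by have := rep_f i (rhoP b); case: ifP => // _ [b' h1 h2]; exists b' => //; exact: rhoE.
by have := rep_e i (rhoP b); case: ifP => // _ [b' h1 h2]; exists b' => //; exact: rhoE.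
Qed.

End Embedding.

(** * Crystals realised on configurations *)

Arguments fo : simpl never.
Arguments eo : simpl never.

Section CrystalModels.
Variable n : nat.
Local Notation T := (ccset n).
Local Notation cl := (cl n).
Local Notation fo := (fo (T := T)).
Local Notation eo := (eo (T := T)).
Local Notation cph := (cph (T := T)).
Local Notation cep := (cep (T := T)).
Implicit Types (i : node n) (x y : seq maya) (C : crystal n).

Definition op_model (E : Type) (rho : E -> seq maya) (g : E -> option E) (d : seq maya -> nat) (h : seq maya -> seq maya) :=
  forall b, if (0 < d (rho b))%N then exists2 b', g b = Some b' & rho b' = h (rho b) else g b = None.

Record cmodel C (rho : C -> seq maya) : Prop := CModel {
  cm_inj : injective rho;
  cm_wt : forall b, cr_wt b = confwt n (rho b);
  cm_f : forall i, op_model rho (cr_f i) (cph i) (fo i);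
  cm_e : forall i, op_model rho (cr_e i) (cep i) (eo i) }.

(** The maximum defining the depth is attained at d, since each step lowers d by one and the
    operator stops exactly when d is 0. *)
Lemma op_model_depth (E : Type) (rho : E -> seq maya) g d h : op_model rho g d h ->
  (forall x, (0 < d x)%N -> d (h x) = (d x).-1) -> forall b, op_depth g b = d (rho b).
Proof.
move=> hm hd b.
have it k : if (k <= d (rho b))%N then exists2 b', iter_op g k b = Some b' & rho b' = iter k h (rho b) /\ d (rho b') = (d (rho b) - k)%N
    else iter_op g k b = None.
  elim: k => [|k IH]; first by exists b; rewrite ?subn0.
  move: IH; case: (leqP k (d (rho b))) => hk.
    move=> [b' e1 [e2 e3]]; rewrite /iter_op iterS -/(iter_op g k b) e1 /=.
    have := hm b'; rewrite e3 subn_gt0; case: (ltnP k (d (rho b))) => hk' //.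
    move=> [b'' e4 e5]; exists b'' => //; rewrite e5 e2; split=> //.
    by rewrite -e2 hd e3 ?subn_gt0 // subnS.
  move=> e; have -> : (k < d (rho b))%N = false by apply/negbTE; rewrite -leqNgt ltnW.
  by rewrite /iter_op iterS -/(iter_op g k b) e.
pose P k := iter_op g k b <> None /\ forall m, iter_op g m b <> None -> (m <= k)%N.
have Pd : P (d (rho b)).
  split; first by have := it (d (rho b)); rewrite leqnn => -[b' ->].
  by move=> m; have := it m; case: (leqP m (d (rho b))) => // _ ->.
have [h1 h2] := epsilon_spec (inhabits 0%N) P (ex_intro _ _ Pd).
by apply/eqP; rewrite eqn_leq (Pd.2 _ h1) (h2 _ Pd.1).
Qed.

Section Facts.
Variables (C : crystal n) (rho : C -> seq maya).
Hypothesis hC : cmodel rho.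
Lemma cm_phi i b : cr_phi i b = cph i (rho b).
Proof. by apply: (op_model_depth (cm_f hC i)) => x /foP []. Qed.
Lemma cm_eps i b : cr_eps i b = cep i (rho b).
Proof. by apply: (op_model_depth (cm_e hC i)) => x /eoP []. Qed.
Lemma cm_iter i k b : (k <= cph i (rho b))%N -> exists2 b', iter_op (cr_f i) k b = Some b' & rho b' = iter k (fo i) (rho b).
Proof.
elim: k => [|k IH] le; first by exists b.
have [b' e1 e2] := IH (ltnW le); have := cm_f hC i b'; rewrite e2; have [-> _ _ _] := iter_foP (ltnW le).
by rewrite subn_gt0 le => -[b'' e3 e4]; exists b''; rewrite // /iter_op iterS -/(iter_op _ k b) e1.
Qed.
Lemma cm_iter_inv i k b b' : iter_op (cr_f i) k b = Some b' -> (k <= cph i (rho b))%N /\ rho b' = iter k (fo i) (rho b).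
Proof.
elim: k b' => [|k IH] b'; first by case=> <-.
rewrite /iter_op iterS -/(iter_op _ k b); case e: (iter_op _ k b) => [b1|] //= e1.
have [le e2] := IH _ e; have := cm_f hC i b1; rewrite e2; have [-> _ _ _] := iter_foP le; rewrite subn_gt0.
case: ltnP => h; last by rewrite e1.
by move=> [b2]; rewrite e1 => -[<-] e3.
Qed.

Lemma cm_Fset i (S : C -> Prop) (S' : seq maya -> Prop) :
  (forall b, S b <-> S' (rho b)) -> (forall x, S' x -> exists b, rho b = x) ->
  (forall b, Fset i S b <-> FS (T := T) i S' (rho b)) /\ (forall x, FS (T := T) i S' x -> exists b, rho b = x).
Proof.
move=> h1 h2; split=> [b|x [c [k [/h2 [b <-] le ->]]]]; last by have [b' _ e] := cm_iter le; exists b'.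
split.
  move=> [b0 [k [/h1 hb /cm_iter_inv [le e]]]]; by exists (rho b0), k.
move=> [c [k [hc le e]]]; have [b0 e0] := h2 _ hc; exists b0, k; split; first by apply/h1; rewrite e0.
rewrite -e0 in le e; have [b' -> e'] := cm_iter le.
by congr Some; apply: (cm_inj hC); rewrite e' e.
Qed.
End Facts.

Definition Fws (w : seq 'I_n.+1) (S : seq maya -> Prop) := foldr (fun j : 'I_n.+1 => FS (T := T) (posr j : node n)) S w.
Lemma cm_Fword C (rho : C -> seq maya) (hC : cmodel rho) w (S : C -> Prop) (S' : seq maya -> Prop) :
  (forall b, S b <-> S' (rho b)) -> (forall x, S' x -> exists b, rho b = x) ->
  (forall b, Fword w S b <-> Fws w S' (rho b)) /\ (forall x, Fws w S' x -> exists b, rho b = x).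
Proof. by move=> h1 h2; elim: w => [|i w [IH1 IH2]] //=; exact: cm_Fset. Qed.

Lemma op_model_cat (E1 E2 : Type) (rho1 : E1 -> seq maya) (rho2 : E2 -> seq maya) g1 g2 d1 d2 d h1 h2 h (c : rel (seq maya)) :
  op_model rho1 g1 d1 h1 -> op_model rho2 g2 d2 h2 ->
  (forall x y, (0 < d (x ++ y))%N = (if c x y then 0 < d1 x else 0 < d2 y)%N) ->
  (forall x y, (0 < d (x ++ y))%N -> h (x ++ y) = if c x y then h1 x ++ y else x ++ h2 y) ->
  op_model (fun b : E1 * E2 => rho1 b.1 ++ rho2 b.2)
    (fun b => if c (rho1 b.1) (rho2 b.2) then omap (fun b1 => (b1, b.2)) (g1 b.1) else omap (fun b2 => (b.1, b2)) (g2 b.2)) d h.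
Proof.
move=> m1 m2 hd hh [b1 b2] /=; case: ifP => pos; last move: pos; rewrite ?hh // ?hd.
  have := pos; rewrite hd; case: ifP => _ p.
    by have := m1 b1; rewrite p => -[b' -> e]; exists (b', b2) => //=; rewrite e.
  by have := m2 b2; rewrite p => -[b' -> e]; exists (b1, b') => //=; rewrite e.
by case: ifP => _ p; [have := m1 b1|have := m2 b2]; rewrite p => ->.
Qed.

Lemma cm_tensor C1 C2 (rho1 : C1 -> seq maya) (rho2 : C2 -> seq maya) K : cmodel rho1 -> cmodel rho2 ->
  (forall b, size (rho1 b) = K) -> cmodel (C := tensor C1 C2) (fun b => rho1 b.1 ++ rho2 b.2).
Proof.
move=> h1 h2 hK; split.
- move=> [b1 b2] [b1' b2'] /eqP /=; rewrite eqseq_cat ?hK // => /andP[/eqP /(cm_inj h1) -> /eqP /(cm_inj h2) ->].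
  by [].
- by move=> b; rewrite /= confwt_cat (cm_wt h1) (cm_wt h2).
- move=> i; have e x y : (0 < cph i (x ++ y))%N = (if (cph i y <= cep i x)%N then 0 < cph i x else 0 < cph i y)%N.
    by rewrite cph_cat; case: (leqP (cph i y) (cep i x)) => h; apply/idP/idP; lia.
  have := op_model_cat (cm_f h1 i) (cm_f h2 i) e (@fo_cat n i).
  by move=> h b; rewrite [cr_f _ _]/= (cm_phi h2) (cm_eps h1); exact: h.
move=> i; have e x y : (0 < cep i (x ++ y))%N = (if (cph i y < cep i x)%N then 0 < cep i x else 0 < cep i y)%N.
  by rewrite cep_cat; case: (ltnP (cph i y) (cep i x)) => h; apply/idP/idP; lia.
have := op_model_cat (cm_e h1 i) (cm_e h2 i) e (@eo_cat n i).
by move=> h b; rewrite [cr_e _ _]/= (cm_phi h2) (cm_eps h1); exact: h.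
Qed.

Variables (V : weight n -> uqmod n) (u : forall La, V La).
Hypothesis hV : forall La : weight n, dominant La -> irr_integrable_hw La (u La).

Record bmodel (La : weight n) (p : int) (m : nat) (rho : Bcr u La -> seq maya) : Prop := BModel {
  bm_cm : cmodel rho;
  bm_size : forall b, size (rho b) = m;
  bm_hw : forall b, Bhw b <-> rho b = bv (nseq m p);
  bm_comp : forall x, (exists w, Sw (T := T) (bv (nseq m p)) w x) <-> exists b, rho b = x }.

Lemma Bcr_model (La : weight n) (p : int) (m : nat) : La = Lam (cl p) *+ m ->
  exists rho : Bcr u La -> seq maya, bmodel p m rho.
Proof.
move=> eLa; have dom : dominant La by move=> i; rewrite eLa wt1Mn /= ffunE; case: eqP => _; rewrite ?mul0rn //; lia.
have w0 : cwt (bv (nseq m p) : T) = La by rewrite [cwt _]confwt_bv eLa big_nseq iter_addr_0.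
have Sg w i : good (Sw (T := T) (bv (nseq m p)) w) i.
  have e : Sw (T := T) (bv (nseq m p)) w = ops_set (map (@OF n) w) (eq (bv (nseq m p))).
    by rewrite /Sw /ops_set foldr_map.
  by rewrite e; exact: (ops_set_good Qqf).
have [rho [h1 h2 h3 h4 h5]] := crystal_model (hV dom) (@conf_cross Qqf n) (opE_bv Qqf ^~ _) w0 Sg.
exists rho; split.
- by split; [exact: h1|exact: h4|move=> i b; have [] := h5 i b|move=> i b; have [] := h5 i b].
- move=> b; have [w hw] := (h2 _).2 (ex_intro _ b erefl).
  have : size (bv (nseq m p)) = m by rewrite size_map size_nseq.
  elim: w (rho b) hw => [|i w IH] x /=; first by move=> <-.
  by move=> [c [k [hc _ ->]]] /(IH _ hc); rewrite size_iter_fo.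
- exact: h3.
exact: h2.
Qed.

Lemma Bhw_exists La p m (rho : Bcr u La -> seq maya) : bmodel p m rho -> exists b0 : Bcr u La, Bhw b0.
Proof.
move=> hr; have [b e] := (bm_comp hr (bv (nseq m p))).1 (ex_intro _ [::] erefl).
by exists b; apply/(bm_hw hr).
Qed.

Section SingleRotation.
Variables (La : weight n) (p : int) (m : nat) (rho : Bcr u La -> seq maya) (rho' : Bcr u (tau_weight La) -> seq maya).
Hypotheses (hr : bmodel p m rho) (hr' : bmodel (p + 1) m rho').

Lemma csh_nseq : csh (bv (nseq m p)) = bv (nseq m (p + 1)).
Proof. by rewrite csh_bv map_nseq. Qed.

Lemma fseq_rot js b0 b0' b : Bhw b0 -> Bhw b0' -> fseq js b0 = Some b ->
  exists2 b', fseq [seq j + 1 | j <- js] b0' = Some b' & rho' b' = csh (rho b).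
Proof.
move=> h0 h0'; elim: js b => [|j js IH] b /=.
  by case=> <-; exists b0' => //; rewrite ((bm_hw hr b0).1 h0) csh_nseq; exact/(bm_hw hr').
case e: (fseq js b0) => [b1|] //= e1.
have [b1' e2 e3] := IH _ e; rewrite e2 /=.
have := cm_f (bm_cm hr') (j + 1) b1'; rewrite e3 cph_sh; have := cm_f (bm_cm hr) j b1.
have e1' : cr_f j b1 = Some b := e1.
case: ifP => _; last by rewrite e1'.
by move=> [b2]; rewrite e1' => -[<-] e4 [b2' e5 e6]; exists b2'; rewrite // e6 fo_sh e4.
Qed.
Lemma fseq_exists (b0 b : Bcr u La) : Bhw b0 -> exists js, fseq js b0 = Some b.
Proof.
move=> h0; have [w hw] := (bm_comp hr (rho b)).2 (ex_intro _ b erefl).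
have [x hx] : exists x, rho b = x by exists (rho b).
rewrite hx in hw; elim: w x b hw hx => [|i w IH] x b /=.
  by move=> e ex; exists [::]; congr Some; apply: (cm_inj (bm_cm hr)); rewrite ex -e; exact/(bm_hw hr).
move=> [c [k [hc le e]]] ex; have [b1 e1] := (bm_comp hr c).1 (ex_intro _ w hc).
have [js ejs] := IH _ _ hc e1; exists (nseq k i ++ js); rewrite /fseq foldr_cat -/(fseq js b0) ejs.
rewrite -e1 in le e; have [b' e2 e3] := cm_iter (bm_cm hr) le.
have -> : b = b' by apply: (cm_inj (bm_cm hr)); rewrite ex e e3.
by rewrite -e2 /iter_op; elim: (k) => //= l ->.
Qed.
Lemma Ftau1_total b : exists b', rho' b' = csh (rho b).
Proof.
have [b0 h0] := Bhw_exists hr; have [b0' h0'] := Bhw_exists hr'; have [js e] := fseq_exists b h0.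
by have [b' _ e'] := fseq_rot h0 h0' e; exists b'.
Qed.
(** F_tau is given through a path of f's from the highest weight element; shifting diagrams by one
    commutes with the operators, so every path leads to the same shifted configuration. *)
Lemma Ftau1P b b' : Ftau1 b b' <-> rho' b' = csh (rho b).
Proof.
split=> [[b0 [b0' [js [h0 h0' e e']]]]|e].
  by have [b1 e1 e2] := fseq_rot h0 h0' e; move: e'; rewrite e1 => -[<-].
have [b0 h0] := Bhw_exists hr; have [b0' h0'] := Bhw_exists hr'; have [js ejs] := fseq_exists b h0.
have [b1 e1 e2] := fseq_rot h0 h0' ejs; exists b0, b0', js; split=> //.
by rewrite e1; congr Some; apply: (cm_inj (bm_cm hr')); rewrite e2 e.
Qed.
End SingleRotation.

(** A relation along the dependent list of factors, recording charge and multiplicity of each; the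
    realization of a single factor is known only by existence. *)
Fixpoint tmodel (La : weight n) (s : seq (weight n)) (ds : seq (int * nat)) : (Btens u La s -> seq maya) -> Prop :=
  match s return (Btens u La s -> seq maya) -> Prop with
  | [::] => fun rho => exists p m, ds = [:: (p, m)] /\ @bmodel La p m rho
  | La' :: s' => fun rho => exists p m ds' (rho1 : Btens u La' s' -> seq maya) (rho2 : Bcr u La -> seq maya),
      [/\ ds = (p, m) :: ds', @tmodel La' s' ds' rho1, @bmodel La p m rho2 & rho = fun b => rho1 b.1 ++ rho2 b.2]
  end.

Lemma tmodel_cm s : forall La ds (rho : Btens u La s -> seq maya), tmodel ds rho ->
  cmodel rho /\ forall b, size (rho b) = sumn (map snd ds).
Proof.
elim: s => [|La' s IH] La ds rho /=.
  by move=> [p [m [-> h]]]; split; [exact: bm_cm h|move=> b; rewrite (bm_size h) /= addn0].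
move=> [p [m [ds' [rho1 [rho2 [-> /IH [h1 h2] h3 ->]]]]]]; split.
  by apply: cm_tensor h2; [exact: h1|exact: bm_cm h3].
by move=> b; rewrite size_cat h2 (bm_size h3) addnC.
Qed.

Definition shds (ds : seq (int * nat)) := [seq (d.1 + 1, d.2) | d <- ds].

Lemma tmodel_rot s : forall La ds (rho : Btens u La s -> seq maya)
    (rho' : Btens u (tau_weight La) (map (@tau_weight n) s) -> seq maya), tmodel ds rho -> tmodel (shds ds) rho' ->
  (forall b b', Ftau_graph b b' <-> rho' b' = csh (rho b)) /\ (forall b, exists b', rho' b' = csh (rho b)).
Proof.
elim: s => [|La' s IH] La ds rho rho' /=.
  move=> [p [m [-> h]]] [p' [m' [[<- <-] h']]]; split; first exact: Ftau1P h h'.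
  exact: Ftau1_total h h'.
move=> [p [m [ds' [rho1 [rho2 [-> t1 b2 ->]]]]]] [p' [m' [ds2 [rho1' [rho2' [[<- <- <-] t1' b2' ->]]]]]].
have [g1 g2] := IH _ _ _ _ t1 t1'; have F2 := Ftau1P b2 b2'; split.
  move=> b b'; rewrite g1 F2 /csh map_cat; split=> [[-> ->] //|/eqP].
  have [_ s1] := tmodel_cm t1; have [_ s1'] := tmodel_cm t1'.
  have es : size (rho1' b'.1) = size (map sh (rho1 b.1)).
    by rewrite size_map s1 s1' /shds -map_comp; congr sumn; apply: eq_map.
  by rewrite eqseq_cat // => /andP[/eqP -> /eqP ->].
move=> b; have [b1 e1] := g2 b.1; have [b3 e2] := Ftau1_total b2 b2' b.2.
by exists (b1, b3); rewrite /= e1 e2 /csh map_cat.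
Qed.

Lemma tmodel_exists s : forall La ds, La :: s = [seq Lam (cl d.1) *+ d.2 | d <- ds] ->
  exists rho : Btens u La s -> seq maya, tmodel ds rho.
Proof.
elim: s => [|La' s IH] La [|[p m] ds] //=.
  case: ds => [|//] [/Bcr_model [rho h]]; by exists rho, p, m.
move=> [/Bcr_model [rho2 h2] /IH [rho1 h1]].
by exists (fun b => rho1 b.1 ++ rho2 b.2), p, m, ds, rho1, rho2.
Qed.

Fixpoint agds (m : nat) (r : seq (seq 'I_n.+1 * nat)) : seq (int * nat) :=
  (1, m) :: (if r is (w', m') :: r' then shds (agds m' r') else [::]).

Lemma agdsE m r : (Lam 1 *+ m) :: agd_weights r = [seq Lam (cl d.1) *+ d.2 | d <- agds m r].
Proof.
elim: r m => [|[w' m'] r IH] m /=; first by [].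
congr (_ :: _); have := congr1 (map (@tau_weight n)) (IH m'); rewrite /= => ->.
rewrite /shds -!map_comp; apply: eq_map => d /=.
by rewrite tau_weightMn tau_weight_Lam clD1.
Qed.

(** The subset AGD in terms of configurations: the rotation becomes the shift of charges and
    tensoring with u_(m Lambda_1) appends m vacua of charge 1. *)
Fixpoint zset (w : seq 'I_n.+1) (m : nat) (r : seq (seq 'I_n.+1 * nat)) : seq maya -> Prop :=
  Fws w (if r is (w', m') :: r' then fun x => exists2 c, zset w' m' r' c & x = csh c ++ bv (nseq m 1)
         else eq (bv (nseq m 1))).

Lemma agd_zset r : forall w m (rho : Btens u (Lam 1 *+ m) (agd_weights r) -> seq maya), tmodel (agds m r) rho ->
  (forall b, agd w b <-> zset w m r (rho b)) /\ (forall x, zset w m r x -> exists b, rho b = x).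
Proof.
elim: r => [|[w' m'] r IH] w m rho ht.
  case: ht (ht) => p [m0 [[<- <-] h]] ht; apply: cm_Fword; first exact: bm_cm h.
    by move=> b; rewrite (bm_hw h); split.
  by move=> x <-; apply/(bm_comp h); exists [::].
have [hc _] := tmodel_cm ht; apply: cm_Fword => //.
  case: ht => p [m0 [ds' [rho1 [rho2 [[<- <- <-] t1 h2 ->]]]]] b.
  have [rho0 t0] := tmodel_exists (agdsE m' r); have [IH1 IH2] := IH w' _ _ t0.
  have [g1 g2] := tmodel_rot t0 t1; have [_ s0] := tmodel_cm t0; have [_ s1] := tmodel_cm t1; split.
    move=> [[b0 /IH1 hb /g1 e] /(bm_hw h2) e2]; exists (rho0 b0) => //; by rewrite e e2.
  move=> [c hz /eqP]; have [b0 e0] := IH2 _ hz; rewrite -e0 in hz *.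
  have es : size (rho1 b.1) = size (csh (rho0 b0)).
    by rewrite size_map s1 s0 /shds -map_comp; congr sumn; apply: eq_map.
  rewrite eqseq_cat // => /andP[/eqP e1 /eqP e2]; split; last exact/(bm_hw h2).
  by exists b0; [exact/IH1|exact/g1].
move=> x [c hz ->]; case: ht => p [m0 [ds' [rho1 [rho2 [[<- <- <-] t1 h2 ->]]]]].
have [rho0 t0] := tmodel_exists (agdsE m' r); have [_ IH2] := IH w' _ _ t0.
have [_ g2] := tmodel_rot t0 t1; have [b0 <-] := IH2 _ hz; have [b1 e1] := g2 b0.
have [b2 e2] := (bm_comp h2 (bv (nseq m 1))).1 (ex_intro _ [::] erefl).
by exists (b1, b2); rewrite /= e1 e2.
Qed.

Definition hasch (S : seq maya -> Prop) (chi : group_ring (weight n)) := exists2 L : seq (seq maya),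
  uniq L /\ (forall x, x \in L <-> S x) & chi = \sum_(x <- L) gexp (confwt n x).

Lemma NoDup_map_uniq (E : Type) (F : eqType) (f : E -> F) (s : seq E) : injective f -> List.NoDup s -> uniq (map f s).
Proof.
move=> fi; elim=> //= a r h _ IH; rewrite IH andbT; apply/negP => /InP /List.in_map_iff [b [/fi e hb]].
by rewrite e in hb.
Qed.

Lemma ch_model C (rho : C -> seq maya) (S : C -> Prop) S' chi : cmodel rho ->
  (forall b, S b <-> S' (rho b)) -> (forall x, S' x -> exists b, rho b = x) -> hasch S' chi -> ch S = chi.
Proof.
move=> hC h1 h2 [L [uL hL] ->].
have key s : List.NoDup s -> (forall b, S b <-> List.In b s) ->
    \sum_(b <- s) gexp (cr_wt b) = \sum_(x <- L) gexp (confwt n x).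
  move=> nd hs; rewrite (eq_bigr (fun b => gexp (confwt n (rho b)))) => [|b _]; last by rewrite (cm_wt hC).
  rewrite -(big_map rho xpredT (fun x => gexp (confwt n x))); apply: perm_big; apply: uniq_perm => //.
    by apply: NoDup_map_uniq => //; exact: cm_inj hC.
  move=> x; apply/idP/idP.
    by move/InP/List.in_map_iff => [b [<- /hs /h1 /hL]].
  by move/hL => sx; have [b e] := h2 _ sx; apply/InP/List.in_map_iff; exists b; split=> //; apply/hs/h1; rewrite e.
have [s [nd hs]] : exists s : seq C, List.NoDup s /\ (forall b, S b <-> List.In b s).
  have hL' x : x \in L -> exists b, rho b = x by move/hL/h2.
  suff [s es] : exists s, map rho s = L.
    exists s; split.
      apply: (List.NoDup_map_inv rho); rewrite -[List.map _ _]/(map rho s) es.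
      elim: (L) uL => [|x r IH] /=; first by constructor.
      by move=> /andP[h3 h4]; constructor; [move/InP; exact/negP|exact: IH].
    move=> b; rewrite h1 -hL -es; split=> [/InP /List.in_map_iff [b' [/(cm_inj hC) <-]] //|h].
    by apply/InP/List.in_map_iff; exists b.
  elim: (L) hL' => [|x r IH] h; first by exists [::].
  have [b eb] := h x (mem_head _ _); have [|s es] := IH; first by move=> y hy; apply: h; rewrite inE hy orbT.
  by exists (b :: s); rewrite /= eb es.
have ex : exists chi : group_ring (weight n), exists s : seq C, [/\ List.NoDup s, forall b, S b <-> List.In b s
      & chi = \sum_(b <- s) gexp (cr_wt b)] by exists (\sum_(b <- s) gexp (cr_wt b)), s.
rewrite /ch; have [s' [h3 h4 ->]] := epsilon_spec (inhabits (0 : group_ring (weight n))) _ ex; exact: key.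
Qed.

Lemma ch_AGD mu w ws chi :
  hasch (zset w (mudiff mu 0) (zip ws [seq mudiff mu k | k <- iota 1 (size ws)])) chi -> ch (AGD u mu w ws) = chi.
Proof.
set r := zip _ _ => h; have [rho t] := tmodel_exists (agdsE (mudiff mu 0) r).
have [h1 h2] := agd_zset w t; exact: ch_model (tmodel_cm t).1 h1 h2 h.
Qed.

End CrystalModels.

(** * Characters *)

Lemma sum_bij (T : eqType) (M : nmodType) (A B : seq T) (g h : T -> T) (F : T -> M) : uniq A -> uniq B ->
  (forall x, x \in A -> g x \in B /\ h (g x) = x) -> (forall y, y \in B -> h y \in A /\ g (h y) = y) ->
  \sum_(y <- B) F y = \sum_(x <- A) F (g x).
Proof.
move=> uA uB hA hB; rewrite -(big_map g xpredT F); apply: perm_big; apply: uniq_perm => //.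
  by rewrite map_inj_in_uniq // => x y /hA [_ ex] /hA [_ ey] e; rewrite -ex e ey.
move=> y; apply/idP/mapP => [/hB [h1 h2]|[x /hA [h1 _] -> //]].
by exists (h y).
Qed.

Lemma subrBB (M : zmodType) (a b c d : M) : a - b - (c - d) = a - c - (b - d).
Proof. by rewrite !opprB addrACA [in RHS]addrACA [- b + _]addrC. Qed.

Section CharacterStep.
Variables (n : nat) (L : gring (weight n)) (i : node n).
Local Notation T := (ccset n).
Local Notation X := (@gX _ L).
Local Notation fo := (fo (T := T) i).
Local Notation eo := (eo (T := T) i).
Local Notation cph := (cph (T := T) i).
Local Notation cep := (cep (T := T) i).
Implicit Types (x : seq maya) (S : seq maya -> Prop) (A B : seq (seq maya)).

Definition refl (la : weight n) : weight n := la - alpha i *~ la.1 i.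
Lemma refl_zmod : zmod_morphism refl.
Proof.
move=> la mu; rewrite /refl; have -> : (la - mu).1 i = la.1 i - mu.1 i by rewrite wt1D wt1N.
by rewrite mulrzBr; exact: subrBB.
Qed.
Definition srefl : L -> L := @gmap _ _ L L refl.
Definition chL A : L := \sum_(x <- A) X (confwt n x).

Lemma srefl_chL A : srefl (chL A) = \sum_(x <- A) X (refl (confwt n x)).
Proof. by rewrite /chL /srefl raddf_sum; apply: eq_bigr => x _; exact: gmapX. Qed.
Lemma iter_fo_wt k x : (k <= cph x)%N -> confwt n (iter k fo x) = confwt n x - alpha i *+ k.
Proof. by move=> h; have [_ _ _] := iter_foP h. Qed.
Lemma iter_eo_wt k x : (k <= cep x)%N -> confwt n (iter k eo x) = confwt n x + alpha i *+ k.
Proof. by move=> h; have [_ _ _] := iter_eoP h. Qed.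
Lemma confwt_diag x : (confwt n x).1 i = (cph x)%:Z - (cep x)%:Z.
Proof. exact: (@cwt_diag n T i x). Qed.
Lemma chL_split A (P : pred (seq maya)) : chL A = chL [seq x <- A | P x] + chL [seq x <- A | ~~ P x].
Proof. by rewrite /chL !big_filter (bigID P). Qed.

(* The reflection of an i-string with its top removed. *)
Definition flip x := if (cep x <= (cph x).+1)%N then iter ((cph x).+1 - cep x) fo x else iter (cep x - (cph x).+1) eo x.
Lemma flipP x : (0 < cep x)%N -> [/\ cep (flip x) = (cph x).+1, cph (flip x) = (cep x).-1, flip (flip x) = x
  & confwt n (flip x) = refl (confwt n x) - alpha i].
Proof.
move=> hx; have key : [/\ cep (flip x) = (cph x).+1, cph (flip x) = (cep x).-1 & confwt n (flip x) = refl (confwt n x) - alpha i].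
  rewrite /flip /refl confwt_diag; case: leqP => h.
    have le : ((cph x).+1 - cep x <= cph x)%N by lia.
    have [-> -> _ _] := iter_foP le; rewrite iter_fo_wt //; split; [lia|lia|].
    rewrite -addrA -opprD; congr (_ - _); rewrite -[in RHS](mulr1z (alpha i)) -mulrzDr.
    by rewrite pmulrn; congr (_ *~ _); lia.
  have le : (cep x - (cph x).+1 <= cep x)%N by lia.
  have [-> -> _ _] := iter_eoP le; rewrite iter_eo_wt //; split; [lia|lia|].
  rewrite -addrA -opprD; congr (_ + _); rewrite -[in RHS](mulr1z (alpha i)) -mulrzDr -mulrNz.
  by rewrite pmulrn; congr (_ *~ _); lia.
have [h1 h2 h3] := key; split=> //.
rewrite {1}/flip h1 h2 prednK //; rewrite /flip; case: (ltngtP (cep x) (cph x).+1) => h.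
- have le : ((cph x).+1 - cep x <= cph x)%N by lia.
  by have [_ _ -> _] := iter_foP le.
- have le : (cep x - (cph x).+1 <= cep x)%N by lia.
  by have [_ _ -> _] := iter_eoP le.
by rewrite h !subnn.
Qed.

Lemma good_flip S x : good (T := T) S i -> S x -> (0 < cep x)%N -> S (flip x).
Proof.
move=> gS sx hx; rewrite /flip; case: leqP => h.
  by apply: (good_iter_f gS) => //; lia.
by apply: (good_iter_e gS) => //; lia.
Qed.

(** Tops are separated from the rest. In B = F_i S the operator f_i matches non-bottoms with
    non-tops, so (1 - x^(-alpha_i)) ch B telescopes to tops minus shifted bottoms; on S the non-tops
    cancel under [flip]. *)
Lemma chL_F S A B : good (T := T) S i -> uniq A -> (forall x, x \in A <-> S x) ->
  uniq B -> (forall x, x \in B <-> FS (T := T) i S x) ->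
  (1 - X (- alpha i)) * chL B = chL A - X (- alpha i) * srefl (chL A).
Proof.
move=> gS uA hA uB hB.
have Bf x : x \in B -> (0 < cph x)%N -> fo x \in B.
  move=> /hB [c [k [sc le ->]]] h; apply/hB; exists c, k.+1; split=> //.
  by move: h; have [-> _ _ _] := iter_foP le; rewrite subn_gt0.
have Be x : x \in B -> (0 < cep x)%N -> eo x \in B.
  move=> /hB [c [[|k] [sc le ->]]] h; apply/hB.
    by exists (eo c), 0%N; split=> //; exact: gS.1.
  exists c, k; split=> //; first exact: ltnW.
  have pos : (0 < cph (iter k fo c))%N by have [-> _ _ _] := iter_foP (ltnW le); rewrite subn_gt0.
  by have [_ _ e _] := foP pos; rewrite iterS e.
have AB x : x \in A -> x \in B by move=> /hA sx; apply/hB; exists x, 0%N.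
have Bh x : x \in B -> cep x = 0%N -> x \in A.
  move=> /hB [c [k [sc le ->]]]; have [_ -> _ _] := iter_foP le; move=> h.
  have k0 : k = 0%N by lia.
  by rewrite k0; apply/hA.
have e1 : X (- alpha i) * chL [seq x <- B | (0 < cph x)%N] = chL [seq x <- B | (0 < cep x)%N].
  rewrite /chL mulr_sumr; rewrite [RHS](@sum_bij _ _ [seq x <- B | (0 < cph x)%N] _ fo eo) ?filter_uniq //.
  - rewrite !big_seq; apply: eq_bigr => x; rewrite mem_filter => /andP[h _].
    by rewrite -gXD addrC -(iter_fo_wt (k := 1)).
  - move=> x; rewrite !mem_filter => /andP[h xB]; have [_ -> -> _] := foP h; by rewrite Bf.
  by move=> x; rewrite !mem_filter => /andP[h xB]; have [-> _ -> _] := eoP h; rewrite Be.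
have e2 : chL [seq x <- B | ~~ (0 < cep x)%N] = chL [seq x <- A | ~~ (0 < cep x)%N].
  apply: perm_big; apply: uniq_perm; rewrite ?filter_uniq // => x; rewrite !mem_filter.
  by case: posnP => //= h; apply/idP/idP => [/Bh ->|/AB].
(* Strings of B are complete, so their bottoms are the reflections of their tops, and the tops lie
   in A. *)
have e3 : chL [seq x <- B | ~~ (0 < cph x)%N] = \sum_(x <- [seq x <- A | ~~ (0 < cep x)%N]) X (refl (confwt n x)).
  rewrite /chL (@sum_bij _ _ [seq x <- A | ~~ (0 < cep x)%N] _ (fun x => iter (cph x) fo x) (fun x => iter (cep x) eo x)) ?filter_uniq //.
  - rewrite !big_seq; apply: eq_bigr => x; rewrite mem_filter -eqn0Ngt => /andP[/eqP h _].
    by rewrite iter_fo_wt // /refl confwt_diag h subr0 pmulrn.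
  - move=> x; rewrite !mem_filter -eqn0Ngt => /andP[/eqP h /hA xA]; have [-> -> e _] := iter_foP (leqnn (cph x)).
    by rewrite h add0n e subnn; split=> //; apply/hB; exists x, (cph x).
  move=> x; rewrite !mem_filter -eqn0Ngt => /andP[/eqP h xB].
  have [q1 q2 q3 _] := iter_eoP (leqnn (cep x)); rewrite q1 h add0n q3 q2 subnn; split=> //=.
  apply: Bh; last by rewrite q2 subnn.
  suff : forall k, (k <= cep x)%N -> iter k eo x \in B by apply.
  elim=> [|k IH] le //; rewrite iterS; apply: Be; first exact: IH (ltnW le).
  by have [_ -> _ _] := iter_eoP (ltnW le); rewrite subn_gt0.
have e4 : X (- alpha i) * (\sum_(x <- [seq x <- A | (0 < cep x)%N]) X (refl (confwt n x))) = chL [seq x <- A | (0 < cep x)%N].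
  rewrite mulr_sumr /chL [RHS](@sum_bij _ _ [seq x <- A | (0 < cep x)%N] _ flip flip) ?filter_uniq //.
  - rewrite !big_seq; apply: eq_bigr => x; rewrite mem_filter => /andP[h _].
    by have [_ _ _ ->] := flipP h; rewrite -gXD addrC.
  - move=> x; rewrite !mem_filter => /andP[h /hA xA]; have [-> _ -> _] := flipP h; split=> //=.
    by apply/hA; exact: good_flip.
  move=> x; rewrite !mem_filter => /andP[h /hA xA]; have [-> _ -> _] := flipP h; split=> //=.
  by apply/hA; exact: good_flip.
rewrite mulrBl mul1r {1}(chL_split B (fun x => 0 < cep x)%N) (chL_split B (fun x => 0 < cph x)%N).
rewrite mulrDr e1 e2 e3 srefl_chL [in RHS](chL_split A (fun x => 0 < cep x)%N).
have -> : \sum_(x <- A) X (refl (confwt n x)) = \sum_(x <- [seq x <- A | (0 < cep x)%N]) X (refl (confwt n x)) +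
    \sum_(x <- [seq x <- A | ~~ (0 < cep x)%N]) X (refl (confwt n x)).
  by rewrite !big_filter; exact: bigID.
rewrite mulrDr e4; have k (a h t : L) : a + h - (a + t) = h - t by rewrite opprD addrACA subrr add0r.
by rewrite !k.
Qed.

End CharacterStep.

(** * The map zeta, Demazure operators and the rotation *)

Section ZetaMap.
Variables (n : nat) (L : gring (expo n)) (L' : gring (weight n)).
Local Notation X := (@gX _ L).
Local Notation Y := (@gX _ L').
Implicit Types (a : expo n) (f : L) (i : 'I_n.+1) (la : weight n).

Definition vz a : weight n := \sum_j var_weight j *~ a j.
Lemma vz_zmod : zmod_morphism vz.
Proof.
move=> a b; rewrite /vz -sumrB; apply: eq_bigr => j _.
by rewrite !ffunE mulrzBr.
Qed.
Lemma vzD a b : vz (a + b) = vz a + vz b. Proof. exact: (zmorphD vz_zmod). Qed.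
Lemma vz_evec j : vz (evec j) = var_weight j.
Proof.
rewrite /vz (bigD1 j) //= evecE eqxx mulr1z big1 ?addr0 // => k kj.
by rewrite evecE (negbTE kj) mulr0z.
Qed.
Lemma var_weightE (j : 'I_n.+2) : var_weight j = Lam ((j : node n) + 1) - Lam (j : node n) + delta_frac n ((n.+2)%:Z + 1 - (2 * j.+1)%:Z).
Proof.
rewrite /var_weight; congr (Lam _ - Lam _ + _); apply: val_inj => /=; last by rewrite modn_small.
by rewrite [(1 %% _)%N]modn_small // addn1.
Qed.
Lemma posr_posl i : (posr i : node n) = (posl i : node n) + 1.
Proof. by apply: val_inj; rewrite /= /bump /= [(1 %% _)%N]modn_small // modn_small ?addn1 ?add1n //; have := ltn_ord i; lia. Qed.
Lemma vz_sroot i : vz (sroot i) = alpha (posr i).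
Proof.
rewrite /sroot (zmorphD vz_zmod) (zmorphN vz_zmod) !vz_evec !var_weightE alphaE posr_posl addrK.
have en : nat_of_ord ((posl i : node n) + 1) = i.+1 by rewrite -posr_posl posrE.
rewrite en poslE /delta_frac; apply/pair_eqP/andP; split; apply/eqP => /=.
  by apply/ffunP => k; rewrite !ffunE; lia.
by lia.
Qed.
Lemma vz_diag i a : (vz a).1 (posr i) = a (posl i) - a (posr i).
Proof.
have e j : (var_weight j).1 (posr i) = (j == posl i)%:R - (j == posr i)%:R.
  rewrite var_weightE posr_posl /= !ffunE addr0; congr (_%:R - _%:R).
    by rewrite (inj_eq (addIr 1)) eq_sym.
  by rewrite eq_sym.
have -> : (vz a).1 (posr i) = \sum_j (var_weight j).1 (posr i) * a j.
  rewrite /vz; elim: (index_enum _) => [|j r IH]; rewrite ?big_nil ?ffunE // !big_cons wt1D IH.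
  by congr (_ + _); exact: wt1Mz.
rewrite (eq_bigr (fun j => ((j == posl i)%:R - (j == posr i)%:R) * a j)) => [|j _]; last by rewrite e.
rewrite (bigD1 (posl i)) //= (bigD1 (posr i)) 1?eq_sym ?posl_posr //= big1 ?addr0 => [|j /andP[h1 h2]].
  by rewrite !eqxx [posr i == _]eq_sym (negbTE (posl_posr i)) subr0 sub0r mul1r mulN1r.
by rewrite (negbTE h1) (negbTE h2) subrr mul0r.
Qed.
Lemma vz_swap i a : vz (swap_expo i a) = refl (posr i) (vz a).
Proof.
rewrite swap_expoE (zmorphD vz_zmod) (zmorphN vz_zmod) (zmorph_mulz vz_zmod) vz_sroot.
by rewrite /refl vz_diag.
Qed.

Definition zl : L -> L' := @gmap _ _ L L' vz.
Lemma zl_zmod : zmod_morphism zl. Proof. exact: glinB. Qed.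
Lemma zlX a : zl (X a) = Y (vz a). Proof. exact: gmapX. Qed.
Lemma zlM f g : zl (f * g) = zl f * zl g. Proof. exact: gmapM vz_zmod _ _. Qed.
Lemma zl0 : zl 0 = 0. Proof. exact: (zmorph0 zl_zmod). Qed.

Lemma zl_sw i f : zl (sw i f) = srefl (posr i) (zl f).
Proof.
move: f; apply: gadd_ext => [f g|f g|a].
- by rewrite swB zl_zmod.
- by rewrite zl_zmod /srefl raddfB.
by rewrite swap_monom !zlX vz_swap /srefl; exact/esym/gmapX.
Qed.

(** zeta of the first N coefficients of a series in q; N varies freely once it exceeds the
    degree. *)
Definition zs (N : nat) (s : nat -> L) : L' := \sum_(d < N) Y (- delta n *+ d) * zl (s d).

Lemma zs_widen N N' s : (N <= N')%N -> (forall D, (N <= D)%N -> s D = 0) -> zs N' s = zs N s.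
Proof.
move=> le h; rewrite /zs (big_ord_widen_cond N' xpredT (fun d => Y (- delta n *+ d) * zl (s d)) le) /=.
rewrite [LHS](bigID (fun d : 'I_N' => d < N)%N) /= [X in _ + X]big1 ?addr0 // => d.
by rewrite -leqNgt => /h ->; rewrite zl0 mulr0.
Qed.

Lemma zs_mulX N a s : zs N (fun D => X a * s D) = Y (vz a) * zs N s.
Proof. by rewrite /zs mulr_sumr; apply: eq_bigr => d _; rewrite zlM zlX mulrCA. Qed.
Lemma refl_fix j la : la.1 j = 0 -> refl j la = la.
Proof. by rewrite /refl => ->; rewrite mulr0z subr0. Qed.
Lemma sreflM j (f g : L') : srefl j (f * g) = srefl j f * srefl j g.
Proof. exact: gmapM (refl_zmod j) _ _. Qed.

Lemma alpha_torsion (j : node n) k : (- alpha j) *+ k = 0 -> k = 0%N.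
Proof.
move/(congr1 (fun la : weight n => la.1 j)); rewrite wt1Mn wt1N alpha_diag ffunE; lia.
Qed.

Variable dm : 'I_n.+1 -> L -> L.
Hypothesis demP : demazure_op L dm.

(** Both b and delta are fixed by the reflection at a node i different from 0, so the Demazure
    relation on characters is the image under zeta of the one on Laurent polynomials, and it has a
    unique solution. *)
Lemma zs_dem i (b : weight n) N s (chi : L') : b.1 (posr i) = 0 ->
  (1 - Y (- alpha (posr i))) * chi = Y b * zs N s - Y (- alpha (posr i)) * srefl (posr i) (Y b * zs N s) ->
  chi = Y b * zs N (fun d => dm i (s d)).
Proof.
move=> hb e; apply: (@one_subX_inj _ L' (- alpha (posr i))) => [k|]; first exact: alpha_torsion.
rewrite {}e sreflM; have -> : srefl (posr i) (Y b) = Y b by rewrite /srefl gmapX refl_fix.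
rewrite [in RHS]mulrCA (mulrCA _ (Y b)) -mulrBr; congr (_ * _).
have sB : zmod_morphism (@srefl n L' (posr i)) by exact: glinB.
rewrite /zs (zmorph_sum sB) !mulr_sumr -sumrB; apply: eq_bigr => d _.
rewrite sreflM; have -> : srefl (posr i) (Y (- delta n *+ d)) = Y (- delta n *+ d).
  rewrite /srefl gmapX refl_fix // wt1Mn wt1N.
  by rewrite [(delta n).1 _]ffunE oppr0 mul0rn.
rewrite (mulrCA _ (Y _)) -mulrBr [in RHS]mulrCA; congr (_ * _).
rewrite -zl_sw -vz_sroot -(zmorphN vz_zmod) -zlX -!zlM -zl_zmod -demP zlM; congr (_ * _).
by rewrite zl_zmod; congr (_ - _); rewrite -[1](gX0 L) zlX (zmorph0 vz_zmod) gX0.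
Qed.

Definition taug : L' -> L' := @gmap _ _ L' L' (@tau_weight n).
Lemma taug_zmod : zmod_morphism taug. Proof. exact: glinB. Qed.
Lemma taugM (f g : L') : taug (f * g) = taug f * taug g. Proof. exact: gmapM (@tau_zmod n) _ _. Qed.
Lemma taugX la : taug (Y la) = Y (tau_weight la). Proof. exact: gmapX. Qed.

Lemma taug_step la b e (z z' : L') : taug z = Y e * z' -> Y la * taug (Y b * z) = Y (la + tau_weight b + e) * z'.
Proof. by move=> h; rewrite taugM taugX h !mulrA -!gXD. Qed.
Lemma ordS_node (j : 'I_n.+2) : (ordS j : node n) = (j : node n) + 1.
Proof. by apply: val_inj; rewrite /= [(1 %% _)%N]modn_small // addn1. Qed.
Lemma tau_var j : tau_weight (var_weight j) = var_weight (ordS j) + delta_frac n 2 - delta n *+ (j == ord_max).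
Proof.
rewrite !var_weightE tau_weightD tau_weight_delta tau_weightD tau_weightN !tau_weight_Lam -!ordS_node -!addrA.
congr (_ + (_ + _)); rewrite /delta /delta_frac; have -> : (ordS j : nat) = if j == ord_max then 0%N else j.+1.
  rewrite -val_eqE /=; case: eqP => [->|h]; first by rewrite modnn.
  by rewrite modn_small //; have := ltn_ord j; lia.
have := ltn_ord j; rewrite -val_eqE /=; case: eqP => [->|h] lj; apply/pair_eqP/andP; split; apply/eqP => /=;
  by [apply/ffunP => k; rewrite !ffunE; lia|lia].
Qed.
Lemma delta_frac_zmod : zmod_morphism (delta_frac n).
Proof. by move=> x y; rewrite /delta_frac; congr (_, _); rewrite subr0. Qed.
(** tau shifts every variable weight to the next one up to delta/l, accounting for the total degree;
    passing from x_l to x_1 costs one further delta, which is the factor q in Phi. *)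
Lemma tau_vz a : tau_weight (vz a) = vz (rotl a) + delta_frac n (2 * \sum_p a p) - delta n *~ a ord_max.
Proof.
have -> : vz (rotl a) = \sum_j var_weight (ordS j) *~ a j.
  rewrite /vz (reindex (@ordS n.+2)) /=; last by exists (@ord_pred n.+2) => j _; rewrite ?ordSK ?ord_predK.
  by apply: eq_bigr => j _; rewrite ffunE ordSK.
have -> : delta_frac n (2 * \sum_p a p) = \sum_j delta_frac n 2 *~ a j.
  rewrite mulr_sumr (zmorph_sum delta_frac_zmod); apply: eq_bigr => j _.
  by rewrite -(zmorph_mulz delta_frac_zmod) mulrzz.
have -> : delta n *~ a ord_max = \sum_j (delta n *+ (j == ord_max)) *~ a j.
  by rewrite (bigD1 ord_max) //= eqxx big1 ?addr0 // => j /negbTE ->; rewrite mulr0n mul0rz.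
rewrite /vz (zmorph_sum (@tau_zmod n)) -big_split /= -sumrB; apply: eq_bigr => j _.
by rewrite tau_weightMz tau_var mulrzBl mulrzDl.
Qed.

Lemma supp_ext (M : zmodType) (F G : L -> M) (P : expo n -> Prop) f : zmod_morphism F -> zmod_morphism G ->
  (forall a, P a -> F (X a) = G (X a)) -> supp_in P f -> F f = G f.
Proof.
move=> FB GB h hf; rewrite (gsumE f) (zmorph_sum FB) (zmorph_sum GB) !big_seq; apply: eq_bigr => a.
by rewrite gsuppP => /hf pa; rewrite (zmorph_mulz FB) (zmorph_mulz GB) h.
Qed.

Lemma phi_homog (M m : nat) f : (M < m)%N -> supp_in (homog M%:Z) f -> phi m f = 0.
Proof.
move=> lt hf; apply: (supp_ext (phi_zmod m) (G := fun=> 0) _ _ hf); first by move=> x y; rewrite subr0.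
move=> a [ha aM]; rewrite phiX; case: eqP => // e.
have : (a ord_max <= \sum_p a p)%O by rewrite (bigD1 ord_max) //= lerDl sumr_ge0.
by rewrite aM e; lia.
Qed.

Lemma taug_zl (M K : nat) f : (M < K)%N -> supp_in (homog M%:Z) f ->
  taug (zl f) = Y (delta_frac n (2 * M%:Z)) * \sum_(m < K) Y (- delta n *+ m) * zl (phi m f).
Proof.
move=> lt hf; apply: (supp_ext (F := fun f => taug (zl f)) (G := fun f => Y (delta_frac n (2 * M%:Z)) * \sum_(m < K) Y (- delta n *+ m) * zl (phi m f)) _ _ _ hf).
- by move=> x y; rewrite zl_zmod taug_zmod.
- by move=> x y; rewrite -mulrBr -sumrB; congr (_ * _); apply: eq_bigr => m _; rewrite phi_zmod zl_zmod mulrBr.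
move=> a [ha aM]; rewrite zlX taugX tau_vz aM.
have amax : (a ord_max <= M%:Z)%O by rewrite -aM (bigD1 ord_max) //= lerDl sumr_ge0.
have lk : (absz (a ord_max) < K)%N by have := ha ord_max; lia.
rewrite (bigD1 (Ordinal lk)) //= big1 => [|m /eqP hm]; last first.
  rewrite phiX; case: eqP => e; last by rewrite zl0 mulr0.
  by case: hm; apply: val_inj; rewrite /= e.
have ea : (absz (a ord_max))%:Z = a ord_max by have := ha ord_max; lia.
rewrite addr0 phiX ea eqxx zlX -!gXD; congr (Y _).
have -> : - delta n *+ absz (a ord_max) = - (delta n *~ a ord_max) by rewrite mulNrn pmulrn ea.
by rewrite [RHS]addrA [RHS]addrC addrA.
Qed.

(** Reindexing of a Cauchy product, exact because the terms beyond the truncation vanish. *)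
Lemma triangle_sum (M : nmodType) (K : nat) (G : nat -> nat -> M) : (forall m e, (K <= m + e)%N -> G m e = 0) ->
  \sum_(D < K) \sum_(m < D.+1) G m (D - m)%N = \sum_(e < K) \sum_(m < K) G m e.
Proof.
move=> hG; rewrite [RHS]exchange_big /=.
have e1 (D : 'I_K) : \sum_(m < D.+1) G m (D - m)%N = \sum_(m < K | (m <= D)%N) G m (D - m)%N.
  by rewrite (big_ord_widen K (fun m => G m (D - m)%N)).
rewrite (eq_bigr _ (fun D _ => e1 D)) (exchange_big_dep xpredT) //=; apply: eq_bigr => m _.
rewrite -(big_mkord (fun D => m <= D)%N (fun D => G m (D - m)%N)) -(big_mkord xpredT (G m)).
rewrite [RHS](big_cat_nat (n := K - m)) ?leq_subr //= [X in _ + X]big_nat_cond [X in _ + X]big1 ?addr0; last first.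
  by move=> e /andP[/andP[h _] _]; apply: hG; have := ltn_ord m; lia.
rewrite -(big_nat_widenl m 0 K xpredT) // -{1}[m : nat]add0n big_addn.
by apply: eq_bigr => e _; rewrite addnK.
Qed.

(** Degree M allows at most q^M from the rotation, so N + M + 1 bounds the new series. The prefactor
    is the delta-shift 2M of [tau_vz], constant because s is homogeneous. *)
Lemma zs_Phi (M N : nat) s : (forall e, supp_in (homog M%:Z) (s e)) -> (forall D, (N <= D)%N -> s D = 0) ->
  taug (zs N s) = Y (delta_frac n (2 * M%:Z)) * zs (N + M.+1) (Phi s) /\
  (forall D, (N + M.+1 <= D)%N -> Phi s D = 0).
Proof.
move=> hs hN; set K := (N + M.+1)%N.
have hG m e : (K <= m + e)%N -> phi m (s e) = 0.
  move=> le; have [h|h] := leqP N e; first by rewrite hN // (zmorph0 (phi_zmod m)).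
  by apply: (phi_homog _ (hs e)); rewrite /K in le; lia.
split; last by move=> D le; rewrite /Phi big1 // => m _; apply: hG; have := ltn_ord m; lia.
rewrite -(zs_widen (N' := K) _ hN); last by rewrite /K leq_addr.
have -> : zs K (Phi s) = \sum_(D < K) \sum_(m < D.+1) Y (- delta n *+ (m + (D - m))) * zl (phi m (s (D - m)%N)).
  rewrite /zs; apply: eq_bigr => D _; rewrite /Phi (zmorph_sum zl_zmod) mulr_sumr; apply: eq_bigr => m _.
  by rewrite subnKC // -ltnS.
rewrite (triangle_sum (G := fun m e => Y (- delta n *+ (m + e)) * zl (phi m (s e)))); last first.
  by move=> m e le; rewrite hG // zl0 mulr0.
rewrite /zs (zmorph_sum taug_zmod) mulr_sumr; apply: eq_bigr => e _.
rewrite taugM taugX (taug_zl (K := K) _ (hs e)); last by rewrite /K; lia.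
rewrite tau_weightMn tau_weightN tau_weight_delta mulrCA; congr (_ * _); rewrite mulr_sumr.
by apply: eq_bigr => m _; rewrite mulrA -gXD -mulrnDr addnC.
Qed.

End ZetaMap.

(** * Matching the recursion for characters with the operator recursion *)

Section DemazureCharacters.
Variable n : nat.
Local Notation T := (ccset n).
Local Notation LG := (group_gring (expo n)).
Local Notation LW := (group_gring (weight n)).
Local Notation zsG := (zs (L := LG) LW).
Implicit Types (S : seq maya -> Prop) (b : weight n) (s : nat -> LG).

Lemma hasch_F S (i : 'I_n.+1) b N s : good (T := T) S (posr i) -> b.1 (posr i) = 0 ->
  hasch S (gX LW b * zsG N s) -> hasch (FS (T := T) (posr i) S) (gX LW b * zsG N (fun d => demazure i (s d))).
Proof.
move=> gS hb [A [uA hA] e]; have [B uB hB] := @FS_list n T (posr i) S A hA.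
exists B; first by split.
have := chL_F LW gS uA hA uB hB; have <- : gX LW b * zsG N s = chL LW A := e.
by move=> /(zs_dem (@demazureP n) hb) <-.
Qed.

Definition OFs (w : seq 'I_n.+1) := [seq OF (posr i : node n) | i : 'I_n.+1 <- w].
Lemma ops_set_cat os os' S : ops_set (n := n) (os ++ os') S = ops_set os (ops_set os' S).
Proof. by rewrite /ops_set foldr_cat. Qed.
Lemma FwsE w S : Fws w S = ops_set (OFs w) S.
Proof. by rewrite /ops_set foldr_map. Qed.

(** The set stays of the form covered by [ops_set_good], so the string property holds before each
    letter; the condition on b says that only Lambda_0 occurs, hence b is fixed by the finite Weyl
    group. *)
Lemma hasch_Fws (w : seq 'I_n.+1) S b N s os : (forall x, S x <-> ops_set (n := n) os (eq (bv [::])) x) -> b.1 =1 (fun j => if j == 0 then b.1 0 else 0) ->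
  hasch S (gX LW b * zsG N s) -> hasch (Fws w S) (gX LW b * zsG N (fun d => demazure_word w (s d))).
Proof.
move=> hS hb h; elim: w => [|i w IH]; first exact: h.
apply: (@hasch_F (Fws w S) i b N (fun d => demazure_word w (s d))); [|by rewrite hb|exact: IH].
have e x : Fws w S x <-> ops_set ((OFs w) ++ os) (eq (bv [::])) x.
  by rewrite FwsE ops_set_cat; exact: ops_ext.
have [g1 g2] := ops_set_good Qqf ((OFs w) ++ os) [::] (posr i).
by split=> c /e hc p; [|move=> p']; apply/e; [apply: g1|apply: g2].
Qed.

Fixpoint core (m : nat) (r : seq (seq 'I_n.+1 * nat)) : seq maya -> Prop :=
  if r is (w', m') :: r' then fun x => exists2 c, Fws w' (core m' r') c & x = csh c ++ bv (nseq m 1)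
  else eq (bv (nseq m 1)).

Lemma zsetE w m r : zset w m r = Fws w (core m r).
Proof. by elim: r w m => [|[w' m'] r IH] w m //=; rewrite IH. Qed.

Lemma app_nseq m p S x : ops_set (nseq m (OA n p)) S x <-> exists2 c, S c & x = c ++ bv (nseq m p).
Proof.
elim: m x => [|m IH] x; first by split=> [h|[c h ->]]; [exists x; rewrite ?cats0|rewrite cats0].
have e : bv (nseq m.+1 p) = bv (nseq m p) ++ [:: vac p] by elim: (m) => //= k ->.
split=> [[c /IH [c' h ->] ->]|[c h ->]]; first by exists c'; rewrite // e catA.
by exists (c ++ bv (nseq m p)); [apply/IH; exists c|rewrite e catA].
Qed.

Lemma core_ops m r : exists os, forall x, core m r x <-> ops_set (n := n) os (eq (bv [::])) x.
Proof.
elim: r m => [|[w' m'] r IH] m.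
  exists (nseq m (OA n 1)) => x; rewrite app_nseq; split=> [<-|[c <- ->] //]; by exists [::].
have [os hos] := IH m'; exists (nseq m (OA n 1) ++ map (@shop n) ((OFs w') ++ os)) => x.
rewrite ops_set_cat app_nseq.
have e c : Fws w' (core m' r) c <-> ops_set ((OFs w') ++ os) (eq (bv [::])) c.
  by rewrite FwsE ops_set_cat; exact: ops_ext.
have e' c : ops_set (map (@shop n) ((OFs w') ++ os)) (eq (bv [::])) c <->
    shset (ops_set ((OFs w') ++ os) (eq (bv [::]))) c.
  by rewrite shset_ops; apply: ops_ext => y; split=> [<-|[z <- ->] //]; exists [::].
split=> [[c /e hc ->]|[c /e' [y /e hy ->] ->]]; last by exists y.
by exists (csh c) => //; apply/e'; exists c.
Qed.

Variables (Psi : {set 'I_n.+2 * 'I_n.+2}) (mu : n.+2.-tuple nat).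
Hypothesis hPsi : root_ideal Psi.
Hypothesis hmu : sorted geq mu.
Local Notation muk k := (nth 0%N mu k).

Local Notation OO k len := (Oser (L := LG) (@demazure n) (muk k) (rows Psi mu k len)).

Definition crows k len := [seq (cword n (nr Psi (inord j)), mudiff mu j.+1) | j <- iota k len].

(** The delta-exponent, in units of delta/(2l), accumulated by the recursion: each rotation adds
    twice the degree of the remaining parts, and each x_1 is compensated by l - 1 = n + 1. *)
Fixpoint dexp (k len : nat) : int :=
  if len is len'.+1 then dexp k.+1 len' + 2 * (\sum_(j <- iota k.+1 len) (muk j)%:Z) - n.+1%:Z * (muk k)%:Z
  else - (n.+1%:Z * (muk k)%:Z).

Lemma cword_desc d : (0 < d <= n.+2)%N -> cword n d = [seq inord k | k <- desc d.-1 (n.+2 - d)].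
Proof.
move=> hd; rewrite /cword /desc map_rev; congr rev; apply: (inj_map val_inj).
rewrite -(filter_map val (fun k => d <= k.+1)%N) val_enum_ord -map_comp [RHS]map_id_in; last first.
  by move=> k; rewrite mem_iota => hk; rewrite /= inordK //; lia.
rewrite [in LHS](_ : n.+1 = (d.-1 + (n.+2 - d))%N); last by lia.
rewrite iotaD add0n filter_cat (@eq_in_filter _ _ pred0) ?filter_pred0 => [|k]; last by rewrite mem_iota /=; lia.
by rewrite (@eq_in_filter _ _ predT) ?filter_predT => [|k]; last by rewrite mem_iota /=; lia.
Qed.

Lemma mu_le k : (muk k.+1 <= muk k)%N.
Proof.
have [lt|ge] := ltnP k.+1 (size mu); last by rewrite (nth_default 0%N ge).
by apply: (@sorted_leq_nth _ geq _ _ 0%N mu hmu k k.+1) => //; rewrite ?inE; [move=> a b c h1 h2; exact: leq_trans h2 h1|move=> a; exact: leqnn|lia].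
Qed.

Lemma tau_hasch S chi m : hasch S chi ->
  hasch (fun x => exists2 c, S c & x = csh c ++ bv (nseq m 1)) (gX LW (Lam 1 *+ m) * taug (chi : LW)).
Proof.
move=> [A [uA hA] ->]; exists [seq csh c ++ bv (nseq m 1) | c <- A]; first split.
- rewrite map_inj_uniq // => c c' e; apply: csh_inj; move/eqP: (e).
  have sz : size (csh c) = size (csh c') by have := congr1 size e; rewrite !size_cat => /addIn.
  by rewrite eqseq_cat // => /andP[/eqP].
- move=> x; split=> [/mapP [c /hA hc ->]|[c /hA hc ->]]; [by exists c|exact: map_f].
rewrite big_map; have e (r : seq (seq maya)) : taug (\sum_(x <- r) gX LW (confwt n x)) = \sum_(x <- r) gX LW (tau_weight (confwt n x)).
  by rewrite (zmorph_sum (taug_zmod (L' := LW))); apply: eq_bigr => x _; exact: taugX.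
rewrite [taug _]e mulr_sumr; apply: eq_bigr => x _; rewrite -gXD; congr (gX LW _).
by rewrite confwt_cat confwt_sh confwt_bv big_nseq iter_addr_0 addrC.
Qed.

Lemma rows_sumE len k : (rows_sum (muk k) (rows Psi mu k len))%:Z = \sum_(j <- iota k len.+1) (muk j)%:Z.
Proof.
rewrite /rows_sum; elim: len k => [|len IH] k /=; first by rewrite big_seq1 addn0.
by rewrite big_cons PoszD; congr (_ + _); have := IH k.+1 => /= ->.
Qed.

(** x_1 has weight Lambda_1 - Lambda_0 + (l-1) delta/(2l), so multiplying by x_1^m trades m Lambda_0
    for m Lambda_1. *)
Lemma x0_weight m c : Lam 0 *+ m + delta_frac n (c - n.+1%:Z * m%:Z) + vz (evec ord0 *+ m) = Lam 1 *+ m + delta_frac n c.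
Proof.
have -> : vz (evec ord0 *+ m : expo n) = var_weight ord0 *+ m.
  by elim: m => [|m IH]; rewrite ?(zmorph0 (@vz_zmod n)) // !mulrS vzD IH vz_evec.
have -> : delta_frac n (c - n.+1%:Z * m%:Z) = delta_frac n c - delta_frac n n.+1%:Z *+ m.
  by rewrite delta_frac_zmod; congr (_ - _); rewrite -[m%:Z]mulr1 mulrCA mulrC -mulrzz -pmulrn mulr1; elim: m => [|m IH] //; rewrite !mulrS -IH; have := zmorphD (@delta_frac_zmod n) => ->.
have -> : var_weight (ord0 : 'I_n.+2) = Lam 1 - Lam 0 + delta_frac n n.+1%:Z.
  have e0 : (ord0 : node n) = 0 by [].
  by rewrite var_weightE [in Lam _]e0 add0r e0; congr (_ + delta_frac n _); rewrite /=; lia.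
rewrite mulrnDl mulrnBl; move: (Lam 0 *+ m) (Lam 1 *+ m) (delta_frac n _ *+ m) (delta_frac n c) => x y z t.
by rewrite [y - x]addrC addrACA [x + (- x + y)]addrA subrr add0r subrK.
Qed.

Lemma base_weight m c (b := Lam 0 *+ m + delta_frac n c) : b.1 =1 (fun j => if j == 0 then b.1 0 else 0).
Proof.
have e j : b.1 j = (j == 0)%:R *+ m by rewrite /b wt1D wt1Mn /= !ffunE addr0.
by move=> j; rewrite !e; case: (eqVneq j 0) => // _; rewrite mul0rn.
Qed.

(** Both recursions run in parallel. tau turns mu_{k+1} Lambda_0 into mu_{k+1} Lambda_1, which
    together with the (mu_k - mu_{k+1}) Lambda_1 of the new vacua is the weight needed for
    x_1^(mu_k). *)
Lemma hasch_core len k : (k + len = n.+1)%N -> exists N,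
  (forall D, (N <= D)%N -> OO k len D = 0) /\
  hasch (core (mudiff mu k) (crows k len))
    (gX LW (Lam 0 *+ muk k + delta_frac n (dexp k len)) * zsG N (OO k len)).
Proof.
elim: len k => [|len IH] k ek.
  exists 1%N; split; first by case.
  exists [:: bv (nseq (mudiff mu k) 1)]; first by split=> // x; rewrite inE; split=> [/eqP ->|->].
  have -> : zsG 1 (OO k 0) = gX LW (vz (evec ord0 *+ muk k)).
    by rewrite /zs big_ord1 [Oser _ _ _ _]/(gX LG (evec ord0 *+ muk k)) zlX mulr0n gX0 mul1r.
  rewrite big_seq1 -[gexp _]/(gX LW _) -gXD; congr (gX LW _).
  have -> : mudiff mu k = muk k by rewrite /mudiff [nth 0%N mu k.+1]nth_default ?subn0 // size_tuple; lia.
  have := x0_weight (muk k) 0; rewrite sub0r /= => ->; rewrite confwt_bv big_nseq iter_addr_0.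
  by rewrite (zmorph0 (@delta_frac_zmod n)) addr0.
have [N [hN hc]] := IH k.+1 ltac:(lia).
have [os hos] := core_ops (mudiff mu k.+1) (crows k.+1 len).
pose d := nr Psi (inord k); pose F e := demazure_word (cword n d) (OO k.+1 len e).
have hF := hasch_Fws (cword n d) hos _ hc.
have := tau_hasch (mudiff mu k) (hF _).
pose M := rows_sum (muk k.+1) (rows Psi mu k.+1 len).
have Fh e : supp_in (L := LG) (homog M%:Z) (F e).
  have := @supp_homog_dnw n LG (@demazure n) (@demazureP n) (desc d.-1 (n.+2 - d)) M _ (@Oser_homog n LG (@demazure n) (@demazureP n) (muk k.+1) (rows Psi mu k.+1 len) e).
  by rewrite dnw_map -cword_desc // nr_gt0 //=; have := nr_le Psi (inord k); lia.
have FN D : (N <= D)%N -> F D = 0 by move=> /hN; rewrite /F => ->; exact: (zmorph0 (dmw_zmod (L := LG) (@demazureP n) (cword n d))).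
have [z1 z2] := @zs_Phi n LG LW M N F Fh FN.
have eO : OO k len.+1 = fun D => gX LG (evec ord0 *+ muk k) * Phi (L := LG) F D.
  apply: funext => D; rewrite /=; congr (_ * _).
  rewrite /Phi; apply: eq_bigr => m _; apply: (congr1 (phi (L := LG) m)).
  by rewrite dnw_map -cword_desc // nr_gt0 //=; have := nr_le Psi (inord k); lia.
move=> hT; exists (N + M.+1)%N; split; first by move=> D /z2 e; rewrite eO e mulr0.
rewrite eO zs_mulX mulrA -gXD.
have -> : dexp k len.+1 = dexp k.+1 len + 2 * M%:Z - n.+1%:Z * (muk k)%:Z by rewrite /= rows_sumE.
rewrite x0_weight; have := hT _; rewrite (taug_step _ _ z1).
have -> : Lam 1 *+ mudiff mu k + tau_weight (Lam 0 *+ muk k.+1 + delta_frac n (dexp k.+1 len)) + delta_frac n (2 * M%:Z) =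
   Lam 1 *+ muk k + delta_frac n (dexp k.+1 len + 2 * M%:Z).
  rewrite tau_weightD tau_weight_delta tau_weightMn tau_weight_Lam add0r addrA -mulrnDr (zmorphD (@delta_frac_zmod n)) -!addrA.
  by congr (_ *+ _ + _); rewrite /mudiff subnK // mu_le.
by apply; exact: base_weight.
Qed.

Lemma dexpE len k : dexp k len = 2 * (\sum_(j <- iota k len.+1) (j%:Z - k%:Z) * (muk j)%:Z) - n.+1%:Z * \sum_(j <- iota k len.+1) (muk j)%:Z.
Proof.
elim: len k => [|len IH] k.
  by rewrite /= !big_seq1 subrr mul0r mulr0 sub0r.
rewrite [dexp _ _]/= IH ![\sum_(j <- iota k len.+2) _]big_cons -/(iota k.+1 len.+1).
have -> : \sum_(j <- iota k.+1 len.+1) (j%:Z - k%:Z) * (muk j)%:Z =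
    \sum_(j <- iota k.+1 len.+1) (j%:Z - k.+1%:Z) * (muk j)%:Z + \sum_(j <- iota k.+1 len.+1) (muk j)%:Z.
  by rewrite -big_split; apply: eq_bigr => j _ /=; rewrite -{3}[(muk j)%:Z]mul1r -mulrDl; congr (_ * _); lia.
by rewrite subrr mul0r add0r; move: (\sum_(j <- _) _) (\sum_(j <- _) _) => x y; lia.
Qed.

Lemma dexp_n_ell2 : dexp 0 n.+1 = - n_ell2 mu.
Proof.
rewrite dexpE /n_ell2 -[iota 0 n.+2]/(index_iota 0 n.+2) !big_mkord opprB; congr (_ - _).
  by congr (_ * _); apply: eq_bigr => i _; rewrite subr0 (tnth_nth 0%N).
rewrite mulrC; congr (_ * _); rewrite sumnE big_tuple -[RHS]/(Posz _).
rewrite (big_morph Posz PoszD (erefl 0)); apply: eq_bigr => i _; by rewrite (tnth_nth 0%N).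
Qed.

Lemma zip_iota (A B : Type) (f : nat -> A) (g : nat -> B) k l :
  zip [seq f j | j <- iota k l] [seq g j | j <- iota k.+1 l] = [seq (f j, g j.+1) | j <- iota k l].
Proof. by elim: l k => //= l IH k; rewrite IH. Qed.

Lemma crows_zip : zip (ns Psi) [seq mudiff mu k | k <- iota 1 (size (ns Psi))] = crows 0 n.+1.
Proof.
have -> : ns Psi = [seq cword n (nr Psi (inord j)) | j <- iota 0 n.+1].
  rewrite /ns -val_enum_ord -map_comp; apply: eq_map => i /=; congr (cword n (nr Psi _)).
  by apply: val_inj; rewrite /= inordK //; have := ltn_ord i; lia.
by rewrite size_map size_iota /crows zip_iota.
Qed.

Lemma zetaE (h : {poly laurent n}) : zeta h = zsG (size h) (fun d => h`_d).
Proof.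
rewrite /zeta /zs; apply: eq_bigr => d _.
have -> : zl LW (h`_d : LG) = lin_ext (fun a => gX LW (vz a)) h`_d by [].
rewrite /lin_ext mulr_sumr; apply: eq_bigr => a _.
rewrite mulrzAr; congr (_ *~ _); rewrite -gXD -[gexp _]/(gX LW _); congr (gX LW _).
by rewrite addrC mulNrn.
Qed.

Lemma catalan_character (w : seq 'I_n.+1) : tame Psi w ->
  hasch (zset w (mudiff mu 0) (zip (ns Psi) [seq mudiff mu k | k <- iota 1 (size (ns Psi))]))
   (gX LW (Lam 0 *+ muk 0 - delta_frac n (n_ell2 mu)) * (zeta (catalan Psi (mu_expo mu) w) : LW)).
Proof.
move=> htame; rewrite crows_zip zsetE; have [N [hN hc]] := hasch_core (add0n n.+1).
have [os hos] := core_ops (mudiff mu 0) (crows 0 n.+1).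
have hF := hasch_Fws w hos _ hc.
set h := catalan _ _ _; pose O d : LG := demazure_word w (OO 0 n.+1 d).
have eh : (fun d => h`_d : LG) = O.
  by apply: funext => d; exact: catalanE.
have ON D : (N <= D)%N -> O D = 0.
  by move=> /hN; rewrite /O => ->; exact: (zmorph0 (dmw_zmod (L := LG) (@demazureP n) w)).
have hs D : (size h <= D)%N -> O D = 0 by move=> le; rewrite -eh nth_default.
(* The polynomial of choice and the operator series have the same coefficients, so both truncations
   are extended to a common one. *)
rewrite zetaE [fun d => _]eh -(zs_widen (N' := size h + N) LW (leq_addr _ _) hs) (zs_widen LW (leq_addl _ _) ON).
rewrite -(zmorphN (@delta_frac_zmod n)) -dexp_n_ell2; by apply: hF; exact: base_weight.
Qed.

End DemazureCharacters.

Theorem theorem2p8 (n : nat)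
    (V : weight n -> uqmod n) (u : forall La : weight n, V La)
    (hV : forall La : weight n, dominant La -> irr_integrable_hw La (u La))
    (Psi : {set 'I_n.+2 * 'I_n.+2}) (mu : n.+2.-tuple nat)
    (w : seq 'I_n.+1)
    (hPsi : root_ideal Psi) (hmu : sorted geq mu) (htame : tame Psi w) :
  zeta (catalan Psi (mu_expo mu) w) =
    gexp (delta_frac n (n_ell2 mu) - Lam 0 *+ nth 0%N mu 0)
      * ch (AGD u mu w (ns Psi)).
Proof.
rewrite (ch_AGD hV (catalan_character hPsi hmu htame)).
move: (zeta _) => z; pose L := group_gring (weight n).
(* Passing to the abstract ring interface; the two exponentials are then inverse to each other. *)
change (z = gX L (delta_frac n (n_ell2 mu) - Lam 0 *+ nth 0%N mu 0) *
  (gX L (Lam 0 *+ nth 0%N mu 0 - delta_frac n (n_ell2 mu)) * (z : L))).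
by rewrite mulrA -gXD addrA subrK subrr gX0 mul1r.
Qed.
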